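(* Let $X, X_1,X_2,\dots$ be i.i.d. $\mathbb{Z}^2$-valued random variables. Assume that the law of the increments is symmetric ($-X \stackrel{d}{=} X$), with a finite variance, and let $\mathcal{G} = \mathbb{E}[XX^{T}]$ be the $2\times 2$ covariance matrix of the increments. Let $Y_t = S_{N_t}$, $t\ge 0$, where $S_n=\sum_{i=1}^n X_i$ and $(N_t)_{t\ge 0}$ is an independent Poisson process of parameter $1$. For $N\ge 1$ let $V_N=\{-N,\dots,N\}^2$, $\tau_N=\inf\{t\ge 0: Y_t\notin V_N\}$, $\ell_x^t=\int_0^t \mathbf{1}_{\{Y_s=x\}}ds$, and for $a\in[0,1]$ let $$\mathcal{M}_N(a)=\left\{x\in V_N:\ \ell_x^{\tau_N}\ge \frac{2}{\pi\sqrt{\det\mathcal{G}}}\,a(\log N)^2\right\}.$$ Then we have the following two almost sure limits: $$\lim_{N\to\infty}\frac{\max_{x\in V_N}\ell_x^{\tau_N}}{(\log N)^2}=\frac{2}{\pi\sqrt{\det \mathcal{G}}}$$ and $$\forall a\in[0,1),\quad \lim_{N\to\infty}\frac{\log|\mathcal{M}_N(a)|}{\log N}=2(1-a).$$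
   Context: $|\mathcal{M}_N(a)|$ denotes the cardinality of the finite set $\mathcal{M}_N(a)$. The walk $Y$ is a continuous time random walk on $\mathbb{Z}^2$ starting at the origin.
   Formalization: The walk is also assumed irreducible: S_n reaches every point of Z^2 with positive probability for some n. Without this the claim fails, e.g. for twice the simple random walk, where the stated constant is 4 times too small; if X lies on a line, det G = 0 and the constant is undefined. *)

(* Defs.v *)
From HB Require Import structures.
From mathcomp Require Import all_boot all_order all_algebra finmap.
From mathcomp Require Import all_classical all_reals all_analysis.
From mathcomp Require Import zify.

Set Implicit Arguments.
Unset Strict Implicit.
Unset Printing Implicit Defensive.

Import Order.TTheory GRing.Theory Num.Theory.
Import numFieldNormedType.Exports.

Local Open Scope classical_set_scope.
Local Open Scope ring_scope.

(* Points of Z^2 are column vectors, so that X *m X^T is the 2 x 2 matrix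
   X X^T.  Countable spaces such as nat and 'cV[int]_2 carry the discrete
   sigma-algebra, in which every set is measurable. *)
Notation Z2 := ('cV[int]_2).

Section probability.
Context d (T : measurableType d) (R : realType) (P : probability T R).

Definition discrete_rv (U : Type) (X : T -> U) : Prop :=
  forall B : set U, measurable (X @^-1` B).

Definition sigma_rv (U : Type) (X : T -> U) : set_system T :=
  preimage_set_system setT X setT.

Definition sigma_family (I U : Type) (D : set I) (X : I -> T -> U) :
    set_system T :=
  <<s \bigcup_(i in D) sigma_rv (X i) >>.

Definition indep_systems (F G : set_system T) : Prop :=
  forall A B : set T, F A -> G B -> P (A `&` B) = (P A * P B)%E.

Definition mutual_indep (I : choiceType) (F : I -> set_system T) : Prop :=
  forall (J : {fset I}) (A : I -> set T), (forall i, i \in J -> F i (A i)) ->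
    P (\bigcap_(i in [set` J]) A i) = (\prod_(i <- J) P (A i))%E.

Record iid (U : Type) (X : nat -> T -> U) : Prop := {
  iid_measurable : forall i, discrete_rv (X i) ;
  iid_law : forall i (B : set U), P (X i @^-1` B) = P (X 0%N @^-1` B) ;
  iid_indep : mutual_indep (fun i => sigma_rv (X i)) }.

(* The values at negative times are irrelevant.  Paths are nondecreasing, so
   the truncated subtraction on nat is the true increment; the infinite grids
   t in the last field cover finite ones, since t may be eventually
   constant. *)
Record poisson_process (lambda : R) (N : R -> T -> nat) : Prop := {
  pp_measurable : forall t, 0 <= t -> discrete_rv (N t) ;
  pp_start : forall w, N 0 w = 0%N ;
  pp_nondecreasing : forall w s t, 0 <= s -> s <= t -> (N s w <= N t w)%N ;
  pp_right_continuous : forall w t, 0 <= t ->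
    \forall s \near t^'+, N s w = N t w ;
  pp_law : forall s t k, 0 <= s -> s < t ->
    P [set w | (N t w - N s w)%N = k] =
      (poisson_pmf (lambda * (t - s)) k)%:E ;
  pp_indep : forall t : nat -> R, 0 <= t 0%N -> nondecreasing_seq t ->
    mutual_indep (fun i => sigma_rv (fun w => (N (t i.+1) w - N (t i) w)%N)) }.

Definition symmetric_law (X : T -> Z2) : Prop :=
  forall B : set Z2, P [set w | B (- X w)] = P [set w | B (X w)].

Definition finite_variance (X : T -> Z2) : Prop :=
  forall i, ('E_P[(fun w => ((X w i 0)%:~R : R) ^+ 2)%R] < +oo)%E.

Definition covariance_mx (X : T -> Z2) : 'M[R]_2 :=
  \matrix_(i, j) fine 'E_P[(fun w => ((X w *m (X w)^T) i j)%:~R)%R]%E.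

Definition partial_sum (X : nat -> T -> Z2) (n : nat) (w : T) : Z2 :=
  \sum_(i < n) X i w.

(* The walk is genuinely a walk on Z^2, not on a proper subgroup.  If the
   increments were carried by a proper sublattice of finite index m, local
   times would be larger by the factor m than the constant
   2 / (pi * sqrt (det G)) predicts; if they were carried by a line, G would be
   singular. *)
Definition irreducible_walk (X : nat -> T -> Z2) : Prop :=
  forall x : Z2, exists n, (0 < P [set w | partial_sum X n w = x])%E.

Definition ct_walk (X : nat -> T -> Z2) (N : R -> T -> nat) (t : R) (w : T)
    : Z2 :=
  partial_sum X (N t w) w.

Definition box (n : nat) : set Z2 := [set x | forall i, `|x i 0| <= n%:Z].

Definition exit_time (Y : R -> T -> Z2) (n : nat) (w : T) : \bar R :=
  ereal_inf [set t%:E | t in [set t : R | 0 <= t /\ ~ box n (Y t w)]].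

Definition local_time (Y : R -> T -> Z2) (x : Z2) (t : \bar R) (w : T)
    : \bar R :=
  (\int[lebesgue_measure]_(s in [set s : R | (0 <= s)%R /\ s%:E <= t])
     ((Y s w == x)%:R)%:E)%E.

Definition exit_local_time (Y : R -> T -> Z2) (n : nat) (x : Z2) (w : T)
    : \bar R :=
  local_time Y x (exit_time Y n w) w.

Definition max_local_time (Y : R -> T -> Z2) (n : nat) (w : T) : \bar R :=
  \big[maxe/-oo%E]_(x <- fset_set (box n)) exit_local_time Y n x w.

Definition thick_const (G : 'M[R]_2) : R := 2 / (pi * Num.sqrt (\det G)).

Definition thick_points (G : 'M[R]_2) (Y : R -> T -> Z2) (a : R) (n : nat)
    (w : T) : set Z2 :=
  [set x | box n x /\
    ((thick_const G * a * ln n%:R ^+ 2)%:E <= exit_local_time Y n x w)%E].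

End probability.

(* fset_set is the empty set on infinite sets; the next two lemmas show that
   this junk value is never used here. *)
Lemma finite_box (n : nat) : finite_set (box n).
Proof.
pose f (g : {ffun 'I_2 -> 'I_(n + n).+1}) : Z2 :=
  \col_i ((g i : nat)%:Z - n%:Z).
apply: (@sub_finite_set _ _ (f @` setT)); last first.
  exact/finite_image/finite_finset.
move=> x xn; exists [ffun i => inord (absz (x i 0 + n%:Z))] => //.
apply/colP => i; rewrite mxE ffunE inordK; have := xn i; lia.
Qed.

Lemma finite_thick_points d (T : measurableType d) (R : realType)
    (G : 'M[R]_2) (Y : R -> T -> Z2) (a : R) (n : nat) (w : T) :
  finite_set (thick_points G Y a n w).
Proof. by apply: sub_finite_set (@finite_box n) => x []. Qed.

(* Main.v *)
Require Import Defs.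
From HB Require Import structures.
From mathcomp Require Import all_boot all_order all_algebra finmap.
From mathcomp Require Import all_classical all_reals all_analysis.
From mathcomp Require Import measurable_realfun.
From mathcomp Require Import zify ring lra.

(* @HEAD@ *)

Set Implicit Arguments.
Unset Strict Implicit.
Unset Printing Implicit Defensive.

Import Order.TTheory GRing.Theory Num.Theory.
Import numFieldNormedType.Exports.

Local Open Scope classical_set_scope.
Local Open Scope ring_scope.

(** Heuristics. Up to small powers, put m = N^2: a walk of m steps lives on the scale of V_N. The
    Green function of the walk with a lifetime of order m grows like [gconst] ln m at the origin,
    and 4 [gconst] is the constant of the theorem ([gconstE]). The number of visits to a site is
    nearly geometric with this mean, so it reaches a [lev m] = a [gconst] (ln m)^2 with probability
    m^(-a + o(1)). Since a [gconst] (2 ln N)^2 is the threshold that defines the thick points, about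
    m^(1 - a) = N^(2 - 2a) of the sites of V_N should be a-thick, and none when a > 1. It remains to
    show that the count has this order, almost surely and for every N.

    Green function. Killing the walk with probability 1 - l at each step gives a Green function that
    is an explicit Fourier integral. Irreducibility enters through [cos_ip_le], the finite variance
    through the expansion of the characteristic function at 0, and [green0_asymptotic] gives the
    value at the origin. At squared distance m^b the value is (1 - b) [U m] to leading order
    ([gq_far_near], [gq_near_near]). This is obtained without a local limit theorem, from the decay
    beyond the killing scale ([green_decay]) and from the flatness of the difference of two Green
    functions on short scales ([gdiff_lipschitz]).

    Tails of visits. [additive_tail] converts a finite distribution of charges into an exponential
    tail for a weighted number of visits. One charge gives [visits_tail]. Charges on a site and on
    the annulus of squared radius m^b around it give [annulus_tail]: a thick site rarely has more
    than about a (1 - b)^2 [lev m] visits per site of that annulus. Two positive charges compensated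
    by a negative annulus give [pair_tail]. The matching lower bound for one site is [visits_lower].

    Counting. The upper bound is Markov's inequality for the count ([upper_scale]). For the lower
    bound the second moment is restricted to [good] sites, whose annuli do not carry too many
    visits; [thick_block] then finds enough thick sites in m steps with probability m^(-e), for e as
    small as desired. Many independent blocks of this length fit into the box before the exit
    ([early_exit], [no_block_prob]), and one of them succeeds ([lower_scale]).

    Continuous time. A site visited v times has as local time a sum of v independent exponential
    holding times, which concentrates at v. This is proved by observing the Poisson clock on a fine
    grid, where it is again a walk with independent increments ([clock_upper], [clock_lower]).

    Almost sure limits. The exceptional probabilities are negative powers of N, hence summable along
    N = 2^k ([ae_dyadic]). Local times at the exit increase with N, which fills the gaps between
    dyadic scales ([nthick_le]) and leads to [max_limit] and [count_limit]. *)

(** * Expectations of bounded measurable functions *)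

Section bounded_expectation.
Context d (T : measurableType d) (R : realType) (P : probability T R).
Implicit Types f g : T -> R.

Definition bounded_mfun f :=
  measurable_fun setT f /\ exists M : R, forall x, `|f x| <= M.

(** A real number, so that field arithmetic applies; for functions that are not integrable it may be
    the default value of [fine], whence the condition [bounded_mfun] throughout. *)
Definition ev f : R := \int[P]_x f x.

Lemma bounded_mfun_integrable f : bounded_mfun f ->
  P.-integrable setT (EFin \o f).
Proof.
move=> [mf [M fM]]; apply: (@le_integrable _ _ _ _ _ _ _ (cst M%:E)) => //.
- exact/measurable_EFinP.
- move=> x _ /=; rewrite lee_fin; apply: (le_trans (fM x)); exact: ler_norm.
- exact: finite_measure_integrable_cst.
Qed.

Lemma bounded_mfun_cst (c : R) : bounded_mfun (cst c).
Proof. by split => //; exists `|c|. Qed.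

Lemma bounded_mfunD f g : bounded_mfun f -> bounded_mfun g ->
  bounded_mfun (fun x => f x + g x).
Proof.
move=> [mf [M fM]] [mg [N gN]]; split; first exact: measurable_funD.
by exists (M + N) => x; rewrite (le_trans (ler_normD _ _))// lerD.
Qed.

Lemma bounded_mfunM f g : bounded_mfun f -> bounded_mfun g ->
  bounded_mfun (fun x => f x * g x).
Proof.
move=> [mf [M fM]] [mg [N gN]]; split; first exact: measurable_funM.
by exists (M * N) => x; rewrite normrM ler_pM.
Qed.

Lemma bounded_mfunZ (c : R) f : bounded_mfun f ->
  bounded_mfun (fun x => c * f x).
Proof. by move=> bf; apply: bounded_mfunM => //; exact: bounded_mfun_cst. Qed.

Lemma bounded_mfunN f : bounded_mfun f -> bounded_mfun (fun x => - f x).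
Proof.
move=> [mf [M fM]]; split; first exact: measurableT_comp.
by exists M => x; rewrite normrN.
Qed.

Lemma bounded_mfunB f g : bounded_mfun f -> bounded_mfun g ->
  bounded_mfun (fun x => f x - g x).
Proof. by move=> bf bg; exact/bounded_mfunD/bounded_mfunN. Qed.

Lemma bounded_mfun_sum (I : Type) (s : seq I) (F : I -> T -> R) :
  (forall i, bounded_mfun (F i)) ->
  bounded_mfun (fun x => \sum_(i <- s) F i x).
Proof.
move=> bF; elim: s => [|i s IH].
  by under eq_fun do rewrite big_nil; exact: bounded_mfun_cst.
by under eq_fun do rewrite big_cons; exact: bounded_mfunD.
Qed.

Lemma ev_cst (c : R) : ev (cst c) = c.
Proof.
rewrite /ev; have := Rintegral_cst P measurableT c.
move=> /= ->; rewrite (_ : fine _ = 1) ?mulr1//.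
by rewrite [X in fine X](_ : _ = 1%E)//; exact: (@probability_setT _ _ _ P).
Qed.

Lemma evD f g : bounded_mfun f -> bounded_mfun g ->
  ev (fun x => f x + g x) = ev f + ev g.
Proof. by move=> bf bg; rewrite /ev RintegralD//; exact: bounded_mfun_integrable. Qed.

Lemma evB f g : bounded_mfun f -> bounded_mfun g ->
  ev (fun x => f x - g x) = ev f - ev g.
Proof. by move=> bf bg; rewrite /ev RintegralB//; exact: bounded_mfun_integrable. Qed.

Lemma evZ (c : R) f : bounded_mfun f -> ev (fun x => c * f x) = c * ev f.
Proof. by move=> bf; rewrite /ev RintegralZl//; exact: bounded_mfun_integrable. Qed.

Lemma ev_sum (I : Type) (s : seq I) (F : I -> T -> R) :
  (forall i, bounded_mfun (F i)) ->
  ev (fun x => \sum_(i <- s) F i x) = \sum_(i <- s) ev (F i).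
Proof.
move=> bF; elim: s => [|i s IH].
  rewrite big_nil; under [X in ev X]eq_fun do rewrite big_nil.
  exact: ev_cst.
rewrite big_cons -IH; under [X in ev X]eq_fun do rewrite big_cons.
by rewrite evD//; exact: bounded_mfun_sum.
Qed.

Lemma ev_le f g : bounded_mfun f -> bounded_mfun g ->
  (forall x, f x <= g x) -> ev f <= ev g.
Proof.
by move=> bf bg fg; rewrite /ev le_Rintegral//; exact: bounded_mfun_integrable.
Qed.

Lemma ev_ge0 f : (forall x, 0 <= f x) -> 0 <= ev f.
Proof. by move=> f0; apply: Rintegral_ge0. Qed.

Lemma ev_norm_le f (M : R) : bounded_mfun f -> (forall x, `|f x| <= M) ->
  `|ev f| <= M.
Proof.
move=> bf fM; rewrite ler_norml; apply/andP; split.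
- rewrite -[leLHS]ev_cst; apply: ev_le => //; first exact: bounded_mfun_cst.
  by move=> x; have := fM x; rewrite ler_norml => /andP[].
- rewrite -[leRHS]ev_cst; apply: ev_le => //; first exact: bounded_mfun_cst.
  by move=> x; have := fM x; rewrite ler_norml => /andP[].
Qed.

Lemma EFin_ev f : bounded_mfun f -> (ev f)%:E = (\int[P]_x (f x)%:E)%E.
Proof.
move=> bf; rewrite /ev /Rintegral fineK//.
exact/integrable_fin_num/bounded_mfun_integrable.
Qed.

End bounded_expectation.

(** * Fubini for bounded functions *)

Section fubini_bounded.
Context d1 d2 (T1 : measurableType d1) (T2 : measurableType d2) (R : realType).
Variables (P1 : probability T1 R) (P2 : probability T2 R).

Lemma bounded_mfun_pair1 (F : T1 * T2 -> R) y : bounded_mfun F ->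
  bounded_mfun (fun x => F (x, y)).
Proof.
move=> [mF [M FM]]; split; last by exists M => x.
by apply: measurableT_comp => //; exact: measurable_pair2.
Qed.

Lemma bounded_mfun_pair2 (F : T1 * T2 -> R) x : bounded_mfun F ->
  bounded_mfun (fun y => F (x, y)).
Proof.
move=> [mF [M FM]]; split; last by exists M => y.
by apply: measurableT_comp => //; exact: measurable_pair1.
Qed.

Lemma bounded_mfun_ev1 (F : T1 * T2 -> R) : bounded_mfun F ->
  bounded_mfun (fun x => ev P2 (fun y => F (x, y))).
Proof.
move=> bF; split; last first.
  have [_ [M FM]] := bF; exists M => x.
  by apply: ev_norm_le => //; exact: bounded_mfun_pair2.
apply/measurable_EFinP.
have := @measurable_fubini_F _ _ _ _ _ P1 P2 _
  (@bounded_mfun_integrable _ _ _ (P1 \x P2)%E _ bF).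
apply: eq_measurable_fun => x _ /=.
by rewrite EFin_ev//; exact: bounded_mfun_pair2.
Qed.

Lemma bounded_mfun_ev2 (F : T1 * T2 -> R) : bounded_mfun F ->
  bounded_mfun (fun y => ev P1 (fun x => F (x, y))).
Proof.
move=> bF; split; last first.
  have [_ [M FM]] := bF; exists M => x.
  by apply: ev_norm_le => //; exact: bounded_mfun_pair1.
apply/measurable_EFinP.
have := @measurable_fubini_G _ _ _ _ _ P1 P2 _
  (@bounded_mfun_integrable _ _ _ (P1 \x P2)%E _ bF).
apply: eq_measurable_fun => x _ /=.
by rewrite EFin_ev//; exact: bounded_mfun_pair1.
Qed.

Lemma ev_fubini (F : T1 * T2 -> R) : bounded_mfun F ->
  ev P1 (fun x => ev P2 (fun y => F (x, y))) =
  ev P2 (fun y => ev P1 (fun x => F (x, y))).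
Proof.
move=> bF; apply: EFin_inj.
rewrite (EFin_ev _ (bounded_mfun_ev1 bF)) (EFin_ev _ (bounded_mfun_ev2 bF)).
transitivity (\int[P1]_x fubini_F P2 (EFin \o F) x)%E.
  by apply: eq_integral => x _; rewrite EFin_ev//; exact: bounded_mfun_pair2.
transitivity (\int[P2]_y fubini_G P1 (EFin \o F) y)%E; last first.
  by apply: eq_integral => x _; rewrite EFin_ev//; exact: bounded_mfun_pair1.
exact: (@Fubini _ _ _ _ _ P1 P2 _
  (@bounded_mfun_integrable _ _ _ (P1 \x P2)%E _ bF)).
Qed.

Lemma ev_prod (F : T1 * T2 -> R) : bounded_mfun F ->
  ev (P1 \x P2)%E F = ev P1 (fun x => ev P2 (fun y => F (x, y))).
Proof.
move=> bF; apply: EFin_inj.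
rewrite (EFin_ev _ (bounded_mfun_ev1 bF)) EFin_ev//.
rewrite -(@integral12_prod_meas1 _ _ _ _ _ P1 P2 _
  (@bounded_mfun_integrable _ _ _ (P1 \x P2)%E _ bF)).
by apply: eq_integral => x _; rewrite /fubini_F EFin_ev//; exact: bounded_mfun_pair2.
Qed.

End fubini_bounded.

Arguments bounded_mfun_cst {d T R} c.

(** * Integrals of functions of countably valued variables *)

Section discrete_integral.
Context d (T : measurableType d) (R : realType) (P : probability T R).
Context {U : countType}.

Lemma discrete_measurable_fun (W : T -> U) d' (V : measurableType d')
    (F : U -> V) (D : set T) : discrete_rv W -> measurable_fun D (F \o W).
Proof.
move=> mW mD B mB; rewrite comp_preimage; apply: measurableI => //; exact: mW.
Qed.

(** Countable additivity is used over [nat], so the atoms of [W] are indexed by their codes; a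
    number that codes no value contributes the empty set. *)
Lemma discrete_level (W : T -> U) n :
  [set w | choice.pickle (W w) = n] =
  if pickle_inv n is Some u then W @^-1` [set u] else set0.
Proof.
case E : (pickle_inv n) => [u|]; apply/seteqP; split => w //=.
- by move=> Wn; move: E; rewrite -Wn pickleK_inv => -[].
- by move=> ->; have := @pickle_invK U n; rewrite E /= => ->.
- by move=> Wn; move: E; rewrite -Wn pickleK_inv.
Qed.

Lemma discrete_bigcup (W : T -> U) (A : set T) :
  A = \bigcup_n (A `&` [set w | choice.pickle (W w) = n]).
Proof.
apply/seteqP; split => w; last by move=> [n _ []].
by move=> Aw; exists (choice.pickle (W w)).
Qed.

Lemma discrete_trivIset (W : T -> U) (A : set T) :
  trivIset setT (fun n => A `&` [set w | choice.pickle (W w) = n]).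
Proof. by move=> i j _ _ [w [[_ /= <-] [_ /= <-]]]. Qed.

Lemma measurable_discrete_level (W : T -> U) (A : set T) n :
  discrete_rv W -> measurable A ->
  measurable (A `&` [set w | choice.pickle (W w) = n]).
Proof.
move=> mW mA; apply: measurableI => //.
exact: (mW [set u | choice.pickle u = n]).
Qed.

Lemma discrete_integralE (W : T -> U) (A : set T) (F : U -> \bar R) :
  discrete_rv W -> measurable A -> (forall u, 0 <= F u)%E ->
  (\int[P]_(w in A) F (W w) = \sum_(0 <= n <oo)
     (if pickle_inv n is Some u then F u * P (A `&` W @^-1` [set u]) else 0))%E.
Proof.
move=> mW mA F0.
rewrite {1}(discrete_bigcup W A) ge0_integral_bigcup//=.
- apply: eq_eseriesr => n _; rewrite discrete_level.
  case: pickle_inv => [u|]; last by rewrite setI0 integral_set0.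
  have mAu : measurable (A `&` W @^-1` [set u]) by apply: measurableI.
  rewrite (eq_integral (cst (F u))) ?integral_cst//.
  by move=> w; rewrite inE => -[_ /= ->].
- by move=> n; exact: measurable_discrete_level.
- rewrite -discrete_bigcup; exact: (@discrete_measurable_fun W).
- exact: discrete_trivIset.
Qed.

Lemma discrete_integral_law (W W' : T -> U) (F : U -> \bar R) :
  discrete_rv W -> discrete_rv W' -> (forall u, 0 <= F u)%E ->
  (forall u, P (W @^-1` [set u]) = P (W' @^-1` [set u])) ->
  (\int[P]_w F (W w) = \int[P]_w F (W' w))%E.
Proof.
move=> mW mW' F0 WW'; rewrite !discrete_integralE//.
by apply: eq_eseriesr => n _; case: pickle_inv => // u; rewrite !setTI WW'.
Qed.

End discrete_integral.

Section discrete_indep.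
Context d (T : measurableType d) (R : realType) (P : probability T R).
Context {U U' : countType}.

(** Fubini from independence on atoms alone: both sides expand, first over the values of [V] and
    then over those of [W], into the same double series. *)
Lemma discrete_integral_indep (V : T -> U') (W : T -> U)
    (F : U' -> U -> \bar R) :
  discrete_rv V -> discrete_rv W -> (forall v u, 0 <= F v u)%E ->
  (forall v u, P (V @^-1` [set v] `&` W @^-1` [set u]) =
               P (V @^-1` [set v]) * P (W @^-1` [set u]))%E ->
  (\int[P]_w F (V w) (W w) = \int[P]_w' \int[P]_w F (V w') (W w))%E.
Proof.
move=> mV mW F0 VW.
have mF : measurable_fun setT (fun w => F (V w) (W w)).
  move=> _ B mB; rewrite setTI.
  have -> : (fun w => F (V w) (W w)) @^-1` B =
      \bigcup_n [set w | if pickle_inv n is Some vu then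
        V w = vu.1 /\ W w = vu.2 /\ B (F vu.1 vu.2) else False].
    apply/seteqP; split => w /=.
      by exists (choice.pickle (V w, W w)) => //=; rewrite pickleK_inv.
    by move=> [n _] /=; case: pickle_inv => // -[v u] /= [-> [-> ]].
  apply: bigcup_measurable => n _; case: (pickle_inv n) => [[v u]|] /=.
    have [BF|BF] := pselect (B (F v u)).
      rewrite (_ : mkset _ = V @^-1` [set v] `&` W @^-1` [set u]).
        by apply: measurableI; [exact: mV|exact: mW].
      by apply/seteqP; split => w /=; [case=> -> [->]|case=> -> ->].
    rewrite (_ : mkset _ = set0)//.
    by apply/seteqP; split => w //= -[_ [_ /BF]].
  rewrite (_ : mkset _ = set0)//.
have mVn n : measurable (setT `&` [set w | choice.pickle (V w) = n]).
  by apply: measurableI => //; exact: (mV [set u | choice.pickle u = n]).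
have cupV : [set: T] = \bigcup_n (setT `&` [set w | choice.pickle (V w) = n]).
  by apply/seteqP; split => w // _; exists (choice.pickle (V w)).
rewrite (discrete_integralE P (W := V) (F := fun v => \int[P]_w F v (W w))%E)//;
  last by move=> v; exact: integral_ge0.
rewrite {1}cupV ge0_integral_bigcup//=; last 2 first.
- by rewrite -cupV.
- by move=> i j _ _ [w [[_ /= <-] [_ /= <-]]].
apply: eq_eseriesr => n _; rewrite discrete_level.
case: pickle_inv => [v|]; last by rewrite setI0 integral_set0.
rewrite (eq_integral (fun w => F v (W w))); last first.
  by move=> w; rewrite inE => -[_ /= ->].
rewrite setTI !discrete_integralE//; try exact: mV.
have <- : (fine (P (V @^-1` [set v])))%:E = P (V @^-1` [set v]).
  by rewrite fineK// fin_num_measure//; exact: mV.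
rewrite muleC -nneseriesZl; last first.
  by move=> m _; case: pickle_inv => // u; rewrite mule_ge0.
apply: eq_eseriesr => m _; case: pickle_inv => [u|]; last by rewrite mule0.
rewrite VW fineK ?fin_num_measure//; try exact: mV.
by rewrite setTI muleCA.
Qed.

End discrete_indep.

(** * The law of an i.i.d. path as an iterated integral *)

Section path_law.
Context d (T : measurableType d) (R : realType) (P : probability T R).
Context (U : countType) (X : nat -> T -> U) (X_iid : iid P X).
Local Open Scope ereal_scope.

Definition path_of (a k : nat) (w : T) : seq U := [seq X i w | i <- iota a k].

(** The expectation of a function of [k] increments ([path_law]), in the form that makes
    conditioning on the first increment definitional. The estimates on paths are inductions on [k]
    through this recursion. *)
Fixpoint EE (k : nat) (F : seq U -> \bar R) : \bar R :=
  if k is k'.+1 then \int[P]_w EE k' (fun s => F (X 0%N w :: s)) else F [::].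

Lemma EE_ge0 k F : (forall s, 0 <= F s) -> 0 <= EE k F.
Proof.
elim: k F => [|k IH] F F0 //=.
by apply: integral_ge0 => w _; apply: IH.
Qed.

Lemma path_of_discrete a k : discrete_rv (path_of a k).
Proof.
elim: k a => [|k IH] a B.
  have [B0|B0] := pselect (B [::]).
    by rewrite (_ : _ @^-1` _ = setT)//; apply/seteqP; split.
  by rewrite (_ : _ @^-1` _ = set0)//; apply/seteqP; split.
have -> : path_of a k.+1 @^-1` B = \bigcup_n
    (if pickle_inv n is Some u then
       X a @^-1` [set u] `&` path_of a.+1 k @^-1` [set s | B (u :: s)]
     else set0).
  apply/seteqP; split => w /=.
    by move=> Bw; exists (choice.pickle (X a w)) => //=; rewrite pickleK_inv.
  by move=> [n _]; case: pickle_inv => // u /= [<-].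
apply: bigcup_measurable => n _; case: pickle_inv => // u.
apply: measurableI; [exact: (iid_measurable X_iid)|exact: IH].
Qed.

Lemma path_pmf a k s :
  P (path_of a k @^-1` [set s]) =
  if size s == k then \prod_(u <- s) P (X 0%N @^-1` [set u]) else 0.
Proof.
case: eqP => [sk|sk]; last first.
  rewrite (_ : _ @^-1` _ = set0) ?measure0//.
  by apply/seteqP; split => w //= E; apply: sk; rewrite -E size_map size_iota.
case: s sk => [|u0 s'] sk.
  move: sk => /= <-; rewrite big_nil (_ : _ @^-1` _ = setT).
    exact: probability_setT.
  by apply/seteqP; split.
set s := u0 :: s' in sk *.
pose A i := X i @^-1` [set nth u0 s (i - a)].
pose J := [fset i | i in iota a k]%fset.
have JE : perm_eq (enum_fset J) (iota a k).
  apply: uniq_perm; [exact: fset_uniq|exact: iota_uniq|].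
  by move=> i; rewrite !inE.
have -> : path_of a k @^-1` [set s] = \bigcap_(i in [set` J]) A i.
  apply/seteqP; split => w /=.
    move=> ws i /=; rewrite !inE mem_iota => /andP[ai ik].
    rewrite /A /= -ws /path_of (nth_map 0%N) ?size_iota ?ltn_subLR//.
    by rewrite nth_iota ?ltn_subLR// subnKC.
  move=> wA; apply: (@eq_from_nth _ u0); first by rewrite size_map size_iota.
  move=> i; rewrite size_map size_iota => ik.
  rewrite (nth_map 0%N) ?size_iota// nth_iota//.
  have := wA (a + i)%N; rewrite /A /= !inE mem_iota leq_addr ltn_add2l ik.
  by rewrite addKn; apply.
rewrite (iid_indep X_iid); last first.
  by move=> i _; exists [set nth u0 s (i - a)] => //; rewrite setTI.
rewrite (perm_big _ JE) /=.
under eq_bigr do rewrite (iid_law X_iid).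
rewrite [RHS](big_nth u0) sk -{1}[a]addn0 iotaDl big_map /index_iota subn0.
by apply: eq_bigr => i _; rewrite addKn.
Qed.

(** The first increment is independent of the remaining ones, by [path_pmf], and has the law of
    [X 0]. The starting index is arbitrary because peeling off an increment raises it. *)
Lemma path_law a k F : (forall s, 0 <= F s) ->
  \int[P]_w F (path_of a k w) = EE k F.
Proof.
elim: k a F => [|k IH] a F F0 /=.
  rewrite (eq_integral (cst (F [::])))// integral_cst//.
  by rewrite -[RHS]mule1; congr (_ * _); exact: probability_setT.
rewrite (eq_integral (fun w => F (X a w :: path_of a.+1 k w)))//.
rewrite (@discrete_integral_indep _ _ _ P _ _ (X a) (path_of a.+1 k)
   (fun u s => F (u :: s)))//; last 3 first.
- exact: (iid_measurable X_iid).
- exact: path_of_discrete.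
- move=> u s.
  rewrite (_ : _ `&` _ = path_of a k.+1 @^-1` [set (u :: s)]); last first.
    by apply/seteqP; split => w; rewrite /path_of /=; [case=> -> ->|case=> -> ->].
  rewrite !path_pmf /= eqSS big_cons (iid_law X_iid a).
  by case: ifP => _; rewrite ?mule0.
transitivity (\int[P]_w' EE k (fun s => F (X a w' :: s))).
  by apply: eq_integral => w' _; rewrite -(IH a.+1).
apply: (@discrete_integral_law _ _ _ P _ _ _ (fun u => EE k (fun s => F (u :: s)))).
- exact: (iid_measurable X_iid).
- exact: (iid_measurable X_iid).
- by move=> u; apply: EE_ge0.
- by move=> u; rewrite (iid_law X_iid a).
Qed.

Lemma EE_le k F G : (forall s, 0 <= F s) -> (forall s, size s = k -> F s <= G s) ->
  EE k F <= EE k G.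
Proof.
elim: k F G => [|k IH] F G F0 FG /=; first exact: FG.
apply: ge0_le_integral => //.
- by move=> w _; exact: EE_ge0.
- exact: (@discrete_measurable_fun _ _ _ (X 0%N) _ _
    (fun u => EE k (fun s => F (u :: s))) _ (iid_measurable X_iid 0%N)).
- exact: (@discrete_measurable_fun _ _ _ (X 0%N) _ _
    (fun u => EE k (fun s => G (u :: s))) _ (iid_measurable X_iid 0%N)).
- by move=> w _; apply: IH => // s sk; apply: FG; rewrite /= sk.
Qed.

Lemma eq_EE k F G : (forall s, size s = k -> F s = G s) -> EE k F = EE k G.
Proof.
elim: k F G => [|k IH] F G FG /=; first exact: FG.
by apply: eq_integral => w _; apply: IH => s sk; apply: FG; rewrite /= sk.
Qed.

Lemma EE_cat k l F : EE (k + l) F = EE k (fun s => EE l (fun s' => F (s ++ s'))).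
Proof.
elim: k F => [|k IH] F //=.
by apply: eq_integral => w _; rewrite IH.
Qed.

Lemma EE_Zl k (c : R) F : (0 <= c)%R -> (forall s, 0 <= F s) ->
  EE k (fun s => c%:E * F s) = c%:E * EE k F.
Proof.
move=> c0 F0; rewrite -!(@path_law 0)//; last by move=> s; rewrite mule_ge0.
rewrite ge0_integralZl//.
exact: (@discrete_measurable_fun _ _ _ _ _ _ F _ (@path_of_discrete 0 k)).
Qed.

Lemma EE_sum k (I : Type) (r : seq I) (F : I -> seq U -> \bar R) :
  (forall i s, 0 <= F i s) ->
  EE k (fun s => \sum_(i <- r) F i s) = \sum_(i <- r) EE k (F i).
Proof.
move=> F0; rewrite -(@path_law 0)//; last by move=> s; exact: sume_ge0.
rewrite ge0_integral_sum//; last first.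
  move=> i; exact: (@discrete_measurable_fun _ _ _ _ _ _ (F i) _ (@path_of_discrete 0 k)).
by apply: eq_bigr => i _; rewrite path_law.
Qed.

Lemma EE_cst k (c : R) : (0 <= c)%R -> EE k (fun=> c%:E) = c%:E.
Proof.
move=> c0; rewrite -(@path_law 0)// integral_cst//.
by rewrite -[RHS]mule1; congr (_ * _); exact: probability_setT.
Qed.

Lemma path_prob a k (B : set (seq U)) :
  P (path_of a k @^-1` B) = EE k (fun s => (\1_B s)%:E).
Proof.
transitivity (\int[P]_w (\1_(path_of a k @^-1` B) w)%:E).
  by rewrite integral_indic ?setIT//; exact: path_of_discrete.
rewrite -(@path_law a k (fun s => (\1_B s)%:E)) => [|s]; last by rewrite lee_fin.
apply: eq_integral => w _; rewrite !indicE; congr (_%:R%:E).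
Qed.

End path_law.

(** * Additive functionals along a path and exponential supersolutions *)

Section additive_functional.
Context (R : realType) (U : Type) (S : Type) (st : S -> U -> S).

(** Occupation at the times 0, ..., k - 1 of a path of k letters: the state reached at the end is
    not counted, which makes [occ_cat] exact. *)
Fixpoint occ (v : S -> R) (x : S) (s : seq U) : R :=
  if s is u :: s' then v x + occ v (st x u) s' else 0.

Fixpoint final (x : S) (s : seq U) : S :=
  if s is u :: s' then final (st x u) s' else x.

Lemma final_cat x s s' : final x (s ++ s') = final (final x s) s'.
Proof. by elim: s x => //=. Qed.

Lemma occ_cat v x s s' : occ v x (s ++ s') = occ v x s + occ v (final x s) s'.
Proof. by elim: s x => [|u s IH] x /=; rewrite ?add0r// IH addrA. Qed.

Lemma occD v v' x s : occ (fun y => v y + v' y) x s = occ v x s + occ v' x s.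
Proof. by elim: s x => [|u s IH] x /=; rewrite ?addr0// IH addrACA. Qed.

Lemma occZ c v x s : occ (fun y => c * v y) x s = c * occ v x s.
Proof. by elim: s x => [|u s IH] x /=; rewrite ?mulr0// IH mulrDr. Qed.

Lemma occ_sum (I : Type) (r : seq I) (v : I -> S -> R) x s :
  occ (fun y => \sum_(i <- r) v i y) x s = \sum_(i <- r) occ (v i) x s.
Proof.
elim: s x => [|u s IH] x /=; first by rewrite big1.
by rewrite IH -big_split.
Qed.

Lemma eq_occ v v' x s : v =1 v' -> occ v x s = occ v' x s.
Proof. by move=> vv'; elim: s x => //= u s IH x; rewrite vv' IH. Qed.

Lemma occ_ge0 v x s : (forall y, 0 <= v y) -> 0 <= occ v x s.
Proof. by move=> v0; elim: s x => //= u s IH x; rewrite addr_ge0. Qed.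

End additive_functional.

Section exponential_supersolution.
Context d (T : measurableType d) (R : realType) (P : probability T R).
Context (U : countType) (X : nat -> T -> U) (X_iid : iid P X).
Context (S : Type) (st : S -> U -> S).
Local Open Scope ereal_scope.

(** Feynman-Kac: by hypothesis c^k exp(occupation) [phi] is a supermartingale. The factor [c] will
    be a survival probability per step, or a correction close to 1. *)
Lemma EE_exp_le (c : R) (v phi : S -> R) k x :
  (0 <= c)%R -> (forall y, 0 <= phi y)%R ->
  (forall y, (c * expR (v y))%:E * \int[P]_w (phi (st y (X 0%N w)))%:E
     <= (phi y)%:E) ->
  (c ^+ k)%:E * EE P X k (fun s => (expR (occ st v x s) * phi (final st x s))%:E)
    <= (phi x)%:E.
Proof.
move=> c0 phi0 step; elim: k x => [|k IH] x /=.
  by rewrite expr0 mul1e expR0 mul1r.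
have F0 y s : 0 <= (expR (occ st v y s) * phi (final st y s))%:E :> \bar R.
  by rewrite lee_fin mulr_ge0// expR_ge0.
apply: le_trans (step x).
rewrite exprS EFinM -muleA.
under eq_integral => w _.
  rewrite (_ : (fun s => _) = (fun s => (expR (v x))%:E *
     (expR (occ st v (st x (X 0%N w)) s) *
      phi (final st (st x (X 0%N w)) s))%:E)); last first.
    by apply/funext => s; rewrite -EFinM expRD mulrA.
  rewrite (EE_Zl X_iid) ?expR_ge0//.
  over.
have mEE : measurable_fun setT (fun w => EE P X k (fun s =>
    (expR (occ st v (st x (X 0%N w)) s) *
     phi (final st (st x (X 0%N w)) s))%:E)).
  exact: (@discrete_measurable_fun _ _ _ (X 0%N) _ _ (fun u => EE P X k
    (fun s => (expR (occ st v (st x u) s) * phi (final st (st x u) s))%:E)) _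
    (iid_measurable X_iid 0%N)).
rewrite ge0_integralZl//; last by move=> w _; apply: EE_ge0.
rewrite [(c * expR _)%:E]EFinM -!muleA lee_wpmul2l ?lee_fin// muleCA.
rewrite lee_wpmul2l ?lee_fin ?expR_ge0//.
rewrite -ge0_integralZl ?lee_fin ?exprn_ge0//; last by move=> w _; apply: EE_ge0.
apply: ge0_le_integral => //.
- by move=> w _; rewrite mule_ge0 ?lee_fin ?exprn_ge0//; apply: EE_ge0.
- exact: measurable_funeM.
- exact: (@discrete_measurable_fun _ _ _ (X 0%N) _ _ (fun u => (phi (st x u))%:E) _
    (iid_measurable X_iid 0%N)).
Qed.

Lemma EE_exp_prob (c a : R) (v phi : S -> R) k x (B : set (seq U)) :
  (0 < c)%R -> (0 < a)%R -> (forall y, 0 <= phi y)%R ->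
  (forall y, (c * expR (v y))%:E * \int[P]_w (phi (st y (X 0%N w)))%:E
     <= (phi y)%:E) ->
  (forall s, size s = k -> B s -> a <= expR (occ st v x s) * phi (final st x s))%R ->
  EE P X k (fun s => (\1_B s)%:E) <= (phi x / (a * c ^+ k))%:E.
Proof.
move=> c0 a0 phi0 step aB.
have := EE_exp_le k x (ltW c0) phi0 step.
set E1 := EE P X k _ => leE1.
have : (a%:E * EE P X k (fun s => (\1_B s)%:E) <= E1).
  rewrite -(EE_Zl X_iid) ?(ltW a0)//.
  rewrite /E1; apply: (EE_le X_iid) => [s|s sk].
    by rewrite mule_ge0// lee_fin ltW.
  rewrite -EFinM lee_fin indicE.
  have [Bs|Bs] := boolP (s \in B); first by rewrite mulr1; apply: aB => //; exact: set_mem.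
  by rewrite mulr0 mulr_ge0 ?expR_ge0.
move=> leB.
rewrite mulrC EFinM lee_pdivlMl ?mulr_gt0 ?exprn_gt0//.
rewrite mulrC EFinM -muleA; apply: le_trans leE1.
by rewrite lee_wpmul2l// lee_fin exprn_ge0// ltW.
Qed.

End exponential_supersolution.

(** * Trigonometric inequalities and the pairing of frequencies with sites *)

Section trigonometry.
Context (R : realType).
Implicit Types a b t : R.

Lemma one_sub_cos t : 1 - cos t = 2 * sin (t / 2) ^+ 2.
Proof. by rewrite {1}(splitr t) cosD -!expr2 cos2sin2; ring. Qed.

Lemma one_sub_cos_ge0 t : 0 <= 1 - cos t.
Proof. by rewrite subr_ge0 cos_le1. Qed.

Lemma normr_cos t : `|cos t| <= 1.
Proof. by rewrite ler_norml cos_le1 cos_geN1. Qed.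

Lemma normr_sin_natM (n : nat) t : `|sin (n%:R * t)| <= n%:R * `|sin t|.
Proof.
elim: n => [|n IH]; first by rewrite !mul0r sin0 normr0.
rewrite -addn1 natrD !mulrDl !mul1r sinD (le_trans (ler_normD _ _))//.
rewrite !normrM lerD//.
  by rewrite (le_trans _ IH)// ler_piMr ?normr_cos.
by rewrite ler_piMl ?normr_cos.
Qed.

Lemma one_sub_cos_intM (n : int) t :
  1 - cos (n%:~R * t) <= n%:~R ^+ 2 * (1 - cos t).
Proof.
rewrite !one_sub_cos [leRHS]mulrCA ler_pM2l// -mulrA.
have -> : n%:~R ^+ 2 * sin (t / 2) ^+ 2 = (n%:~R * sin (t / 2)) ^+ 2 :> R.
  by rewrite exprMn.
rewrite -[leLHS]real_normK ?num_real// -[leRHS]real_normK ?num_real//.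
rewrite ler_sqr ?nnegrE// normrM.
have [m [->|->]] : exists m : nat, n = m%:Z \/ n = - m%:Z.
  by exists `|n|%N; have := lerP 0 n; lia.
- by rewrite -pmulrn (ger0_norm (ler0n _ _)) normr_sin_natM.
- by rewrite mulrNz mulNr sinN !normrN -pmulrn (ger0_norm (ler0n _ _)) normr_sin_natM.
Qed.

Lemma one_sub_cosD a b :
  1 - cos (a + b) <= 2 * (1 - cos a) + 2 * (1 - cos b).
Proof.
rewrite !one_sub_cos [(a + b) / 2]mulrDl sinD.
have := cos2Dsin2 (a / 2); have := cos2Dsin2 (b / 2).
set s := sin _; set c := cos _; set s' := sin _; set c' := cos _ => h h'.
have : (s' * c - c' * s) ^+ 2 >= 0 by exact: sqr_ge0.
have : 0 <= s' ^+ 2 * s ^+ 2 by rewrite mulr_ge0 ?sqr_ge0.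
nra.
Qed.

(* |cos a - cos b| <= 2 |sin ((a - b) / 2)|, then AM-GM *)
Lemma normr_cosB (eta : R) a b : 0 < eta ->
  `|cos a - cos b| <= eta + (1 - cos (a - b)) / (2 * eta).
Proof.
move=> eta0; rewrite one_sub_cos.
pose u := (a + b) / 2; pose v := (a - b) / 2.
have -> : a = u + v by rewrite /u /v; field.
have -> : b = u - v by rewrite /u /v; field.
rewrite cosD cosB.
have -> : (u + v - (u - v)) / 2 = v by field.
have -> : cos u * cos v - sin u * sin v - (cos u * cos v + sin u * sin v) =
  - 2 * sin u * sin v by ring.
rewrite !normrM normrN (ger0_norm (ler0n _ _)).
have su : `|sin u| <= 1 by rewrite ler_norml sin_le1 sin_geN1.
apply: (@le_trans _ _ (2 * `|sin v|)).
  by rewrite ler_wpM2r// -[leRHS]mulr1 ler_wpM2l.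
rewrite -[sin v ^+ 2]real_normK ?num_real//.
have -> : 2 * `|sin v| ^+ 2 / (2 * eta) = `|sin v| ^+ 2 / eta.
  by field; rewrite gt_eqF.
rewrite -subr_ge0.
have -> : eta + `|sin v| ^+ 2 / eta - 2 * `|sin v| = (eta - `|sin v|) ^+ 2 / eta.
  by field; rewrite gt_eqF.
by rewrite divr_ge0 ?sqr_ge0// ltW.
Qed.

Definition ip (th : R * R) (x : Z2) : R :=
  th.1 * (x 0 0)%:~R + th.2 * (x 1 0)%:~R.

Definition sqn (x : Z2) : R := (x 0 0)%:~R ^+ 2 + (x 1 0)%:~R ^+ 2.

Lemma ipD th x y : ip th (x + y) = ip th x + ip th y.
Proof. by rewrite /ip !mxE !rmorphD /=; ring. Qed.

Lemma ipN th x : ip th (- x) = - ip th x.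
Proof. by rewrite /ip !mxE !rmorphN /=; ring. Qed.

Lemma ip0 th : ip th 0 = 0.
Proof. by rewrite /ip !mxE /= !mulr0 addr0. Qed.

Lemma sqn_ge0 x : 0 <= sqn x.
Proof. by rewrite addr_ge0 ?sqr_ge0. Qed.

Lemma sqnN x : sqn (- x) = sqn x.
Proof. by rewrite /sqn !mxE !rmorphN /= !sqrrN. Qed.

Lemma sqn_parallelogram x y : sqn (x + y) + sqn (x - y) = 2 * sqn x + 2 * sqn y.
Proof. by rewrite /sqn !mxE !rmorphD !rmorphN /=; ring. Qed.

Lemma one_sub_cos_ip_le (th : R * R) x :
  1 - cos (ip th x) <= 2 * sqn x * Num.max (1 - cos th.1) (1 - cos th.2).
Proof.
apply: (le_trans (one_sub_cosD _ _)).
rewrite ![_ * _%:~R]mulrC.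
have h1 := one_sub_cos_intM (x 0 0) th.1.
have h2 := one_sub_cos_intM (x 1 0) th.2.
set m := Num.max _ _.
have m1 : 1 - cos th.1 <= m by rewrite le_max lexx.
have m2 : 1 - cos th.2 <= m by rewrite le_max lexx orbT.
have := ler_wpM2l (sqr_ge0 ((x 0 0)%:~R : R)) m1.
have := ler_wpM2l (sqr_ge0 ((x 1 0)%:~R : R)) m2.
rewrite /sqn; lra.
Qed.

End trigonometry.

(** * Averages over the frequency torus *)

Section uniform_mean.
Context (R : realType).

Lemma ltrNpi : - pi < pi :> R.
Proof. by rewrite gtrN// pi_gt0. Qed.

Definition unif : probability (measurableTypeR R) R := uniform_prob ltrNpi.

Definition unif2 : probability (measurableTypeR R * measurableTypeR R)%type R :=
  (unif \x unif)%E.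

Local Notation Theta := (measurableTypeR R * measurableTypeR R)%type.

Lemma measurable_ip (x : Z2) : measurable_fun setT (fun th : Theta => ip th x).
Proof. by apply: measurable_funD; apply: measurable_funM. Qed.

Lemma measurable_cos : measurable_fun setT (@cos R).
Proof. by apply: continuous_measurable_fun; exact: continuous_cos. Qed.

Lemma bounded_mfun_cos_ip (x : Z2) : bounded_mfun (fun th : Theta => cos (ip th x)).
Proof.
split; last by exists 1 => th; exact: normr_cos.
by apply: (measurableT_comp measurable_cos); exact: measurable_ip.
Qed.

Lemma bounded_mfunV d (T : measurableType d) (f : T -> R) (c : R) :
  0 < c -> measurable_fun setT f -> (forall x, c <= f x) ->
  bounded_mfun (fun x => (f x)^-1).
Proof.
move=> c0 mf cf; have f0 x : 0 < f x by exact: lt_le_trans (cf x).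
split.
  (* Measurability of the inverse of a positive function is read off from exp(- ln f). *)
  rewrite (_ : (fun x => _) = (fun x => expR (- ln (f x)))).
    apply: measurableT_comp; first exact: measurable_expR.
    apply: measurableT_comp => //.
    by apply: measurableT_comp => //; exact: measurable_ln.
  by apply/funext => x; rewrite -lnV ?posrE// lnK// posrE invr_gt0.
exists c^-1 => x; rewrite ger0_norm; last by rewrite invr_ge0 ltW.
by rewrite ler_pV2 ?inE ?unitfE ?gt_eqF ?f0 ?c0.
Qed.

Lemma ftc (a b : R) (f F : R -> R) : a < b ->
  (forall t, a <= t <= b -> is_derive t 1 F (f t)) ->
  (forall t, a <= t <= b -> {for t, continuous f}) ->
  (\int[lebesgue_measure]_(t in `[a, b]) (f t)%:E = (F b - F a)%:E)%E.
Proof.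
move=> ab dF cf.
have cF t : a <= t <= b -> {for t, continuous F}.
  move=> /dF dFt; apply: differentiable_continuous.
  exact/derivable1_diffP.
rewrite (@continuous_FTC2 _ _ F _ _ ab) ?EFinB//.
- apply: continuous_in_subspaceT => t; rewrite inE /= in_itv /=.
  exact: cf.
- split.
  + by move=> t; rewrite in_itv /= => /andP[at_ tb]; have := dF t;
      rewrite !ltW// => /(_ isT) [].
  + by apply: cvg_at_right_filter; apply: cF; rewrite lexx ltW.
  + by apply: cvg_at_left_filter; apply: cF; rewrite lexx ltW.
- move=> t; rewrite in_itv /= => /andP[at_ tb].
  by rewrite derive1E; have := dF t; rewrite !ltW// => /(_ isT) [].
Qed.

Lemma sin_periodic_int (a : R) (n : int) :
  sin (a + pi * n%:~R) = sin (a - pi * n%:~R).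
Proof.
have nat_case (b : R) (m : nat) : sin (b + pi *+ 2 * m%:R) = sin b.
  elim: m => [|m IH]; first by rewrite mulr0 addr0.
  by rewrite -[m.+1]addn1 natrD mulrDr mulr1 addrA sinD2pi.
have [m [->|->]] : exists m : nat, n = m%:Z \/ n = - m%:Z.
  by exists `|n|%N; have := lerP 0 n; lia.
- rewrite -pmulrn -(nat_case (a - pi * m%:R) m); congr sin.
  by rewrite mulr2n; ring.
- rewrite mulrNz -pmulrn -(nat_case (a + pi * - m%:R) m); congr sin.
  by rewrite mulr2n; ring.
Qed.

Lemma integral_cosDM (a : R) (n : int) : n != 0 ->
  (\int[lebesgue_measure]_(t in `[(- pi)%R, pi]) (cos (a + t * n%:~R))%:E = 0)%E.
Proof.
move=> n0; have nR0 : n%:~R != 0 :> R by rewrite intr_eq0.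
have dF (t : R) : - pi <= t <= pi ->
    is_derive t 1 (fun t : R => sin (a + t * n%:~R) / n%:~R) (cos (a + t * n%:~R)).
  move=> _.
  have -> : (fun t : R => sin (a + t * n%:~R) / n%:~R) =
     (fun t : R => n%:~R^-1 *: ((@sin R) \o (fun t : R => a + n%:~R *: t)) t).
    by apply/funext => u /=; rewrite /GRing.scale /= mulrC [_ * u]mulrC.
  apply: is_derive_eq.
  rewrite /GRing.scale /= add0r mulr1 [n%:~R * t]mulrC.
  by field.
have cf (t : R) : - pi <= t <= pi -> {for t, continuous (fun t : R => cos (a + t * n%:~R))}.
  move=> _.
  have -> : (fun t : R => cos (a + t * n%:~R)) = (@cos R) \o (fun t : R => a + t * n%:~R) by [].
  apply: continuous_comp; last exact: continuous_cos.
  by apply: cvgD; [exact: cvg_cst|apply: cvgM; [exact: cvg_id|exact: cvg_cst]].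
by rewrite (ftc ltrNpi dF cf) mulNr sin_periodic_int subrr.
Qed.

Lemma ev_unif (f : R -> R) : (forall t, 0 <= f t) -> bounded_mfun f ->
  (ev unif f)%:E =
  ((pi *+ 2)^-1%:E * \int[lebesgue_measure]_(t in `[(- pi)%R, pi]) (f t)%:E)%E.
Proof.
move=> f0 bf; rewrite EFin_ev// integral_uniform//.
  by rewrite opprK -mulr2n.
by apply/measurable_EFinP; exact: bf.1.
Qed.

End uniform_mean.

(** * The Green function of the killed walk *)

Section green_function.
Context d (T : measurableType d) (R : realType) (P : probability T R).
Context (X0 : T -> Z2) (mX0 : discrete_rv X0) (symX0 : symmetric_law P X0).
Local Notation Theta := (measurableTypeR R * measurableTypeR R)%type.

Definition step_op (f : Z2 -> R) (x : Z2) : R := ev P (fun w => f (x + X0 w)).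

Lemma bounded_mfun_step (f : Z2 -> R) (M : R) :
  (forall x, `|f x| <= M) -> forall x, bounded_mfun (fun w => f (x + X0 w)).
Proof.
move=> fM x; split; last by exists M.
exact: (@discrete_measurable_fun _ _ _ X0 _ _ (fun y => f (x + y))).
Qed.

Lemma law_opp (F : Z2 -> \bar R) : (forall x, 0 <= F x)%E ->
  (\int[P]_w F (- X0 w)%R = \int[P]_w F (X0 w))%E.
Proof.
move=> F0; apply: (@discrete_integral_law _ _ _ P _ (fun w => - X0 w)) => //.
- by move=> B; exact: (mX0 [set y | B (- y)]).
- by move=> u; exact: (symX0 [set u]).
Qed.

(** The characteristic function: for a symmetric law the sine part vanishes. *)
Definition charf (th : R * R) : R := ev P (fun w => cos (ip th (X0 w))).

Lemma normr_charf th : `|charf th| <= 1.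
Proof.
apply: ev_norm_le => [|w]; last exact: normr_cos.
rewrite (_ : (fun w => _) = (fun w => cos (ip th (0 + X0 w)))).
  by apply: (bounded_mfun_step (M := 1) (f := fun y => cos (ip th y))) => y; exact: normr_cos.
by apply/funext => w; rewrite add0r.
Qed.

Lemma measurable_coord (i : 'I_2) :
  measurable_fun setT (fun w => (X0 w i 0)%:~R : R).
Proof. exact: (@discrete_measurable_fun _ _ _ X0 _ _ (fun y => (y i 0)%:~R : R)). Qed.

Lemma bounded_mfun_cos_step (g : Theta -> R) (x : Z2) : bounded_mfun g ->
  bounded_mfun (fun wt : T * Theta => cos (ip wt.2 (x + X0 wt.1)) * g wt.2).
Proof.
move=> bg; apply: bounded_mfunM; last first.
  split; first by apply: measurableT_comp => //; exact: bg.1.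
  by have [_ [M gM]] := bg; exists M.
split; last by exists 1 => wt; exact: normr_cos.
apply: (measurableT_comp (@measurable_cos R)).
rewrite /ip.
have mc i : measurable_fun setT (fun wt : T * Theta => ((x + X0 wt.1) i 0)%:~R : R).
  have -> : (fun wt : T * Theta => ((x + X0 wt.1) i 0)%:~R : R) =
     (fun w => ((x + X0 w) i 0)%:~R) \o fst by [].
  apply: measurableT_comp => //.
  exact: (@discrete_measurable_fun _ _ _ X0 _ _ (fun y => ((x + y) i 0)%:~R : R)).
apply: measurable_funD; apply: measurable_funM => //.
- by apply: (measurableT_comp (f := fst)).
- by apply: (measurableT_comp (f := snd)).
Qed.

Lemma bounded_mfun_charf : bounded_mfun (charf : Theta -> R).
Proof.
have b1 := bounded_mfun_cos_step 0 (bounded_mfun_cst (1 : R)).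
have := bounded_mfun_ev2 P (unif2 R) b1.
congr (bounded_mfun _); apply/funext => th; rewrite /charf /=.
by congr ev; apply/funext => w; rewrite add0r mulr1.
Qed.

Lemma ev_cos_step th x : ev P (fun w => cos (ip th (x + X0 w))) =
  cos (ip th x) * charf th.
Proof.
have bs : bounded_mfun (fun w => sin (ip th (X0 w))).
  split; last by exists 1 => w; rewrite ler_norml sin_le1 sin_geN1.
  exact: (@discrete_measurable_fun _ _ _ X0 _ _ (fun y => sin (ip th y))).
have bc : bounded_mfun (fun w => cos (ip th (X0 w))).
  split; last by exists 1 => w; exact: normr_cos.
  exact: (@discrete_measurable_fun _ _ _ X0 _ _ (fun y => cos (ip th y))).
have s0 : ev P (fun w => sin (ip th (X0 w))) = 0.
  have b1 : bounded_mfun (cst (1 : R) : T -> R) by exact: bounded_mfun_cst.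
  have : (ev P (fun w => 1 - sin (ip th (X0 w))) = ev P (fun w => 1 + sin (ip th (X0 w)))).
    apply: EFin_inj; rewrite (EFin_ev _ (bounded_mfunB b1 bs)) (EFin_ev _ (bounded_mfunD b1 bs)).
    rewrite -(@law_opp (fun y => (1 + sin (ip th y))%:E)).
      by apply: eq_integral => w _; rewrite ipN sinN.
    by move=> x0; rewrite lee_fin -lerBlDl sub0r sin_geN1.
  by rewrite (evD P b1 bs) (evB P b1 bs) => h; lra.
rewrite (_ : (fun w => _) = (fun w => cos (ip th x) * cos (ip th (X0 w)) -
    sin (ip th x) * sin (ip th (X0 w)))); last first.
  by apply/funext => w; rewrite ipD cosD.
rewrite (evB P (bounded_mfunZ (cos (ip th x)) bc) (bounded_mfunZ (sin (ip th x)) bs)).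
by rewrite (evZ P _ bc) (evZ P _ bs) s0 mulr0 subr0.
Qed.

(** Fourier inversion of the sum over n of l^n P(S_n = x): the expected number of visits to x when
    the walk survives each step with probability l. The Fourier form carries the asymptotics, and
    [green_eq] is its first-step equation. *)
Definition green (l : R) (x : Z2) : R :=
  ev (unif2 R) (fun th => cos (ip th x) * (1 - l * charf th)^-1).

Section fixed_killing.
Variable l : R.
Hypothesis l01 : 0 < l < 1.

Lemma den_ge th : 1 - l <= 1 - l * charf th.
Proof.
have /andP[l0 l1] := l01; have := normr_charf th; rewrite ler_norml => /andP[_].
by rewrite -(ler_pM2l l0) mulr1; lra.
Qed.

Lemma den_gt0 th : 0 < 1 - l * charf th.
Proof. by apply: lt_le_trans (den_ge th); rewrite subr_gt0; case/andP: l01. Qed.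

Lemma bounded_mfun_den : bounded_mfun (fun th : Theta => (1 - l * charf th)^-1).
Proof.
apply: (@bounded_mfunV _ _ _ _ (1 - l)); last exact: den_ge.
  by rewrite subr_gt0; case/andP: l01.
by apply: (bounded_mfunB (bounded_mfun_cst 1) (bounded_mfunZ l bounded_mfun_charf)).1.
Qed.

Lemma bounded_mfun_green x :
  bounded_mfun (fun th : Theta => cos (ip th x) * (1 - l * charf th)^-1).
Proof.
by apply: bounded_mfunM; [exact: bounded_mfun_cos_ip|exact: bounded_mfun_den].
Qed.

Lemma ev_unif2_cos (x : Z2) :
  ev (unif2 R) (fun th => cos (ip th x)) = (x == 0)%:R.
Proof.
have bc := bounded_mfun_cos_ip R x.
have ev_cos (a : R) (n : int) :
    ev (unif R) (fun t => cos (a + t * n%:~R)) = (n == 0)%:R * cos a.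
  have [->|n0] := eqVneq n 0.
    rewrite (_ : (fun t => _) = cst (cos a)) ?ev_cst ?mul1r//.
    by apply/funext => t; rewrite mulr0 addr0.
  have bf : bounded_mfun (fun t : measurableTypeR R => cos (a + t * n%:~R)).
    split; last by exists 1 => t; exact: normr_cos.
    by apply: (measurableT_comp (@measurable_cos R)); apply: measurable_funD => //; apply: measurable_funM.
  have b1 := bounded_mfun_cst (1 : R) : bounded_mfun (cst 1 : measurableTypeR R -> R).
  (* [ev_unif] is for nonnegative integrands; adding 1 to the cosine makes it applicable. *)
  have h : (ev (unif R) (fun t => 1 + cos (a + t * n%:~R)))%:E = (ev (unif R) (cst 1))%:E.
    have g0 (t : R) : 0 <= 1 + cos (a + t * n%:~R) by rewrite -lerBlDl sub0r cos_geN1.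
    rewrite (ev_unif g0 (bounded_mfunD b1 bf)) (@ev_unif _ (cst 1) _ b1); last by [].
    congr (_ * _)%E.
    have i1 (f : R -> R) : bounded_mfun (f : measurableTypeR R -> R) ->
        lebesgue_measure.-integrable `[(- pi)%R, pi] (EFin \o f).
      move=> [mf [M fM]]; apply: measurable_bounded_integrable => //.
      - by rewrite /= lebesgue_measure_itv /= lte_fin ltrNpi -EFinB ltry.
      - exact: measurable_funTS.
      - by exists M; split; rewrite ?num_real// => x1 Mx1 y _; apply: le_trans (ltW Mx1).
    under eq_integral do rewrite EFinD.
    rewrite integralD//=; [|exact: (i1 (cst 1))|exact: i1].
    by rewrite integral_cosDM// adde0.
  move: h => [] ; rewrite (evD _ b1 bf) => h.
  by rewrite mul0r; move: h; rewrite -[RHS]addr0 => /addrI.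
rewrite ev_prod//=.
rewrite (_ : (fun t => _) = (fun t => (x 1 0 == 0)%:R * cos (0 + t * (x 0 0)%:~R))); last first.
  by apply/funext => t; rewrite /ip /= ev_cos add0r.
rewrite evZ; last first.
  split; last by exists 1 => t; exact: normr_cos.
  by apply: (measurableT_comp (@measurable_cos R)); apply: measurable_funD => //; apply: measurable_funM.
rewrite ev_cos cos0 mulr1 -natrM mulnb; congr (_%:R); congr nat_of_bool.
apply/idP/idP => [/andP[/eqP x1 /eqP x0]|/eqP ->]; last by rewrite !mxE eqxx.
apply/eqP/colP => i; rewrite mxE.
by have [->|->] : i = 0 \/ i = 1 by case: i => -[|[|]]// p; [left|right]; apply/val_inj.
Qed.

Lemma step_green x : step_op (green l) x =
  ev (unif2 R) (fun th => cos (ip th x) * charf th * (1 - l * charf th)^-1).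
Proof.
rewrite /step_op /green.
rewrite (@ev_fubini _ _ _ _ _ P (unif2 R)
  (fun wt => cos (ip wt.2 (x + X0 wt.1)) * (1 - l * charf wt.2)^-1)); last first.
  exact: (@bounded_mfun_cos_step _ x bounded_mfun_den).
congr ev; apply/funext => th /=.
have bc : bounded_mfun (fun w => cos (ip th (x + X0 w))).
  by apply: (bounded_mfun_step (M := 1) (f := fun y => cos (ip th y))) => y; exact: normr_cos.
rewrite -ev_cos_step [RHS]mulrC -(evZ P _ bc).
by congr ev; apply/funext => w; rewrite mulrC.
Qed.

Lemma green_eq x : green l x = (x == 0)%:R + l * step_op (green l) x.
Proof.
rewrite step_green -ev_unif2_cos.
have bcc : bounded_mfun (fun th : Theta => cos (ip th x) * charf th * (1 - l * charf th)^-1).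
  apply: bounded_mfunM; last exact: bounded_mfun_den.
  by apply: bounded_mfunM; [exact: bounded_mfun_cos_ip|exact: bounded_mfun_charf].
rewrite -(evZ _ _ bcc) -(evD _ (bounded_mfun_cos_ip R x) (bounded_mfunZ l bcc)).
congr ev; apply/funext => th; have := den_gt0 th => D0.
by field; rewrite gt_eqF.
Qed.

Lemma green_norm_le x : `|green l x| <= green l 0.
Proof.
have b0 := bounded_mfun_green 0; have bx := bounded_mfun_green x.
have D0 (th : Theta) : 0 < (1 - l * charf th)^-1 by rewrite invr_gt0 den_gt0.
rewrite ler_norml; apply/andP; split.
- rewrite -mulN1r -(evZ _ _ b0); apply: ev_le => //; first exact: bounded_mfunZ.
  by move=> th; rewrite ip0 cos0 mul1r ler_pM2r ?D0// cos_geN1.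
- by apply: ev_le => // th; rewrite ip0 cos0 ler_pM2r ?D0// cos_le1.
Qed.

Lemma greenN x : green l (- x) = green l x.
Proof. by congr ev; apply/funext => th; rewrite ipN cosN. Qed.

Lemma step_op_le (f g : Z2 -> R) (M : R) : (forall x, `|f x| <= M) ->
  (forall x, `|g x| <= M) -> (forall x, f x <= g x) ->
  forall x, step_op f x <= step_op g x.
Proof.
by move=> fM gM fg x; apply: ev_le => //;
  [exact: (bounded_mfun_step fM)|exact: (bounded_mfun_step gM)].
Qed.

(* Since l < 1, a bounded l-subharmonic nonnegative function vanishes: iterating
   f <= l * step_op f gives f <= l ^+ k * M for all k. *)
Lemma killed_maximum_principle (f : Z2 -> R) (M : R) :
  (forall x, `|f x| <= M) -> (forall x, 0 < f x -> f x <= l * step_op (fun y => Num.max (f y) 0) x) ->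
  forall x, f x <= 0.
Proof.
move=> fM fP; have /andP[l0 l1] := l01.
have M0 : 0 <= M by exact: le_trans (normr_ge0 _) (fM 0).
set g := fun y => Num.max (f y) 0.
have g0 y : 0 <= g y by rewrite le_max lexx orbT.
have gM y : `|g y| <= M.
  rewrite ger0_norm// ge_max M0 andbT; apply: le_trans (fM y); exact: ler_norm.
have it k : forall y, g y <= l ^+ k * M.
  elim: k => [|k IH] x; first by rewrite expr0 mul1r (le_trans (ler_norm _)).
  rewrite ge_max; apply/andP; split; last by rewrite mulr_ge0// exprn_ge0// ltW.
  have [fx|fx] := ltP 0 (f x); last first.
    by apply: le_trans fx _; rewrite mulr_ge0// exprn_ge0// ltW.
  apply: (le_trans (fP _ fx)); rewrite exprS -mulrA ler_pM2l//.
  rewrite -[leRHS](ev_cst P); apply: ev_le => [|| w]; last exact: IH.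
    exact: (@bounded_mfun_step g M gM x).
  exact: bounded_mfun_cst.
move=> x; apply: (@le_trans _ _ (g x)); first by rewrite le_max lexx.
have cv : (fun k => l ^+ k * M) @ \oo --> (0 : R).
  rewrite -[X in _ --> X](mul0r M); apply: cvgMl.
  by apply: cvg_expr; rewrite ger0_norm// ltW.
by apply: (cvgr_to_ge cv); apply: nearW => k; exact: it.
Qed.

(** Positivity is not visible on the Fourier integral; it follows from [green_eq] and the maximum
    principle applied to the opposite function. *)
Lemma green_ge0 x : 0 <= green l x.
Proof.
rewrite -oppr_le0.
apply: (@killed_maximum_principle (fun y => - green l y) (green l 0)) => [y|y y0].
  by rewrite normrN green_norm_le.
have := green_eq y; have /andP[l0 l1] := l01.
have : - step_op (green l) y <= step_op (fun z => Num.max (- green l z) 0) y.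
  have bg := bounded_mfun_step (M := green l 0) green_norm_le y.
  rewrite /step_op -mulN1r -(evZ _ _ bg); apply: ev_le.
  - exact: bounded_mfunZ.
  - apply: (@bounded_mfun_step (fun z => Num.max (- green l z) 0) (green l 0)) => z.
    rewrite ger0_norm ?le_max ?lexx ?orbT// ge_max.
    have := green_norm_le z; have := normr_ge0 (green l z).
    by rewrite ler_norml => h0 /andP[]; lra.
  - by move=> w; rewrite mulN1r le_max lexx.
rewrite -(ler_pM2l l0) mulrN => h1 ->; apply: le_trans h1.
by rewrite opprD gerDr oppr_le0.
Qed.

Lemma green0_ge1 : 1 <= green l 0.
Proof.
rewrite green_eq eqxx lerDl mulr_ge0//; first by case/andP: l01 => /ltW.
by apply: ev_ge0 => w; exact: green_ge0.
Qed.

(** The total mass of the Green function is the mean lifetime. The sum W over distinct sites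
    satisfies W <= 1 + l [step_op W], and the constant (1 - l)^(-1) solves the equation with
    equality, so that their difference is handled by the maximum principle. *)
Lemma green_sum_le (I : Type) (r : seq I) (z : I -> Z2) (x : Z2) : 
  (forall y, (\sum_(i <- r) (y == z i)%:R <= 1 :> R)) ->
  \sum_(i <- r) green l (x - z i) <= (1 - l)^-1.
Proof.
move=> r1; have /andP[l0 l1] := l01.
have l1' : 0 < 1 - l by rewrite subr_gt0.
pose W y := \sum_(i <- r) green l (y - z i).
have bg i y : bounded_mfun (fun w => green l (y + X0 w - z i)).
  apply: (@bounded_mfun_step (fun y => green l (y - z i)) (green l 0)) => y'.
  exact: green_norm_le.
have WE y : W y = \sum_(i <- r) (y == z i)%:R + l * step_op W y.
  rewrite /step_op /W ev_sum// mulr_sumr -big_split /=; apply: eq_bigr => i _.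
  rewrite green_eq subr_eq0; congr (_ + _ * ev _ _).
  by apply/funext => w; rewrite addrAC.
pose M := (size r)%:R * green l 0.
have W0 y : 0 <= W y by apply: sumr_ge0 => i _; exact: green_ge0.
have WM y : `|W y| <= M.
  rewrite ger0_norm// /W /M; elim: (r) => [|i r' IH]; first by rewrite big_nil mul0r.
  rewrite big_cons /= -[(size r').+1]addn1 addnC natrD mulrDl mul1r lerD//.
  exact: le_trans (ler_norm _) (green_norm_le _).
rewrite -subr_le0.
apply: (@killed_maximum_principle (fun y => W y - (1 - l)^-1) (M + (1 - l)^-1)) => [y|y y0].
  rewrite (le_trans (ler_normB _ _))// lerD// ger0_norm// invr_ge0 ltW//.
have M0 : 0 <= M by exact: le_trans (normr_ge0 _) (WM 0).
have bW := bounded_mfun_step WM y.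
have h : step_op W y - (1 - l)^-1 <= step_op (fun y => Num.max (W y - (1 - l)^-1) 0) y.
  rewrite -[X in _ - X](ev_cst P) -(evB _ bW (bounded_mfun_cst _)); apply: ev_le.
  - exact: (bounded_mfunB bW (bounded_mfun_cst _)).
  - apply: (@bounded_mfun_step (fun y => Num.max (W y - (1 - l)^-1) 0) M) => z'.
    rewrite ger0_norm ?le_max ?lexx ?orbT// ge_max M0 andbT.
    have := WM z'; rewrite ger0_norm// => h; rewrite lerBlDr (le_trans h)// lerDl.
    by rewrite invr_ge0 ltW.
  - by move=> w; rewrite le_max lexx.
rewrite WE; apply: (le_trans _ (ler_wpM2l (ltW l0) h)).
have h1 := r1 y; set s := step_op W y.
have hK : (1 - l)^-1 = 1 + l * (1 - l)^-1 by field; rewrite gt_eqF.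
by move: hK; set K := (1 - l)^-1 => hK; lra.
Qed.

Definition mean_sq : \bar R := (\int[P]_w (sqn R (X0 w))%:E)%E.

Hypothesis fin_mean_sq : (mean_sq < +oo)%E.

Definition sigma2 : R := fine mean_sq.

Lemma mean_sqE : mean_sq = sigma2%:E.
Proof.
rewrite /sigma2 fineK// ge0_fin_numE//; apply: integral_ge0 => w _.
by rewrite lee_fin sqn_ge0.
Qed.

Lemma sigma2_ge0 : 0 <= sigma2.
Proof. by apply: Rintegral_ge0 => w _; exact: sqn_ge0. Qed.

(** The cross term cancels by averaging the parallelogram identity over [X0] and [- X0], which have
    the same law. *)
Lemma integral_sqn_step x :
  (\int[P]_w (sqn R (x + X0 w))%:E = (sqn R x + sigma2)%:E)%E.
Proof.
have m (f : Z2 -> R) : measurable_fun setT (fun w => (f (X0 w))%:E).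
  by apply/measurable_EFinP; exact: (@discrete_measurable_fun _ _ _ X0 _ _ f).
have s0 y : (0 <= (sqn R y)%:E)%E by rewrite lee_fin sqn_ge0.
have e : (\int[P]_w (sqn R (x + X0 w))%:E = \int[P]_w (sqn R (x - X0 w))%:E)%E.
  exact: esym (@law_opp (fun y => (sqn R (x + y))%:E) _).
have : ((\int[P]_w (sqn R (x + X0 w))%:E) + (\int[P]_w (sqn R (x - X0 w))%:E) =
   (2 * (sqn R x + sigma2))%:E)%E.
  rewrite -ge0_integralD//; [|exact: (m (fun y => sqn R (x + y)))|exact: (m (fun y => sqn R (x - y)))].
  rewrite EFinM (EFinD (sqn R x)) -mean_sqE /mean_sq.
  have -> : ((sqn R x)%:E = \int[P]_w (cst (sqn R x)%:E) w)%E.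
    by rewrite integral_cst// -[LHS]mule1; congr (_ * _)%E; exact/esym/probability_setT.
  rewrite -ge0_integralD//; try exact: (m (sqn R)); try by move=> *; rewrite lee_fin sqn_ge0.
  rewrite -ge0_integralZl//; try by move=> *; rewrite adde_ge0// lee_fin sqn_ge0.
  2: by apply: emeasurable_funD => //; exact: (m (sqn R)).
  apply: eq_integral => w _; rewrite -!EFinD sqn_parallelogram -EFinM; congr (_%:E).
  by ring.
rewrite -e; case: (integral _ _ _) => [r| |] //= [h].
by congr (_%:E); lra.
Qed.

(* Compare green l with the l-superharmonic function
   green l 0 * (sqn + sigma2 / (1 - l)) / sqn z, which is >= green l 0 at the pole. *)
Lemma green_decay z : z != 0 ->
  green l z * sqn R z * (1 - l) <= green l 0 * sigma2.
Proof.
move=> z0; have /andP[l0 l1] := l01; have l1' : 0 < 1 - l by rewrite subr_gt0.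
have z2 : 0 < sqn R z.
  rewrite lt_neqAle sqn_ge0 andbT eq_sym.
  apply: contra z0; rewrite /sqn paddr_eq0 ?sqr_ge0// !sqrf_eq0 !intr_eq0.
  move=> /andP[/eqP h0 /eqP h1]; apply/eqP/colP => i; rewrite mxE.
  by have [->|->] : i = 0 \/ i = 1 by case: i => -[|[|]]// p; [left|right]; apply/val_inj.
set M := green l 0; have M1 : 1 <= M := green0_ge1.
have M0 : 0 < M by apply: lt_le_trans M1.
pose c := M / sqn R z; have c0 : 0 <= c by rewrite divr_ge0// ltW.
pose psi y := c * (sqn R y + sigma2 / (1 - l)).
have psi0 y : 0 <= psi y.
  by rewrite mulr_ge0// addr_ge0 ?sqn_ge0// divr_ge0 ?sigma2_ge0// ltW.
pose psi' y := Num.min (psi y) M.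
have psi'0 y : 0 <= psi' y by rewrite le_min psi0 ltW.
have psi'M y : `|psi' y| <= M by rewrite ger0_norm// ge_min lexx orbT.
have step_psi y : step_op psi' y <= c * (sqn R y + sigma2 + sigma2 / (1 - l)).
  rewrite -lee_fin /step_op EFin_ev; last exact: bounded_mfun_step psi'M y.
  apply: (@le_trans _ _ (\int[P]_w (c%:E * ((sqn R (y + X0 w))%:E + (sigma2 / (1 - l))%:E)))%E).
    apply: ge0_le_integral => //.
    - by move=> w _; rewrite lee_fin.
    - by apply/measurable_EFinP; exact: (bounded_mfun_step psi'M y).1.
    - apply/measurable_EFinP; exact: (@discrete_measurable_fun _ _ _ X0 _ _ (fun u => psi (y + u))).
    - by move=> w _; rewrite lee_fin ge_min lexx.
  have ms : measurable_fun setT (fun w => (sqn R (y + X0 w))%:E).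
    by apply/measurable_EFinP; exact: (@discrete_measurable_fun _ _ _ X0 _ _ (fun u => sqn R (y + u))).
  have s0 : 0 <= sigma2 / (1 - l) by rewrite divr_ge0 ?sigma2_ge0// ltW.
  rewrite ge0_integralZl//; try by [apply: emeasurable_funD|move=> w _; rewrite adde_ge0// lee_fin sqn_ge0].
  rewrite ge0_integralD//; try by move=> w _; rewrite lee_fin sqn_ge0.
  rewrite integral_sqn_step integral_cst//.
  rewrite (_ : (_ * P _)%E = (sigma2 / (1 - l))%:E).
    by rewrite -EFinD -EFinM.
  by rewrite -[RHS]mule1; congr (_ * _)%E; exact: probability_setT.
have psi'z : psi' z = M.
  rewrite /psi' /psi; apply/min_idPr.
  rewrite mulrDr /c divfK ?gt_eqF// lerDl mulr_ge0// divr_ge0 ?sigma2_ge0// ltW//.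
have gM y : `|green l (y - z)| <= M by exact: green_norm_le.
have main x : green l (x - z) - psi' x <= 0.
  apply: (@killed_maximum_principle (fun y => green l (y - z) - psi' y) (M + M)) => y.
    by rewrite (le_trans (ler_normB _ _))// lerD.
  rewrite subr_gt0 => hy.
  have yz : y != z.
    by apply: contraTneq hy => ->; rewrite psi'z -leNgt (le_trans (ler_norm _)).
  have psi'y : psi' y = psi y.
    move: hy; rewrite /psi'; case: (leP (psi y) M) => [_ _ //|_ hy].
    by move: hy; rewrite ltNge (le_trans (ler_norm _)).
  have bg : bounded_mfun (fun w => green l (y + X0 w - z)).
    exact: (@bounded_mfun_step (fun y => green l (y - z)) M).
  have bp := bounded_mfun_step psi'M y.
  set h := fun y => Num.max (green l (y - z) - psi' y) 0.
  have hM y' : `|h y'| <= M.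
    rewrite ger0_norm ?le_max ?lexx ?orbT// ge_max (ltW M0) andbT lerBlDr.
    by rewrite (le_trans (le_trans (ler_norm _) (gM y')))// lerDl.
  have bh := bounded_mfun_step hM y.
  have h1 : ev P (fun w => green l (y + X0 w - z)) <= step_op h y + step_op psi' y.
    rewrite /step_op -(evD P bh bp); apply: ev_le => //; first exact: bounded_mfunD.
    by move=> w; rewrite -lerBlDr le_max lexx.
  have gy : green l (y - z) = l * ev P (fun w => green l (y + X0 w - z)).
    rewrite green_eq subr_eq0 (negbTE yz) add0r; congr (_ * ev _ _).
    by apply/funext => w; rewrite addrAC.
  rewrite psi'y gy lerBlDr; apply: (le_trans (ler_wpM2l (ltW l0) h1)).
  rewrite mulrDr lerD2l.
  apply: (le_trans (ler_wpM2l (ltW l0) (step_psi y))).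
  rewrite /psi mulrCA ler_wpM2l//.
  have s0 := sigma2_ge0; have sn := sqn_ge0 R y.
  have -> : sqn R y + sigma2 / (1 - l) =
     l * (sqn R y + sigma2 + sigma2 / (1 - l)) + ((1 - l) * sqn R y + sigma2 * (1 - l)).
    by field; rewrite gt_eqF.
  by rewrite lerDl addr_ge0// mulr_ge0// ltW.
have := main 0; rewrite sub0r greenN subr_le0 => h.
have : green l z <= psi 0 by apply: (le_trans h); rewrite ge_min lexx.
rewrite /psi /c /sqn !mxE /= expr0n /= !add0r => h'.
rewrite -mulrA mulrC -ler_pdivlMl ?mulr_gt0//.
apply: (le_trans h'); rewrite le_eqVlt; apply/orP; left; apply/eqP.
by field; rewrite !gt_eqF.
Qed.

End fixed_killing.

End green_function.

(** * Irreducibility as a lower bound on 1 - charf *)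

Section irreducible_charf.
Context d (T : measurableType d) (R : realType) (P : probability T R).
Context (X : nat -> T -> Z2) (X_iid : iid P X).
Context (symX : symmetric_law P (X 0%N)) (X_irr : irreducible_walk P X).
Local Notation charf := (charf P (X 0%N)).
Local Notation shift := (fun x y : Z2 => x + y).

Lemma final_path_of (x : Z2) a k w :
  final shift x (path_of X a k w) = x + \sum_(i < k) X (a + i)%N w.
Proof.
elim: k x a => [|k IH] x a; first by rewrite big_ord0 addr0.
rewrite /= (IH (x + X a w) a.+1) big_ord_recl addn0 addrA; congr (_ + _).
by apply: eq_bigr => i _; rewrite /= addSnnS.
Qed.

Lemma EE_one_sub_cos th k x :
  EE P X k (fun s => (1 - cos (ip th (final shift x s)))%:E) =
  (1 - cos (ip th x) * charf th ^+ k)%:E.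
Proof.
elim: k x => [|k IH] x /=; first by rewrite expr0 mulr1.
under eq_integral do rewrite IH.
have mX := iid_measurable X_iid 0%N.
have bc : bounded_mfun (fun w => cos (ip th (x + X 0%N w))).
  by apply: (bounded_mfun_step mX (M := 1) (f := fun y => cos (ip th y))) => y; exact: normr_cos.
have b1 : bounded_mfun (cst (1 : R) : T -> R) by exact: bounded_mfun_cst.
have bz : bounded_mfun (fun w => cos (ip th (x + X 0%N w)) * charf th ^+ k).
  by apply: bounded_mfunM => //; exact: bounded_mfun_cst.
rewrite -(EFin_ev P (bounded_mfunB b1 bz)) (evB _ b1 bz) ev_cst; congr ((1 - _)%:E).
rewrite (_ : (fun w => _) = (fun w => charf th ^+ k * cos (ip th (x + X 0%N w)))).
  by rewrite (evZ _ _ bc) (ev_cos_step mX symX) exprS; ring.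
by apply/funext => w; rewrite mulrC.
Qed.

(** If the walk is at x at time n with probability p > 0, then 1 - charf^n, the mean of 1 - cos(th .
    S_n), is at least p (1 - cos(th . x)). Moreover 1 - charf^n <= n (1 - charf), whence C = n /
    p. *)
Lemma cos_ip_le_charf x : exists2 C : R, 0 <= C &
  forall th, 1 - cos (ip th x) <= C * (1 - charf th).
Proof.
have [n] := X_irr x; set p := P _ => p0.
have pfin : (p \is a fin_num).
  rewrite fin_num_measure//.
  rewrite (_ : [set w | _] = path_of X 0 n @^-1` [set s | final shift 0 s = x]).
    exact: (path_of_discrete X_iid).
  by apply/seteqP; split => w /=; rewrite final_path_of add0r.
have fp0 : 0 < fine p by rewrite fine_gt0// p0 -ge0_fin_numE// ltW.
exists (n%:R / fine p) => [|th]; first by rewrite divr_ge0// ltW.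
have h : (((1 - cos (ip th x)) * fine p)%:E <= (1 - charf th ^+ n)%:E)%E.
  have := EE_one_sub_cos th n 0; rewrite ip0 cos0 mul1r => <-.
  rewrite EFinM fineK// /p.
  rewrite (_ : [set w | _] = path_of X 0 n @^-1` [set s | final shift 0 s = x]); last first.
    by apply/seteqP; split => w /=; rewrite final_path_of add0r.
  rewrite (path_prob X_iid) -(EE_Zl X_iid) ?one_sub_cos_ge0//.
  apply: (EE_le X_iid) => [s|s _]; first by rewrite -EFinM lee_fin mulr_ge0// one_sub_cos_ge0.
  rewrite -EFinM lee_fin indicE; have [|_] := boolP (s \in _).
    by rewrite inE /= => ->; rewrite mulr1.
  by rewrite mulr0 one_sub_cos_ge0.
rewrite lee_fin -ler_pdivlMr// in h; apply: (le_trans h).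
rewrite mulrAC ler_pM2r ?invr_gt0//.
have := normr_charf P (iid_measurable X_iid 0%N) th; rewrite ler_norml => /andP[cN1 c1].
elim: n {p p0 pfin fp0 h} => [|n IH]; first by rewrite expr0 subrr mul0r.
have cn : charf th ^+ n <= 1.
  apply: le_trans (ler_norm _) _; rewrite normrX exprn_ile1//.
  by rewrite ler_norml cN1.
rewrite -[n.+1]addn1 natrD exprD expr1 mulrDl mul1r.
have h1 : (1 - charf th ^+ n) * (1 - charf th) >= 0.
  by rewrite mulr_ge0 ?subr_ge0.
have h2 : -1 <= charf th ^+ n.
  rewrite lerNl (le_trans (ler_norm _))// normrN normrX exprn_ile1//.
  by rewrite ler_norml cN1.
have h3 : 0 <= (1 + charf th ^+ n) * (1 - charf th).
  by rewrite mulr_ge0 ?subr_ge0//; lra.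
nra.
Qed.

(** The only form in which irreducibility is used from here on. [cos_ip_le_charf] treats the two
    coordinate directions, and [one_sub_cos_ip_le] passes to all x at the price of the factor
    |x|^2. *)
Lemma cos_ip_le : exists2 C : R, 0 < C &
  forall th x, 1 - cos (ip th x) <= C * sqn R x * (1 - charf th).
Proof.
pose e i : Z2 := delta_mx i 0.
have [C0 C00 h0] := cos_ip_le_charf (e 0).
have [C1 C10 h1] := cos_ip_le_charf (e 1).
have e0 th : ip th (e 0) = th.1 :> R by rewrite /ip /e !mxE /= mulr1 mulr0 addr0.
have e1 th : ip th (e 1) = th.2 :> R by rewrite /ip /e !mxE /= mulr1 mulr0 add0r.
exists (2 * (C0 + C1 + 1)) => [|th x]; first lra.
have c1 : 0 <= 1 - charf th.
  have := normr_charf P (iid_measurable X_iid 0%N) th; rewrite ler_norml => /andP[_].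
  by rewrite subr_ge0.
apply: (le_trans (one_sub_cos_ip_le th x)).
rewrite -[leRHS]mulrA -!mulrA ler_pM2l// mulrCA ler_wpM2l ?sqn_ge0//.
have := h0 th; have := h1 th; rewrite e0 e1 => a1 a0.
rewrite ge_max; apply/andP; split; apply: le_trans (ler_wpM2r c1 _).
- exact: a0.
- lra.
- exact: a1.
- lra.
Qed.

End irreducible_charf.

(** * Differences of Green functions at two killing rates *)

Section resolvent_difference.
Context d (T : measurableType d) (R : realType) (P : probability T R).
Context (X0 : T -> Z2) (mX0 : discrete_rv X0) (symX0 : symmetric_law P X0).
Local Notation Theta := (measurableTypeR R * measurableTypeR R)%type.
Local Notation charf := (charf P X0).
Local Notation green := (green P X0).
Variables (l l' : R).
Hypotheses (l01 : 0 < l < 1) (l'01 : 0 < l' < 1) (l'l : l' <= l).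

(** With the ratio l' / l the resolvent identity gives the Fourier symbol (1 - l' / l) / ((1 - l
    charf) (1 - l' charf)). The singularity of short distances cancels, and what remains varies
    little on scales below (1 - l')^(-1/2). *)
Definition gdiff (w : Z2) : R := green l w - l' / l * green l' w.

Let den (l : R) (th : Theta) : R := (1 - l * charf th)^-1.

Let bden2 : bounded_mfun (fun th => den l th * den l' th).
Proof. by apply: bounded_mfunM; exact: bounded_mfun_den. Qed.

Let bcos2 w : bounded_mfun (fun th : Theta => cos (ip th w) * (den l th * den l' th)).
Proof. by apply: bounded_mfunM => //; exact: bounded_mfun_cos_ip. Qed.

Let den_pos th : 0 < den l th * den l' th.
Proof. by rewrite mulr_gt0// invr_gt0; exact: den_gt0. Qed.

Let coef_ge0 : 0 <= 1 - l' / l.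
Proof. by rewrite subr_ge0 ler_pdivrMr ?mul1r//; case/andP: l01. Qed.

Lemma gdiffE w : gdiff w = (1 - l' / l) *
  ev (unif2 R) (fun th => cos (ip th w) * (den l th * den l' th)).
Proof.
rewrite /gdiff /green -(evZ _ _ (bounded_mfun_green P mX0 l'01 w)).
rewrite -(evB _ (bounded_mfun_green P mX0 l01 w)); last first.
  by apply: bounded_mfunZ; exact: bounded_mfun_green.
rewrite -(evZ _ _ (bcos2 w)); congr ev; apply/funext => th; rewrite /den.
have := den_gt0 P mX0 l01 th; have := den_gt0 P mX0 l'01 th.
have /andP[l0 _] := l01.
by move=> d1 d2; field; rewrite !gt_eqF.
Qed.

Lemma gdiff_le0 w : gdiff w <= gdiff 0.
Proof.
rewrite !gdiffE ler_wpM2l//; apply: ev_le => // th.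
by rewrite ip0 cos0 mul1r ler_piMl ?cos_le1// ltW.
Qed.

Lemma gdiff_le w : gdiff w <= green l w.
Proof.
rewrite gerBl mulr_ge0//; last exact: green_ge0.
by rewrite divr_ge0// ltW//; [case/andP: l'01|case/andP: l01].
Qed.

(* By [normr_cosB], cos moves by at most eta + (1 - cos (ip th h)) / (2 eta); the
   factor 1 - cos (ip th h) <= C |h|^2 (1 - charf th) cancels one denominator. *)
Lemma gdiff_lipschitz (C eta : R) (w h : Z2) : 0 < eta -> 2^-1 <= l -> 0 <= C ->
  (forall th x, 1 - cos (ip th x) <= C * sqn R x * (1 - charf th)) ->
  gdiff (w + h) <= gdiff w + eta * green l 0 +
    2 * (1 - l') * C * sqn R h * green l' 0 / eta.
Proof.
move=> eta0 l2 C0 hC.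
have bd' := bounded_mfun_den P mX0 l'01.
have e1 : ev (unif2 R) (fun th => cos (ip th (w + h)) * (den l th * den l' th)) <=
  ev (unif2 R) (fun th => cos (ip th w) * (den l th * den l' th)) +
  eta * ev (unif2 R) (fun th => cos (ip th 0) * (den l th * den l' th)) +
  C * sqn R h / eta * ev (unif2 R) (fun th => den l' th).
  have bA := bcos2 w; have bB := bounded_mfunZ eta (bcos2 0).
  have bC := bounded_mfunZ (C * sqn R h / eta) bd'.
  rewrite -(evZ _ eta (bcos2 0)) -(evZ _ (C * sqn R h / eta) bd') -(evD _ bA bB).
  rewrite -(evD _ (bounded_mfunD bA bB) bC).
  apply: ev_le => //; first exact: (bounded_mfunD (bounded_mfunD bA bB) bC).
  move=> th; rewrite ip0 cos0 mul1r.
  have := normr_cosB (ip th (w + h)) (ip th w) eta0.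
  have -> : ip th (w + h) - ip th w = ip th h by rewrite ipD addrAC subrr add0r.
  move=> /(le_trans (ler_norm _)) hc.
  have d1 : 0 < den l th by rewrite invr_gt0; exact: den_gt0.
  have d2 : 0 < den l' th by rewrite invr_gt0; exact: den_gt0.
  have hD : (1 - cos (ip th h)) * den l th <= 2 * (C * sqn R h).
    rewrite ler_pdivrMr; last exact: den_gt0.
    apply: (le_trans (hC th h)).
    rewrite [2 * _]mulrC -[leRHS]mulrA ler_wpM2l//.
      by rewrite mulr_ge0// sqn_ge0.
    have := normr_charf P mX0 th; rewrite ler_norml => /andP[cN1 c1].
    have : 0 <= (1 - charf th) * (2 * l - 1) by rewrite mulr_ge0//; lra.
    by have /andP[_ l1] := l01; lra.
  have -> : cos (ip th w) * (den l th * den l' th) + eta * (den l th * den l' th) +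
     C * sqn R h / eta * den l' th =
     (cos (ip th w) * den l th + eta * den l th + C * sqn R h / eta) * den l' th by ring.
  rewrite mulrA ler_pM2r//.
  have : (cos (ip th (w + h)) - cos (ip th w)) * den l th <=
      (eta + (1 - cos (ip th h)) / (2 * eta)) * den l th by rewrite ler_pM2r// addrC.
  have h3 : (1 - cos (ip th h)) / (2 * eta) * den l th <= C * sqn R h / eta.
    rewrite mulrAC ler_pdivrMr ?mulr_gt0//; apply: (le_trans hD).
    by rewrite le_eqVlt; apply/orP; left; apply/eqP; field; rewrite gt_eqF.
  by rewrite ipD; lra.
have eqg : ev (unif2 R) (fun th => den l' th) = green l' 0.
  by congr ev; apply/funext => th; rewrite ip0 cos0 mul1r.
rewrite eqg in e1.
have e2 : gdiff (w + h) <= gdiff w + eta * gdiff 0 +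
    (1 - l' / l) * (C * sqn R h / eta * green l' 0).
  by rewrite !gdiffE; have := ler_wpM2l coef_ge0 e1; lra.
have g0 : 0 <= green l' 0 by exact: green_ge0.
have hh : (1 - l' / l) * (C * sqn R h / eta * green l' 0) <=
   2 * (1 - l') * C * sqn R h * green l' 0 / eta.
  rewrite -[leRHS]mulrA -[leRHS]mulrA.
  have -> : C * sqn R h / eta * green l' 0 = C * (sqn R h * (green l' 0 / eta)) by ring.
  rewrite -[leRHS]mulrA ler_wpM2r//.
    by rewrite mulr_ge0// mulr_ge0 ?sqn_ge0// divr_ge0// ltW.
  have /andP[l0 l1] := l01; have /andP[l'0 l'1] := l'01.
  rewrite lerBlDr -lerBlDl ler_pdivlMr//.
  have : 0 <= (2 * l - 1) * (1 - l') by rewrite mulr_ge0//; lra.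
  lra.
have : eta * gdiff 0 <= eta * green l 0 by rewrite ler_pM2l// gdiff_le.
lra.
Qed.

End resolvent_difference.

(** * Calculus: Taylor bounds and two explicit integrals *)

Section calculus_bounds.
Context (R : realType).
Implicit Types t u x : R.

Lemma ge0_derive_ge0 (f df : R -> R) u : 0 <= u -> f 0 = 0 ->
  (forall x, 0 <= x <= u -> is_derive x 1 f (df x)) ->
  (forall x, 0 <= x <= u -> 0 <= df x) -> 0 <= f u.
Proof.
rewrite le_eqVlt => /predU1P[<- -> //|u0] f0 fdf df0.
have [c cu fE] : exists2 c, c \in `]0, u[ & f u - f 0 = df c * (u - 0).
  apply: MVT => //.
    by move=> x; rewrite in_itv /= => /andP[x0 xu]; apply: fdf; rewrite !ltW.
  apply: continuous_in_subspaceT => x; rewrite inE /= in_itv /= => xu.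
  by apply: differentiable_continuous; apply/derivable1_diffP; have [] := fdf x xu.
move: fE; rewrite f0 !subr0 => ->; apply: mulr_ge0; last exact: ltW.
by apply: df0; move: cu; rewrite in_itv /= => /andP[c0 cu]; rewrite !ltW.
Qed.

Lemma sin_le_id u : 0 <= u -> sin u <= u.
Proof.
move=> u0; rewrite -subr_ge0.
apply: (@ge0_derive_ge0 (fun x => x - sin x) (fun x => 1 - cos x)) => //.
rewrite ?sin0 ?subrr//; by move=> x _; exact: one_sub_cos_ge0.
Qed.

Lemma normr_sin_le u : `|sin u| <= `|u|.
Proof.
wlog u0 : u / 0 <= u => [h|].
  have [/h//|/ltW] := lerP 0 u; rewrite -oppr_ge0 => /h.
  by rewrite sinN !normrN.
have [u1|u1] := lerP u 1; last first.
  by rewrite (ger0_norm u0) (le_trans _ (ltW u1))// ler_norml sin_le1 sin_geN1.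
rewrite [leRHS]ger0_norm// ger0_norm ?sin_le_id//.
by have [->|un0] := eqVneq u 0; [rewrite sin0|rewrite ltW// sin2_gt0// lt_neqAle eq_sym un0 u0 (le_lt_trans u1)// ltrDl].
Qed.

Lemma one_sub_cos_le t : 1 - cos t <= t ^+ 2 / 2.
Proof.
rewrite one_sub_cos.
have := normr_sin_le (t / 2); rewrite -(@ler_pXn2r _ 2%N) ?nnegrE// !real_normK ?num_real//.
by rewrite expr_div_n; lra.
Qed.

Lemma sin_ge u : 0 <= u -> u - u ^+ 3 / 6 <= sin u.
Proof.
move=> u0; rewrite -subr_ge0.
apply: (@ge0_derive_ge0 (fun x => sin x - (x - x ^+ 3 / 6))
   (fun x => cos x - (1 - x ^+ 2 / 2))) => //.
- by rewrite sin0 expr0n /= mul0r !subr0.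
- move=> x _; apply: is_derive_eq.
  by rewrite /GRing.scale /=; field.
- by move=> x _; have := one_sub_cos_le x; lra.
Qed.

(** The minimum with 1 keeps the remainder integrable when t = th . X has only two moments. *)
Lemma cos_taylor t : t ^+ 2 / 2 - (1 - cos t) <= t ^+ 2 * Num.min 1 (t ^+ 2).
Proof.
have c1 := one_sub_cos_ge0 t; have t2 := sqr_ge0 t.
case: (leP 1 (t ^+ 2)) => h; first by lra.
wlog t0 : t c1 t2 h / 0 <= t => [H|].
  have [|/ltW] := lerP 0 t; first exact: H.
  by rewrite -oppr_ge0 => t0; have := H (- t); rewrite cosN sqrrN; apply.
rewrite one_sub_cos.
have u0 : 0 <= t / 2 by lra.
have := sin_ge u0; set u := t / 2 in u0 *; set s := sin u => hs.
have tu : t = 2 * u by rewrite /u; field.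
rewrite tu in h *.
have u1 : u ^+ 2 <= 1 by lra.
have p0 : 0 <= u - u ^+ 3 / 6.
  have -> : u - u ^+ 3 / 6 = u * (1 - u ^+ 2 / 6) by ring.
  by rewrite mulr_ge0//; lra.
have : (u - u ^+ 3 / 6) ^+ 2 <= s ^+ 2.
  by rewrite ler_pXn2r ?nnegrE// (le_trans p0).
have u4 : 0 <= u ^+ 4 by rewrite -[4%N]/(2 * 2)%N exprM sqr_ge0.
have u6 : 0 <= u ^+ 6 by rewrite -[6%N]/(3 * 2)%N exprM sqr_ge0.
lra.
Qed.

Lemma mul_cos_le_sin u : 0 <= u <= pi / 2 -> u * cos u <= sin u.
Proof.
move=> /andP[u0 upi]; rewrite -subr_ge0.
apply: (@ge0_derive_ge0 (fun x => sin x - x * cos x) (fun x => x * sin x)) => //.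
- by rewrite sin0 mul0r subr0.
- move=> x _; apply: is_derive_eq.
  by rewrite /GRing.scale /=; ring.
- move=> x /andP[x0 xu]; rewrite mulr_ge0//.
  apply: sin_ge0_pi; rewrite x0 (le_trans xu)// (le_trans upi)//.
  by have := pi_gt0 R; lra.
Qed.

(** With u = pi / 2 - atan x one has tan(atan x) = cos u / sin u = x, and u cos u <= sin u reads u x
    <= 1. *)
Lemma atan_ge x : 0 < x -> pi / 2 - x^-1 <= atan x.
Proof.
move=> x0; pose u := pi / 2 - atan x.
have := atan_gtNpi2 x; have := atan_ltpi2 x => a1 a2.
have at0 : 0 < atan x by rewrite -(atan0 R) lt_atan.
have hu : 0 <= u <= pi / 2 by rewrite /u; apply/andP; split; lra.
have := mul_cos_le_sin hu.
have su : sin u = cos (atan x) by rewrite /u -[RHS]cosN; rewrite -[X in sin X]opprB sinN sinBpihalf opprK cosN.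
have cu : cos u = sin (atan x) by rewrite /u -cosBpihalf -[RHS]cosN opprB.
have c0 : 0 < cos (atan x) by apply: cos_gt0_pihalf; rewrite a1 a2.
have : tan (atan x) = x by exact: atanK.
rewrite su cu /tan => hx; rewrite -{1}(divfK (lt0r_neq0 c0) (sin (atan x))) hx.
rewrite mulrA -[X in _ <= X -> _]mul1r ler_pM2r// => ux.
by rewrite lerBlDr -lerBlDl -/u -[_^-1]mul1r ler_pdivlMr.
Qed.

Lemma integral_inv_quadratic (M N y0 a b : R) : a < b -> 0 < M -> 0 < N ->
  (\int[lebesgue_measure]_(y in `[a, b]) ((M ^+ 2 + N ^+ 2 * (y + y0) ^+ 2)^-1)%:E =
   ((atan (N / M * (b + y0)) - atan (N / M * (a + y0))) / (M * N))%:E)%E.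
Proof.
move=> ab M0 N0.
have den0 (y : R) : 0 < M ^+ 2 + N ^+ 2 * (y + y0) ^+ 2.
  by rewrite ltr_wpDr ?exprn_gt0// mulr_ge0// sqr_ge0.
have dF (y : R) : a <= y <= b -> is_derive y 1
    (fun y : R => atan (N / M * (y + y0)) / (M * N))
    ((M ^+ 2 + N ^+ 2 * (y + y0) ^+ 2)^-1).
  move=> _.
  have -> : (fun y : R => atan (N / M * (y + y0)) / (M * N)) =
    (fun y : R => (M * N)^-1 *: (atan \o (fun y : R => (N / M) *: (y + y0))) y).
    by apply/funext => z; rewrite /GRing.scale /= mulrC.
  apply: is_derive_eq; rewrite /GRing.scale /= addr0 mulr1.
  have := den0 y; have d1 : 0 < 1 + (N / M * (y + y0)) ^+ 2 by rewrite ltr_wpDr// sqr_ge0.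
  by move=> d2; field; rewrite exprMn !gt_eqF.
have cf (y : R) : a <= y <= b -> {for y, continuous (fun y : R => (M ^+ 2 + N ^+ 2 * (y + y0) ^+ 2)^-1)}.
  move=> _; apply: cvgV; first by rewrite gt_eqF.
  apply: cvgD; first exact: cvg_cst.
  apply: cvgM; first exact: cvg_cst.
  have cy : (fun y : R => y + y0) x @[x --> y] --> y + y0 by apply: cvgD; [exact: cvg_id|exact: cvg_cst].
  by rewrite expr2; under eq_fun do rewrite expr2; exact: cvgM.
by rewrite (ftc ab dF cf) mulrBl.
Qed.

Lemma integral_inv_sqrt (k r : R) : 0 < k -> 0 < r ->
  (\int[lebesgue_measure]_(x in `[(- r)%R, r]) ((Num.sqrt (x ^+ 2 + k))^-1)%:E =
   (2 * ln (r + Num.sqrt (r ^+ 2 + k)) - ln k)%:E)%E.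
Proof.
move=> k0 r0; have nr : - r < r by rewrite gtrN.
have p0 (x : R) : 0 < x ^+ 2 + k by rewrite ltr_wpDl// sqr_ge0.
have s0 (x : R) : 0 < Num.sqrt (x ^+ 2 + k) by rewrite sqrtr_gt0.
have sx (x : R) : 0 < x + Num.sqrt (x ^+ 2 + k).
  rewrite -ltrBlDl sub0r; have [x0|x0] := ltP x 0; last first.
    by rewrite (le_lt_trans _ (s0 x))// oppr_le0.
  have -> : - x = Num.sqrt (x ^+ 2) by rewrite sqrtr_sqr ltr0_norm.
  by rewrite ltr_sqrt// ltrDl.
have dF (x : R) : - r <= x <= r -> is_derive x 1
    (fun x : R => ln (x + Num.sqrt (x ^+ 2 + k))) ((Num.sqrt (x ^+ 2 + k))^-1).
  move=> _.
  have -> : (fun x : R => ln (x + Num.sqrt (x ^+ 2 + k))) =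
     (@ln R) \o (fun x : R => x + ((@Num.sqrt R) \o (fun x : R => x ^+ 2 + k)) x) by [].
  have h1 := is_derive1_ln (sx x); have h2 := is_derive1_sqrt (p0 x).
  apply: is_derive_eq; rewrite /GRing.scale /= .
  have := s0 x; have := sx x; set s := Num.sqrt _ => a1 a2.
  by field; rewrite !gt_eqF.
have cf (x : R) : - r <= x <= r -> {for x, continuous (fun x : R => (Num.sqrt (x ^+ 2 + k))^-1)}.
  move=> _; apply: cvgV; first by rewrite gt_eqF.
  apply: (@continuous_comp _ _ _ (fun x : R => x ^+ 2 + k) (@Num.sqrt R)); last exact: sqrt_continuous.
  by apply: cvgD; [apply: cvgM; exact: cvg_id|exact: cvg_cst].
rewrite (ftc nr dF cf); congr (_%:E).
rewrite sqrrN; have -> : - r + Num.sqrt (r ^+ 2 + k) = k / (r + Num.sqrt (r ^+ 2 + k)).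
  rewrite -[k](addKr (r ^+ 2)) -{2}[r ^+ 2 + k]sqr_sqrtr ?ltW//.
  by have := sx r => h; rewrite addKr; field; rewrite gt_eqF.
by rewrite ln_div ?posrE//; ring.
Qed.

End calculus_bounds.

(** * The covariance form and the behaviour of the characteristic function *)

Section second_moments.
Context d (T : measurableType d) (R : realType) (P : probability T R).
Context (X0 : T -> Z2) (mX0 : discrete_rv X0) (symX0 : symmetric_law P X0).
Context (varX0 : finite_variance P X0).
Local Notation charf := (charf P X0).

Let xi (i : 'I_2) (w : T) : R := (X0 w i 0)%:~R.

Let mxi (f : Z2 -> R) : measurable_fun setT (fun w => f (X0 w)).
Proof. exact: (@discrete_measurable_fun _ _ _ X0 _ _ f). Qed.

Lemma integrable_sq i : P.-integrable setT (fun w => (xi i w ^+ 2)%:E).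
Proof.
apply/integrableP; split.
  by apply/measurable_EFinP; exact: (mxi (fun y => (y i 0)%:~R ^+ 2)).
apply: le_lt_trans (varX0 i); rewrite unlock le_eqVlt; apply/orP; left; apply/eqP.
by apply: eq_integral => w _ /=; rewrite ger0_norm ?sqr_ge0.
Qed.

Lemma integrable_mul i j : P.-integrable setT (fun w => (xi i w * xi j w)%:E).
Proof.
apply: (@le_integrable _ _ _ _ _ _ _ (fun w => (xi i w ^+ 2)%:E + (xi j w ^+ 2)%:E)%E) => //.
- apply/measurable_EFinP; exact: (mxi (fun y => (y i 0)%:~R * (y j 0)%:~R)).
- move=> w _; rewrite -EFinD !abse_EFin lee_fin.
  rewrite [leRHS]ger0_norm ?addr_ge0 ?sqr_ge0// normrM.
  rewrite -[xi i w ^+ 2]real_normK ?num_real// -[xi j w ^+ 2]real_normK ?num_real//.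
  have := sqr_ge0 (`|xi i w| - `|xi j w|).
  have : 0 <= `|xi i w| * `|xi j w| by rewrite mulr_ge0.
  lra.
- by apply: integrableD => //; exact: integrable_sq.
Qed.

Definition moment (i j : 'I_2) : R := \int[P]_w (xi i w * xi j w).

Lemma covariance_mxE : covariance_mx P X0 = \matrix_(i, j) moment i j.
Proof.
apply/matrixP => i j; rewrite !mxE unlock /moment /Rintegral; congr fine.
by apply: eq_integral => w _; rewrite !mxE big_ord1 mxE rmorphM.
Qed.

(** The quadratic form of the covariance matrix, that is, the variance of th . X. *)
Definition quad (th : R * R) : R :=
  moment 0 0 * th.1 ^+ 2 + 2 * moment 0 1 * th.1 * th.2 + moment 1 1 * th.2 ^+ 2.

Lemma ip_sqE th w : ip th (X0 w) ^+ 2 = th.1 ^+ 2 * (xi 0 w * xi 0 w) +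
  (2 * th.1 * th.2) * (xi 0 w * xi 1 w) + th.2 ^+ 2 * (xi 1 w * xi 1 w).
Proof. by rewrite /ip /xi; ring. Qed.

Lemma integrable_ip_sq th : P.-integrable setT (fun w => (ip th (X0 w) ^+ 2)%:E).
Proof.
under eq_fun do rewrite ip_sqE !EFinD !EFinM -!EFinM.
apply: integrableD => //; [apply: integrableD => //|];
  under eq_fun do rewrite EFinM; apply: integrableZl => //; exact: integrable_mul.
Qed.

Lemma Rintegral_ip_sq th : \int[P]_w (ip th (X0 w) ^+ 2) = quad th.
Proof.
have iz i j (c : R) : P.-integrable setT (EFin \o (fun w => c * (xi i w * xi j w))).
  rewrite /comp; under eq_fun do rewrite EFinM.
  by apply: integrableZl => //; exact: integrable_mul.
rewrite (@eq_Rintegral _ _ _ P setT (fun w => th.1 ^+ 2 * (xi 0 w * xi 0 w) +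
  (2 * th.1 * th.2) * (xi 0 w * xi 1 w) + th.2 ^+ 2 * (xi 1 w * xi 1 w))); last first.
  by move=> w _; exact: ip_sqE.
rewrite RintegralD//; last first.
  rewrite /comp; under eq_fun do rewrite EFinD.
  by apply: integrableD => //; exact: iz.
rewrite RintegralD//.
rewrite !RintegralZl//; try exact: integrable_mul.
by rewrite /quad /moment; ring.
Qed.

Lemma bounded_mfun_one_sub_cos th : bounded_mfun (fun w => 1 - cos (ip th (X0 w)) : R).
Proof.
apply: bounded_mfunB; first exact: bounded_mfun_cst.
split; last by exists 1 => w; exact: normr_cos.
exact: (mxi (fun y => cos (ip th y))).
Qed.

Lemma one_sub_charf th : 1 - charf th = \int[P]_w (1 - cos (ip th (X0 w))).
Proof.
rewrite -[RHS]/(ev P _) evB ?ev_cst//; first exact: bounded_mfun_cst.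
split; last by exists 1 => w; exact: normr_cos.
exact: (mxi (fun y => cos (ip th y))).
Qed.

Lemma one_sub_charf_le th : 1 - charf th <= quad th / 2.
Proof.
rewrite one_sub_charf -Rintegral_ip_sq mulrC -RintegralZl//; last exact: integrable_ip_sq.
apply: le_Rintegral => //.
- exact/bounded_mfun_integrable/bounded_mfun_one_sub_cos.
- rewrite /comp; under eq_fun do rewrite EFinM.
  by apply: integrableZl => //; exact: integrable_ip_sq.
- by move=> w _; have := one_sub_cos_le (ip th (X0 w)); lra.
Qed.

Lemma quad_ge0 th : 0 <= quad th.
Proof. by rewrite -Rintegral_ip_sq; apply: Rintegral_ge0 => w _; exact: sqr_ge0. Qed.

Lemma ip_sq_le th x : ip th x ^+ 2 <= (th.1 ^+ 2 + th.2 ^+ 2) * sqn R x.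
Proof.
rewrite /ip /sqn -subr_ge0; set a := _%:~R; set b := _%:~R.
have -> : (th.1 ^+ 2 + th.2 ^+ 2) * (a ^+ 2 + b ^+ 2) - (th.1 * a + th.2 * b) ^+ 2 =
   (th.1 * b - th.2 * a) ^+ 2 by ring.
exact: sqr_ge0.
Qed.

Lemma integrable_sqn : P.-integrable setT (fun w => (sqn R (X0 w))%:E).
Proof. by rewrite /sqn; under eq_fun do rewrite EFinD; apply: integrableD => //; exact: integrable_sq. Qed.

Lemma mean_sq_fin : (mean_sq P X0 < +oo)%E.
Proof.
have /integrableP[_] := integrable_sqn; apply: le_lt_trans.
by apply: ge0_le_integral => //; [move=> w _; rewrite lee_fin sqn_ge0|
  apply/measurable_EFinP; exact: (mxi (sqn R))|
  apply: measurableT_comp => //; apply/measurable_EFinP; exact: (mxi (sqn R))|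
  move=> w _; exact: lee_abs].
Qed.

(** Dominated convergence as r tends to 0, the squared norm being the dominating function. It
    supplies the o(|th|^2) in the expansion of [charf]. *)
Lemma truncated_mean_sq (e : R) : 0 < e -> exists2 r : R, 0 < r &
  \int[P]_w (sqn R (X0 w) * Num.min 1 (r * sqn R (X0 w))) <= e.
Proof.
move=> e0.
pose f (n : nat) w : \bar R := (sqn R (X0 w) * Num.min 1 (n.+1%:R^-1 * sqn R (X0 w)))%:E.
have mf n : measurable_fun setT (f n).
  by apply/measurable_EFinP; exact: (mxi (fun y => sqn R y * Num.min 1 (n.+1%:R^-1 * sqn R y))).
have f0 n w : (0 <= f n w)%E.
  by rewrite lee_fin mulr_ge0 ?sqn_ge0// le_min ler01 mulr_ge0 ?sqn_ge0// invr_ge0.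
have fle n w : (f n w <= (sqn R (X0 w))%:E)%E.
  by rewrite lee_fin ler_piMr ?sqn_ge0// ge_min lexx.
have f_cvg : {ae P, forall w, setT w -> f n w @[n --> \oo] --> cst 0%E w}.
  apply: aeW => w _; rewrite /f; apply: cvg_EFin; first by apply: nearW.
  rewrite /comp /=.
  apply: (@squeeze_cvgr _ _ _ _ (cst 0) (fun n => (sqn R (X0 w)) ^+ 2 * n.+1%:R^-1)).
  + apply: nearW => n; have := f0 n w; rewrite lee_fin => -> /=.
    by rewrite expr2 -mulrA ler_wpM2l ?sqn_ge0// ge_min mulrC lexx orbT.
  + exact: cvg_cst.
  + rewrite -[X in _ --> X](mulr0 (sqn R (X0 w) ^+ 2)); apply: cvgMr.
    exact: cvg_harmonic.
have f_dom : {ae P, forall w n, setT w -> (`|f n w| <= (sqn R (X0 w))%:E)%E}.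
  by apply: aeW => w n _; rewrite gee0_abs.
have [_ _] := @dominated_convergence _ _ _ P setT measurableT f (cst 0%E)
  (fun w => (sqn R (X0 w))%:E) mf (measurable_cst _) f_cvg integrable_sqn f_dom.
rewrite integral0 => /fine_cvgP[] _ /cvgrPdist_lt /(_ e e0) [n _ hn].
exists n.+1%:R^-1; first by rewrite invr_gt0.
have := hn n (leqnn n); rewrite /= sub0r normrN => /ltW; apply: le_trans.
by rewrite ler_norm.
Qed.

End second_moments.

Section charf_quadratic.
Context d (T : measurableType d) (R : realType) (P : probability T R).
Context (X0 : T -> Z2) (mX0 : discrete_rv X0) (symX0 : symmetric_law P X0).
Context (varX0 : finite_variance P X0).
Local Notation charf := (charf P X0).
Local Notation quad := (quad P X0).
Local Notation moment := (moment P X0).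
Context (C : R) (C0 : 0 < C)
  (hC : forall th x, 1 - cos (ip th x) <= C * sqn R x * (1 - charf th)).

Lemma one_sub_cos1_le th : 1 - cos th.1 <= C * (1 - charf th).
Proof.
have := hC th (delta_mx 0 0); rewrite /ip /sqn !mxE /=.
by rewrite mulr1 mulr0 addr0 expr1n expr0n /= addr0 mulr1.
Qed.

Lemma one_sub_cos2_le th : 1 - cos th.2 <= C * (1 - charf th).
Proof.
have := hC th (delta_mx 1 0); rewrite /ip /sqn !mxE /=.
by rewrite mulr1 mulr0 add0r expr1n expr0n /= add0r mulr1.
Qed.

Lemma one_sub_cos_ge (t : R) : `|t| <= 2^-1 -> t ^+ 2 / 4 <= 1 - cos t.
Proof.
rewrite -(@ler_pXn2r _ 2%N) ?nnegrE// real_normK ?num_real// => t2.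
have := cos_taylor t; have : t ^+ 2 * Num.min 1 (t ^+ 2) <= t ^+ 2 / 4.
  rewrite ler_wpM2l ?sqr_ge0//; have : Num.min 1 (t ^+ 2) <= t ^+ 2 by rewrite ge_min lexx orbT.
  by move=> h; apply: (le_trans h); lra.
lra.
Qed.

Lemma norm_sq_le_quad th : `|th.1| <= 2^-1 -> `|th.2| <= 2^-1 ->
  th.1 ^+ 2 + th.2 ^+ 2 <= 4 * C * quad th.
Proof.
move=> /one_sub_cos_ge h1 /one_sub_cos_ge h2.
have := one_sub_cos1_le th; have := one_sub_cos2_le th.
have := ler_wpM2l (ltW C0) (one_sub_charf_le mX0 varX0 th).
lra.
Qed.

(** By [cos_taylor] the error is at most |th|^2 times a truncated second moment, and |th|^2 is at
    most 4 C [quad th] because irreducibility makes the form nondegenerate. *)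
Lemma charf_quad_near0 (e : R) : 0 < e -> exists2 r : R, 0 < r <= 2^-1 &
  forall th, `|th.1| <= r -> `|th.2| <= r ->
  (1 - e) * (quad th / 2) <= 1 - charf th.
Proof.
(* Chosen so that 4 C [quad th] times this bound is e [quad th] / 2. *)
move=> e0; have e1 : 0 < e / (8 * C) by rewrite divr_gt0// mulr_gt0.
have [r0 r00 hr0] := truncated_mean_sq mX0 varX0 e1.
exists (Num.min 2^-1 r0); first by rewrite lt_min r00 ge_min lexx invr_gt0 !andbT.
move=> th; rewrite !le_min => /andP[h1 h1'] /andP[h2 h2'].
set S := th.1 ^+ 2 + th.2 ^+ 2.
have S0 : 0 <= S by rewrite addr_ge0 ?sqr_ge0.
have sq (t : R) : `|t| <= 2^-1 -> `|t| <= r0 -> t ^+ 2 <= r0 / 2.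
  move=> a b; rewrite -real_normK ?num_real// expr2 [leRHS]mulrC.
  by rewrite ler_pM.
have Sr : S <= r0 by have := sq _ h1 h1'; have := sq _ h2 h2'; rewrite /S; lra.
have hS := norm_sq_le_quad h1 h2.
pose g w := sqn R (X0 w) * Num.min 1 (r0 * sqn R (X0 w)).
have ig : P.-integrable setT (EFin \o g).
  apply: (@le_integrable _ _ _ _ _ _ _ (fun w => (sqn R (X0 w))%:E)) => //.
  - apply/measurable_EFinP.
    exact: (@discrete_measurable_fun _ _ _ X0 _ _ (fun y => sqn R y * Num.min 1 (r0 * sqn R y))).
  - move=> w _ /=; rewrite lee_fin ger0_norm.
      by rewrite (le_trans _ (ler_norm _))// ler_piMr ?sqn_ge0// ge_min lexx.
    by rewrite mulr_ge0 ?sqn_ge0// le_min ler01 mulr_ge0 ?sqn_ge0// ltW.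
  - exact: integrable_sqn.
have iq := integrable_ip_sq mX0 varX0 th.
have iq2 : P.-integrable setT (EFin \o (fun w => 2^-1 * ip th (X0 w) ^+ 2)).
  by rewrite /comp; under eq_fun do rewrite EFinM; apply: integrableZl.
have ic := bounded_mfun_integrable P (bounded_mfun_one_sub_cos mX0 th).
have : quad th / 2 - (1 - charf th) <= S * \int[P]_w g w.
  have -> : quad th / 2 - (1 - charf th) =
      \int[P]_w (2^-1 * ip th (X0 w) ^+ 2 - (1 - cos (ip th (X0 w)))).
    by rewrite RintegralB// RintegralZl// Rintegral_ip_sq// -one_sub_charf// mulrC.
  rewrite -RintegralZl//; apply: le_Rintegral => //.
  - by rewrite /comp; under eq_fun do rewrite EFinB; apply: integrableB.
  - by rewrite /comp; under eq_fun do rewrite EFinM; apply: integrableZl.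
  move=> w _; have := cos_taylor (ip th (X0 w)).
  have s0 := sqn_ge0 R (X0 w).
  have : ip th (X0 w) ^+ 2 * Num.min 1 (ip th (X0 w) ^+ 2) <= S * g w.
    rewrite /g mulrA; apply: ler_pM.
    - exact: sqr_ge0.
    - by rewrite le_min ler01 sqr_ge0.
    - exact: ip_sq_le.
    - rewrite le_min ge_min lexx /= ge_min; apply/orP; right.
      by rewrite (le_trans (ip_sq_le _ _))// ler_wpM2r.
  lra.
have : S * \int[P]_w g w <= 4 * C * quad th * (e / (8 * C)).
  by apply: ler_pM => //; apply: Rintegral_ge0 => w _;
    rewrite mulr_ge0 ?sqn_ge0// le_min ler01 mulr_ge0 ?sqn_ge0// ltW.
have -> : 4 * C * quad th * (e / (8 * C)) = e * (quad th / 2) by field; rewrite gt_eqF.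
lra.
Qed.

Lemma cos1_lt1 : cos 1 < 1 :> R.
Proof.
have : 0 < sin (1 / 2 : R) by apply: sin2_gt0; rewrite divr_gt0//=; lra.
by move=> h; rewrite -subr_gt0 one_sub_cos mulr_gt0// exprn_gt0.
Qed.

Definition quad_det : R := moment 0 0 * moment 1 1 - moment 0 1 ^+ 2.

Lemma moment11_gt0 : 0 < moment 1 1.
Proof.
have := one_sub_cos2_le (0, 1); have := one_sub_charf_le mX0 varX0 (0, 1).
rewrite /quad /= expr0n /= !mulr0 !mul0r !add0r expr1n mulr1 => h1 h2.
have := ler_wpM2l (ltW C0) h1; have := cos1_lt1 => h3 h4.
rewrite -(pmulr_rgt0 _ C0); lra.
Qed.

(** At the frequency below, which minimizes [quad] among those with first coordinate 1, the form
    equals the determinant divided by the moment c. It is positive there because 0 < 1 - cos 1 <= C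
    (1 - charf) <= C [quad] / 2. *)
Lemma quad_det_gt0 : 0 < quad_det.
Proof.
have c0 := moment11_gt0; set c := moment 1 1 in c0.
pose th : R * R := (1, - moment 0 1 / c).
have := one_sub_cos1_le th; have := one_sub_charf_le mX0 varX0 th.
have -> : quad th = quad_det / c.
  by rewrite /quad /quad_det /th /= -/c; field; rewrite gt_eqF.
move=> h1 /= h2; have := ler_wpM2l (ltW C0) h1; have := cos1_lt1 => h3 h4.
have : 0 < C * (quad_det / c / 2) by lra.
by rewrite pmulr_rgt0// pmulr_lgt0// pmulr_lgt0// invr_gt0.
Qed.

Lemma det_covariance : \det (covariance_mx P X0) = quad_det.
Proof.
rewrite covariance_mxE (expand_det_row _ 0) !big_ord_recl big_ord0 /cofactor.
rewrite !det_mx11 !mxE /= /bump /=.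
have -> : lift 0 0 = 1 :> 'I_2 by apply/val_inj.
have -> : lift 1 0 = 0 :> 'I_2 by apply/val_inj.
have m10 : moment 1 0 = moment 0 1.
  by rewrite /moment; apply: eq_Rintegral => w _; rewrite mulrC.
by rewrite m10 /quad_det /=; ring.
Qed.

(** For a periodic walk [charf] may approach -1 away from the origin, but only values near 1 make 1
    - l charf small, and these are excluded by [cos_ip_le] in the coordinate directions. *)
Lemma charf_off0 (r : R) : 0 < r <= 2^-1 -> exists2 k : R, 0 < k &
  forall th, `|th.1| <= pi -> `|th.2| <= pi -> (r < `|th.1|) || (r < `|th.2|) ->
  k <= 1 - charf th.
Proof.
move=> /andP[r0 r2].
have rp : r <= pi by have := pi_ge2 R; lra.
have hr : 0 < 1 - cos r.
  by apply: lt_le_trans (one_sub_cos_ge _); rewrite ?ger0_norm ?(ltW r0)// divr_gt0// exprn_gt0.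
have mono (t : R) : `|t| <= pi -> r < `|t| -> 1 - cos r <= 1 - cos t.
  move=> tp rt; have ct : cos t = cos `|t|.
    by have [t0|/ltW t0] := leP 0 t; [rewrite (ger0_norm t0)|rewrite (ler0_norm t0) cosN].
  rewrite lerD2l lerN2 ct ltW// ltr_cos// in_itv /=; rewrite ?(ltW r0) ?rp ?normr_ge0 ?tp//.
exists ((1 - cos r) / C) => [|th h1 h2 /orP[h|h]]; first by rewrite divr_gt0.
- rewrite ler_pdivrMr// mulrC; apply: le_trans (one_sub_cos1_le th); exact: mono.
- rewrite ler_pdivrMr// mulrC; apply: le_trans (one_sub_cos2_le th); exact: mono.
Qed.

End charf_quadratic.

(** * Logarithmic divergence of the Green function at the origin *)

Section unif2_bounds.
Context (R : realType).
Local Notation Theta := (measurableTypeR R * measurableTypeR R)%type.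
Variables (F : Theta -> R) (G : R -> R) (I : R).
Hypotheses (bF : bounded_mfun F) (F0 : forall th, 0 <= F th).
Hypotheses (G0 : forall x, 0 <= G x) (mG : measurable_fun setT G).

Let pi2 : 0 < pi *+ 2 :> R. Proof. by rewrite mulrn_wgt0// pi_gt0. Qed.

Let g (x : R) : R := ev (unif R) (fun y => F (x, y)).

Let bg : bounded_mfun (g : measurableTypeR R -> R).
Proof. exact: (bounded_mfun_ev1 (unif R) (unif R) bF). Qed.

Let g0 x : 0 <= g x. Proof. exact: ev_ge0. Qed.

Let inner x : (\int[lebesgue_measure]_(y in `[(- pi)%R, pi]) (F (x, y))%:E =
  (pi *+ 2 * g x)%:E)%E.
Proof.
rewrite EFinM /g ev_unif//; last exact: bounded_mfun_pair2.
by rewrite muleA -EFinM divff ?mul1e// gt_eqF.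
Qed.

Let evE : (ev (unif2 R) F)%:E =
  ((pi *+ 2)^-1%:E * \int[lebesgue_measure]_(x in `[(- pi)%R, pi]) (g x)%:E)%E.
Proof. by rewrite /unif2 ev_prod// ev_unif. Qed.

Let meg : measurable_fun setT (fun x : R => (g x)%:E).
Proof. by apply/measurable_EFinP; exact: bg.1. Qed.

Lemma ev_unif2_le : 
  (\int[lebesgue_measure]_(x in `[(- pi)%R, pi]) (G x)%:E = I%:E)%E ->
  (forall x, - pi <= x <= pi ->
    (\int[lebesgue_measure]_(y in `[(- pi)%R, pi]) (F (x, y))%:E <= (G x)%:E)%E) ->
  ev (unif2 R) F <= I / (pi *+ 2) ^+ 2.
Proof.
move=> GI FG; have c0 : 0 <= (pi *+ 2)^-1 :> R by rewrite invr_ge0 ltW.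
have h : (\int[lebesgue_measure]_(x in `[(- pi)%R, pi]) (g x)%:E <=
    (pi *+ 2)^-1%:E * \int[lebesgue_measure]_(x in `[(- pi)%R, pi]) (G x)%:E)%E.
  rewrite -ge0_integralZl//; last 2 first.
  - by apply: measurable_funTS; exact/measurable_EFinP.
  - by move=> x _; rewrite lee_fin.
  apply: ge0_le_integral => //.
  - by move=> x _; rewrite lee_fin.
  - exact: measurable_funTS.
  - apply: measurable_funTS; apply: measurable_funeM; exact/measurable_EFinP.
  - move=> x; rewrite /= in_itv /= => /FG; rewrite inner lee_fin => h.
    by rewrite -EFinM lee_fin ler_pdivlMl.
rewrite -lee_fin evE; apply: (le_trans (lee_wpmul2l _ h)); first by rewrite lee_fin.
by rewrite GI -!EFinM lee_fin expr2 invfM [leRHS]mulrC mulrA.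
Qed.

Lemma ev_unif2_ge (r B : R) : 0 < r <= pi -> 0 <= B ->
  (\int[lebesgue_measure]_(x in `[(- r)%R, r]) (G x)%:E = I%:E)%E ->
  (forall x, - r <= x <= r ->
    ((G x)%:E <= \int[lebesgue_measure]_(y in `[(- pi)%R, pi]) (F (x, y))%:E + B%:E)%E) ->
  (I - 2 * r * B) / (pi *+ 2) ^+ 2 <= ev (unif2 R) F.
Proof.
move=> /andP[r0 rpi] B0 GI FG.
have JE : (\int[lebesgue_measure]_(x in `[(- pi)%R, pi]) (g x)%:E =
    (pi *+ 2 * ev (unif2 R) F)%:E)%E.
  by rewrite EFinM evE muleA -EFinM divff ?mul1e// gt_eqF.
have JJ : (\int[lebesgue_measure]_(x in `[(- r)%R, r]) (g x)%:E <=
    (pi *+ 2 * ev (unif2 R) F)%:E)%E.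
  rewrite -JE; apply: ge0_subset_integral => //.
  - exact: measurable_funTS.
  - by move=> x _; rewrite lee_fin.
  - by move=> x /=; rewrite !in_itv /= => /andP[a b]; apply/andP; split; lra.
have : (I%:E <= (pi *+ 2)%:E * \int[lebesgue_measure]_(x in `[(- r)%R, r]) (g x)%:E +
    (2 * r * B)%:E)%E.
  rewrite -GI.
  have -> : ((2 * r * B)%:E = \int[lebesgue_measure]_(x in `[(- r)%R, r]) (cst B%:E) x)%E.
    rewrite integral_cst//= lebesgue_measure_itv /= lte_fin gtrN// -EFinB -EFinM.
    by congr (_%:E); ring.
  rewrite -ge0_integralZl//; last 3 first.
  - exact: measurable_funTS.
  - by move=> x _; rewrite lee_fin.
  - by rewrite lee_fin ltW.
  rewrite -ge0_integralD//; [|by move=> x _; rewrite mule_ge0 ?lee_fin ?g0 ?ltW|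
    by apply: measurable_funTS; apply: measurable_funeM].
  apply: ge0_le_integral => //.
  - by move=> x _; rewrite lee_fin.
  - by apply: measurable_funTS; exact/measurable_EFinP.
  - apply: measurable_funTS; apply: emeasurable_funD => //; exact: measurable_funeM.
  - by move=> x; rewrite /= in_itv /= => /FG; rewrite inner EFinM.
have p0 : (0%:E <= (pi *+ 2 : R)%:E)%E by rewrite lee_fin ltW.
move=> h; have := le_trans h (leeD (lee_wpmul2l p0 JJ) (lexx _)).
rewrite -EFinM -EFinD lee_fin => h'.
rewrite ler_pdivrMr ?exprn_gt0// lerBlDr; apply: (le_trans h').
by rewrite le_eqVlt; apply/orP; left; apply/eqP; ring.
Qed.

End unif2_bounds.

Section green_asymptotics.
Context d (T : measurableType d) (R : realType) (P : probability T R).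
Context (X0 : T -> Z2) (mX0 : discrete_rv X0) (symX0 : symmetric_law P X0).
Context (varX0 : finite_variance P X0).
Local Notation charf := (charf P X0).
Local Notation quad := (quad P X0).
Local Notation moment := (moment P X0).
Local Notation green := (green P X0).
Context (C : R) (C0 : 0 < C)
  (hC : forall th x, 1 - cos (ip th x) <= C * sqn R x * (1 - charf th)).
Local Notation D := (quad_det P X0).
Local Notation c := (moment 1 1).

(** The coefficient of ln(1 / (1 - l)) in [green l 0], see [green0_asymptotic]. *)
Definition gconst : R := (2 * pi * Num.sqrt D)^-1.

Let c0 : 0 < c. Proof. exact: (moment11_gt0 mX0 varX0 C0 hC). Qed.
Let D0 : 0 < D. Proof. exact: (quad_det_gt0 mX0 varX0 C0 hC). Qed.

Lemma gconst_gt0 : 0 < gconst.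
Proof. by rewrite invr_gt0 !mulr_gt0 ?pi_gt0// sqrtr_gt0. Qed.

(** Completing the square in y makes the inner integral of the reciprocal an arctangent and leaves
    the outer integral of (x^2 + k)^(-1/2), which produces the logarithm of k, hence of delta. *)
Lemma complete_square (s delta x y : R) : 0 < s -> 0 < delta ->
  let k := 2 * c * delta / (s * D) in
  delta + s / 2 * quad (x, y) =
  (Num.sqrt (s * D / (2 * c)) * Num.sqrt (x ^+ 2 + k)) ^+ 2 +
  Num.sqrt (s * c / 2) ^+ 2 * (y + moment 0 1 * x / c) ^+ 2.
Proof.
move=> s0 d0 k.
have h1 : 0 <= s * D / (2 * c) by apply/ltW/divr_gt0; rewrite mulr_gt0.
have k0 : 0 < k by apply: divr_gt0; rewrite ?mulr_gt0.
have h2 : 0 <= x ^+ 2 + k by rewrite addr_ge0 ?sqr_ge0 ?ltW.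
have h3 : 0 <= s * c / 2 by apply/ltW/divr_gt0; rewrite ?mulr_gt0.
rewrite exprMn (sqr_sqrtr h1) (sqr_sqrtr h2) (sqr_sqrtr h3).
by rewrite /k /quad /quad_det /=; field; rewrite -/D !gt_eqF.
Qed.

Lemma sqrt_coef (s z : R) : 0 < s ->
  Num.sqrt (s * D / (2 * c)) * z * Num.sqrt (s * c / 2) =
  s / 2 * Num.sqrt D * z.
Proof.
move=> s0; rewrite mulrAC -sqrtrM ?divr_ge0 ?mulr_ge0 ?ltW//; congr (_ * _).
have -> : s * D / (2 * c) * (s * c / 2) = (s / 2) ^+ 2 * D by field; rewrite gt_eqF.
by rewrite sqrtrM ?sqr_ge0// sqrtr_sqr ger0_norm// divr_ge0// ltW.
Qed.

Lemma measurable_inv_sqrt (k : R) : 0 < k ->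
  measurable_fun setT (fun x : R => (Num.sqrt (x ^+ 2 + k))^-1).
Proof.
move=> k0; apply: continuous_measurable_fun => x.
have p0 : 0 < x ^+ 2 + k by rewrite ltr_wpDl// sqr_ge0.
apply: cvgV; first by rewrite gt_eqF// sqrtr_gt0.
apply: (@continuous_comp _ _ _ (fun x : R => x ^+ 2 + k) (@Num.sqrt R)); last exact: sqrt_continuous.
by apply: cvgD; [apply: cvgM; exact: cvg_id|exact: cvg_cst].
Qed.

(** Near the origin the denominator is at least delta + s [quad] / 2, whose reciprocal is integrated
    exactly over the whole square. Elsewhere [charf_off0] bounds the integrand by the constant 2 /
    kap. *)
Lemma green0_upper (s : R) : 0 < s < 1 -> exists K, exists2 d0 : R, 0 < d0 &
  forall delta, 0 < delta < d0 ->
  green (1 - delta) 0 <= gconst / s * ln delta^-1 + K.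
Proof.
move=> /andP[s0 s1]; pose e := (1 - s) / 2.
have e0 : 0 < e by rewrite /e; lra.
have [r /[dup] hr0 /andP[r0 r2] hr] := charf_quad_near0 mX0 varX0 C0 hC e0.
have [kap kap0 hkap] := charf_off0 C0 hC hr0.
have sD : 0 < Num.sqrt D by rewrite sqrtr_gt0.
exists (gconst / s * (2 * ln (pi + Num.sqrt (pi ^+ 2 + 1)) - ln (2 * c / (s * D))) + 2 / kap).
exists (Num.min (Num.min e 2^-1) (s * D / (2 * c))).
  by rewrite !lt_min e0 invr_gt0 ltr0n divr_gt0 ?mulr_gt0.
move=> delta /andP[d0]; rewrite !lt_min => /andP[/andP[de d2] dk].
set l := 1 - delta; have l01 : 0 < l < 1 by rewrite /l; apply/andP; split; lra.
pose k := 2 * c * delta / (s * D).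
have k0 : 0 < k by rewrite divr_gt0 ?mulr_gt0.
have k1 : k <= 1.
  rewrite ler_pdivrMr ?mulr_gt0// mul1r mulrC -ler_pdivlMr ?mulr_gt0// ltW//.
have pi0 := pi_gt0 R.
pose G x := 2 * pi / (s * Num.sqrt D) * (Num.sqrt (x ^+ 2 + k))^-1 + 4 * pi / kap.
have is0 (x : R) : 0 <= (Num.sqrt (x ^+ 2 + k))^-1 by rewrite invr_ge0 sqrtr_ge0.
have cG : 0 <= 2 * pi / (s * Num.sqrt D) by rewrite divr_ge0 ?mulr_ge0// ltW.
have cG' : 0 <= 4 * pi / kap by rewrite divr_ge0 ?mulr_ge0// ltW.
have := @ev_unif2_le _ (fun th => cos (ip th 0) * (1 - l * charf th)^-1) G
  (2 * pi / (s * Num.sqrt D) * (2 * ln (pi + Num.sqrt (pi ^+ 2 + k)) - ln k) + 2 * pi * (4 * pi / kap))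
  (bounded_mfun_green P mX0 l01 0).
move=> /(_ _ _ _ _ _)/wrap[th|x||||hle].
- by rewrite ip0 cos0 mul1r invr_ge0 ltW// den_gt0.
- by rewrite addr_ge0// mulr_ge0.
- by apply: measurable_funD => //; apply: measurable_funM => //; exact: measurable_inv_sqrt.
- rewrite /G; under eq_integral do rewrite EFinD.
  have mi : measurable_fun `[(- pi)%R, pi] (fun x : R => ((Num.sqrt (x ^+ 2 + k))^-1)%:E).
    by apply: measurable_funTS; apply/measurable_EFinP; exact: measurable_inv_sqrt.
  have mi2 : measurable_fun `[(- pi)%R, pi] (fun x : R =>
      (2 * pi / (s * Num.sqrt D) * (Num.sqrt (x ^+ 2 + k))^-1)%:E).
    apply: measurable_funTS; apply/measurable_EFinP.
    by apply: measurable_funM => //; exact: measurable_inv_sqrt.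
  rewrite ge0_integralD//; try by move=> x _; rewrite lee_fin; first [exact: cG'|exact: mulr_ge0 cG (is0 x)].
  under eq_integral do rewrite EFinM.
  rewrite ge0_integralZl//; try by move=> x _; rewrite lee_fin.
  rewrite integral_inv_sqrt// integral_cst//= lebesgue_measure_itv /= lte_fin gtrN//.
  by rewrite -EFinB -!EFinM -EFinD; congr (_%:E); ring.
- move=> x xpi; pose M := Num.sqrt (s * D / (2 * c)) * Num.sqrt (x ^+ 2 + k).
  pose N := Num.sqrt (s * c / 2).
  have M0 : 0 < M by rewrite mulr_gt0// sqrtr_gt0 ?divr_gt0 ?mulr_gt0// ltr_wpDl ?sqr_ge0.
  have N0 : 0 < N by rewrite sqrtr_gt0 divr_gt0 ?mulr_gt0.
  have q0 (y : R) : 0 < M ^+ 2 + N ^+ 2 * (y + moment 0 1 * x / c) ^+ 2.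
    by rewrite ltr_wpDr ?exprn_gt0// mulr_ge0// sqr_ge0.
  have MN : M * N = s / 2 * Num.sqrt D * Num.sqrt (x ^+ 2 + k).
    by rewrite /M /N sqrt_coef.
  have hF (y : R) : - pi <= y <= pi -> cos (ip (x, y) 0) * (1 - l * charf (x, y))^-1 <=
     (M ^+ 2 + N ^+ 2 * (y + moment 0 1 * x / c) ^+ 2)^-1 + 2 / kap.
    move=> ypi; rewrite ip0 cos0 mul1r.
    have ch1 := one_sub_charf_le mX0 varX0 (x, y).
    have [/andP[hx hy]|] := boolP ((`|x| <= r) && (`|y| <= r)).
      have := hr (x, y) hx hy => h.
      apply: (@le_trans _ _ ((M ^+ 2 + N ^+ 2 * (y + moment 0 1 * x / c) ^+ 2)^-1)); last first.
        by rewrite lerDl divr_ge0// ltW.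
      rewrite lef_pV2 ?posrE//; last exact: den_gt0.
      rewrite -complete_square//.
      have q1 := quad_ge0 mX0 varX0 (x, y).
      have h1 : 0 <= (l - (1 - e)) * (1 - charf (x, y)).
        rewrite mulr_ge0//; first by rewrite /l; lra.
        by rewrite subr_ge0; have := normr_charf P mX0 (x, y); rewrite ler_norml => /andP[].
      have h2 : (1 - e) * ((1 - e) * (quad (x, y) / 2)) <= (1 - e) * (1 - charf (x, y)).
        by rewrite ler_wpM2l// /e; lra.
      have h3 : 0 <= ((1 - e) ^+ 2 - s) * (quad (x, y) / 2).
        rewrite mulr_ge0//; last by rewrite divr_ge0.
        by rewrite /e; have := sqr_ge0 (1 - s); lra.
      by move: h1 h2 h3; rewrite /l; lra.
    rewrite negb_and -!ltNge => hxy.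
    have := hkap (x, y) _ _ hxy; rewrite /= !ler_norml => /(_ xpi ypi) hk.
    apply: (@le_trans _ _ (2 / kap)); last by rewrite lerDr invr_ge0 ltW.
    have -> : 2 / kap = (kap / 2)^-1 by rewrite invf_div.
    rewrite lef_pV2 ?posrE ?divr_gt0//; last exact: den_gt0.
    have : 2^-1 * kap <= l * (1 - charf (x, y)) by rewrite ler_pM// /l; lra.
    rewrite /l; lra.
  have mq : measurable_fun `[(- pi)%R, pi]
      (fun y : R => ((M ^+ 2 + N ^+ 2 * (y + moment 0 1 * x / c) ^+ 2)^-1)%:E).
    apply: measurable_funTS; apply/measurable_EFinP.
    apply: (bounded_mfunV (c := M ^+ 2) _ _ _).1; first by rewrite exprn_gt0.
      apply: measurable_funD => //; apply: measurable_funM => //.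
      by apply: measurable_funX; apply: measurable_funD.
    by move=> y; rewrite lerDl mulr_ge0// sqr_ge0.
  apply: (@le_trans _ _ (\int[lebesgue_measure]_(y in `[(- pi)%R, pi])
     (((M ^+ 2 + N ^+ 2 * (y + moment 0 1 * x / c) ^+ 2)^-1)%:E + (2 / kap)%:E))%E).
    apply: ge0_le_integral => //; first
    [ by move=> y _; rewrite lee_fin ip0 cos0 mul1r invr_ge0 ltW// den_gt0
    | by apply: measurable_funTS; apply/measurable_EFinP;
      exact: (bounded_mfun_pair2 x (bounded_mfun_green P mX0 l01 0)).1
    | exact: emeasurable_funD
    | by move=> y; rewrite /= in_itv /= => /hF h; rewrite -EFinD lee_fin].
  rewrite ge0_integralD//; try by move=> y _; rewrite lee_fin ?invr_ge0 ?divr_ge0 ?ltW.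
  rewrite integral_inv_quadratic ?ltrNpi// integral_cst//= lebesgue_measure_itv /= lte_fin gtrN//.
  rewrite -EFinB -!EFinM -EFinD lee_fin /G; apply: lerD; last first.
    by rewrite le_eqVlt; apply/orP; left; apply/eqP; field; rewrite gt_eqF.
  rewrite MN.
  have := atan_ltpi2 (N / M * (pi + moment 0 1 * x / c)).
  have := atan_gtNpi2 (N / M * (- pi + moment 0 1 * x / c)) => a1 a2.
  have -> : 2 * pi / (s * Num.sqrt D) * (Num.sqrt (x ^+ 2 + k))^-1 =
      pi / (s / 2 * Num.sqrt D * Num.sqrt (x ^+ 2 + k)).
    by field; rewrite !gt_eqF// sqrtr_gt0 ltr_wpDl ?sqr_ge0.
  rewrite ler_pM2r; first lra.
  by rewrite invr_gt0 -MN mulr_gt0.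
have -> : green l 0 = ev (unif2 R) (fun th => cos (ip th 0) * (1 - l * charf th)^-1) by [].
apply: (le_trans hle).
have lnk : - ln k = ln delta^-1 - ln (2 * c / (s * D)).
  have -> : k = delta * (2 * c / (s * D)) by rewrite /k; ring.
  have -> : ln delta^-1 = - ln delta :> R by rewrite lnV ?posrE.
  rewrite [ln (delta * _)]lnM ?posrE//; first by ring.
  by rewrite divr_gt0 ?mulr_gt0.
have lnp : ln (pi + Num.sqrt (pi ^+ 2 + k)) <= ln (pi + Num.sqrt (pi ^+ 2 + 1)) :> R.
  have p1 (z : R) : 0 < pi + Num.sqrt z by rewrite ltr_pwDl// sqrtr_ge0.
  rewrite ler_ln ?posrE ?p1//.
  by rewrite lerD2l ler_sqrt ?lerD2l// addr_ge0 ?sqr_ge0.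
have -> : (2 * pi / (s * Num.sqrt D) * (2 * ln (pi + Num.sqrt (pi ^+ 2 + k)) - ln k) +
   2 * pi * (4 * pi / kap)) / (pi *+ 2) ^+ 2 =
   gconst / s * (2 * ln (pi + Num.sqrt (pi ^+ 2 + k)) - ln k) + 2 / kap.
  rewrite /gconst; move: (pi : R) pi0 => p p0; rewrite mulr2n.
  by field; rewrite !gt_eqF.
rewrite addrA lerD2r -mulrDr ler_pM2l ?divr_gt0 ?gconst_gt0//.
by rewrite addrA; lra.
Qed.

(** Here 1 - l charf <= delta + [quad] / 2 everywhere, and the strip |x| <= r suffices for the
    divergence. In it both arctangents are close to their limits by [atan_ge], at the cost of a
    constant. *)
Lemma green0_lower : exists K, exists2 d0 : R, 0 < d0 &
  forall delta, 0 < delta < d0 ->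
  gconst * ln delta^-1 - K <= green (1 - delta) 0.
Proof.
have sD : 0 < Num.sqrt D by rewrite sqrtr_gt0.
(* For |x| <= r the centre of the square is shifted by at most 1, and 1 <= pi / 2, so that the
   shifted interval of y still contains [- pi / 2, pi / 2]. *)
pose b := moment 0 1; pose r := Num.min 1 (c / (`|b| + 1)).
have b1 : 0 < `|b| + 1 by rewrite ltr_wpDl.
have r0 : 0 < r by rewrite lt_min ltr01 divr_gt0.
have pi0 := pi_gt0 R; have pi2 := pi_ge2 R.
have rpi : r <= pi by rewrite ge_min; apply/orP; left; lra.
(* What the two ends of the arctangent cost after division by M N; the product with 1 / M cancels
   the dependence on x and delta. *)
pose B := 8 / (pi * c).
have B0 : 0 <= B by rewrite divr_ge0// mulr_ge0// ltW.
exists (gconst * (ln (2 * c / D) - 2 * ln r) + 2 * r * B / (pi *+ 2) ^+ 2).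
exists 1 => // delta /andP[d0 d1].
set l := 1 - delta; have l01 : 0 < l < 1 by rewrite /l; apply/andP; split; lra.
pose k := 2 * c * delta / (1 * D).
have k0 : 0 < k by rewrite divr_gt0 ?mulr_gt0.
pose G x := 2 * pi / Num.sqrt D * (Num.sqrt (x ^+ 2 + k))^-1.
have is0 (x : R) : 0 <= (Num.sqrt (x ^+ 2 + k))^-1 by rewrite invr_ge0 sqrtr_ge0.
have cG : 0 <= 2 * pi / Num.sqrt D by rewrite divr_ge0 ?mulr_ge0// ltW.
have F0 (th : R * R) : 0 <= cos (ip th 0) * (1 - l * charf th)^-1.
  by rewrite ip0 cos0 mul1r invr_ge0 ltW// den_gt0.
have mG : measurable_fun setT G.
  by apply: measurable_funM => //; exact: measurable_inv_sqrt.
have := @ev_unif2_ge _ (fun th => cos (ip th 0) * (1 - l * charf th)^-1) G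
  (2 * pi / Num.sqrt D * (2 * ln (r + Num.sqrt (r ^+ 2 + k)) - ln k))
  (bounded_mfun_green P mX0 l01 0) F0 (fun x => mulr_ge0 cG (is0 x)) mG r B.
rewrite r0 rpi => /(_ isT B0 _ _)/wrap[|x xr|hle].
- rewrite /G; under eq_integral do rewrite EFinM.
  rewrite ge0_integralZl//; try by move=> x _; rewrite lee_fin.
    by rewrite integral_inv_sqrt// -EFinM.
  by apply: measurable_funTS; apply/measurable_EFinP; exact: measurable_inv_sqrt.
- pose M := Num.sqrt (1 * D / (2 * c)) * Num.sqrt (x ^+ 2 + k).
  pose N := Num.sqrt (1 * c / 2); pose y0 := moment 0 1 * x / c.
  have M0 : 0 < M by rewrite mulr_gt0// sqrtr_gt0 ?divr_gt0 ?mulr_gt0// ltr_wpDl ?sqr_ge0.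
  have N0 : 0 < N by rewrite sqrtr_gt0 divr_gt0 ?mulr_gt0.
  have q0 (y : R) : 0 < M ^+ 2 + N ^+ 2 * (y + y0) ^+ 2.
    by rewrite ltr_wpDr ?exprn_gt0// mulr_ge0// sqr_ge0.
  have MN : M * N = 1 / 2 * Num.sqrt D * Num.sqrt (x ^+ 2 + k).
    by rewrite /M /N sqrt_coef.
  have hF (y : R) : (M ^+ 2 + N ^+ 2 * (y + y0) ^+ 2)^-1 <=
      cos (ip (x, y) 0) * (1 - l * charf (x, y))^-1.
    rewrite ip0 cos0 mul1r lef_pV2 ?posrE//; last exact: den_gt0.
    rewrite /M /N /y0 -complete_square//.
    have := one_sub_charf_le mX0 varX0 (x, y).
    have : 0 <= delta * (1 - charf (x, y)).
      rewrite mulr_ge0 ?(ltW d0)// subr_ge0.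
      by have := normr_charf P mX0 (x, y); rewrite ler_norml => /andP[].
    by rewrite /l; lra.
  have mq : measurable_fun `[(- pi)%R, pi]
      (fun y : R => ((M ^+ 2 + N ^+ 2 * (y + y0) ^+ 2)^-1)%:E).
    apply: measurable_funTS; apply/measurable_EFinP.
    apply: (bounded_mfunV (c := M ^+ 2) _ _ _).1; first by rewrite exprn_gt0.
      apply: measurable_funD => //; apply: measurable_funM => //.
      by apply: measurable_funX; apply: measurable_funD.
    by move=> y; rewrite lerDl mulr_ge0// sqr_ge0.
  apply: (@le_trans _ _ (\int[lebesgue_measure]_(y in `[(- pi)%R, pi])
     ((M ^+ 2 + N ^+ 2 * (y + y0) ^+ 2)^-1)%:E + B%:E)%E); last first.
    apply: leeD => //; apply: ge0_le_integral => //; first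
    [ by move=> y _; rewrite lee_fin invr_ge0 ltW
    | by apply: measurable_funTS; apply/measurable_EFinP;
      exact: (bounded_mfun_pair2 x (bounded_mfun_green P mX0 l01 0)).1
    | by move=> y _; rewrite lee_fin].
  rewrite integral_inv_quadratic ?ltrNpi// -EFinD lee_fin /G.
  have y01 : `|y0| <= 1.
    rewrite /y0 normrM normfV (gtr0_norm c0) ler_pdivrMr// mul1r normrM.
    have xr' : `|x| <= c / (`|b| + 1).
      by rewrite (@le_trans _ _ r)// ?ler_norml// ge_min lexx orbT.
    apply: (@le_trans _ _ ((`|b| + 1) * (c / (`|b| + 1)))).
      by apply: ler_pM => //; rewrite lerDl.
    by rewrite mulrCA divff ?mulr1// gt_eqF.
  have MNp : 0 < N / M * (pi / 2) by rewrite !mulr_gt0// ?invr_gt0// divr_gt0.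
  have a0 := atan_ge MNp.
  have mono (z z' : R) : z <= z' -> atan (N / M * z) <= atan (N / M * z').
    rewrite le_eqVlt => /predU1P[->//|zz]; apply/ltW/lt_atan.
    by rewrite ltr_pM2l// divr_gt0.
  have a1 : atan (N / M * (pi / 2)) <= atan (N / M * (pi + y0)).
    by apply: mono; move: y01; rewrite ler_norml => /andP[]; lra.
  have a2 : atan (N / M * (- pi + y0)) <= - atan (N / M * (pi / 2)).
    rewrite -atanN -mulrN; apply: mono.
    by move: y01; rewrite ler_norml => /andP[]; lra.
  have -> : 2 * pi / Num.sqrt D * (Num.sqrt (x ^+ 2 + k))^-1 = pi / (M * N).
    by rewrite MN; field; rewrite !gt_eqF// sqrtr_gt0 ltr_wpDl ?sqr_ge0.
  have -> : B = 2 * (N / M * (pi / 2))^-1 / (M * N).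
    have -> : 2 * (N / M * (pi / 2))^-1 / (M * N) = 4 / (pi * N ^+ 2).
      by move: (pi : R) pi0 => p p0; field; rewrite !gt_eqF.
    rewrite /N sqr_sqrtr; last by rewrite divr_ge0 ?mulr_ge0// ltW.
    by rewrite /B; move: (pi : R) pi0 => p p0; field; rewrite !gt_eqF.
  rewrite -mulrDl ler_pM2r; last by rewrite invr_gt0; exact: mulr_gt0.
  move: (atan (N / M * (pi + y0))) (atan (N / M * (- pi + y0)))
    (atan (N / M * (pi / 2))) ((N / M * (pi / 2))^-1) a0 a1 a2 => u1 u2 u3 u4.
  by move: (pi : R) => p; lra.
have -> : green l 0 = ev (unif2 R) (fun th => cos (ip th 0) * (1 - l * charf th)^-1) by [].
apply: le_trans hle.
have lnk : - ln k = ln delta^-1 - ln (2 * c / D).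
  have -> : k = delta * (2 * c / D) by rewrite /k mul1r; ring.
  have -> : ln delta^-1 = - ln delta :> R by rewrite lnV ?posrE.
  rewrite [ln (delta * _)]lnM ?posrE//; first by ring.
  by rewrite divr_gt0 ?mulr_gt0.
have lnp : ln r <= ln (r + Num.sqrt (r ^+ 2 + k)).
  have p1 (z : R) : 0 < r + Num.sqrt z by rewrite ltr_pwDl// sqrtr_ge0.
  by rewrite ler_ln ?posrE ?p1// lerDl sqrtr_ge0.
have -> : (2 * pi / Num.sqrt D * (2 * ln (r + Num.sqrt (r ^+ 2 + k)) - ln k) - 2 * r * B) /
   (pi *+ 2) ^+ 2 =
   gconst * (2 * ln (r + Num.sqrt (r ^+ 2 + k)) - ln k) - 2 * r * B / (pi *+ 2) ^+ 2.
  rewrite /gconst; move: (pi : R) pi0 => p p0; rewrite mulr2n.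
  by field; rewrite !gt_eqF.
rewrite opprD addrA lerD2r -mulrBr ler_pM2l ?gconst_gt0//.
lra.
Qed.

Lemma green0_asymptotic (e : R) : 0 < e -> exists2 d0 : R, 0 < d0 &
  forall delta, 0 < delta < d0 ->
  (gconst - e) * ln delta^-1 <= green (1 - delta) 0 <= (gconst + e) * ln delta^-1.
Proof.
move=> e0; have h0 := gconst_gt0.
pose s := gconst / (gconst + e / 2).
have gs : gconst / s = gconst + e / 2.
  by rewrite /s; field; rewrite !gt_eqF//; lra.
have s01 : 0 < s < 1.
  by rewrite divr_gt0 ?ltr_pdivrMr ?mul1r//=; lra.
have [K [d0 d00 hK]] := green0_upper s01.
have [K' [d0' d00' hK']] := green0_lower.
pose L0 := 2 * (`|K| + `|K'|) / e.
exists (Num.min (Num.min d0 d0') (expR (- L0))).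
  by rewrite !lt_min d00 d00' expR_gt0.
move=> delta /andP[dl0]; rewrite !lt_min => /andP[/andP[h1 h2] h3].
have L : L0 <= ln delta^-1.
  rewrite lnV ?posrE// lerNr -(expRK (- L0)) ler_ln ?posrE ?expR_gt0//; exact: ltW.
have := hK delta; have := hK' delta; rewrite dl0 h1 h2 gs => /(_ isT) hl /(_ isT) hu.
have : `|K| + `|K'| <= e / 2 * ln delta^-1.
  apply: le_trans (ler_wpM2l _ L); last by rewrite divr_ge0// ltW.
  by rewrite /L0 le_eqVlt; apply/orP; left; apply/eqP; field; rewrite gt_eqF.
have := ler_norm K; have := ler_norm K'; have := normr_ge0 K; have := normr_ge0 K'.
have e2 : e / 2 * ln delta^-1 <= e * ln delta^-1.
  rewrite ler_wpM2r//; last lra.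
  apply: le_trans L; rewrite divr_ge0 ?mulr_ge0 ?addr_ge0// ltW//.
by move=> *; apply/andP; split; lra.
Qed.

Lemma gconstE : gconst = thick_const (covariance_mx P X0) / 4.
Proof.
rewrite /thick_const det_covariance /gconst; move: (pi : R) (pi_gt0 R) => p p0.
by field; rewrite !gt_eqF// sqrtr_gt0.
Qed.

End green_asymptotics.

(** * Exponential tails from potentials; visits of the killed walk *)

Section additive_tails.
Context d (T : measurableType d) (R : realType) (P : probability T R).
Context (X : nat -> T -> Z2) (X_iid : iid P X) (symX : symmetric_law P (X 0%N)).
Local Notation mX := (iid_measurable X_iid 0%N).
Local Notation green := (green P (X 0%N)).
Local Notation step_op := (step_op P (X 0%N)).
Local Notation shift := (fun x y : Z2 => x + y).

Variable l : R.
Hypothesis l01 : 0 < l < 1.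

(** The entries of [cz] are charges with their sites. Charges may be negative, as in [pair_tail];
    the constant 1 keeps the function positive when they are controlled. *)
Definition potential (cz : seq (R * Z2)) (y : Z2) : R :=
  1 + \sum_(c <- cz) c.1 * green l (y - c.2).

Definition charge_at (cz : seq (R * Z2)) (y : Z2) : R :=
  \sum_(c <- cz) c.1 * (y == c.2)%:R.

Lemma potential_bounded cz : exists M : R, forall y, `|potential cz y| <= M.
Proof.
exists (1 + \sum_(c <- cz) `|c.1| * green l 0) => y.
rewrite (le_trans (ler_normD _ _))// normr1 lerD2l.
apply: (le_trans (ler_norm_sum _ _ _)); apply: ler_sum => c _.
by rewrite normrM ler_wpM2l//; exact: (green_norm_le P mX l01).
Qed.

Lemma step_potential cz y :
  l * step_op (potential cz) y = potential cz y - charge_at cz y - (1 - l).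
Proof.
have bg z : bounded_mfun (fun w => green l (y + X 0%N w - z)).
  apply: (bounded_mfun_step mX (f := fun y => green l (y - z)) (M := green l 0)) => y'.
  exact: (green_norm_le P mX l01).
have hz z : l * ev P (fun w => green l (y + X 0%N w - z)) = green l (y - z) - (y == z)%:R.
  rewrite (green_eq mX symX l01 (y - z)) subr_eq0 addrAC subrr add0r; congr (_ * ev _ _).
  by apply/funext => w; rewrite addrAC.
rewrite /step_op /potential (evD _ (bounded_mfun_cst 1)); last first.
  by apply: bounded_mfun_sum => c; exact: bounded_mfunZ.
rewrite ev_cst ev_sum => [|c]; last exact: bounded_mfunZ.
rewrite mulrDr mulr1 mulr_sumr /charge_at.
under eq_bigr => c _ do rewrite (evZ _ _ (bg c.2)) mulrCA hz mulrBr.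
by rewrite sumrB; ring.
Qed.

(* If v * phi <= f for phi = 1 + green f, then l * exp(v) * step phi
   <= exp(v) * (phi - f) <= exp(v) * (1 - v) * phi <= phi. *)
Lemma additive_tail (cz : seq (R * Z2)) (v : Z2 -> R) (phi0 th : R) k x
    (B : set (seq Z2)) :
  0 < phi0 -> (forall y, phi0 <= potential cz y) ->
  (forall y, v y * potential cz y <= charge_at cz y) ->
  (forall s, size s = k -> B s -> th <= occ shift v x s) ->
  (EE P X k (fun s => (\1_B s)%:E) <=
   (potential cz x / (expR th * phi0 * l ^+ k))%:E)%E.
Proof.
move=> p0 hp hv hB; have /andP[l0 l1] := l01.
have [M hM] := potential_bounded cz.
have pg y : 0 < potential cz y by exact: lt_le_trans (hp y).
apply: (EE_exp_prob X_iid (st := shift) (v := v)) => //.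
- by rewrite mulr_gt0// expR_gt0.
- by move=> y; exact: ltW.
- move=> y; rewrite -EFin_ev; last exact: (bounded_mfun_step mX hM).
  rewrite -EFinM lee_fin mulrAC -[ev _ _]/(step_op _ _) step_potential.
  have h1 := hv y; have h2 : 1 - v y <= expR (- v y).
    by have := expR_ge1Dx (- v y).
  have h3 : potential cz y - charge_at cz y - (1 - l) <= expR (- v y) * potential cz y.
    have := ler_wpM2r (ltW (pg y)) h2; lra.
  have := ler_wpM2r (expR_ge0 (v y)) h3.
  by rewrite mulrAC -expRD addNr expR0 mul1r.
- by move=> s sk Bs; apply: ler_pM; rewrite ?expR_ge0 ?(ltW p0) ?ler_expR ?hp ?hB.
Qed.

Definition visits (z x : Z2) (s : seq Z2) : R :=
  occ shift (fun y => (y == z)%:R) x s.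

Let q0 := green l 0.
Let q01 : 1 <= q0. Proof. exact: (green0_ge1 mX symX l01). Qed.

(* The probability that the walk killed at rate 1 - l visits z at least t times. *)
Definition killed_visits (z : Z2) (t : nat) (x : Z2) : R :=
  if t is t'.+1 then green l (x - z) / q0 * (1 - q0^-1) ^+ t' else 1.

Let ratio01 : 0 <= 1 - q0^-1 <= 1.
Proof.
have q0p : 0 < q0 by exact: lt_le_trans q01.
rewrite subr_ge0 invf_le1// q01 /= gerBl invr_ge0 ltW//.
Qed.

Lemma killed_visits01 z t x : 0 <= killed_visits z t x <= 1.
Proof.
have q0p : 0 < q0 by exact: lt_le_trans q01.
case: t => [|t] /=; first by rewrite ler01 lexx.
have /andP[r0 r1] := ratio01.
have g0 : 0 <= green l (x - z) by exact: (green_ge0 mX symX l01).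
have g1 : green l (x - z) / q0 <= 1.
  rewrite ler_pdivrMr// mul1r; apply: le_trans (ler_norm _) _.
  exact: (green_norm_le P mX l01).
rewrite mulr_ge0 ?exprn_ge0 ?divr_ge0 ?(ltW q0p)//= mulr_ile1 ?exprn_ge0 ?divr_ge0 ?(ltW q0p)//.
by rewrite exprn_ile1.
Qed.

(** First-step analysis: when the walk stands on z, the present time is one more visit. *)
Lemma step_killed_visits z t x : l * step_op (killed_visits z t.+1) x =
  killed_visits z (if x == z then t.+2 else t.+1) x.
Proof.
have q0p : 0 < q0 by exact: lt_le_trans q01.
have bg : bounded_mfun (fun w => green l (x + X 0%N w - z)).
  apply: (bounded_mfun_step mX (f := fun y => green l (y - z)) (M := q0)) => y'.
  exact: (green_norm_le P mX l01).
have hz : l * ev P (fun w => green l (x + X 0%N w - z)) = green l (x - z) - (x == z)%:R.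
  rewrite (green_eq mX symX l01 (x - z)) subr_eq0 addrAC subrr add0r; congr (_ * ev _ _).
  by apply/funext => w; rewrite addrAC.
rewrite /step_op /=.
rewrite (_ : (fun w => _) = (fun w => ((1 - q0^-1) ^+ t / q0) * green l (x + X 0%N w - z))); last first.
  by apply/funext => w; rewrite mulrC mulrA mulrAC.
rewrite (evZ _ _ bg) mulrCA hz.
have [->|xz] := eqVneq x z; last by rewrite subr0 /killed_visits; ring.
by rewrite /killed_visits subrr -/q0 exprS /=; field; rewrite gt_eqF.
Qed.

(** A killed walk that visits z at least t times does so within its first k steps, unless it
    survives k steps, which has probability l^k. *)
Lemma visits_ge_prob z t k x :
  ((killed_visits z t x - l ^+ k)%:E <=
   EE P X k (fun s => (\1_[set s | t%:R <= visits z x s] s)%:E))%E.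
Proof.
have /andP[l0 l1] := l01.
have i0 t' x' k' : (0%:E <= EE P X k'
    (fun s => (\1_[set s | t'%:R <= visits z x' s] s)%:E))%E.
  by apply: EE_ge0 => s; rewrite lee_fin.
have vis0 x' s : 0 <= visits z x' s by exact: occ_ge0.
have t0 k' x' : EE P X k' (fun s => (\1_[set s | 0%:R <= visits z x' s] s)%:E) = 1%:E.
  rewrite -(EE_cst X_iid k' ler01); apply: eq_EE => s _; rewrite indicE mem_set//; exact: vis0.
elim: k t x => [|k IH] t x.
  apply: (le_trans _ (i0 t x 0%N)).
  by rewrite lee_fin expr0 subr_le0; have /andP[] := killed_visits01 z t x.
case: t => [|t].
  by rewrite t0 lee_fin /= gerBl exprn_ge0// ltW.
pose t' := if x == z then t else t.+1.
have -> : EE P X k.+1 (fun s => (\1_[set s | t.+1%:R <= visits z x s] s)%:E) =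
   (\int[P]_w EE P X k (fun s => (\1_[set s | t'%:R <= visits z (x + X 0%N w) s] s)%:E))%E.
  rewrite /=; apply: eq_integral => w _; apply: eq_EE => s _.
  rewrite !indicE; congr (_%:R%:E); congr nat_of_bool.
  have e : (t.+1%:R <= visits z x (X 0%N w :: s)) = (t'%:R <= visits z (x + X 0%N w) s).
    rewrite /visits /t' /=; case: ifP => _; last by rewrite add0r.
    by rewrite -natr1 addrC lerD2l.
  by apply/idP/idP => /set_mem /= h; apply/mem_set; rewrite /= ?e// -e.
have [[xz t0']|[u tu]] : (x == z) /\ t = 0%N \/ exists u, t' = u.+1.
  rewrite /t'; case: ifP => _; last by right; exists t.
  by case: (t) => [|u]; [left|right; exists u].
  rewrite /t' xz t0'; under eq_integral do rewrite t0.
  rewrite integral_cst// (_ : (_ * _)%E = 1%:E); last first.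
    by rewrite -[RHS]mule1; congr (_ * _)%E; exact: probability_setT.
  rewrite lee_fin; have /andP[_ h] := killed_visits01 z 1 x.
  by rewrite (le_trans _ h)// gerBl exprn_ge0// ltW.
pose h w := Num.max (killed_visits z t' (x + X 0%N w) - l ^+ k) 0.
have lk : 0 <= l ^+ k <= 1 by rewrite exprn_ge0 ?exprn_ile1 ?ltW.
have bk : bounded_mfun (fun w => killed_visits z t' (x + X 0%N w)).
  apply: (bounded_mfun_step mX (M := 1)) => y.
  by have /andP[a0 a1] := killed_visits01 z t' y; rewrite ger0_norm.
have bh : bounded_mfun h.
  apply: (bounded_mfun_step mX (f := fun y => Num.max (killed_visits z t' y - l ^+ k) 0) (M := 1)) => y.
  have /andP[a0 a1] := killed_visits01 z t' y; rewrite ger0_norm ?le_max ?lexx ?orbT//.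
  by rewrite ge_max ler01 andbT; lra.
apply: (@le_trans _ _ (ev P h)%:E); last first.
  rewrite EFin_ev//; apply: ge0_le_integral => //.
  - by move=> w _; rewrite lee_fin le_max lexx orbT.
  - by apply/measurable_EFinP; exact: bh.1.
  - exact: (@discrete_measurable_fun _ _ _ _ _ _ (fun y => EE P X k
      (fun s => (\1_[set s | t'%:R <= visits z (x + y) s] s)%:E)) _ mX).
  - move=> w _; rewrite /h; case: (leP 0 (killed_visits z t' (x + X 0%N w) - l ^+ k)) => _; [exact: IH|exact: i0].
rewrite lee_fin.
have h1 : step_op (killed_visits z t') x - l ^+ k <= ev P h.
  rewrite -[X in _ - X](ev_cst P) -(evB _ bk (bounded_mfun_cst _)); apply: ev_le => //.
    exact: (bounded_mfunB bk (bounded_mfun_cst _)).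
  by move=> w; rewrite le_max lexx.
have h2 : 0 <= ev P h by apply: ev_ge0 => w; rewrite le_max lexx orbT.
have -> : killed_visits z t.+1 x = l * step_op (killed_visits z t') x.
  by rewrite tu step_killed_visits -tu /t'; move: tu; rewrite /t'; case: ifP => _ ->.
rewrite exprS -mulrBr; have [h3|/ltW h3] := leP 0 (step_op (killed_visits z t') x - l ^+ k).
  by apply: le_trans h1; rewrite ler_piMl// ltW.
by apply: le_trans h2; rewrite pmulr_rle0.
Qed.

End additive_tails.

#[global] Opaque green gconst.

(** * The Green function at polynomial scales *)

Section near_infinity.
Context (R : realType).

Lemma ln_near (A : R) : \forall m \near \oo, A <= ln (m%:R : R).
Proof.
near=> m; have m0 : expR A <= m%:R by near: m; exact: nbhs_infty_ger.
by rewrite -[leLHS]expRK ler_ln ?posrE ?expR_gt0// (lt_le_trans (expR_gt0 A)).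
Unshelve. all: by end_near. Qed.

Lemma powRN_near (e c : R) : 0 < e -> 0 < c ->
  \forall m \near \oo, (m%:R : R) `^ (- e) <= c.
Proof.
move=> e0 c0; near=> m.
have m1 : (0 < m)%N by near: m; exact: nbhs_infty_gt.
have h : - ln c / e <= ln (m%:R : R) by near: m; exact: ln_near.
rewrite /powR pnatr_eq0 gtn_eqF// -[leRHS]lnK ?posrE// ler_expR.
by move: h; rewrite ler_pdivrMr//; lra.
Unshelve. all: by end_near. Qed.

Lemma natr_powRD (m : nat) (a b : R) : (0 < m)%N ->
  (m%:R : R) `^ (a + b) = m%:R `^ a * m%:R `^ b.
Proof. by move=> m0; rewrite powRD// pnatr_eq0 -lt0n m0 implybT. Qed.

Lemma natr_powR_gt0 (m : nat) (a : R) : (0 < m)%N -> 0 < (m%:R : R) `^ a.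
Proof. by move=> m0; rewrite powR_gt0// ltr0n. Qed.

End near_infinity.

Section green_at_scale.
Context d (T : measurableType d) (R : realType) (P : probability T R).
Context (X0 : T -> Z2) (mX0 : discrete_rv X0) (symX0 : symmetric_law P X0).
Context (varX0 : finite_variance P X0).
Context (C : R) (C0 : 0 < C)
  (hC : forall th x, 1 - cos (ip th x) <= C * sqn R x * (1 - charf P X0 th)).

(** A lifetime of order m^al, hence a spatial scale of order m^(al / 2). *)
Definition kill (al : R) (m : nat) : R := 1 - m%:R `^ (- al).
Definition gq (al : R) (m : nat) : Z2 -> R := green P X0 (kill al m).
(** The unit of the Green function at scale m: [gq al m 0] is al [U m] to leading order
    ([gq0_near]). *)
Definition U (m : nat) : R := gconst P X0 * ln m%:R.

Let gc0 : 0 < gconst P X0. Proof. exact: (gconst_gt0 mX0 varX0 C0 hC). Qed.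

Lemma one_sub_kill al m : 1 - kill al m = m%:R `^ (- al).
Proof. by rewrite /kill opprB addrC subrK. Qed.

Lemma kill_near (al : R) : 0 < al ->
  \forall m \near \oo, 2^-1 <= kill al m /\ 0 < kill al m < 1.
Proof.
move=> al0; near=> m.
have h : (m%:R : R) `^ (- al) <= 2^-1 by near: m; apply: powRN_near.
have m0 : (0 < m)%N by near: m; exact: nbhs_infty_gt.
have := natr_powR_gt0 (- al) m0; rewrite /kill => p0.
by split; [lra|apply/andP; split; lra].
Unshelve. all: by end_near. Qed.

Lemma U_near (A : R) : \forall m \near \oo, A <= U m.
Proof.
near=> m; have h : A / gconst P X0 <= ln (m%:R : R) by near: m; exact: ln_near.
by rewrite /U mulrC -ler_pdivrMr.
Unshelve. all: by end_near. Qed.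

Lemma gq0_near (al e : R) : 0 < al -> 0 < e -> \forall m \near \oo,
  (al - e) * U m <= gq al m 0 <= (al + e) * U m.
Proof.
move=> al0 e0; have e1 : 0 < e * gconst P X0 / al by rewrite divr_gt0// mulr_gt0.
have [d0 d00 h] := green0_asymptotic mX0 varX0 C0 hC e1.
near=> m.
have m0 : (0 < m)%N by near: m; exact: nbhs_infty_gt.
have hd : (m%:R : R) `^ (- al) <= d0 / 2 by near: m; apply: powRN_near; rewrite // divr_gt0.
have := h (m%:R `^ (- al)); rewrite natr_powR_gt0//= => /(_ _)/wrap[|]; first lra.
rewrite -/(kill al m) -/(gq al m) -powRN opprK ln_powR.
have -> : (gconst P X0 - e * gconst P X0 / al) * (al * ln m%:R) = (al - e) * U m.
  by rewrite /U; field; rewrite gt_eqF.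
have -> : (gconst P X0 + e * gconst P X0 / al) * (al * ln m%:R) = (al + e) * U m.
  by rewrite /U; field; rewrite gt_eqF.
by [].
Unshelve. all: by end_near. Qed.

Definition gd (al b : R) (m : nat) : Z2 -> R := gdiff P X0 (kill al m) (kill b m).

(** The ratio of the two survival probabilities tends to 1, so that [gd] is nearly [gq al - gq b]:
    the visits between the times m^b and m^al. The last two bounds let it replace [gq al] up to the
    short-range part [gq b]. *)
Lemma gd_near (al b e : R) : 0 < b < al -> 0 < e -> \forall m \near \oo,
  [/\ (al - b - e) * U m <= gd al b m 0,
   forall w, gd al b m w <= (al - b + e) * U m,
   forall w, gd al b m w <= gq al m w &
   forall w, gq al m w <= gd al b m w + gq b m w].
Proof.
move=> /andP[b0 ba] e0; have al0 : 0 < al by lra.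
have e3 : 0 < e / 3 by rewrite divr_gt0.
have aux1 (x y p u r : R) : (1 - p) * y <= r * y -> p * y <= e / 3 * u ->
    x <= (al + e / 3) * u -> (b - e / 3) * u <= y -> x - r * y <= (al - b + e) * u.
  by lra.
have aux2 (x y u r : R) : r * y <= y -> 0 <= e / 3 * u -> (al - e / 3) * u <= x ->
    y <= (b + e / 3) * u -> (al - b - e) * u <= x - r * y.
  by lra.
near=> m.
have /andP[a1 a2] : (al - e / 3) * U m <= gq al m 0 <= (al + e / 3) * U m.
  by near: m; apply: gq0_near.
have /andP[b1 b2] : (b - e / 3) * U m <= gq b m 0 <= (b + e / 3) * U m.
  by near: m; apply: gq0_near.
have [k1 k2] : 2^-1 <= kill al m /\ 0 < kill al m < 1 by near: m; apply: kill_near.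
have [k1' k2'] : 2^-1 <= kill b m /\ 0 < kill b m < 1 by near: m; apply: kill_near.
have m0 : (0 < m)%N by near: m; exact: nbhs_infty_gt.
have rb : (m%:R : R) `^ (- b) <= e / 3 / (b + e / 3).
  by near: m; apply: powRN_near => //; rewrite divr_gt0//; lra.
have U0 : 1 <= U m by near: m; exact: U_near.
have kk : kill b m <= kill al m.
  by rewrite lerD2l lerN2 ler_powR ?lerN2 ?ler1n// ltW.
have r1 : kill b m / kill al m <= 1 by rewrite ler_pdivrMr ?mul1r//; case/andP: k2.
have /andP[ka0 ka1] := k2; have /andP[kb0 kb1] := k2'.
have r2 : kill b m <= kill b m / kill al m.
  by rewrite ler_pdivlMr// ler_piMr// ltW.
have gb0 : 0 <= gq b m 0 by exact: (green_ge0 mX0 symX0 k2').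
have r0 : 0 <= kill b m / kill al m by apply: le_trans r2; case/andP: k2' => /ltW.
have w0 : gd al b m 0 <= (al - b + e) * U m.
  rewrite /gd /gdiff -/(gq al m) -/(gq b m).
  have h1 : kill b m * gq b m 0 <= kill b m / kill al m * gq b m 0 by rewrite ler_wpM2r.
  have h2 : (m%:R `^ (- b)) * gq b m 0 <= e / 3 * U m.
    apply: (@le_trans _ _ (e / 3 / (b + e / 3) * ((b + e / 3) * U m))).
      by apply: ler_pM => //; exact: powR_ge0.
    by rewrite mulrA divfK// gt_eqF// addr_gt0.
  exact: aux1 h1 h2 a2 b1.
split.
- rewrite /gd /gdiff -/(gq al m) -/(gq b m).
  have h1 : kill b m / kill al m * gq b m 0 <= gq b m 0 by rewrite ler_piMl.
  have h2 : 0 <= e / 3 * U m by rewrite mulr_ge0 ?(ltW e3)// (le_trans ler01).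
  exact: aux2 h1 h2 a1 b2.
- by move=> w; apply: le_trans w0; exact: (gdiff_le0 P mX0 k2 k2' kk).
- by move=> w; exact: (gdiff_le mX0 symX0 k2 k2').
- move=> w; rewrite /gd /gdiff -/(gq al m) -/(gq b m).
  have gw0 : 0 <= gq b m w by exact: (green_ge0 mX0 symX0 k2').
  have h1 : kill b m / kill al m * gq b m w <= gq b m w by rewrite ler_piMl.
  by rewrite -addrA lerDl addrC subr_ge0.
Unshelve. all: by end_near. Qed.

(** Split [gq al] into [gd al b'] and [gq b'] with b' slightly below b. The first is at most about
    (al - b') [U m]; the second has range m^(b' / 2) and is negligible at squared distance m^b by
    [green_decay]. *)
Lemma gq_far_near (al b e kap : R) : 0 < b < al -> 0 < e -> 0 < kap ->
  \forall m \near \oo, forall z, kap * m%:R `^ b <= sqn R z ->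
  gq al m z <= (al - b + e) * U m.
Proof.
move=> /andP[b0 ba] e0 kap0.
pose e' := Num.min (e / 4) (b / 2); have e'0 : 0 < e' by rewrite lt_min !divr_gt0.
have e'e : e' <= e / 4 by rewrite ge_min lexx.
have e'b : e' <= b / 2 by rewrite ge_min lexx orbT.
pose b' := b - e'; have b'0 : 0 < b' < al by apply/andP; split; rewrite /b'; lra.
have e4 : 0 < e / 4 by rewrite divr_gt0.
pose s2 := sigma2 P X0.
have s20 : 0 <= s2 by exact: sigma2_ge0.
have auxf (x u : R) : 0 < x ->
    x * u * (s2 + 1) * (e / 4 * kap / (x * (s2 + 1))) = kap * (e / 4 * u).
  by move=> x0; field; rewrite !gt_eqF// ltr_wpDl.
have aux3 : e' + e / 4 + e / 4 <= e by lra.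
have aux4 (x y t u : R) : x <= (al - b' + e / 4) * u -> y <= x + t -> t <= e / 4 * u ->
    (e' + e / 4 + e / 4) * u <= e * u -> y <= (al - b + e) * u.
  by rewrite /b'; lra.
near=> m => z hz.
have [_ g1 _ g2] : [/\ (al - b' - e / 4) * U m <= gd al b' m 0,
   forall w, gd al b' m w <= (al - b' + e / 4) * U m,
   forall w, gd al b' m w <= gq al m w &
   forall w, gq al m w <= gd al b' m w + gq b' m w] by near: m; apply: gd_near.
have /andP[_ hb] : (b' - e / 4) * U m <= gq b' m 0 <= (b' + e / 4) * U m.
  by near: m; apply: gq0_near; case/andP: b'0.
have [k1 k2] : 2^-1 <= kill b' m /\ 0 < kill b' m < 1.
  by near: m; apply: kill_near; case/andP: b'0.
have m0 : (0 < m)%N by near: m; exact: nbhs_infty_gt.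
have U0 : 1 <= U m by near: m; exact: U_near.
have hs : (m%:R : R) `^ (- e') <= e / 4 * kap / ((b' + e / 4) * (s2 + 1)).
  have /andP[b'p _] := b'0.
  by near: m; apply: powRN_near => //; rewrite divr_gt0// ?mulr_gt0//; lra.
have z0 : z != 0.
  apply: contraTneq hz => ->; rewrite /sqn !mxE /= expr0n /= addr0 -ltNge.
  by rewrite mulr_gt0// natr_powR_gt0.
have gz0 : 0 <= gq b' m z by exact: (green_ge0 mX0 symX0 k2).
have dec := green_decay mX0 symX0 k2 (mean_sq_fin mX0 varX0) z0.
have far : gq b' m z <= e / 4 * U m.
  have mb : m%:R `^ b = m%:R `^ b' * m%:R `^ e' :> R.
    by rewrite -natr_powRD//; congr (_ `^ _); rewrite /b'; lra.
  have h1 : gq b' m z * (kap * m%:R `^ b) * m%:R `^ (- b') <= (b' + e / 4) * U m * s2.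
    apply: le_trans (ler_wpM2r s20 hb).
    apply: le_trans dec; rewrite one_sub_kill -/(gq b' m z).
    by rewrite ler_wpM2r ?powR_ge0// ler_wpM2l.
  have pb : m%:R `^ b' * m%:R `^ (- b') = 1 :> R by rewrite -natr_powRD// subrr powRr0.
  have pe : m%:R `^ e' * m%:R `^ (- e') = 1 :> R by rewrite -natr_powRD// subrr powRr0.
  have h2 : gq b' m z * kap * m%:R `^ e' <= (b' + e / 4) * U m * s2.
    apply: le_trans h1; rewrite mb le_eqVlt; apply/orP; left; apply/eqP; symmetry.
    rewrite (_ : _ * _ * _ = gq b' m z * kap * m%:R `^ e' * (m%:R `^ b' * m%:R `^ (- b'))); last by ring.
    by rewrite pb mulr1.
  have h3 : gq b' m z * kap <= (b' + e / 4) * U m * s2 * m%:R `^ (- e').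
    have := ler_wpM2r (powR_ge0 (m%:R : R) (- e')) h2.
    by rewrite -[gq b' m z * kap * _ * _]mulrA pe mulr1.
  have /andP[b'p _] := b'0; have be : 0 < b' + e / 4 by rewrite addr_gt0.
  have h4 : (b' + e / 4) * U m * s2 * m%:R `^ (- e') <= kap * (e / 4 * U m).
    apply: (@le_trans _ _ ((b' + e / 4) * U m * (s2 + 1) * (e / 4 * kap / ((b' + e / 4) * (s2 + 1))))).
      have bU : 0 <= (b' + e / 4) * U m.
        by rewrite mulr_ge0 ?(ltW be)// (le_trans ler01).
      by apply: ler_pM; [exact: mulr_ge0|exact: powR_ge0|rewrite ler_wpM2l// lerDl|exact: hs].
    by rewrite auxf.
  by rewrite -(ler_pM2l kap0) mulrC; exact: le_trans h4.
apply: (aux4 _ _ _ _ (g1 z) (g2 z) far).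
by rewrite ler_wpM2r ?(le_trans ler01)//; exact: aux3.
Unshelve. all: by end_near. Qed.

(** Displacements of squared length m^b are invisible to [gd al b'] when b' > b: in
    [gdiff_lipschitz] the product (1 - l') |h|^2 is of order m^(b - b'). *)
Lemma gq_lipschitz_near (al b b' e K : R) : 0 < b < b' -> b' < al -> 0 < e -> 0 < K ->
  \forall m \near \oo, forall w h, sqn R h <= K * m%:R `^ b ->
  gd al b' m (w + h) <= gq al m w + e * U m.
Proof.
move=> /andP[b0 bb'] b'a e0 K0.
have al0 : 0 < al by lra.
have b'0 : 0 < b' by lra.
pose eta := e / 2 / (al + 1); have eta0 : 0 < eta by rewrite !divr_gt0//; lra.
have CK : 0 < 2 * C * K * (b' + 1) by rewrite mulr_gt0 ?mulr_gt0//; lra.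
have small0 : 0 < e / 2 * eta / (2 * C * K * (b' + 1)).
  by apply: divr_gt0 => //; apply: mulr_gt0 => //; lra.
have bb0 : 0 < b' - b by rewrite subr_gt0.
near=> m => w h hh.
have [k1 k2] : 2^-1 <= kill al m /\ 0 < kill al m < 1 by near: m; apply: kill_near.
have [k1' k2'] : 2^-1 <= kill b' m /\ 0 < kill b' m < 1 by near: m; apply: kill_near.
have m0 : (0 < m)%N by near: m; exact: nbhs_infty_gt.
have U0 : 1 <= U m by near: m; exact: U_near.
have /andP[_ ha] : (al - 1) * U m <= gq al m 0 <= (al + 1) * U m.
  by near: m; apply: gq0_near.
have /andP[_ hb] : (b' - 1) * U m <= gq b' m 0 <= (b' + 1) * U m.
  by near: m; apply: gq0_near.
have kk : kill b' m <= kill al m.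
  by rewrite lerD2l lerN2 ler_powR ?lerN2 ?ler1n// ltW.
have small : (m%:R : R) `^ (- (b' - b)) <= e / 2 * eta / (2 * C * K * (b' + 1)).
  by near: m; apply: powRN_near.
have := gdiff_lipschitz mX0 symX0 k2 k2' kk w h eta0 k1 (ltW C0) hC.
rewrite -/(gd al b' m) -/(gq al m) -/(gq b' m) => /le_trans; apply.
rewrite -addrA; apply: lerD; first exact: (gdiff_le mX0 symX0 k2 k2').
have -> : e * U m = eta * ((al + 1) * U m) + e / 2 * U m.
  by rewrite /eta; field; rewrite gt_eqF// addr_gt0.
apply: lerD; first by rewrite ler_pM2l.
rewrite one_sub_kill.
rewrite ler_pdivrMr//.
have pb : m%:R `^ (- (b' - b)) = m%:R `^ (- b') * m%:R `^ b :> R.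
  by rewrite -natr_powRD//; congr (_ `^ _); rewrite opprB addrC.
have p0 : 0 <= (m%:R : R) `^ (- b') by exact: powR_ge0.
apply: (@le_trans _ _ (2 * C * K * (b' + 1) * m%:R `^ (- (b' - b)) * U m)).
  rewrite pb; have h1 : sqn R h * gq b' m 0 <= K * m%:R `^ b * ((b' + 1) * U m).
    apply: ler_pM => //; first exact: sqn_ge0.
    exact: (green_ge0 mX0 symX0 k2').
  by have := ler_wpM2l (mulr_ge0 (mulr_ge0 (ler0n R 2) p0) (ltW C0)) h1; lra.
apply: (@le_trans _ _ (2 * C * K * (b' + 1) * (e / 2 * eta / (2 * C * K * (b' + 1))) * U m)).
  apply: ler_wpM2r; first exact: le_trans ler01 _.
  by apply: ler_wpM2l => //; exact: ltW.
rewrite le_eqVlt; apply/orP; left; apply/eqP; field.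
by rewrite !gt_eqF// addr_gt0.
Unshelve. all: by end_near. Qed.

(** Moving from z back to the origin changes [gd al (b + e')] by little, and its value there is
    about (al - b - e') [U m]. *)
Lemma gq_near_near (al b e K : R) : 0 < b < al -> 0 < e -> 0 < K ->
  \forall m \near \oo, forall z, sqn R z <= K * m%:R `^ b ->
  (al - b - e) * U m <= gq al m z.
Proof.
move=> /andP[b0 ba] e0 K0.
pose e' := Num.min (e / 4) ((al - b) / 2).
have e'0 : 0 < e' by rewrite lt_min !divr_gt0// subr_gt0.
have e'e : e' <= e / 4 by rewrite ge_min lexx.
have e'b : e' <= (al - b) / 2 by rewrite ge_min lexx orbT.
have e4 : 0 < e / 4 by rewrite divr_gt0.
have aux3 : e' + e / 4 + e / 4 <= e by lra.
have aux4 (x y u : R) : (al - (b + e') - e / 4) * u <= x -> (e' + e / 4 + e / 4) * u <= e * u ->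
    x <= y + e / 4 * u -> (al - b - e) * u <= y.
  by lra.
near=> m => z hz.
have lip : forall w h, sqn R h <= K * m%:R `^ b ->
    gd al (b + e') m (w + h) <= gq al m w + e / 4 * U m.
  by near: m; apply: gq_lipschitz_near => //; try (apply/andP; split); lra.
have [g1 _ _ _] : [/\ (al - (b + e') - e / 4) * U m <= gd al (b + e') m 0,
   forall w, gd al (b + e') m w <= (al - (b + e') + e / 4) * U m,
   forall w, gd al (b + e') m w <= gq al m w &
   forall w, gq al m w <= gd al (b + e') m w + gq (b + e') m w].
  by near: m; apply: gd_near => //; apply/andP; split; lra.
have U0 : 1 <= U m by near: m; exact: U_near.
have := lip z (- z); rewrite sqnN subrr => /(_ hz); apply: aux4 g1 _.
by rewrite ler_wpM2r ?(le_trans ler01)//; exact: aux3.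
Unshelve. all: by end_near. Qed.

(** The same bound as at distance m^(b / 2), for the average over any set of at least order m^b
    sites, even around one of them: the short-range part has total mass m^b' by [green_sum_le],
    negligible after division by the number of sites. *)
Lemma gq_sum_near (al b e kap : R) : 0 < b < al -> 0 < e -> 0 < kap ->
  \forall m \near \oo, forall (D : seq Z2) w, uniq D -> kap * m%:R `^ b <= (size D)%:R ->
  \sum_(z <- D) gq al m (w - z) <= (al - b + e) * U m * (size D)%:R.
Proof.
move=> /andP[b0 ba] e0 kap0.
pose e' := Num.min (e / 4) (b / 2); have e'0 : 0 < e' by rewrite lt_min !divr_gt0.
have e'e : e' <= e / 4 by rewrite ge_min lexx.
have e'b : e' <= b / 2 by rewrite ge_min lexx orbT.
pose b' := b - e'; have b'0 : 0 < b' < al by apply/andP; split; rewrite /b'; lra.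
have e4 : 0 < e / 4 by rewrite divr_gt0.
have aux3 : e' + e / 4 + e / 4 <= e by lra.
have aux4 (y s u n : R) : s <= y -> y <= e / 4 * n -> e / 4 * n <= e / 4 * u * n ->
    (e' + e / 4 + e / 4) * u * n <= e * u * n -> (al - b' + e / 4) * u * n + s <= (al - b + e) * u * n.
  by rewrite /b'; lra.
near=> m => D w uD hD.
have [_ g1 _ g2] : [/\ (al - b' - e / 4) * U m <= gd al b' m 0,
   forall w, gd al b' m w <= (al - b' + e / 4) * U m,
   forall w, gd al b' m w <= gq al m w &
   forall w, gq al m w <= gd al b' m w + gq b' m w] by near: m; apply: gd_near.
have [k1 k2] : 2^-1 <= kill b' m /\ 0 < kill b' m < 1.
  by near: m; apply: kill_near; case/andP: b'0.
have m0 : (0 < m)%N by near: m; exact: nbhs_infty_gt.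
have U0 : 1 <= U m by near: m; exact: U_near.
have hs : (m%:R : R) `^ (- e') <= e / 4 * kap.
  by near: m; apply: powRN_near => //; rewrite mulr_gt0.
apply: (@le_trans _ _ (\sum_(z <- D) ((al - b' + e / 4) * U m + gq b' m (w - z)))).
  by apply: ler_sum => z _; apply: (le_trans (g2 _)); rewrite lerD2r.
rewrite big_split /= big_const_seq count_predT iter_addr addr0 -[_ *+ size D]mulr_natr.
have sum1 : \sum_(z <- D) gq b' m (w - z) <= m%:R `^ b'.
  have := green_sum_le mX0 symX0 k2 (r := D) (z := id) w.
  rewrite one_sub_kill -powRN opprK; apply => y.
  rewrite (eq_bigr (fun i => (if i == y then 1 else 0))) => [|i _]; last by rewrite eq_sym; case: eqP.
  rewrite -big_mkcond /= big_const_seq iter_addr addr0 -mulr_natr mul1r -[leRHS]/(1%:R) ler_nat.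
  by rewrite count_uniq_mem//; case: (_ \in _).
have hsum : m%:R `^ b' <= e / 4 * (size D)%:R :> R.
  have -> : m%:R `^ b' = m%:R `^ b * m%:R `^ (- e') :> R by rewrite -natr_powRD.
  apply: (@le_trans _ _ (m%:R `^ b * (e / 4 * kap))); first by rewrite ler_wpM2l ?powR_ge0.
  by rewrite (_ : _ * _ = e / 4 * (kap * m%:R `^ b)) ?ler_wpM2l ?(ltW e4)//; ring.
have s0 : 0 <= (size D)%:R :> R by [].
have h5 : e / 4 * (size D)%:R <= e / 4 * U m * (size D)%:R.
  by rewrite -[leRHS]mulrA ler_pM2l// ler_peMl.
apply: (aux4 _ _ _ _ sum1 hsum h5).
by rewrite ler_wpM2r// ler_wpM2r ?(le_trans ler01)//; exact: aux3.
Unshelve. all: by end_near. Qed.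

(** An approximate mean value inequality for a superharmonic function. In [pair_tail] it keeps the
    potential positive in spite of the negative charges on the annulus. *)
Lemma gq_sum_le_center_near (al b e kap K : R) : 0 < b < al -> 0 < e -> 0 < kap -> 0 < K ->
  \forall m \near \oo, forall (D : seq Z2) w, uniq D -> kap * m%:R `^ b <= (size D)%:R ->
  (forall z, z \in D -> sqn R z <= K * m%:R `^ b) ->
  \sum_(z <- D) gq al m (w - z) <= (gq al m w + e * U m) * (size D)%:R.
Proof.
move=> /andP[b0 ba] e0 kap0 K0.
pose e' := Num.min (e / 4) ((al - b) / 2).
have e'0 : 0 < e' by rewrite lt_min !divr_gt0// subr_gt0.
have e'e : e' <= e / 4 by rewrite ge_min lexx.
have e'b : e' <= (al - b) / 2 by rewrite ge_min lexx orbT.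
have e4 : 0 < e / 4 by rewrite divr_gt0.
have aux3 : (b + e') - b + e / 4 + e / 4 <= e by lra.
have aux4 (x s u n : R) : s <= ((b + e') - b + e / 4) * u * n ->
    ((b + e') - b + e / 4 + e / 4) * u * n <= e * u * n ->
    (x + e / 4 * u) * n + s <= (x + e * u) * n.
  by lra.
near=> m => D w uD hD hK.
have lip : forall w h, sqn R h <= K * m%:R `^ b ->
    gd al (b + e') m (w + h) <= gq al m w + e / 4 * U m.
  by near: m; apply: gq_lipschitz_near => //; try (apply/andP; split); lra.
have [_ _ _ g2] : [/\ (al - (b + e') - e / 4) * U m <= gd al (b + e') m 0,
   forall w, gd al (b + e') m w <= (al - (b + e') + e / 4) * U m,
   forall w, gd al (b + e') m w <= gq al m w &
   forall w, gq al m w <= gd al (b + e') m w + gq (b + e') m w].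
  by near: m; apply: gd_near => //; apply/andP; split; lra.
have hs : forall (D : seq Z2) w, uniq D -> kap * m%:R `^ b <= (size D)%:R ->
  \sum_(z <- D) gq (b + e') m (w - z) <= ((b + e') - b + e / 4) * U m * (size D)%:R.
  by near: m; apply: gq_sum_near => //; apply/andP; split; lra.
have U0 : 1 <= U m by near: m; exact: U_near.
apply: (@le_trans _ _ (\sum_(z <- D) ((gq al m w + e / 4 * U m) + gq (b + e') m (w - z)))).
  rewrite big_seq [leRHS]big_seq; apply: ler_sum => z zD.
  by apply: (le_trans (g2 _)); rewrite lerD2r; apply: lip; rewrite sqnN; exact: hK.
rewrite big_split /= big_const_seq count_predT iter_addr addr0 -[_ *+ size D]mulr_natr.
apply: aux4; first exact: hs D w uD hD.
by rewrite ler_wpM2r// ler_wpM2r ?(le_trans ler01)//; exact: aux3.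
Unshelve. all: by end_near. Qed.

End green_at_scale.

(** * Boxes and annuli at polynomial scales *)

Section boxes.
Context (R : realType).
Local Open Scope fset_scope.

Definition bx (r : nat) : {fset Z2} := fset_set (box r).

Lemma in_bx (z : Z2) r : (z \in bx r) = (`|z 0 0| <= r%:Z)%R && (`|z 1 0| <= r%:Z)%R.
Proof.
rewrite in_fset_set; last exact: finite_box.
apply/idP/andP => [/set_mem h|[h0 h1]]; first by split; exact: h.
apply/mem_set => i.
by have [->|->] : i = 0%R \/ i = 1%R by case: i => -[|[|]]// p; [left|right]; apply/val_inj.
Qed.

Lemma absz_shift_lt (k : int) (r : nat) :
  (`|k| <= r%:Z)%R -> (absz (k + r%:Z)%R < r.*2.+1)%N.
Proof. lia. Qed.

Lemma absz_shiftK (k : int) (r : nat) :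
  (`|k| <= r%:Z)%R -> k = ((absz (k + r%:Z)%R)%:Z - r%:Z)%R.
Proof. lia. Qed.

Lemma card_bx r : #|` bx r| = ((r.*2.+1) ^ 2)%N.
Proof.
pose f (p : 'I_r.*2.+1 * 'I_r.*2.+1) : Z2 :=
  (\col_i (if i == 0 then (p.1 : nat)%:Z - r%:Z else (p.2 : nat)%:Z - r%:Z))%R.
have fI : injective f.
  move=> [a b] [a' b'] /colP e; have := e 0%R; have := e 1%R; rewrite !mxE /= => e1 e0.
  by congr pair; apply/val_inj => /=; lia.
have pe : perm_eq (enum_fset (bx r)) [seq f p | p <- enum {: 'I_r.*2.+1 * 'I_r.*2.+1}].
  apply: uniq_perm; first exact: fset_uniq.
    by rewrite map_inj_uniq ?enum_uniq.
  move=> z; rewrite in_bx; apply/andP/mapP => /= [[h0 h1]|[[a b] _ ->]].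
    exists (Ordinal (absz_shift_lt h0), Ordinal (absz_shift_lt h1)); rewrite ?mem_enum//; apply/colP => i; rewrite mxE /=.
    have [->|->] : i = 0%R \/ i = 1%R by case: i => -[|[|]]// p; [left|right]; apply/val_inj.
      exact: absz_shiftK h0.
    exact: absz_shiftK h1.
  by rewrite !mxE /=; have := ltn_ord a; have := ltn_ord b; split; lia.
by rewrite cardfE /= -?cardfE (perm_size pe) size_map -cardE card_prod !card_ord.
Qed.

End boxes.

Section scales.
Context (R : realType).

Lemma sqn_in_bx z r : z \in bx r -> sqn R z <= 2 * r%:R ^+ 2.
Proof.
rewrite in_bx => /andP[h0 h1].
have sq (k : int) : (`|k| <= r%:Z)%R -> (k%:~R : R) ^+ 2 <= r%:R ^+ 2.
  move=> hk; rewrite -real_normK ?num_real// ler_pXn2r ?nnegrE//.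
  by rewrite -intr_norm -[r%:R]/(r%:Z%:~R) ler_int.
by rewrite /sqn; have := sq _ h0; have := sq _ h1; lra.
Qed.

Lemma sqn_notin_bx z r : z \notin bx r -> r.+1%:R ^+ 2 <= sqn R z.
Proof.
rewrite in_bx negb_and => h.
have sq (k : int) : ~~ (`|k| <= r%:Z)%R -> r.+1%:R ^+ 2 <= (k%:~R : R) ^+ 2.
  move=> hk; rewrite -[leRHS]real_normK ?num_real// ler_pXn2r ?nnegrE//.
  by rewrite -intr_norm -[r.+1%:R]/(r.+1%:Z%:~R) ler_int; lia.
rewrite /sqn; case/orP: h => /sq h.
  by rewrite (le_trans h)// lerDl sqr_ge0.
by rewrite (le_trans h)// lerDr sqr_ge0.
Qed.

Definition rad (b : R) (m : nat) : nat := Num.truncn (m%:R `^ (b / 2)).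

Lemma rad_bounds b m : (0 < m)%N ->
  (rad b m)%:R ^+ 2 <= m%:R `^ b <= (rad b m).+1%:R ^+ 2.
Proof.
move=> m0; have p0 := powR_ge0 (m%:R : R) (b / 2).
have -> : m%:R `^ b = (m%:R `^ (b / 2)) ^+ 2.
  by rewrite -powR_mulrn// -powRrM divfK.
apply/andP; split; rewrite ler_pXn2r ?nnegrE//.
  by rewrite /rad truncn_le.
exact/ltW/truncnS_gt.
Qed.

(** Removing the box of half the radius keeps every site at squared distance of order m^b from the
    centre, while at least m^b sites remain. *)
Definition annulus (b : R) (m : nat) : seq Z2 :=
  enum_fset (bx (rad b m) `\` bx (rad b m)./2)%fset.

Lemma annulus_uniq b m : uniq (annulus b m).
Proof. exact: fset_uniq. Qed.

Lemma annulus_sqn b m z : (0 < m)%N -> z \in annulus b m ->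
  4^-1 * m%:R `^ b <= sqn R z <= 2 * m%:R `^ b.
Proof.
move=> m0; rewrite /annulus inE => /andP[/sqn_notin_bx h1 /sqn_in_bx h2].
have /andP[r1 r2] := rad_bounds b m0; apply/andP; split; last first.
  by apply: (le_trans h2); rewrite ler_pM2l.
apply: le_trans h1; apply: (@le_trans _ _ (4^-1 * (rad b m).+1%:R ^+ 2)).
  by rewrite ler_pM2l// invr_gt0.
have -> : 4^-1 * (rad b m).+1%:R ^+ 2 = (2^-1 * (rad b m).+1%:R) ^+ 2 :> R by field.
rewrite ler_pXn2r ?nnegrE ?mulr_ge0 ?invr_ge0// mulrC ler_pdivrMr// -natrM ler_nat.
by move: (rad b m) => r; lia.
Qed.

Lemma annulus_size b m : (0 < m)%N -> 0 < b -> m%:R `^ b <= (size (annulus b m))%:R :> R.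
Proof.
move=> m0 b0; have /andP[r1 r2] := rad_bounds b m0; apply: (le_trans r2).
have rad1 : (0 < rad b m)%N.
  rewrite /rad truncn_gt0 -[leLHS](powRr0 (m%:R : R)) ler_powR ?ler1n//.
  by rewrite divr_ge0// ltW.
have sub : (bx (rad b m)./2 `<=` bx (rad b m))%fset.
  apply/fsubsetP => z; rewrite !in_bx; move: (rad b m) => r; lia.
rewrite -natrX ler_nat /annulus cardfsDS//  !card_bx.
by move: (rad b m) rad1 => r r0; nia.
Qed.

End scales.

(** * Tail of the number of visits to one site *)

Section exponential_tails.
Context d (T : measurableType d) (R : realType) (P : probability T R).
Context (X : nat -> T -> Z2) (X_iid : iid P X) (symX : symmetric_law P (X 0%N)).
Context (varX : finite_variance P (X 0%N)).
Context (C : R) (C0 : 0 < C)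
  (hC : forall th x, 1 - cos (ip th x) <= C * sqn R x * (1 - charf P (X 0%N) th)).
Local Notation mX := (iid_measurable X_iid 0%N).
Local Notation gq := (gq P (X 0%N)).
Local Notation U := (U P (X 0%N)).

(** A site has more than a [lev m] visits within m steps with probability about m^(-a). *)
Definition lev (m : nat) : R := U m * ln m%:R.

Lemma levE m : lev m = U m * ln m%:R. Proof. by []. Qed.

Definition annulus_visits (b : R) (m : nat) (z : Z2) (s : seq Z2) : R :=
  \sum_(v <- (annulus b m : seq Z2)) visits R (z + v) 0 s.

Lemma kill1_pow m : (1 < m)%N -> expR (- 2) <= (kill 1 m : R) ^+ m.
Proof.
move=> m1; have m0 : 0 < m%:R :> R by rewrite ltr0n ltnW.
have p0 : 0 < m.-1%:R :> R by rewrite ltr0n; case: m m1 {m0} => [|[]].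
have mE : m%:R = m.-1%:R + 1 :> R by rewrite natr1 prednK// ltnW.
have kE : (kill 1 m : R) = (1 + m.-1%:R^-1)^-1.
  by rewrite /kill powR_inv1 ?ltW// mE; field; rewrite !gt_eqF//; lra.
have h : expR (- m.-1%:R^-1) <= (kill 1 m : R).
  have q0 : 0 < 1 + m.-1%:R^-1 :> R by rewrite addr_gt0// invr_gt0.
  by rewrite kE expRN lef_pV2 ?posrE ?expR_gt0//; exact: expR_ge1Dx.
apply: (@le_trans _ _ (expR (- m.-1%:R^-1) ^+ m)); last first.
  apply: lerXn2r => //; rewrite ?nnegrE ?expR_ge0//.
  exact: le_trans (expR_ge0 _) h.
rewrite -expRM_natl ler_expR mulrN lerN2 -/(m%:R / m.-1%:R) ler_pdivrMr// mE.
by rewrite mulrDl mul1r lerD2l -[1]/(1%:R) ler_nat; case: m m1 {m0 p0 mE kE h} => [|[]].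
Qed.

(** Entries are (charge, weight, site): the charges build the potential and the weights the
    functional of visits. At killing rate 1 / m, surviving m steps costs only the factor e^(-2)
    ([kill1_pow]). For negative entries the condition weight times potential <= charge reads
    |charge| <= |weight| times potential. *)
Lemma weighted_tail m (cz : seq (R * R * Z2)) (f0 M r : R) (B : set (seq Z2)) :
  let pot := potential P X ((kill 1 m : R)) [seq (c.1.1, c.2) | c <- cz] in
  (1 < m)%N -> 0 < f0 -> (forall y, f0 <= pot y) -> pot 0 <= M ->
  (forall c, c \in cz -> c.1.2 * pot c.2 <= c.1.1) ->
  (forall s, B s -> r * ln m%:R <= \sum_(c <- cz) c.1.2 * visits R c.2 0 s) ->
  (EE P X m (fun s => (\1_B s)%:E) <= (M / f0 * expR 2 * m%:R `^ (- r))%:E)%E.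
Proof.
move=> pot m1 f00 hf hM hw hB.
have m0 : (0 < m)%N by exact: ltnW.
have k01 : 0 < (kill 1 m : R) < 1.
  rewrite /kill powR_inv1// gtrBl invr_gt0 ltr0n m0 andbT subr_gt0 invf_lt1 ?ltr0n//.
  by rewrite ltr1n.
pose v y := \sum_(c <- cz) c.1.2 * (y == c.2)%:R.
have hv y : v y * pot y <= charge_at [seq (c.1.1, c.2) | c <- cz] y.
  rewrite /v /charge_at big_map /= mulr_suml big_seq [leRHS]big_seq.
  apply: ler_sum => c cc; have [->|_] := eqVneq y c.2; last by rewrite !mulr0 mul0r.
  by rewrite !mulr1; exact: hw.
have hB' s : size s = m -> B s -> r * ln m%:R <= occ (fun x y : Z2 => x + y) v 0 s.
  move=> _ /hB h; apply: (le_trans h); rewrite /v occ_sum le_eqVlt; apply/orP; left.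
  by apply/eqP; apply: eq_bigr => c _; rewrite occZ.
apply: le_trans (additive_tail X_iid symX k01 f00 hf hv hB') _.
rewrite lee_fin; have e0 := expR_gt0 (r * ln (m%:R : R)).
have -> : m%:R `^ (- r) = (expR (r * ln m%:R))^-1 :> R.
  by rewrite /powR pnatr_eq0 gtn_eqF// mulNr expRN.
have M0 : 0 <= M by apply: le_trans hM; apply: le_trans (hf 0); exact: ltW.
have := kill1_pow m1; rewrite expRN => hk.
have k0 : 0 < (kill 1 m : R) ^+ m by apply: lt_le_trans hk; rewrite invr_gt0 expR_gt0.
rewrite ler_pdivrMr ?mulr_gt0//.
have -> : M / f0 * expR 2 / expR (r * ln m%:R) * (expR (r * ln m%:R) * f0 * (kill 1 m : R) ^+ m) =
   M * (expR 2 * (kill 1 m : R) ^+ m) by field; rewrite !gt_eqF.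
apply: (le_trans hM); rewrite ler_peMr// -ler_pdivrMl ?expR_gt0// mulr1.
exact: hk.
Qed.

(** A single charge at z: the potential there is at most about 1 + A, so weights up to nearly 1 /
    [U m] are allowed, and a [lev m] visits then weigh a ln m. *)
Lemma visits_tail (a e : R) : 0 < a -> 0 < e -> exists2 M : R, 0 < M &
  \forall m \near \oo, forall z,
  (EE P X m (fun s => (\1_[set s | a * lev m <= visits R z 0%R s] s)%:E) <=
   (M * m%:R `^ (- (a - e)))%:E)%E.
Proof.
move=> a0 e0; pose e' := Num.min 1 (e / (2 * a)).
have e'0 : 0 < e' by rewrite lt_min ltr01 divr_gt0// mulr_gt0.
have e'1 : 2 * a * e' <= e.
  by rewrite mulrC -ler_pdivlMr ?mulr_gt0// ge_min lexx orbT.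
pose s := (e' + 1 + e')^-1.
have s0 : 0 < s by rewrite invr_gt0; lra.
have sa : a - e <= s * a.
  have : (1 - 2 * e') <= s by rewrite -[s]mul1r ler_pdivlMr; nra.
  by move=> /(ler_wpM2r (ltW a0)); lra.
(* A large charge makes the constant 1 of the potential negligible: it amounts to A e'. *)
pose A := e'^-1; have A0 : 0 < A by rewrite invr_gt0.
have aux (q u : R) : 0 < u -> q <= (1 + e') * u -> s / u * (1 + A / u * q) <= A / u.
  move=> u0 hq; rewrite mulrAC ler_pM2r ?invr_gt0// ler_pdivrMl; last lra.
  have : A / u * q <= A * (1 + e').
    by rewrite -mulrA ler_pM2l// mulrC ler_pdivrMr.
  have : A * e' = 1 by rewrite mulVf// gt_eqF.
  by move: (A / u * q) => Q hA h; nra.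
exists ((1 + A * (1 + e')) / 1 * expR 2).
  by rewrite divr1 mulr_gt0 ?expR_gt0// addr_gt0// mulr_gt0//; lra.
have kp := kill_near (@ltr01 R).
near=> m => z.
have m1 : (1 < m)%N by near: m; exact: nbhs_infty_gt.
have U0 : 0 < U m.
  by apply: (@lt_le_trans _ _ 1) => //; near: m; exact: (U_near mX varX C0 hC).
have [_ k01] : 2^-1 <= (kill 1 m : R) /\ 0 < (kill 1 m : R) < 1 by near: m.
have /andP[_ hq0] : (1 - e') * U m <= gq 1 m 0 <= (1 + e') * U m.
  by near: m; apply: (gq0_near mX varX C0 hC).
have g0 y : 0 <= gq 1 m y by exact: (green_ge0 mX symX k01).
have gle y : gq 1 m y <= (1 + e') * U m.
  by apply: le_trans hq0; apply: le_trans (ler_norm _) _; exact: (green_norm_le P mX k01).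
apply: (@le_trans _ _ ((1 + A * (1 + e')) / 1 * expR 2 * m%:R `^ (- (s * a)))%:E); last first.
  rewrite lee_fin; apply: ler_wpM2l.
    by rewrite divr1 mulr_ge0 ?expR_ge0// addr_ge0// mulr_ge0 ?(ltW A0)//; lra.
  by rewrite ler_powR ?lerN2// ler1n ltnW.
apply: (@weighted_tail m [:: (A / U m, s / U m, z)]) => //=.
- move=> y; rewrite /potential big_seq1 /= lerDl; apply: mulr_ge0; last exact: g0.
  by rewrite divr_ge0 ?(ltW A0)// ltW.
- rewrite /potential big_seq1 /= lerD2l -mulrA ler_pM2l// mulrC ler_pdivrMr//.
  exact: gle.
- move=> c; rewrite inE => /eqP -> /=; rewrite /potential big_seq1 /= subrr.
  exact: aux.
- move=> s' /= h; rewrite big_seq1 /= -mulrA -/(s * _) .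
  apply: (@le_trans _ _ (s / U m * (a * lev m))); last first.
    by apply: ler_wpM2l => //; apply: divr_ge0; exact: ltW.
  by rewrite /lev le_eqVlt; apply/orP; left; apply/eqP; field; rewrite gt_eqF.
Unshelve. all: by end_near. Qed.

End exponential_tails.

(** * Arithmetic of weights and charges *)

Section tail_arithmetic.
Context (R : realType).

Lemma wt_le (B W S q : R) : 0 <= B -> 0 < W -> S <= q * W -> B / W * S <= B * q.
Proof.
move=> B0 W0 h; rewrite -mulrA ler_wpM2l// mulrC ler_pdivrMr//.
Qed.

Lemma wt_ge (B W S q : R) : 0 <= B -> 0 < W -> q * W <= S -> B * q <= B / W * S.
Proof.
move=> B0 W0 h; rewrite -mulrA ler_wpM2l// mulrC ler_pdivlMr//.
Qed.

Lemma wt_charge (A D W p : R) : 0 < W -> 0 < D -> 0 <= A -> p <= D ->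
  A / D / W * p <= A / W.
Proof.
move=> W0 D0 A0 h; rewrite mulrAC ler_pM2r ?invr_gt0// mulrAC ler_pdivrMr//.
exact: ler_wpM2l.
Qed.

(** To first order a charge be on the annulus lowers the weight of the centre by be rho, and the
    annulus returns (1 + eta) be rho (1 - be). The balance be rho (eta - be - eta be) is quadratic
    in eta for be = eta / 4, and the errors e are of smaller order. *)
Lemma annulus_arith (rho eta be e : R) : 0 < rho < 1 -> 0 < eta <= 1 ->
  be = eta / 4 -> e = be * rho * eta / 36 ->
  1 + eta ^+ 2 * rho / 16 <= (1 + 2 * e + be * (rho + e))^-1 +
    be / (e + (1 + be) * (rho + e)) * ((1 + eta) * rho ^+ 2).
Proof.
move=> /andP[r0 r1] /andP[t0 t1] beE eE.
have be0 : 0 < be by rewrite beE divr_gt0.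
have e0 : 0 < e by rewrite eE divr_gt0// !mulr_gt0.
have br : 0 < be * rho by rewrite mulr_gt0.
have h1 : 1 - (2 * e + be * (rho + e)) <= (1 + 2 * e + be * (rho + e))^-1.
  have x0 : 0 < 2 * e + be * (rho + e) by nra.
  rewrite -addrA -[leRHS]mul1r ler_pdivlMr; last by rewrite addr_gt0.
  by move: (2 * e + be * (rho + e)) x0 => x x0; nra.
have D0 : 0 < e + (1 + be) * (rho + e) by rewrite addr_gt0// mulr_gt0 ?addr_gt0.
have h2 : be * (rho * (1 - be) - 3 * e) <= be / (e + (1 + be) * (rho + e)) * rho ^+ 2.
  rewrite mulrAC ler_pdivlMr// -mulrA ler_pM2l// -subr_ge0.
  have -> : rho ^+ 2 - (rho * (1 - be) - 3 * e) * (e + (1 + be) * (rho + e)) =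
    rho ^+ 2 * be ^+ 2 + rho * e * (1 + 4 * be + be ^+ 2) + 3 * e ^+ 2 * (2 + be) by ring.
  by rewrite !addr_ge0 ?mulr_ge0 ?addr_ge0 ?mulr_ge0 ?exprn_ge0 ?ltW.
have h3 : (1 + eta) * (be * (rho * (1 - be) - 3 * e)) <=
    be / (e + (1 + be) * (rho + e)) * ((1 + eta) * rho ^+ 2).
  by rewrite [leRHS]mulrCA ler_pM2l// addr_gt0.
apply: le_trans (lerD h1 h3).
rewrite -subr_ge0.
have -> : 1 - (2 * e + be * (rho + e)) + (1 + eta) * (be * (rho * (1 - be) - 3 * e)) -
    (1 + eta ^+ 2 * rho / 16) = eta ^+ 2 * rho *
    ((2 - eta) / 16 - (2 + eta + 3 / 4 * eta ^+ 2) / 144).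
  by rewrite eE beE; field.
rewrite mulr_ge0 ?mulr_ge0 ?exprn_ge0 ?(ltW r0) ?(ltW t0)//.
have : eta ^+ 2 <= 1 by rewrite exprn_ile1// ltW.
by lra.
Qed.

Lemma sqnB_le (x y : Z2) : sqn R (x - y) <= 2 * sqn R x + 2 * sqn R y.
Proof.
rewrite /sqn !mxE !rmorphB /=.
have h (p q : R) : (p - q) ^+ 2 <= 2 * p ^+ 2 + 2 * q ^+ 2.
  by rewrite -subr_ge0 (_ : _ - _ = (p + q) ^+ 2) ?sqr_ge0//; ring.
have := h (x 0 0)%:~R (y 0 0)%:~R; have := h (x 1 0)%:~R (y 1 0)%:~R; lra.
Qed.

End tail_arithmetic.

(** * Joint tails for a site and an annulus, and for two sites *)

Section multi_point_tails.
Context d (T : measurableType d) (R : realType) (P : probability T R).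
Context (X : nat -> T -> Z2) (X_iid : iid P X) (symX : symmetric_law P (X 0%N)).
Context (varX : finite_variance P (X 0%N)).
Context (C : R) (C0 : 0 < C)
  (hC : forall th x, 1 - cos (ip th x) <= C * sqn R x * (1 - charf P (X 0%N) th)).
Local Notation mX := (iid_measurable X_iid 0%N).
Local Notation gq := (gq P (X 0%N)).
Local Notation U := (U P (X 0%N)).
Local Notation lev := (lev P X).
Local Notation sz b m := ((size (annulus b m : seq Z2))%:R : R).

Lemma gqN al m x : gq al m (- x) = gq al m x.
Proof. exact: greenN. Qed.

(** The Green function estimates of one scale. The constant 20 is 2 x 2 + 2 x 8: it covers the
    difference of an annulus site and of a displacement of squared length at most 8 m^b. *)
Lemma annulus_near (b e : R) : 0 < b < 1 -> 0 < e -> \forall m \near \oo,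
  [/\ (1 < m)%N, 0 < U m, 0 < sz b m & forall y, 0 <= gq 1 m y <= (1 + e) * U m] /\
  [/\ forall z, sqn R z <= 20 * m%:R `^ b -> (1 - b - e) * U m <= gq 1 m z,
      forall v, v \in annulus b m -> sqn R v <= 2 * m%:R `^ b,
      forall v, v \in annulus b m -> gq 1 m v <= (1 - b + e) * U m,
      forall w, \sum_(v <- annulus b m) gq 1 m (w - v) <= (1 - b + e) * (U m * sz b m) &
      forall w, \sum_(v <- annulus b m) gq 1 m (w - v) <= (gq 1 m w + e * U m) * sz b m].
Proof.
move=> b01 e0; have /andP[b0 b1] := b01.
have c1 : 0 < 4^-1 :> R by rewrite invr_gt0.
have c20 : 0 < 20 :> R by []. have c2 : 0 < 2 :> R by [].
near=> m.
have m1 : (1 < m)%N by near: m; exact: nbhs_infty_gt.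
have m0 : (0 < m)%N by exact: ltnW.
have U0 : 0 < U m.
  by apply: (@lt_le_trans _ _ 1) => //; near: m; exact: (U_near mX varX C0 hC).
have [_ k01] : 2^-1 <= (kill 1 m : R) /\ 0 < (kill 1 m : R) < 1.
  by near: m; exact: kill_near ltr01.
have /andP[_ hq0] : (1 - e) * U m <= gq 1 m 0 <= (1 + e) * U m.
  by near: m; apply: (gq0_near mX varX C0 hC).
have n1 := annulus_size m0 b0.
have n1' : 1 * m%:R `^ b <= sz b m by rewrite mul1r.
have p0 : 0 < (m%:R : R) `^ b by exact: natr_powR_gt0.
have un := @annulus_uniq R b m.
split; split => //.
- exact: lt_le_trans n1.
- move=> y; apply/andP; split; first exact: (green_ge0 mX symX k01).
  apply: le_trans hq0; apply: le_trans (ler_norm _) _; exact: (green_norm_le P mX k01).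
- by near: m; apply: (gq_near_near mX symX varX C0 hC).
- by move=> v vD; have /andP[] := annulus_sqn m0 vD.
- move=> v vD; have /andP[h _] := annulus_sqn m0 vD; move: v h {vD}.
  by near: m; apply: (gq_far_near mX symX varX C0 hC).
- move=> w; rewrite mulrA; move: un n1' => /[swap]; move: w.
  move=> w hn hu; move: (annulus b m) w hu hn.
  by near: m; apply: (gq_sum_near mX symX varX C0 hC).
- have hs : forall v, v \in annulus b m -> sqn R v <= 2 * m%:R `^ b.
    by move=> v vD; have /andP[] := annulus_sqn m0 vD.
  move=> w; move: (annulus b m) w un n1' hs.
  by near: m; apply: (gq_sum_le_center_near mX symX varX C0 hC).
Unshelve. all: by end_near. Qed.

Lemma annulus_potential (k : R) m (D : seq Z2) z y :
  \sum_(v <- D) k * green P (X 0%N) (kill 1 m) (y - (z + v)) =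
  k * \sum_(v <- D) gq 1 m (y - z - v).
Proof. by rewrite mulr_sumr; apply: eq_bigr => v _; rewrite opprD addrA. Qed.

(** A site with a [lev m] visits typically comes with an average of a (1 - b)^2 [lev m] visits on
    the annulus of scale b. Positive charges on both show that an excess by a factor 1 + eta costs a
    power of m beyond m^(-a). *)
Lemma annulus_tail (a b eta : R) : 0 < a -> 0 < b < 1 -> 0 < eta <= 1 ->
  exists2 M : R, 0 < M & \forall m \near \oo, forall z,
  (EE P X m (fun s => (\1_[set s | a * lev m <= visits R z 0%R s /\
     (1 + eta) * a * (1 - b) ^+ 2 * (lev m * sz b m) <= annulus_visits b m z s] s)%:E) <=
   (M * m%:R `^ (- (a * (1 + eta ^+ 2 * (1 - b) / 16))))%:E)%E.
Proof.
move=> a0 b01 t01; have /andP[b0 b1] := b01; have /andP[t0 t1] := t01.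
pose rho := 1 - b; pose be := eta / 4; pose e := be * rho * eta / 36.
have r0 : 0 < rho by rewrite subr_gt0. have r1 : rho < 1 by rewrite /rho; lra.
have be0 : 0 < be by rewrite divr_gt0.
have e0 : 0 < e by rewrite divr_gt0// !mulr_gt0.
pose A := e^-1; have A0 : 0 < A by rewrite invr_gt0.
have Ae : A * e = 1 by rewrite mulVf// gt_eqF.
pose B := be * A; have B0 : 0 < B by rewrite mulr_gt0.
pose s := (1 + 2 * e + be * (rho + e))^-1.
pose u := be / (e + (1 + be) * (rho + e)).
have bre : 0 < be * (rho + e) by rewrite mulr_gt0// addr_gt0.
have D1 : 0 < 1 + 2 * e + be * (rho + e) by lra.
have D2 : 0 < e + (1 + be) * (rho + e) by lra.
have AD1 := mulr_gt0 A0 D1; have AD2 := mulr_gt0 A0 D2; have A0' := ltW A0; have B0' := ltW B0.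
have s0 : 0 < s by rewrite invr_gt0. have u0 : 0 < u by rewrite divr_gt0.
have sE : s = A / (A * (1 + 2 * e + be * (rho + e))) by rewrite /s; field; rewrite !gt_eqF.
have uE : u = B / (A * (e + (1 + be) * (rho + e))) by rewrite /u /B; field; rewrite !gt_eqF.
have ar : a * (1 + eta ^+ 2 * (1 - b) / 16) <= a * (s + u * ((1 + eta) * rho ^+ 2)).
  by rewrite ler_pM2l//; apply: annulus_arith => //; rewrite r0.
have aux1 (S : R) : S <= B * (rho + e) -> 1 + (A * (1 + e) + S) <= A * (1 + 2 * e + be * (rho + e)).
  by rewrite /B => h; nra.
have aux2 (S S' : R) : S <= A * (rho + e) -> S' <= B * (rho + e) -> 1 + (S + S') <= A * (e + (1 + be) * (rho + e)).
  by rewrite /B => h; nra.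
exists ((1 + (A + B) * (1 + e)) / 1 * expR 2).
  by rewrite divr1 mulr_gt0 ?expR_gt0// addr_gt0// mulr_gt0 ?addr_gt0.
have nr := annulus_near b01 e0.
have fin (L V q : R) : 0 < V -> 0 < q -> a * (s + u * ((1 + eta) * rho ^+ 2)) * L =
    s / V * (a * (V * L)) + u / (V * q) * ((1 + eta) * a * rho ^+ 2 * (V * L * q)).
  by move: s u {s0 u0 sE uE ar} => s u V0 q0; field; rewrite !gt_eqF.
apply: filterS nr => m [[m1 U0 n0 g01] [_ _ hD hsum _]] z.
set D := annulus b m in hD hsum *; set n := sz b m in n0 hsum *.
have Un : 0 < U m * n by rewrite mulr_gt0.
have g0 y : 0 <= gq 1 m y by have /andP[] := g01 y.
have sg0 y : 0 <= \sum_(v <- D) gq 1 m (y - v) by exact: sumr_ge0.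
apply: (@le_trans _ _ ((1 + (A + B) * (1 + e)) / 1 * expR 2 *
    m%:R `^ (- (a * (s + u * ((1 + eta) * rho ^+ 2)))))%:E); last first.
  rewrite lee_fin; apply: ler_wpM2l.
    by rewrite divr1 mulr_ge0 ?expR_ge0// addr_ge0// mulr_ge0 ?addr_ge0 ?ltW.
  by rewrite ler_powR ?lerN2// ler1n ltnW.
pose cz' := (A / U m, s / U m, z) :: [seq (B / (U m * n), u / (U m * n), z + v) | v <- D].
have [cz czE] : exists cz, cz = cz' by exists cz'.
have potE y : potential P X (kill 1 m) [seq (c.1.1, c.2) | c <- cz] y =
    1 + (A / U m * gq 1 m (y - z) + B / (U m * n) * \sum_(v <- D) gq 1 m (y - z - v)).
  by rewrite /potential czE /cz' /= big_cons /= !big_map /= annulus_potential.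
apply: (@weighted_tail _ _ _ _ _ X_iid symX m cz) => //=.
- move=> y; rewrite potE lerDl addr_ge0//; apply: mulr_ge0 => //; apply: divr_ge0; exact: ltW.
- rewrite potE lerD2l mulrDl; apply: lerD.
    by apply: wt_le => //; have /andP[] := g01 (0 - z).
  apply: wt_le => //; apply: le_trans (hsum _) _.
  by apply: ler_wpM2r; [exact: ltW|rewrite /rho in r1; lra].
- move=> c; rewrite {1}czE inE => /orP[/eqP -> /=|/mapP[v vD -> /=]].
    rewrite potE sE; apply: wt_charge => //.
    rewrite subrr; apply: le_trans (aux1 (B / (U m * n) * \sum_(v <- D) gq 1 m (0 - v)) _).
      by rewrite lerD2l lerD2r; apply: wt_le => //; have /andP[] := g01 0.
    by apply: wt_le.
  rewrite potE uE; apply: wt_charge => //.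
  apply: aux2; last by apply: wt_le.
  by apply: wt_le; rewrite // addrC addKr; exact: hD.
- move=> s' /= [h1 h2]; rewrite czE /cz' big_cons big_map /=.
  under eq_bigr => v _ do over.
  rewrite -mulr_sumr -/(annulus_visits b m z s').
  apply: (@le_trans _ _ (s / U m * (a * lev m) +
     u / (U m * n) * ((1 + eta) * a * (1 - b) ^+ 2 * (lev m * n)))); last first.
    by apply: lerD; apply: ler_wpM2l => //; apply: divr_ge0; exact: ltW.
  rewrite !levE le_eqVlt; apply/orP; left; apply/eqP; rewrite -/rho.
  exact: fin.
Qed.

(** Charges A on both sites and -A spread over the annulus of the first. At a site the contribution
    1 - b of the other one is cancelled by the annulus, so each keeps a weight of nearly 1 / [U m];
    on the annulus the potential is about A (1 - b), which allows the weight -1 / (1 - b). Few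
    visits to the annulus thus make the two sites behave almost independently, up to the term kap /
    (1 - b). *)
Lemma pair_tail (a b g kap A e : R) : 0 < a -> 0 < b < 1 -> 0 < e -> 0 < A ->
  A * e <= 2^-1 -> 3 * e < 1 - b -> 0 <= g ->
  exists2 M : R, 0 < M & \forall m \near \oo, forall z1 z2,
  sqn R (z2 - z1) <= 8 * m%:R `^ b -> gq 1 m (z2 - z1) <= (1 - b + g) * U m ->
  (EE P X m (fun s => (\1_[set s | [/\ a * lev m <= visits R z1 0%R s,
     a * lev m <= visits R z2 0%R s &
     annulus_visits b m z1 s <= kap * (lev m * sz b m)]] s)%:E) <=
   (M * m%:R `^ (- (2 * (A / (1 + A * (1 + g + 3 * e))) * a - kap / (1 - b - 3 * e))))%:E)%E.
Proof.
move=> a0 b01 e0 A0 Ae be g0; have /andP[b0 b1] := b01.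
pose rho := 1 - b; have r0 : 0 < rho by rewrite subr_gt0.
pose D1 := 1 + A * (1 + g + 3 * e); pose D2 := rho - 3 * e.
have D10 : 0 < D1 by rewrite addr_gt0// mulr_gt0//; lra.
have D20 : 0 < D2 by rewrite subr_gt0.
exists ((1 + A * (2 * (1 + e))) / 2^-1 * expR 2).
  have e1 : 0 < 1 + e by lra. have A2 : 0 < A * (2 * (1 + e)) by rewrite !mulr_gt0.
  have := expR_gt0 (2 : R); move: (expR 2) (A * _) A2 => E Q Q0 E0; nra.
have nr := annulus_near b01 e0.
have A0' := ltW A0.
have aux1 (p q S : R) : p <= A * (1 + e) -> q <= A * (rho + g) -> A * (rho - e) <= S ->
  1 + (p + (q - S)) <= D1 by rewrite /D1; nra.
have aux2 (p q S : R) : A * (rho - e) <= p -> A * (rho - e) <= q -> S <= A * (rho + e) ->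
  A * D2 <= 1 + (p + (q - S)) by rewrite /D2; nra.
have aux3 (p q S : R) : S <= p + A * e -> 0 <= q -> 2^-1 <= 1 + (p + (q - S)) by nra.
have aux4 (p q S : R) : p <= A * (1 + e) -> q <= A * (1 + e) -> 0 <= S ->
  1 + (p + (q - S)) <= 1 + A * (2 * (1 + e)) by nra.
have fin (L V q : R) : 0 < V -> 0 < q -> (2 * (A / D1) * a - kap / D2) * L =
    A / D1 / V * (a * (V * L)) + (A / D1 / V * (a * (V * L)) - D2^-1 / (V * q) * (kap * (V * L * q))).
  by move: D1 D2 D10 D20 {aux1 aux2} => D1 D2 D10 D20 V0 q0; field; rewrite !gt_eqF.
apply: filterS nr => m [[m1 U0 n0 g01] [hnear hD2 hD hsum hcen]] z1 z2 hz hg.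
set D := annulus b m in hD hD2 hsum hcen *; set n := sz b m in n0 hsum hcen *.
have Un : 0 < U m * n by rewrite mulr_gt0.
have gge y : 0 <= gq 1 m y by have /andP[] := g01 y.
have gle y : gq 1 m y <= (1 + e) * U m by have /andP[] := g01 y.
have p0 : 0 < (m%:R : R) `^ b by apply: natr_powR_gt0; exact: ltnW.
have hge w : sqn R w <= 8 * m%:R `^ b ->
    (rho - e) * (U m * n) <= \sum_(v <- D) gq 1 m (w - v).
  move=> hw; rewrite mulrA [X in X <= _](_ : _ = \sum_(v <- D) (rho - e) * U m); last first.
    by rewrite big_const_seq count_predT iter_addr addr0 -mulr_natr.
  rewrite big_seq [leRHS]big_seq; apply: ler_sum => v vD; apply: hnear.
  apply: le_trans (sqnB_le _ _ _) _; have := hD2 _ vD; nra.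
pose cz' := (A / U m, A / D1 / U m, z1) :: (A / U m, A / D1 / U m, z2) ::
  [seq (- (A / (U m * n)), - (D2^-1 / (U m * n)), z1 + v) | v <- D].
have [cz czE] : exists cz, cz = cz' by exists cz'.
have potE y : potential P X (kill 1 m) [seq (c.1.1, c.2) | c <- cz] y =
    1 + (A / U m * gq 1 m (y - z1) + (A / U m * gq 1 m (y - z2) -
         A / (U m * n) * \sum_(v <- D) gq 1 m (y - z1 - v))).
  by rewrite /potential czE /cz' /= !big_cons /= !big_map /= annulus_potential mulNr.
have W0 : 0 <= A / (U m * n) by apply: divr_ge0; exact: ltW.
have AU0 : 0 <= A / U m by apply: divr_ge0; exact: ltW.
have sge y : 0 <= \sum_(v <- D) gq 1 m (y - v) by exact: sumr_ge0.
apply: (@weighted_tail _ _ _ _ _ X_iid symX m cz) => //=.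
- move=> y; rewrite potE; apply: aux3; last exact: mulr_ge0.
  rewrite (_ : _ + A * e = A * (gq 1 m (y - z1) / U m + e)); last by rewrite mulrDr mulrAC mulrA.
  apply: wt_le => //; apply: le_trans (hcen _) _.
  by rewrite [leRHS]mulrA [(_ + e) * U m]mulrDl divfK ?gt_eqF//.
- rewrite potE; apply: aux4; last exact: mulr_ge0.
    exact: wt_le.
  exact: wt_le.
- move=> c; rewrite {1}czE inE => /orP[/eqP -> /=|].
    rewrite potE; apply: wt_charge => //; apply: aux1.
    + exact: wt_le.
    + by apply: wt_le; rewrite // -gqN opprB.
    + apply: wt_ge => //; apply: hge; rewrite subrr /sqn !mxE expr0n addr0 mulr_ge0// ltW.
  rewrite inE => /orP[/eqP -> /=|/mapP[v vD -> /=]].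
    rewrite potE [A / U m * _ + _]addrCA; apply: wt_charge => //; apply: aux1.
    + exact: wt_le.
    + exact: wt_le.
    + by apply: wt_ge => //; apply: hge.
  rewrite potE mulNr lerN2.
  apply: (@le_trans _ _ (D2^-1 / (U m * n) * (A * D2))).
    by rewrite le_eqVlt; apply/orP; left; apply/eqP; field; rewrite !gt_eqF.
  apply: ler_wpM2l; first by apply: divr_ge0; rewrite ?invr_ge0 ltW.
  apply: aux2.
  + apply: wt_ge => //; rewrite (_ : z1 + v - z1 = v); last by rewrite addrC addKr.
    apply: hnear; apply: le_trans (hD2 _ vD) _.
    by rewrite ler_pM2r// ler_nat.
  + apply: wt_ge => //; apply: hnear; apply: (@le_trans _ _ (20 * m%:R `^ b)) => //.
    rewrite (_ : z1 + v - z2 = v - (z2 - z1)); last by rewrite opprB addrCA addrA.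
    by apply: le_trans (sqnB_le _ _ _) _; have := hD2 _ vD; lra.
  + by apply: wt_le.
- move=> s' /= [h1 h2 h3]; rewrite czE /cz' !big_cons big_map /=.
  rewrite -mulr_sumr -/(annulus_visits b m z1 s').
  apply: (@le_trans _ _ (A / D1 / U m * (a * lev m) + (A / D1 / U m * (a * lev m) -
     D2^-1 / (U m * n) * (kap * (lev m * n))))); last first.
    have s0 : 0 <= A / D1 / U m by rewrite !divr_ge0// ltW.
    apply: lerD; first exact: ler_wpM2l.
    apply: lerD; first exact: ler_wpM2l.
    rewrite mulNr lerN2; apply: ler_wpM2l => //.
    by apply: divr_ge0; rewrite ?invr_ge0 ltW.
  rewrite !levE le_eqVlt; apply/orP; left; apply/eqP; rewrite -/rho -/D1 -/D2.
  exact: fin.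
Qed.

(** At distances close to m^(1/2) the mutual Green function g [U m] is already small, and the
    charges on the two sites alone suffice. *)
Lemma far_pair_tail (a g A e : R) : 0 < a -> 0 < e -> 0 < A -> 0 <= g ->
  exists2 M : R, 0 < M & \forall m \near \oo, forall z1 z2, gq 1 m (z2 - z1) <= g * U m ->
  (EE P X m (fun s => (\1_[set s | a * lev m <= visits R z1 0%R s /\
     a * lev m <= visits R z2 0%R s] s)%:E) <=
   (M * m%:R `^ (- (2 * (A / (1 + A * (1 + g + 3 * e))) * a)))%:E)%E.
Proof.
move=> a0 e0 A0 g0; have A0' := ltW A0.
pose D1 := 1 + A * (1 + g + 3 * e).
have D10 : 0 < D1 by rewrite addr_gt0// mulr_gt0//; lra.
exists ((1 + A * (2 * (1 + e))) / 1 * expR 2).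
  have e1 : 0 < 1 + e by lra. have A2 : 0 < A * (2 * (1 + e)) by rewrite !mulr_gt0.
  have := expR_gt0 (2 : R); rewrite divr1; move: (expR 2) (A * _) A2 => E Q Q0 E0; nra.
have b01 : 0 < (2^-1 : R) < 1 by lra.
have nr := annulus_near b01 e0.
have aux1 (p q : R) : p <= A * (1 + e) -> q <= A * g -> 1 + (p + q) <= D1.
  by rewrite /D1; nra.
have fin (L V : R) : 0 < V -> 2 * (A / D1) * a * L = A / D1 / V * (a * (V * L)) + A / D1 / V * (a * (V * L)).
  by move: D1 D10 {aux1} => D1 D10 V0; field; rewrite !gt_eqF.
apply: filterS nr => m [[m1 U0 n0 g01] _] z1 z2 hg.
have gge y : 0 <= gq 1 m y by have /andP[] := g01 y.
have gle y : gq 1 m y <= (1 + e) * U m by have /andP[] := g01 y.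
have AU0 : 0 <= A / U m by apply: divr_ge0; exact: ltW.
pose cz' := [:: (A / U m, A / D1 / U m, z1); (A / U m, A / D1 / U m, z2)].
have [cz czE] : exists cz, cz = cz' by exists cz'.
have potE y : potential P X (kill 1 m) [seq (c.1.1, c.2) | c <- cz] y =
    1 + (A / U m * gq 1 m (y - z1) + A / U m * gq 1 m (y - z2)).
  by rewrite /potential czE /cz' /= !big_cons /= big_nil addr0.
apply: (@weighted_tail _ _ _ _ _ X_iid symX m cz) => //=.
- by move=> y; rewrite potE lerDl; apply: addr_ge0; apply: mulr_ge0 => //; apply: gge.
- rewrite potE lerD2l [leRHS](_ : _ = A * (1 + e) + A * (1 + e)); last by ring.
  by apply: lerD; exact: wt_le.
- move=> c; rewrite {1}czE inE => /orP[/eqP -> /=|].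
    rewrite potE; apply: wt_charge => //; apply: aux1; first exact: wt_le.
    by apply: wt_le; rewrite // -gqN opprB.
  rewrite inE => /eqP -> /=.
  by rewrite potE [A / U m * _ + _]addrC; apply: wt_charge => //; apply: aux1; exact: wt_le.
- move=> s' /= [h1 h2]; rewrite czE /cz' !big_cons big_nil addr0 /=.
  apply: (@le_trans _ _ (A / D1 / U m * (a * lev m) + A / D1 / U m * (a * lev m))); last first.
    have s0 : 0 <= A / D1 / U m by rewrite !divr_ge0// ltW.
    by apply: lerD; exact: ler_wpM2l.
  rewrite !levE le_eqVlt; apply/orP; left; apply/eqP; rewrite -/D1.
  exact: fin.
Qed.

End multi_point_tails.

(** * Probabilities of path events and the second moment method *)

Section path_events.
Context d (T : measurableType d) (R : realType) (P : probability T R).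
Context (U : countType) (X : nat -> T -> U) (X_iid : iid P X).
Local Open Scope ereal_scope.

Definition EEi k (B : set (seq U)) : \bar R := EE P X k (fun s => (\1_B s)%:E).

Lemma EEi_ge0 k B : 0 <= EEi k B.
Proof. by apply: EE_ge0 => s; rewrite lee_fin. Qed.

Lemma EEi_le k (A B : set (seq U)) : (forall s, size s = k -> A s -> B s) ->
  EEi k A <= EEi k B.
Proof.
move=> h; apply: (EE_le X_iid) => [s|s sk]; first by rewrite lee_fin.
rewrite lee_fin !indicE; have [/set_mem As|_] := boolP (s \in A) => //.
by rewrite (mem_set (h _ sk As)).
Qed.

Lemma EEi_le1 k B : EEi k B <= 1.
Proof.
rewrite -(EE_cst X_iid k (@ler01 R)); by apply: (EE_le X_iid) => s *; rewrite lee_fin.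
Qed.

Lemma EED k (F G : seq U -> \bar R) : (forall s, 0 <= F s) -> (forall s, 0 <= G s) ->
  EE P X k (fun s => F s + G s) = EE P X k F + EE P X k G.
Proof.
move=> F0 G0.
have := EE_sum X_iid k [:: true; false] (F := fun b => if b then F else G).
rewrite !big_cons big_nil adde0 => <-; last by case.
by apply: eq_EE => s *; rewrite !big_cons big_nil adde0.
Qed.

Lemma EEi_union k (I : eqType) (r : seq I) (A B : set (seq U)) (Bi : I -> set (seq U)) :
  (forall s, size s = k -> A s -> ~ B s -> exists2 i, i \in r & Bi i s) ->
  EEi k A <= EEi k B + \sum_(i <- r) EEi k (Bi i).
Proof.
move=> h; rewrite -(EE_sum X_iid) => [|i s]; last by rewrite lee_fin.
rewrite -EED => [|s|s]; [|by rewrite lee_fin|by apply: sume_ge0 => i _; rewrite lee_fin].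
apply: (EE_le X_iid) => s *; first by rewrite lee_fin.
rewrite [X in (_ <= _ + X)%E]sumEFin -EFinD lee_fin.
rewrite !indicE; have [/set_mem As|_] := boolP (s \in A); last first.
  by rewrite addr_ge0// sumr_ge0.
have [/set_mem Bs|/negP nB] := boolP (s \in B); first by rewrite lerDl sumr_ge0.
have [i ir Bis] : exists2 i, i \in r & Bi i s by apply: h => // Bs; apply: nB; exact: mem_set.
rewrite add0r (big_rem i ir)/= indicE (mem_set Bis) lerDl sumr_ge0//.
Qed.

(* Paley-Zygmund, integrating z <= mu / 2 + (c / 2) z ^ 2 + 1_{mu / 2 <= z} / (2 c)
   at c = mu / (2 S). *)
Lemma second_moment_method k (I : Type) (V : seq I) (A : I -> set (seq U)) (mu S : R) :
  (0 < mu)%R -> (0 < S)%R -> mu%:E <= \sum_(i <- V) EEi k (A i) ->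
  \sum_(i <- V) \sum_(j <- V) EEi k (A i `&` A j) <= S%:E ->
  (mu ^+ 2 / (4 * S))%:E <= EEi k [set s | (mu / 2 <= \sum_(i <- V) \1_(A i) s)%R].
Proof.
move=> mu0 S0 h1 h2; set B := [set s | _].
pose c := (mu / (2 * S))%R; have c0 : (0 < c)%R by rewrite divr_gt0// mulr_gt0.
pose Z s : R := (\sum_(i <- V) \1_(A i) s)%R.
have Z0 s : (0 <= Z s)%R by exact: sumr_ge0.
have Z2 s : (Z s * Z s)%:E = \sum_(i <- V) \sum_(j <- V) (\1_(A i `&` A j) s)%:E.
  rewrite /Z mulr_suml; under [RHS]eq_bigr do rewrite sumEFin.
  rewrite sumEFin; congr EFin; apply: eq_bigr => i _; rewrite mulr_sumr.
  by apply: eq_bigr => j _; rewrite indicI.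
have B0 s : 0 <= (\1_B s)%:E by rewrite lee_fin.
have hZ : mu%:E <= EE P X k (fun s => (mu / 2)%:E + ((c / 2)%:E * (Z s * Z s)%:E + (2 * c)^-1%:E * (\1_B s)%:E)).
  apply: (le_trans h1); rewrite -(EE_sum X_iid) => [|i s]; last by rewrite lee_fin.
  apply: (EE_le X_iid) => s *; first by apply: sume_ge0 => i _; rewrite lee_fin.
  rewrite sumEFin -/(Z s) -!EFinM -!EFinD lee_fin.
  have q0 : (0 < (2 * c)^-1)%R by rewrite invr_gt0 mulr_gt0.
  have [zs|zs] := leP (mu / 2)%R (Z s).
    rewrite indicE (mem_set (zs : B s)) mulr1.
    have : (0 <= (c * Z s - 1) ^+ 2 * (2 * c)^-1)%R by rewrite mulr_ge0 ?sqr_ge0// ltW.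
    have -> : ((c * Z s - 1) ^+ 2 * (2 * c)^-1 = c / 2 * (Z s * Z s) + (2 * c)^-1 - Z s)%R.
      by field; rewrite gt_eqF.
    by move: (Z s) => z; lra.
  have c20 : (0 <= c / 2)%R by rewrite divr_ge0// ltW.
  apply: (le_trans (ltW zs)); rewrite lerDl; apply: addr_ge0; apply: mulr_ge0 => //.
    exact: mulr_ge0.
  exact: ltW.
have c2 : (0 <= c / 2)%R by rewrite divr_ge0// ltW.
have ic2 : (0 <= (2 * c)^-1)%R by rewrite invr_ge0 mulr_ge0// ltW.
have Zc s : 0 <= (c / 2)%:E * (Z s * Z s)%:E by rewrite -EFinM lee_fin; apply: mulr_ge0 => //; exact: mulr_ge0.
have Bc s : 0 <= (2 * c)^-1%:E * (\1_B s)%:E by apply: mule_ge0; rewrite ?lee_fin.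
move: hZ; rewrite EED => [|s|s]; [|by rewrite lee_fin divr_ge0// ltW|exact: adde_ge0].
rewrite EED// (EE_cst X_iid) ?divr_ge0 ?(ltW mu0)//.
rewrite (EE_Zl X_iid) => [||s]; [|by []|by rewrite lee_fin mulr_ge0].
rewrite (EE_Zl X_iid)//.
have -> : EE P X k (fun s => (Z s * Z s)%:E) = \sum_(i <- V) \sum_(j <- V) EEi k (A i `&` A j).
  transitivity (EE P X k (fun s => \sum_(i <- V) \sum_(j <- V) (\1_(A i `&` A j) s)%:E)).
    by apply: eq_EE => s *; exact: Z2.
  rewrite (EE_sum X_iid) => [|i s]; last by apply: sume_ge0 => j _; rewrite lee_fin.
  by apply: eq_bigr => i _; rewrite (EE_sum X_iid)// => j s; rewrite lee_fin.
move=> h; have hfin : EEi k B \is a fin_num.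
  by rewrite ge0_fin_numE ?EEi_ge0// (le_lt_trans (EEi_le1 _ _))// ltry.
have : mu%:E <= (mu / 2)%:E + ((c / 2)%:E * S%:E + (2 * c)^-1%:E * EEi k B).
  apply: (le_trans h); apply: leeD2l; apply: leeD2r; apply: lee_wpmul2l => //.
rewrite -(fineK hfin) -!EFinM -!EFinD !lee_fin; move: (fine _) => p.
have -> : (c / 2 * S = mu / 4)%R by rewrite /c; field; rewrite gt_eqF.
move=> hp; have : (mu / 4 <= (2 * c)^-1 * p)%R by lra.
have cc : (0 < 2 * c)%R by rewrite mulr_gt0.
rewrite [leRHS]mulrC ler_pdivlMr// => hp'.
suff -> : (mu ^+ 2 / (4 * S) = mu / 4 * (2 * c))%R by [].
by rewrite /c; field; rewrite gt_eqF.
Qed.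

End path_events.

(** * Lower bound for the visits to one site *)

Section visits_lower_bound.
Context d (T : measurableType d) (R : realType) (P : probability T R).
Context (X : nat -> T -> Z2) (X_iid : iid P X) (symX : symmetric_law P (X 0%N)).
Context (varX : finite_variance P (X 0%N)).
Context (C : R) (C0 : 0 < C)
  (hC : forall th x, 1 - cos (ip th x) <= C * sqn R x * (1 - charf P (X 0%N) th)).
Local Notation mX := (iid_measurable X_iid 0%N).
Local Notation gq := (gq P (X 0%N)).
Local Notation U := (U P (X 0%N)).
Local Notation lev := (lev P X).

Lemma natr_powRE (m : nat) (x : R) : (0 < m)%N -> (m%:R : R) `^ x = expR (x * ln m%:R).
Proof. by move=> m0; rewrite /powR pnatr_eq0 gtn_eqF. Qed.

Lemma one_sub_geo (q : R) n : 1 < q -> expR (- (n%:R / (q - 1))) <= (1 - q^-1) ^+ n.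
Proof.
move=> q1; have q0 : 0 < q by lra. have q2 : 0 < q - 1 by rewrite subr_gt0.
rewrite -mulrN expRM_natl; apply: lerXn2r; rewrite ?nnegrE ?expR_ge0//.
  by rewrite subr_ge0 invf_le1// ltW.
rewrite expRN -[leRHS]invrK lef_pV2 ?posrE ?expR_gt0 ?invr_gt0 ?subr_gt0 ?invf_lt1//.
apply: le_trans (expR_ge1Dx _); rewrite le_eqVlt; apply/orP; left; apply/eqP.
by field; rewrite ?gt_eqF//.
Qed.

Lemma expR_sqr (y : R) : 0 <= y -> y ^+ 2 / 4 <= expR y.
Proof.
move=> y0; have h := expR_ge1Dx (y / 2).
have -> : y = y / 2 + y / 2 by field.
rewrite expRD; move: (expR _) h => E h; nra.
Qed.

(** For the killed walk the law of visits is explicit: a hitting probability, bounded below here,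
    times a geometric tail of mean about al [U m]. [visits_ge_prob] removes the killing. *)
Lemma visits_lower (a b e : R) : 0 < a -> 0 < b < 1 -> 0 < e ->
  \forall m \near \oo, forall z, sqn R z <= 2 * m%:R `^ b ->
  ((m%:R `^ (- (a + e)))%:E <=
   EEi P X m [set s | (a * lev m <= visits R z 0 s)%R])%E.
Proof.
move=> a0 /andP[b0 b1] e0; have c2 : 0 < 2 :> R by [].
pose ze := Num.min ((1 - b) / 2) (Num.min (4^-1) (e / (16 * a))).
have z0 : 0 < ze by rewrite !lt_min; apply/and3P; split; [rewrite divr_gt0// subr_gt0|rewrite invr_gt0|rewrite divr_gt0// mulr_gt0].
have z1 : ze <= (1 - b) / 2 by rewrite ge_min lexx.
have z2 : ze <= 4^-1 by rewrite !ge_min lexx orbT.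
have z3 : ze * (16 * a) <= e.
  by rewrite -ler_pdivlMr ?mulr_gt0// !ge_min lexx !orbT.
(* With al slightly below 1 the killed walk survives m steps with probability at most exp(- m^ze),
   smaller than any power of m, while the exponent a / al stays within e / 2 of a. *)
pose al := 1 - ze; pose c := (al - b) / 4.
have alb : b < al by rewrite /al; lra.
have c0 : 0 < c by rewrite divr_gt0// subr_gt0.
pose e1 := Num.min (ze / 2) ((al - b) / 2).
have e10 : 0 < e1 by rewrite lt_min !divr_gt0// subr_gt0.
have e1z : e1 <= ze / 2 by rewrite ge_min lexx.
have e1b : e1 <= (al - b) / 2 by rewrite ge_min lexx orbT.
have bal : 0 < b < al by rewrite b0.
have c20 : 0 < c / 2 by rewrite divr_gt0.
have e20 : 0 < e / 2 by rewrite divr_gt0.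
have al0 : 0 < al by lra.
have al1 : al <= 1 by rewrite /al; lra.
have auxq (u q L : R) : 0 < u -> (al - e1) * u <= q -> 1 <= e1 * u ->
    - ((a + e / 2) * L) <= - (a * (u * L) / (q - 1)) \/ L < 0.
  move=> u0 hq hu; have [L0|L0] := leP 0 L; [left|by right].
  have d0 : 0 < q - 1 by nra.
  rewrite lerN2 ler_pdivrMr//.
  have h : (1 - 2 * ze) * u <= q - 1 by rewrite /al in hq *; nra.
  have h2 : a <= (a + e / 2) * (1 - 2 * ze) by nra.
  have h3 : a * u <= (a + e / 2) * (q - 1).
    apply: (@le_trans _ _ ((a + e / 2) * ((1 - 2 * ze) * u))); last by rewrite ler_pM2l//; lra.
    by rewrite mulrA ler_pM2r.
  by rewrite mulrA -subr_ge0 mulrAC -mulrBl mulr_ge0// subr_ge0.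
have auxr (u q g : R) : 0 < u -> q <= (al + e1) * u -> 0 < q -> (al - b - e1) * u <= g -> c <= g / q.
  move=> u0 hq q0 hg; rewrite ler_pdivlMr//; apply: le_trans hg.
  have q2 : q <= 2 * u by apply: (le_trans hq); rewrite ler_pM2r//; lra.
  apply: (@le_trans _ _ (c * (2 * u))); first by rewrite ler_pM2l.
  by rewrite mulrA ler_pM2r// /c; lra.
have ale : 0 < al - e1 by lra.
have auxU (u : R) : 2 / (al - e1) <= u -> 1 < (al - e1) * u.
  by rewrite ler_pdivrMr// mulrC => h; lra.
have auxf (q x y : R) : 0 < q -> x <= c / 2 -> 0 < x -> y <= 1 -> q * x <= c * q - q * x * y.
  move=> q0 hx x0 y1; rewrite [c * q]mulrC -mulrA -mulrBr ler_pM2l//; nra.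
have auxz (L : R) : 1 <= L -> 4 * (a + 2 * e) / ze ^+ 2 <= L -> (a + 2 * e) * L <= (ze * L) ^+ 2 / 4.
  move=> L1; have zz : 0 < ze ^+ 2 by rewrite exprn_gt0.
  rewrite ler_pdivrMr// exprMn; move: (ze ^+ 2) zz => w w0 hw; nra.
near=> m => z hz.
have m1 : (1 < m)%N by near: m; exact: nbhs_infty_gt.
have m0 : (0 < m)%N by exact: ltnW.
have U1 : e1^-1 <= U m by near: m; exact: (U_near mX varX C0 hC).
have U0 : 0 < U m by apply: lt_le_trans U1; rewrite invr_gt0.
have U2 : 2 / (al - e1) <= U m by near: m; exact: (U_near mX varX C0 hC).
have [_ k01] : 2^-1 <= (kill al m : R) /\ 0 < (kill al m : R) < 1 by near: m; exact: kill_near.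
have /andP[hq1 hq2] : (al - e1) * U m <= gq al m 0 <= (al + e1) * U m.
  by near: m; apply: (gq0_near mX varX C0 hC).
have hg : (al - b - e1) * U m <= gq al m z.
  by move: z hz; near: m; apply: (gq_near_near mX symX varX C0 hC).
have L1 : 1 <= ln (m%:R : R) by near: m; exact: ln_near.
have L0 : 0 <= ln (m%:R : R) by exact: le_trans ler01 L1.
have L2 : 4 * (a + 2 * e) / ze ^+ 2 <= ln (m%:R : R) by near: m; exact: ln_near.
have L3 : (m%:R : R) `^ (- (e / 2)) <= c / 2 by near: m; apply: powRN_near.
have L4 : (m%:R : R) `^ (- e) <= c / 2 by near: m; apply: powRN_near.
set t := (Num.truncn (a * lev m)).+1.
have lev0 : 0 <= a * lev m by rewrite !levE; apply: mulr_ge0; [exact: ltW|apply: mulr_ge0; [exact: ltW|lra]].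
apply: (@le_trans _ _ (EEi P X m [set s | t%:R <= visits R z 0 s])); last first.
  apply: (EEi_le X_iid) => s _ /=; apply: le_trans; exact/ltW/truncnS_gt.
apply: le_trans (visits_ge_prob X_iid symX k01 z t m 0).
rewrite lee_fin /killed_visits /t sub0r.
have q1 : 1 < gq al m 0.
  exact: lt_le_trans (auxU _ U2) hq1.
have hr : c <= green P (X 0%N) (kill al m) (- z) / green P (X 0%N) (kill al m) 0.
  rewrite greenN; apply: (auxr (U m)) => //; exact: lt_trans q1.
have hpow : m%:R `^ (- (a + e / 2)) <= (1 - (green P (X 0%N) (kill al m) 0)^-1) ^+ (Num.truncn (a * lev m)).
  apply: le_trans (one_sub_geo _ q1); rewrite natr_powRE// ler_expR.
  have [|h|] := auxq (U m) (gq al m 0) (ln m%:R) U0 hq1; last by rewrite ltNge L0.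
    by rewrite mulrC -ler_pdivrMr// div1r.
  rewrite mulNr; apply: (le_trans h); rewrite lerN2 ler_pM2r ?invr_gt0 ?subr_gt0//.
  by rewrite truncn_le.
have hk : kill al m ^+ m <= m%:R `^ (- (a + 2 * e)).
  rewrite /kill; apply: (@le_trans _ _ (expR (- m%:R `^ (- al)) ^+ m)).
    apply: lerXn2r; rewrite ?nnegrE ?expR_ge0//; last exact: expR_ge1Dx.
    by case/andP: k01 => /ltW.
  rewrite -expRM_natl [leRHS]natr_powRE// ler_expR mulrN mulNr lerN2.
  have -> : m%:R * m%:R `^ (- al) = m%:R `^ ze :> R.
    by rewrite -{1}[m%:R]powRr1// -natr_powRD// /al opprB addrC subrK.
  rewrite natr_powRE//; apply: le_trans (expR_sqr _); last exact: mulr_ge0 (ltW z0) L0.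
  exact: auxz.
apply: (@le_trans _ _ (c * m%:R `^ (- (a + e / 2)) - m%:R `^ (- (a + 2 * e)))); last first.
  apply: lerB => //; apply: ler_pM => //; exact: ltW.
have E1 : m%:R `^ (- (a + e)) = m%:R `^ (- (a + e / 2)) * m%:R `^ (- (e / 2)) :> R.
  by rewrite -natr_powRD//; congr (_ `^ _); field.
have E2 : m%:R `^ (- (a + 2 * e)) = m%:R `^ (- (a + e / 2)) * m%:R `^ (- (e / 2)) * m%:R `^ (- e) :> R.
  by rewrite -!natr_powRD//; congr (_ `^ _); field.
have p0 := natr_powR_gt0 (- (a + e / 2)) m0.
have L5 : (m%:R : R) `^ (- e) <= 1.
  by rewrite -[leRHS](powRr0 (m%:R : R)) ler_powR ?ler1n// oppr_le0 ltW.
by rewrite E1 E2; apply: auxf => //; exact: natr_powR_gt0.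
Unshelve. all: by end_near. Qed.

End visits_lower_bound.

(** * Truncated second moment of the number of thick sites *)

Section second_moment.
Context d (T : measurableType d) (R : realType) (P : probability T R).
Context (X : nat -> T -> Z2) (X_iid : iid P X) (symX : symmetric_law P (X 0%N)).
Context (varX : finite_variance P (X 0%N)).
Context (C : R) (C0 : 0 < C)
  (hC : forall th x, 1 - cos (ip th x) <= C * sqn R x * (1 - charf P (X 0%N) th)).
Local Notation mX := (iid_measurable X_iid 0%N).
Local Notation gq := (gq P (X 0%N)).
Local Notation U := (U P (X 0%N)).
Local Notation lev := (lev P X).
Local Notation sz b m := ((size (annulus b m : seq Z2))%:R : R).

Lemma absorb_near (M e : R) : 0 < e -> \forall m \near \oo, (0 < m)%N /\
  forall x, M * m%:R `^ x <= (m%:R : R) `^ (x + e).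
Proof.
move=> e0; near=> m; have m0 : (0 < m)%N by near: m; exact: nbhs_infty_gt.
have hM : ln (Num.max 1 M) / e <= ln (m%:R : R) by near: m; exact: ln_near.
split=> // x; rewrite natr_powRD// mulrC ler_wpM2l ?powR_ge0//.
have M1 : 0 < Num.max 1 M by rewrite lt_max ltr01.
apply: (@le_trans _ _ (Num.max 1 M)); first by rewrite le_max lexx orbT.
by rewrite natr_powRE// -[leLHS]lnK ?posrE// ler_expR mulrC -ler_pdivrMr.
Unshelve. all: by end_near. Qed.

(** With A = 1 / k and e = k^2 / 10 all errors in the exponent of [pair_tail] are of order k. For b
    = 1 - rho the limiting exponent is - a (1 + b), and - a (1 + b) <= 1 - 2a - b is (1 - a) (1 - b)
    >= 0. *)
Lemma pair_arith (a k rho e : R) : 0 < a < 1 -> 0 < k <= 2^-1 -> k <= rho <= 1 ->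
  e = k ^+ 2 / 10 ->
  - (2 * (k^-1 / (1 + k^-1 * (1 + (k + e) + 3 * e))) * a -
     (1 + k) * a * rho ^+ 2 / (rho - 3 * e)) + k <= 1 - 2 * a + 10 * k - (1 - rho).
Proof.
move=> /andP[a0 a1] /andP[k0 k1] /andP[kr r1] eE.
have e0 : 0 < e by rewrite eE divr_gt0// exprn_gt0.
have ek : e <= k / 20 by rewrite eE; nra.
have D0 : 0 < 1 + 2 * k + 4 * e by lra.
have -> : k^-1 / (1 + k^-1 * (1 + (k + e) + 3 * e)) = (1 + 2 * k + 4 * e)^-1.
  by field; rewrite !gt_eqF//; nra.
have h1 : 1 - 3 * k <= (1 + 2 * k + 4 * e)^-1.
  by rewrite -[leRHS]mul1r ler_pdivlMr//; nra.
have r3 : 0 < rho - 3 * e by lra.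
have h2 : rho ^+ 2 / (rho - 3 * e) <= rho * (1 + k).
  rewrite ler_pdivrMr// expr2 -mulrA ler_pM2l; last lra.
  have : 3 * e * (1 + k) <= k * rho by rewrite eE; nra.
  by lra.
have h3 : (1 + k) * a * rho ^+ 2 / (rho - 3 * e) <= a * rho + 3 * k.
  rewrite -mulrA; apply: (@le_trans _ _ ((1 + k) * a * (rho * (1 + k)))).
    by rewrite ler_wpM2l// mulr_ge0//; lra.
  have : a * rho <= 1 by nra.
  have : 0 < a * rho by rewrite mulr_gt0//; lra.
  move=> p0 p1; have -> : (1 + k) * a * (rho * (1 + k)) = a * rho * (1 + k) ^+ 2 by ring.
  by nra.
have h4 : (1 - 3 * k) * a <= (1 + 2 * k + 4 * e)^-1 * a by rewrite ler_wpM2r// ltW.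
have h5 : 0 <= (1 - a) * (1 - rho) by apply: mulr_ge0; lra.
have h6 : 0 <= (1 - a) * rho by apply: mulr_ge0; lra.
have h7 : k * a <= k by rewrite ler_piMr// ltW.
move: h3 h4; set W := _ / (rho - 3 * e); set V := _^-1 => h3 h4.
by move: W V h3 h4 => W V h3 h4; lra.
Qed.

Lemma far_arith (a k e : R) : 0 < a < 1 -> 0 < k <= 2^-1 -> e = k ^+ 2 / 10 ->
  - (2 * (k^-1 / (1 + k^-1 * (1 + (k + e) + 3 * e))) * a) + k <= - 2 * a + 8 * k.
Proof.
move=> /andP[a0 a1] /andP[k0 k1] eE.
have e0 : 0 < e by rewrite eE divr_gt0// exprn_gt0.
have ek : e <= k / 20 by rewrite eE; nra.
have D0 : 0 < 1 + 2 * k + 4 * e by lra.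
have -> : k^-1 / (1 + k^-1 * (1 + (k + e) + 3 * e)) = (1 + 2 * k + 4 * e)^-1.
  by field; rewrite !gt_eqF//; nra.
have h1 : 1 - 3 * k <= (1 + 2 * k + 4 * e)^-1.
  by rewrite -[leRHS]mul1r ler_pdivlMr//; nra.
by move: (_^-1) h1 => W h1; nra.
Qed.

Lemma card_bx_le (b : R) m : (0 < m)%N -> 0 < b -> (#|` bx (rad b m)|)%:R <= 9 * (m%:R : R) `^ b.
Proof.
move=> m0 b0; rewrite card_bx; have /andP[h _] := rad_bounds b m0.
have p1 : 1 <= (m%:R : R) `^ b by rewrite -[leLHS](powRr0 (m%:R : R)) ler_powR ?ler1n// ltW.
apply: (@le_trans _ _ (8 * (rad b m)%:R ^+ 2 + 1)); last by lra.
by rewrite -natrX -natrM natr1 ler_nat; move: (rad b m) => r; nia.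
Qed.

Lemma card_bx_ge (b : R) m : (0 < m)%N -> (m%:R : R) `^ b <= (#|` bx (rad b m)|)%:R.
Proof.
move=> m0; rewrite card_bx; have /andP[_ h] := rad_bounds b m0; apply: (le_trans h).
by rewrite -natrX ler_nat; move: (rad b m) => r; nia.
Qed.

Lemma count_bx (V : {fset Z2}) (z : Z2) r :
  (count (fun z' : Z2 => (z' - z)%R \in bx r) (enum_fset V) <= #|` bx r|)%N.
Proof.
rewrite -size_filter cardfE /= -?cardfE -(size_map (fun z' : Z2 => z' - z)).
apply: uniq_leq_size.
  by rewrite map_inj_uniq ?filter_uniq ?fset_uniq// => x y /addIr.
by move=> y /mapP[x]; rewrite mem_filter => /andP[h _] ->.
Qed.

Context (a : R) (a01 : 0 < a < 1) (n : nat).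
Let k : R := (n.+2%:R)^-1.
Let bk (i : nat) : R := i%:R * k.
Let kap i := (1 + k) * a * (1 - bk i) ^+ 2.

(** For a near 1 the plain second moment of the number of thick sites is too large, because of rare
    clusters. Requiring the typical profile a (1 - b)^2, up to a factor 1 + k, at the scales b = i k
    removes these clusters. *)
Definition good m z : set (seq Z2) := [set s | a * lev m <= visits R z 0 s /\
  forall i, (0 < i < n.+2)%N -> annulus_visits (bk i) m z s <= kap i * (lev m * sz (bk i) m)].

Let k0 : 0 < k. Proof. by rewrite invr_gt0. Qed.
Let k1 : k <= 2^-1. Proof. by rewrite lef_pV2 ?posrE// ler_nat. Qed.
Let kn : n.+2%:R * k = 1. Proof. by rewrite mulfV// pnatr_eq0. Qed.
Let bk01 i : (0 < i < n.+2)%N -> 0 < bk i < 1.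
Proof.
move=> /andP[i0 i1]; rewrite /bk mulr_gt0 ?ltr0n//=.
by rewrite /k ltr_pdivrMr ?ltr0n// mul1r ltr_nat.
Qed.
Let bk_ge i : (0 < i < n.+2)%N -> k <= 1 - bk i.
Proof.
move=> /andP[i0 i1]; rewrite -kn /bk -mulrBl -[leLHS]mul1r ler_pM2r// lerBrDr.
by rewrite addrC natr1 ler_nat.
Qed.
Let a0 : 0 < a. Proof. by case/andP: a01. Qed.
Let a1 : a < 1. Proof. by case/andP: a01. Qed.

(** The truncation is almost free: each violated annulus constraint costs a power of m more than the
    event of being thick ([annulus_tail]), and there are n + 1 of them. *)
Lemma good_lower : \forall m \near \oo, forall z, sqn R z <= 2 * m%:R `^ (1 - k) ->
  ((m%:R `^ (- (a + 2 * k)))%:E <= EEi P X m (good m z))%E.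
Proof.
(* With eta = k and 1 - b >= k the gain in [annulus_tail] is at least a k^3 / 16 = 4 ga; one ga
   absorbs its constant, another one the number of scales, and e <= ga is kept for
   [visits_lower]. *)
pose ga := a * k ^+ 3 / 64; have ga0 : 0 < ga by rewrite divr_gt0// mulr_gt0// exprn_gt0.
pose e := Num.min ga k; have e0 : 0 < e by rewrite lt_min ga0.
have eg : e <= ga by rewrite ge_min lexx. have ek : e <= k by rewrite ge_min lexx orbT.
have b01 : 0 < 1 - k < 1 by have := k0; have := k1; lra.
have nv := visits_lower X_iid symX varX C0 hC a0 b01 e0.
pose E i m z : set (seq Z2) := [set s | a * lev m <= visits R z 0%R s /\
     (1 + k) * a * (1 - bk i) ^+ 2 * (lev m * sz (bk i) m) <= annulus_visits (bk i) m z s].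
have nE : \forall m \near \oo, forall i : 'I_n.+2, (0 < i)%N -> forall z,
    (EEi P X m (E i m z) <= (m%:R `^ (- (a + 3 * ga)))%:E)%E.
  apply: filter_forall => -[i ii] /=; have [i0|i0] := ltnP 0 i; last first.
    by apply: nearW => m.
  have i01 : (0 < i < n.+2)%N by rewrite i0.
  have k01 : 0 < k <= 1 by rewrite k0/=; have := k1; lra.
  have [M M0 hM] := annulus_tail X_iid symX varX C0 hC a0 (bk01 i01) k01.
  have := absorb_near M ga0; apply: filterS2 hM => m hM [m0 hA] _ z.
  apply: (le_trans (hM z)); rewrite lee_fin; apply: (le_trans (hA _)).
  apply: ler_powR; first by rewrite ler1n.
  have := bk_ge i01; have : 0 < a * k ^+ 2 by rewrite mulr_gt0// exprn_gt0.
  rewrite /ga; move: (bk i) => b; have -> : a * k ^+ 3 = (a * k ^+ 2) * k by ring.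
  have -> : a * (1 + k ^+ 2 * (1 - b) / 16) = a + (a * k ^+ 2) * (1 - b) / 16 by ring.
  by move: (a * k ^+ 2) => w w0 h; nra.
have nA := absorb_near (2 * n.+2%:R) ga0.
have nB := absorb_near 2 k0.
apply: filterS3 nv (filterI nA nB) nE => m hv [[m0 hA] [_ hB]] hE z hz.
have h1 : (EEi P X m [set s | (a * lev m <= visits R z 0 s)%R] <=
   EEi P X m (good m z) + \sum_(i <- iota 1 n.+1) EEi P X m (E i m z))%E.
  apply: (EEi_union X_iid) => s _ /= hs hg; apply: contrapT => hn; apply: hg; split=> // i ii.
  rewrite leNgt; apply/negP => h; apply: hn.
  have im : i \in iota 1 n.+1 by rewrite mem_iota.
  by apply: (ex_intro2 _ _ i im); split=> //; exact: ltW.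
have h2 : (\sum_(i <- iota 1 n.+1) EEi P X m (E i m z) <= (n.+2%:R * m%:R `^ (- (a + 3 * ga)))%:E)%E.
  apply: (@le_trans _ _ (\sum_(i <- iota 1 n.+1) (m%:R `^ (- (a + 3 * ga)))%:E)%E).
    rewrite big_seq [leRHS]big_seq; apply: lee_sum => i; rewrite mem_iota => /andP[i0 i1].
    exact: (hE (Ordinal (i1 : (i < n.+2)%N))).
  rewrite sumEFin lee_fin big_const_seq count_predT size_iota iter_addr addr0 -[leLHS]mulr_natl.
  by rewrite ler_wpM2r ?powR_ge0// ler_nat.
have h3 := le_trans (hv z hz) (le_trans h1 (leeD2l _ h2)).
move: h3; rewrite -leeBlDr// -EFinB; apply: le_trans; rewrite lee_fin.
have := hA (- (a + 3 * ga)); have := hB (- (a + 2 * k)).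
have : (m%:R : R) `^ (- (a + 3 * ga) + ga) <= m%:R `^ (- (a + e)) by apply: ler_powR; [rewrite ler1n|lra].
have : (m%:R : R) `^ (- (a + 2 * k) + k) <= m%:R `^ (- (a + e)) by apply: ler_powR; [rewrite ler1n|lra].
move: (_ `^ (- (a + e))) (_ `^ (- (a + 3 * ga))) (_ `^ (- (a + 2 * k))) => x y w; rewrite -mulrA; lra.
Qed.

(** For sites whose distance lies between the scales i - 1 and i, the constraint of the annulus of
    scale i around the first one enters [pair_tail]. At the smallest scale the bound for one site is
    enough. *)
Lemma good_pair_near i : (0 < i < n.+2)%N -> \forall m \near \oo, forall z1 z2,
  z2 - z1 \in bx (rad (bk i) m) -> (i = 1%N \/ z2 - z1 \notin bx (rad (bk i.-1) m)) ->
  (EEi P X m (good m z1 `&` good m z2) <= (m%:R `^ (1 - 2 * a + 10 * k - bk i))%:E)%E.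
Proof.
move=> i01; have [i1|i1] := eqVneq i 1%N.
  have [M M0 hM] := visits_tail X_iid symX varX C0 hC a0 k0.
  have := absorb_near M k0; apply: filterS2 hM => m hM [m0 hA] z1 z2 _ _.
  apply: le_trans (_ : EEi P X m [set s | (a * lev m <= visits R z1 0 s)%R] <= _)%E.
    by apply: (EEi_le X_iid) => s _ [[]].
  apply: (le_trans (hM z1)); rewrite lee_fin; apply: (le_trans (hA _)).
  apply: ler_powR; first by rewrite ler1n.
  by rewrite i1 /bk mul1r; have := k0; have := a1; lra.
have i2 : (0 < i.-1 < n.+2)%N by case: i i01 i1 => [|[|i]]//= ii _; rewrite ltnW.
pose e := k ^+ 2 / 10; have e0 : 0 < e by rewrite divr_gt0// exprn_gt0.
have ik0 : 0 < k^-1 by rewrite invr_gt0.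
have Ae : k^-1 * e <= 2^-1.
  by rewrite /e expr2 -mulrA mulKf ?gt_eqF//; have := k1; lra.
have e3 : 3 * e < 1 - bk i.
  by apply: lt_le_trans (bk_ge i01); have := k1; have := k0; rewrite /e; nra.
have g0 : 0 <= k + e by apply: addr_ge0; exact: ltW.
have [M M0 hM] := pair_tail X_iid symX varX C0 hC (kap i) a0 (bk01 i01) e0 ik0 Ae e3 g0.
have nf := gq_far_near mX symX varX C0 hC (bk01 i2) e0 (@ltr01 R).
have := absorb_near M k0; apply: filterS3 hM nf => m hM hf [m0 hA] z1 z2 zi [//|zn].
  by move=> /eqP; rewrite (negbTE i1).
have p0 : 0 <= (m%:R : R) `^ bk i by exact: powR_ge0.
apply: le_trans (le_trans (hM z1 z2 _ _) _).
- apply: (EEi_le X_iid) => s _ [[h1 h2] [h3 _]]; split=> //; exact: h2.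
- apply: (le_trans (sqn_in_bx R zi)); have /andP[h _] := rad_bounds (bk i) m0; lra.
- have -> : 1 - bk i + (k + e) = 1 - bk i.-1 + e.
    by rewrite /bk -{1}(prednK (proj1 (andP i01))) -natr1; ring.
  apply: hf; rewrite mul1r; apply: le_trans (sqn_notin_bx R zn).
  by have /andP[] := rad_bounds (bk i.-1) m0.
rewrite lee_fin; apply: (le_trans (hA _)); apply: ler_powR; first by rewrite ler1n.
have := @pair_arith a k (1 - bk i) e a01.
rewrite (_ : 1 - (1 - bk i) = bk i); last by ring.
by apply => //; rewrite ?k0 ?k1 ?bk_ge//=; have /andP[] := bk01 i01; lra.
Qed.

Lemma good_far_near : \forall m \near \oo, forall z1 z2,
  z2 - z1 \notin bx (rad (bk n.+1) m) ->
  (EEi P X m (good m z1 `&` good m z2) <= (m%:R `^ (- 2 * a + 8 * k))%:E)%E.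
Proof.
pose e := k ^+ 2 / 10; have e0 : 0 < e by rewrite divr_gt0// exprn_gt0.
have ik0 : 0 < k^-1 by rewrite invr_gt0.
have g0 : 0 <= k + e by apply: addr_ge0; exact: ltW.
have i01 : (0 < n.+1 < n.+2)%N by rewrite !ltnS leqnn.
have [M M0 hM] := far_pair_tail X_iid symX varX C0 hC a0 e0 ik0 g0.
have nf := gq_far_near mX symX varX C0 hC (bk01 i01) e0 (@ltr01 R).
have := absorb_near M k0; apply: filterS3 hM nf => m hM hf [m0 hA] z1 z2 zn.
apply: le_trans (le_trans (hM z1 z2 _) _).
- by apply: (EEi_le X_iid) => s _ [[h1 h2] [h3 _]].
- have -> : k + e = 1 - bk n.+1 + e by rewrite -kn /bk -natr1; ring.
  apply: hf; rewrite mul1r; apply: le_trans (sqn_notin_bx R zn).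
  by have /andP[] := rad_bounds (bk n.+1) m0.
rewrite lee_fin; apply: (le_trans (hA _)); apply: ler_powR; first by rewrite ler1n.
by apply: far_arith => //; rewrite k0 k1.
Qed.

(** At most 9 m^b sites lie within scale b of z1 and each pair costs m^(1 - 2a + 10k - b): every
    scale contributes the same power of m, and the far pairs contribute no more. *)
Lemma good_pairs_sum : \forall m \near \oo, forall (V : {fset Z2}) z1,
  (#|` V|)%:R <= 9 * (m%:R : R) `^ (1 - k) ->
  (\sum_(z2 <- V) EEi P X m (good m z1 `&` good m z2) <= (m%:R `^ (1 - 2 * a + 11 * k))%:E)%E.
Proof.
have nP : \forall m \near \oo, forall i : 'I_n.+2, (0 < i)%N -> forall z1 z2,
    z2 - z1 \in bx (rad (bk i) m) -> (i = 1%N :> nat \/ z2 - z1 \notin bx (rad (bk i.-1) m)) ->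
    (EEi P X m (good m z1 `&` good m z2) <= (m%:R `^ (1 - 2 * a + 10 * k - bk i))%:E)%E.
  apply: filter_forall => -[i ii] /=; have [i0|i0] := ltnP 0 i; last by apply: nearW => m.
  have i01 : (0 < i < n.+2)%N by rewrite i0.
  by apply: filterS (good_pair_near i01) => m h _; exact: h.
have nA := absorb_near (9 * n.+3%:R) k0.
apply: filterS3 nP good_far_near nA => m hP hF [m0 hA] V z1 hV.
pose w i := (m%:R : R) `^ (1 - 2 * a + 10 * k - bk i).
pose wf := (m%:R : R) `^ (- 2 * a + 8 * k).
have w0 i : 0 <= w i by exact: powR_ge0. have wf0 : 0 <= wf by exact: powR_ge0.
pose h z2 := \sum_(i <- iota 1 n.+1) (z2 - z1 \in bx (rad (bk i) m))%:R * w i + wf.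
apply: (@le_trans _ _ (\sum_(z2 <- V) (h z2)%:E)%E).
  apply: lee_sum => z2 _; have [zV|zV] := boolP (z2 - z1 \in bx (rad (bk n.+1) m)); last first.
    apply: (le_trans (hF _ _ zV)); rewrite lee_fin /h lerDr sumr_ge0// => i _.
    exact: mulr_ge0.
  pose p i := (0 < i)%N && (z2 - z1 \in bx (rad (bk i) m)).
  have exp : exists i, p i by exists n.+1; rewrite /p /= zV.
  (* The least scale whose box contains the difference; it lies outside the box of the preceding
     scale. *)
  have [i /andP[i0 ib] imin] := ex_minnP exp.
  have iin : (i < n.+2)%N by rewrite ltnS imin// /p zV.
  have := hP (Ordinal iin) i0 z1 z2 ib; move=> /= H.
  apply: le_trans (H _) _.
    have [i1|i1] := eqVneq i 1%N; [by left|right]; apply/negP => hb.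
    have : (i <= i.-1)%N by apply: imin; rewrite /p hb andbT -ltnS prednK// ltn_neqAle eq_sym i1.
    by rewrite leqNgt ltn_predL i0.
  have im : i \in iota 1 n.+1 by rewrite mem_iota i0.
  rewrite lee_fin /h (big_rem i im) /=.
  rewrite ib mul1r -/(w i) -[leRHS]addrA lerDl; apply: addr_ge0 => //.
  by apply: sumr_ge0 => j _; exact: mulr_ge0.
rewrite sumEFin lee_fin /h big_split /= exchange_big /=.
have hc i : (0 < i < n.+2)%N ->
    \sum_(z2 <- V) (z2 - z1 \in bx (rad (bk i) m))%:R * w i <= 9 * m%:R `^ (1 - 2 * a + 10 * k).
  move=> i01; rewrite -mulr_suml.
  have -> : \sum_(z2 <- V) (z2 - z1 \in bx (rad (bk i) m))%:R =
      (count (fun z2 : Z2 => z2 - z1 \in bx (rad (bk i) m)) (enum_fset V))%:R :> R.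
    rewrite -sum1_count natr_sum [RHS]big_mkcond; apply: eq_bigr => z2 _.
    by case: ifP.
  have /andP[b0 _] := bk01 i01.
  have h1 := count_bx V z1 (rad (bk i) m); have h2 := card_bx_le m0 b0.
  apply: (@le_trans _ _ (9 * m%:R `^ bk i * w i)).
    by rewrite ler_wpM2r//; apply: le_trans h2; rewrite ler_nat.
  by rewrite /w -mulrA -natr_powRD// addrC subrK.
apply: le_trans (_ : _ <= \sum_(i <- iota 1 n.+1) (9 * m%:R `^ (1 - 2 * a + 10 * k)) + 9 * m%:R `^ (1 - k) * wf) _.
  apply: lerD.
    rewrite big_seq [leRHS]big_seq; apply: ler_sum => i.
    by rewrite -[1%N :: iota 2 n]/(iota 1 n.+1) mem_iota => ii; exact: hc.
  rewrite big_const_seq count_predT iter_addr addr0 -[leLHS]mulr_natl ler_wpM2r//.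
rewrite big_const_seq count_predT size_iota iter_addr addr0 -[X in X + _]mulr_natl /wf -mulrA -natr_powRD//.
have hw : (m%:R : R) `^ (1 - k + (- 2 * a + 8 * k)) <= m%:R `^ (1 - 2 * a + 10 * k).
  by apply: ler_powR; [rewrite ler1n|have := k0; lra].
have := hA (1 - 2 * a + 10 * k); rewrite (_ : _ + k = 1 - 2 * a + 11 * k); last by ring.
have p0 : 0 <= (m%:R : R) `^ (1 - 2 * a + 10 * k) by exact: powR_ge0.
apply: le_trans; rewrite (_ : n.+3%:R = n.+1%:R + 2 :> R); last by rewrite -natrD addn2.
move: (n.+1%:R : R) (ler0n R n.+1) hw p0 => N N0.
by move: (_ `^ _) (_ `^ _) => x y hw p0; nra.
Qed.

(** Take for V the box of about m^(1 - k) sites. The mean number of good sites is at least m^(1 - a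
    - 3k) and the second moment at most m^(2 - 2a + 11k), so that [second_moment_method] gives the
    probability m^(-17k) / 4. *)
Lemma thick_block : \forall m \near \oo, exists V : {fset Z2},
  ((m%:R `^ (- (18 * k)))%:E <= EEi P X m [set s | (m%:R `^ (1 - a - 4 * k) <=
     \sum_(z <- V) \1_[set s | (a * lev m <= visits R z 0 s)%R] s)%R])%E.
Proof.
have bn : bk n.+1 = 1 - k by rewrite /bk -[n.+1%:R](addrK 1) natr1 mulrBl kn mul1r.
have bk0 : 0 < 1 - k by have := k1; lra.
have nA := absorb_near 9 k0.
apply: filterS3 good_lower good_pairs_sum nA => m hL hP [m0 hA].
exists (bx (rad (1 - k) m)); set V := bx _.
have V1 : (m%:R : R) `^ (1 - k) <= (#|` V|)%:R by exact: card_bx_ge.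
have V2 : (#|` V|)%:R <= 9 * (m%:R : R) `^ (1 - k) by exact: card_bx_le.
have pw x : 0 < (m%:R : R) `^ x by exact: natr_powR_gt0.
pose mu := (m%:R : R) `^ (1 - a - 3 * k); pose S := (m%:R : R) `^ (2 - 2 * a + 11 * k).
have h1 : (mu%:E <= \sum_(z <- V) EEi P X m (good m z))%E.
  apply: (@le_trans _ _ (\sum_(z <- V) (m%:R `^ (- (a + 2 * k)))%:E)%E); last first.
    rewrite big_seq [leRHS]big_seq; apply: lee_sum => z zV; apply: hL.
    by apply: (le_trans (sqn_in_bx R zV)); rewrite ler_pM2l//; have /andP[] := rad_bounds (1 - k) m0.
  rewrite sumEFin lee_fin big_const_seq count_predT iter_addr addr0 -[leRHS]mulr_natl.
  rewrite /mu (_ : 1 - a - 3 * k = 1 - k + - (a + 2 * k)); last by ring.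
  by rewrite natr_powRD// ler_wpM2r// ltW.
have h2 : (\sum_(z1 <- V) \sum_(z2 <- V) EEi P X m (good m z1 `&` good m z2) <= S%:E)%E.
  apply: (@le_trans _ _ (\sum_(z <- V) (m%:R `^ (1 - 2 * a + 11 * k))%:E)%E).
    by apply: lee_sum => z _; apply: hP.
  rewrite sumEFin lee_fin big_const_seq count_predT iter_addr addr0 -[leLHS]mulr_natl.
  apply: (@le_trans _ _ (9 * m%:R `^ (1 - k) * m%:R `^ (1 - 2 * a + 11 * k))).
    by rewrite ler_wpM2r// ltW.
  rewrite -mulrA -natr_powRD//; apply: (le_trans (hA _)).
  by rewrite (_ : _ + k = 2 - 2 * a + 11 * k)//; ring.
have := second_moment_method X_iid (pw _ : 0 < mu) (pw _ : 0 < S) h1 h2.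
have hA4 x : 4 * (m%:R : R) `^ x <= m%:R `^ (x + k).
  by apply: le_trans (hA x); rewrite ler_pM2r// ler_nat.
have hq : (m%:R : R) `^ (- (18 * k)) <= mu ^+ 2 / (4 * S).
  rewrite ler_pdivlMr; last by rewrite mulr_gt0// pw.
  rewrite mulrCA -natr_powRD//; apply: (le_trans (hA4 _)).
  rewrite expr2 /mu -natr_powRD// (_ : _ + k = 1 - a - 3 * k + (1 - a - 3 * k))//; ring.
move=> h; apply: le_trans (_ : (mu ^+ 2 / (4 * S))%:E <= _)%E; first by rewrite lee_fin.
apply: (le_trans h); apply: (EEi_le X_iid) => s _ /= hs.
apply: (@le_trans _ _ (mu / 2)).
  rewrite ler_pdivlMr//; have := hA4 (1 - a - 4 * k).
  rewrite (_ : 1 - a - 4 * k + k = 1 - a - 3 * k); last by ring.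
  by rewrite -/mu; have := pw (1 - a - 4 * k); lra.
apply: (le_trans hs); apply: ler_sum => z _; rewrite !indicE.
have [/set_mem[hz _]|_] := boolP (s \in good m z); last by [].
by rewrite mem_set.
Qed.

End second_moment.

(** * Thick sites in one block with a small probability *)

Section thick_lower.
Context d (T : measurableType d) (R : realType) (P : probability T R).
Context (X : nat -> T -> Z2) (X_iid : iid P X) (symX : symmetric_law P (X 0%N)).
Context (varX : finite_variance P (X 0%N)).
Context (C : R) (C0 : 0 < C)
  (hC : forall th x, 1 - cos (ip th x) <= C * sqn R x * (1 - charf P (X 0%N) th)).

Lemma thick_lower (a e : R) : 0 < a < 1 -> 0 < e -> \forall m \near \oo, exists V : {fset Z2},
  ((m%:R `^ (- e))%:E <= EEi P X m [set s | (m%:R `^ (1 - a - e) <=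
     \sum_(z <- V) \1_[set s | (a * lev P X m <= visits R z 0 s)%R] s)%R])%E.
Proof.
move=> a01 e0; pose n := Num.truncn (18 / e).
have nk : 18 * (n.+2%:R)^-1 <= e.
  rewrite ler_pdivrMr// mulrC -ler_pdivrMr//; apply: (le_trans (ltW (truncnS_gt _))).
  by rewrite ler_nat.
have n0 : 0 < (n.+2%:R)^-1 :> R by rewrite invr_gt0.
have m1 : \forall m \near \oo, (0 < m)%N by exact: nbhs_infty_gt.
apply: filterS2 m1 (thick_block X_iid symX varX C0 hC a01 n) => m m0 [V hV]; exists V.
have p1 : 1 <= m%:R :> R by rewrite ler1n.
apply: le_trans (le_trans hV _).
  by rewrite lee_fin; apply: ler_powR => //; rewrite lerN2.
apply: (EEi_le X_iid) => s _ /=; apply: le_trans.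
by apply: ler_powR => //; rewrite lerD2l lerN2 (le_trans _ nk)// ler_pM2r// ler_nat.
Qed.

End thick_lower.

(** * The Poisson clock observed on a grid *)

Section poisson_grid.
Context d (T : measurableType d) (R : realType) (P : probability T R).
Context (N : R -> T -> nat) (pois : poisson_process P 1 N).
Variable dt : R.
Hypothesis dt0 : 0 < dt.

(** On the grid the clock is a walk on [nat] with i.i.d. increments, so that the supersolution
    bounds for paths apply to it; [dt] times an occupation approximates the time spent in a set of
    levels. *)
Definition grid_incr (j : nat) (w : T) : nat := (N (dt * j.+1%:R) w - N (dt * j%:R) w)%N.

Let t0 (j : nat) : 0 <= dt * j%:R. Proof. by rewrite mulr_ge0// ltW. Qed.

Lemma discrete_rv_nat2 (U : Type) (f : nat -> nat -> U) (V W : T -> nat) :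
  discrete_rv V -> discrete_rv W -> discrete_rv (fun w => f (V w) (W w)).
Proof.
move=> mV mW B; rewrite (_ : _ @^-1` B =
    \bigcup_n (V @^-1` [set n] `&` W @^-1` [set u | B (f n u)])).
  by apply: bigcup_measurable => n _; apply: measurableI; [exact: mV|exact: mW].
apply/seteqP; split => [w /= h|w [n _ [/= <-]]//].
by exists (V w).
Qed.

Lemma grid_incr_pmf j k : P (grid_incr j @^-1` [set k]) = (poisson_pmf dt k)%:E.
Proof.
have lt : dt * j%:R < dt * j.+1%:R by rewrite ltr_pM2l// ltr_nat.
have := pp_law pois k (t0 j) lt.
by rewrite -mulrBr -natrB// subSnn mulr1 mul1r.
Qed.

Lemma grid_incr_iid : iid P grid_incr.
Proof.
have m i : discrete_rv (grid_incr i).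
  by apply: (discrete_rv_nat2 (fun a b => (a - b)%N)); apply: (pp_measurable pois).
split=> // [i B|].
  have e j : P (grid_incr j @^-1` B) = (\int[P]_w ((\1_B (grid_incr j w))%:E))%E.
    rewrite (_ : (fun w => _) = (fun w => (\1_(grid_incr j @^-1` B) w)%:E)).
      by rewrite integral_indic ?setIT//; exact: m.
    by apply/funext => w.
  rewrite !e; apply: (discrete_integral_law (F := fun u => (\1_B u)%:E)) => //.
  by move=> u; rewrite !grid_incr_pmf.
apply: (pp_indep pois (t := fun j => dt * j%:R)); first by rewrite mulr0.
by apply/nondecreasing_seqP => j; rewrite ler_pM2l// ler_nat.
Qed.

Local Notation addst := (fun x u : nat => (x + u)%N).

Lemma path_ofS a k w : path_of grid_incr a k.+1 w = rcons (path_of grid_incr a k w) (grid_incr (a + k) w).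
Proof. by rewrite /path_of -addn1 iotaD map_cat cats1. Qed.

Lemma grid_final k w : final addst 0%N (path_of grid_incr 0 k w) = N (dt * k%:R) w.
Proof.
elim: k => [|k IH]; first by rewrite mulr0 (pp_start pois).
rewrite path_ofS -cats1 final_cat IH /= add0n /grid_incr subnKC//.
by apply: (pp_nondecreasing pois) => //; rewrite ler_pM2l// ler_nat.
Qed.

Lemma grid_occ (v : nat -> R) k w :
  occ addst v 0%N (path_of grid_incr 0 k w) = \sum_(i < k) v (N (dt * i%:R) w).
Proof.
elim: k => [|k IH]; first by rewrite big_ord0.
by rewrite path_ofS -cats1 occ_cat IH grid_final big_ord_recr /= addr0.
Qed.

Let p0 : R := expR (- dt).
Let p1 : R := dt * expR (- dt).

(** One grid step is split into no jump, one jump and several jumps, the last having a probability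
    of order dt^2. *)
Lemma grid_step (phi : nat -> R) y (al be : R) : (forall z, 0 <= phi z) ->
  0 <= al -> 0 <= be ->
  (forall j, phi (y + j)%N <= phi y * (if j is j'.+1 then if j' is 0%N then al else be else 1)) ->
  (\int[P]_w (phi (y + grid_incr 0 w)%N)%:E <=
   (phi y * (p0 + al * p1 + be * (1 - p0 - p1)))%:E)%E.
Proof.
move=> phi0 al0 be0 h; have mD := iid_measurable grid_incr_iid 0%N.
pose I k w : R := (grid_incr 0 w == k)%:R.
have bI k : bounded_mfun (I k).
  split; last by exists 1 => w; rewrite /I; case: eqP; rewrite ?normr1 ?normr0.
  exact: (@discrete_measurable_fun _ _ nat _ _ (measurableTypeR R) (fun u => (u == k)%:R) setT mD).
have evI k : ev P (I k) = poisson_pmf dt k.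
  apply: EFin_inj; rewrite EFin_ev// -(grid_incr_pmf 0).
  rewrite (_ : (fun w => _) = (fun w => (\1_(grid_incr 0 @^-1` [set k]) w)%:E)).
    by rewrite integral_indic ?setIT//; exact: mD.
  apply/funext => w; rewrite /I indicE.
  have [e|/eqP e] := eqVneq (grid_incr 0 w) k; first by rewrite mem_set.
  by rewrite memNset.
pose f w := phi y * (I 0%N w + al * I 1%N w + be * (1 - I 0%N w - I 1%N w)).
have b1 := bounded_mfunB (bounded_mfunB (bounded_mfun_cst 1) (bI 0%N)) (bI 1%N).
have b2 := bounded_mfunZ al (bI 1%N).
have b3 := bounded_mfunZ be b1.
have b12 := bounded_mfunD (bI 0%N) b2.
have b123 := bounded_mfunD b12 b3.
have e0 : poisson_pmf dt 0 = p0 by rewrite /poisson_pmf dt0 expr0 fact0 invr1 !mul1r.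
have e1 : poisson_pmf dt 1 = p1 by rewrite /poisson_pmf dt0 expr1 invr1 mulr1.
have -> : (phi y * (p0 + al * p1 + be * (1 - p0 - p1)))%:E = (\int[P]_w (f w)%:E)%E.
  rewrite -EFin_ev; last exact: (bounded_mfunZ (phi y) b123).
  rewrite /f (evZ _ _ b123) (evD _ b12 b3) (evD _ (bI 0%N) b2) (evZ _ _ (bI 1%N)) (evZ _ _ b1).
  rewrite (evB _ (bounded_mfunB (bounded_mfun_cst 1) (bI 0%N)) (bI 1%N)).
  by rewrite (evB _ (bounded_mfun_cst 1) (bI 0%N)) ev_cst !evI e0 e1.
apply: ge0_le_integral => //.
- by move=> w _; rewrite lee_fin.
- exact: (@discrete_measurable_fun _ _ _ _ _ _ (fun u => (phi (y + u)%N)%:E) _ mD).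
- by apply/measurable_EFinP; exact: (bounded_mfunZ (phi y) b123).1.
- move=> w _; rewrite lee_fin /f /I; apply: (le_trans (h _)).
  rewrite ler_wpM2l//; case: (grid_incr 0 w) => [|[|j]] /=; lra.
Qed.

Definition cnt (A : pred nat) (n : nat) : nat := count A (iota 0 n).

Lemma cntS A n : cnt A n.+1 = (cnt A n + A n)%N.
Proof. by rewrite /cnt -addn1 iotaD count_cat /= add0n addn0. Qed.

Lemma cnt_le A n m : (n <= m)%N -> (cnt A n <= cnt A m)%N.
Proof. by move=> /subnKC <-; rewrite /cnt iotaD count_cat leq_addr. Qed.

Let p0E : 1 - dt <= p0 <= 1 - dt + dt ^+ 2.
Proof.
apply/andP; split; first exact: expR_ge1Dx.
rewrite /p0 expRN -[leRHS]invrK lef_pV2 ?posrE ?expR_gt0//; last first.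
  by rewrite invr_gt0; nra.
apply: le_trans (expR_ge1Dx _); rewrite -[leLHS]mul1r ler_pdivrMr; last nra.
rewrite (_ : (1 + dt) * _ = 1 + dt ^+ 3); last by ring.
by rewrite lerDl exprn_ge0// ltW.
Qed.

(** Chernoff bound for a sum of at most b exponential holding times. The supersolution (1 - u)^cnt
    charges each level of [A] already passed with the inverse of 1 / (1 - u), the exponential moment
    of one holding time; u is of order e. *)
Lemma grid_upper (A : pred nat) n (b e : R) : 0 < e <= 1 -> dt <= e / 4 ->
  (forall k, (cnt A k)%:R <= b) ->
  (EEi P grid_incr n [set s | ((1 + e) * b <= dt * occ addst (fun y => (A y)%:R) 0%N s)%R] <=
   (expR (- (b * e ^+ 2 / 32)))%:E)%E.
Proof.
move=> /andP[e0 e1] de hb; have b0 : 0 <= b by apply: le_trans (hb 0%N).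
pose u := e / 8; have u0 : 0 < u by rewrite divr_gt0.
have u1 : u <= 8^-1 by rewrite /u; lra.
pose q := 1 - u; have q0 : 0 < q by rewrite /q; lra.
have q1 : q <= 1 by rewrite /q; lra.
pose B := expR (u / q).
have qB : 1 <= q * B.
  rewrite mulrC -ler_pdivrMr// mul1r; apply: le_trans (expR_ge1Dx _).
  by rewrite le_eqVlt; apply/orP; left; apply/eqP; rewrite /q; field; rewrite gt_eqF.
pose phi k : R := q ^+ cnt A k.
have phi0 k : 0 < phi k by rewrite exprn_gt0.
pose v y : R := u * (1 - dt) * (dt * (A y)%:R).
have step y : ((1 * expR (v y))%:E * \int[P]_w (phi (y + grid_incr 0 w)%N)%:E <= (phi y)%:E)%E.
  have al0 : 0 <= q ^+ (A y) by rewrite exprn_ge0// ltW.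
  have := @grid_step phi y (q ^+ (A y)) (q ^+ (A y)) (fun z => ltW (phi0 z)) al0 al0.
  have hj j : phi (y + j.+1)%N <= phi y * q ^+ (A y).
    rewrite /phi -exprD -cntS; apply: ler_wiXn2l; rewrite ?(ltW q0)//.
    by apply: cnt_le; rewrite addnS ltnS leq_addr.
  move=> /(_ _)/wrap[j|].
    by case: j => [|[|j]]; rewrite ?addn0 ?mulr1//; exact: hj.
  move=> hI; apply: le_trans (_ : (expR (v y))%:E * (phi y * (p0 + q ^+ A y * p1 + q ^+ A y * (1 - p0 - p1)))%:E <= _)%E.
    by rewrite mul1r; apply: lee_wpmul2l => //; rewrite lee_fin expR_ge0.
  rewrite -EFinM lee_fin mulrCA ler_piMr// ?(ltW (phi0 y))//.
  have /andP[h1 h2] := p0E.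
  rewrite /v; case: (A y) => /=; last first.
    by rewrite !mulr0 expR0 expr0 !mul1r; lra.
  rewrite mulr1 expr1 (_ : p0 + _ + _ = 1 - u * (1 - p0)); last by rewrite /q; ring.
  have : 1 - u * (1 - p0) <= expR (- (u * (1 - dt) * dt)).
    apply: le_trans (expR_ge1Dx _); rewrite lerD2l lerN2; nra.
  by rewrite expRN => h; rewrite -ler_pdivlMl ?expR_gt0// mulr1.
pose a := expR (u * (1 - dt) * ((1 + e) * b)) * expR (- (u / q * b)).
have a0 : 0 < a by rewrite mulr_gt0 ?expR_gt0.
apply: le_trans (EE_exp_prob grid_incr_iid (st := addst) (v := v) (phi := phi) (k := n) (x := 0%N)
   ltr01 a0 (fun z => ltW (phi0 z)) step _) _.
  move=> s _ /= hs; apply: ler_pM; rewrite ?expR_ge0//.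
    rewrite ler_expR /v occZ ler_wpM2l//; last by rewrite occZ.
    by apply: mulr_ge0; [exact: ltW|lra].
  rewrite /phi; apply: (@le_trans _ _ (B ^- cnt A (final addst 0%N s))).
    rewrite /B -expRM_natl -expRN ler_expR lerN2 [leRHS]mulrC; apply: ler_wpM2r; last exact: hb.
    by rewrite divr_ge0// ltW.
  rewrite -exprVn; apply: lerXn2r; rewrite ?nnegrE ?(ltW q0) ?invr_ge0 ?expR_ge0//.
  by rewrite -[leLHS]mul1r ler_pdivrMr ?expR_gt0.
rewrite lee_fin expr1n mulr1 /phi /cnt /= expr0 div1r /a -expRD -expRN ler_expR.
have uq : u / q <= u * (1 + e / 4) by rewrite ler_pdivrMr// /q /u; nra.
have h1 : u / q * b <= u * (1 + e / 4) * b by rewrite ler_wpM2r.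
have h2 : u * (1 - e / 4) * ((1 + e) * b) <= u * (1 - dt) * ((1 + e) * b).
  apply: ler_wpM2r; first by apply: mulr_ge0 => //; lra.
  by rewrite ler_pM2l//; lra.
have h3 : b * e ^+ 2 / 32 <= u * (1 - e / 4) * ((1 + e) * b) - u * (1 + e / 4) * b.
  rewrite -subr_ge0 (_ : _ - _ = b * e ^+ 2 * ((1 - e) / 32)); last by rewrite /u; field.
  apply: mulr_ge0; last lra.
  by apply: mulr_ge0 => //; apply: exprn_ge0; exact: ltW.
lra.
Qed.

(** The opposite Chernoff bound, with (1 + u)^cnt. The event asks that the clock has passed [K], so
    that all levels of [A] have been counted. A multiple jump may skip several levels and raise the
    function by up to 2^cnt; this is harmless when 2^cnt dt^2 n <= 1. *)
Lemma grid_lower (A : pred nat) n (K : nat) (b e : R) : 0 < e <= 1 -> 0 <= b ->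
  dt <= 1 -> (forall k, A k -> (k < K)%N) -> b <= (cnt A K)%:R ->
  2 ^+ (cnt A K) * dt ^+ 2 * n%:R <= 1 ->
  (EEi P grid_incr n [set s | (K <= final addst 0%N s)%N /\
     (dt * occ addst (fun y => (A y)%:R) 0%N s <= (1 - e) * b)%R] <=
   (expR (1 - b * e ^+ 2 / 4))%:E)%E.
Proof.
move=> /andP[e0 e1] b0 d1 AK hb hn; pose c := cnt A K.
pose u := e / 2; have u0 : 0 < u by rewrite divr_gt0.
have u1 : u <= 1 by rewrite /u; lra.
pose q := 1 + u; have q0 : 0 < q by rewrite /q; lra.
have q1 : 1 <= q by rewrite /q; lra.
have cK k : (cnt A k <= c)%N.
  have [kK|/ltnW Kk] := leqP k K; first exact: cnt_le.
  rewrite /c /cnt -(subnKC Kk) iotaD count_cat /= add0n addnC.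
  rewrite (_ : count A (iota K _) = 0%N) ?add0n//; apply/eqP; rewrite -leqn0 leqNgt -has_count.
  apply/hasPn => x; rewrite mem_iota => /andP[Kx _]; apply/negP => /AK; rewrite ltnNge.
  by rewrite Kx.
have cE k : (K <= k)%N -> cnt A k = c by move=> Kk; apply/eqP; rewrite eqn_leq cK cnt_le.
pose phi k : R := q ^+ cnt A k.
have phi0 k : 0 < phi k by rewrite exprn_gt0.
pose v y : R := - u * (dt * (A y)%:R).
pose C := 2 ^+ c : R; have C0 : 0 <= C by rewrite exprn_ge0.
have C1 : q ^+ c <= C by apply: lerXn2r; rewrite ?nnegrE ?(ltW q0)// /q; lra.
(* The loss per step due to multiple jumps; over n steps it is at most the factor e. *)
pose ic := 1 + C * dt ^+ 2; have ic0 : 0 < ic.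
  by apply: ltr_pwDl => //; apply: mulr_ge0 => //; rewrite exprn_ge0// ltW.
have step y : ((ic^-1 * expR (v y))%:E * \int[P]_w (phi (y + grid_incr 0 w)%N)%:E <= (phi y)%:E)%E.
  have al0 : 0 <= q ^+ (A y) by rewrite exprn_ge0// ltW.
  have := @grid_step phi y (q ^+ (A y)) C (fun z => ltW (phi0 z)) al0 C0.
  move=> /(_ _)/wrap[j|].
    case: j => [|[|j]]; first by rewrite addn0 mulr1.
      by rewrite /phi addn1 cntS exprD.
    apply: (@le_trans _ _ (phi y * q ^+ c)); last by rewrite ler_pM2l.
    rewrite /phi -exprD; apply: ler_weXn2l => //; apply: leq_trans (cK _) _; exact: leq_addl.
  move=> hI; apply: le_trans (_ : (ic^-1 * expR (v y))%:E * (phi y * (p0 + q ^+ A y * p1 + C * (1 - p0 - p1)))%:E <= _)%E.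
    by apply: lee_wpmul2l => //; rewrite lee_fin mulr_ge0 ?expR_ge0// invr_ge0 ltW.
  rewrite -EFinM lee_fin mulrCA ler_piMr// ?(ltW (phi0 y))// -mulrA ler_pdivrMl// mulr1.
  have /andP[h1 _] := p0E.
  have p11 : p1 = dt * p0 by [].
  have p0l : p0 <= 1 by rewrite /p0 -[leRHS]expR0 ler_expR oppr_le0 ltW.
  have p0p : 0 < p0 by exact: expR_gt0.
  have h2 : 1 - p0 - p1 <= dt ^+ 2 by rewrite p11; nra.
  have h3 : p0 + p1 <= 1.
    rewrite p11 -[X in X + _]mul1r -mulrDl /p0 expRN ler_pdivrMr ?expR_gt0// mul1r.
    exact: expR_ge1Dx.
  have h4 : C * (1 - p0 - p1) <= C * dt ^+ 2 by exact: ler_wpM2l.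
  have h5 : 0 <= C * (1 - p0 - p1) by apply: mulr_ge0 => //; lra.
  rewrite /v; case: (A y) => /=; last first.
    by rewrite !mulr0 expR0 expr0 !mul1r /ic; lra.
  rewrite mulr1 expr1 mulNr expRN ler_pdivrMl ?expR_gt0//.
  have h6 : p0 + q * p1 <= expR (u * dt).
    apply: le_trans (expR_ge1Dx _); rewrite /q p11; rewrite p11 in h3.
    have : u * (dt * p0) <= u * dt by rewrite ler_pM2l// ler_piMr// ltW.
    by lra.
  have h7 : 1 <= expR (u * dt) by rewrite -[leLHS]expR0 ler_expR mulr_ge0// ltW.
  have h8 : C * dt ^+ 2 <= expR (u * dt) * (C * dt ^+ 2).
    by rewrite ler_peMl// mulr_ge0// exprn_ge0// ltW.
  rewrite /ic [leRHS]mulrDr [X in _ <= X + _]mulr1; lra.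
pose a := expR (- u * ((1 - e) * b)) * q ^+ c.
have a0 : 0 < a by rewrite mulr_gt0 ?expR_gt0// exprn_gt0.
have ici : 0 < ic^-1 by rewrite invr_gt0.
apply: le_trans (EE_exp_prob grid_incr_iid (st := addst) (v := v) (phi := phi) (k := n) (x := 0%N)
   ici a0 (fun z => ltW (phi0 z)) step _) _.
  move=> s _ /= [hK hs]; apply: ler_pM; rewrite ?expR_ge0 ?exprn_ge0 ?(ltW q0)//.
    rewrite ler_expR /v occZ !mulNr lerN2 ler_pM2l// occZ.
    exact: hs.
  by rewrite /phi cE.
rewrite lee_fin /phi /cnt /= expr0 div1r exprVn invfM invrK /a invfM.
have icn : ic ^+ n <= expR 1.
  apply: (@le_trans _ _ (expR (C * dt ^+ 2) ^+ n)).
    by apply: lerXn2r; rewrite ?nnegrE ?expR_ge0 ?(ltW ic0)//; exact: expR_ge1Dx.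
  by rewrite -expRM_natl ler_expR mulrC.
have qc : (q ^+ c)^-1 <= expR (- (c%:R * (u / q))).
  rewrite -mulrN expRM_natl -exprVn; apply: lerXn2r; rewrite ?nnegrE ?expR_ge0 ?invr_ge0 ?(ltW q0)//.
  apply: le_trans (expR_ge1Dx _); rewrite le_eqVlt; apply/orP; left; apply/eqP.
  by rewrite /q; field; rewrite gt_eqF.
apply: (@le_trans _ _ (expR (u * ((1 - e) * b)) * expR (- (c%:R * (u / q))) * expR 1)).
  apply: ler_pM; rewrite ?exprn_ge0 ?(ltW ic0)//.
    by rewrite mulr_ge0 ?invr_ge0 ?expR_ge0 ?exprn_ge0 ?(ltW q0).
  by rewrite -expRN mulNr opprK ler_wpM2l ?expR_ge0.
rewrite -!expRD ler_expR.
have h1 : b * (u * (1 - u)) <= c%:R * (u / q).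
  apply: ler_pM => //; first by apply: mulr_ge0; [exact: ltW|lra].
  by rewrite ler_pM2l// -[leRHS]mul1r ler_pdivlMr// /q; nra.
have h2 : u * ((1 - e) * b) - b * (u * (1 - u)) = - (b * e ^+ 2 / 4) by rewrite /u; field.
lra.
Qed.

(** Outside this event the grid clock takes every value up to its final one, which [grid_hits]
    exploits to locate the exit time. *)
Lemma grid_skip n :
  (EEi P grid_incr n [set s | exists2 i, (i < size s)%N & (1 < nth 0%N s i)%N] <=
   (n%:R * dt ^+ 2)%:E)%E.
Proof.
have mD := iid_measurable grid_incr_iid.
pose Bi i : set (seq nat) := [set s | (1 < nth 0%N s i)%N].
have h : (EEi P grid_incr n [set s | exists2 i, (i < size s)%N & (1 < nth 0%N s i)%N] <=
   EEi P grid_incr n set0 + \sum_(i <- iota 0 n) EEi P grid_incr n (Bi i))%E.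
  apply: (EEi_union grid_incr_iid) => s sn [i isz hi] _; exists i => //.
  by rewrite mem_iota add0n -sn.
apply: (le_trans h).
have -> : EEi P grid_incr n set0 = 0%E.
  rewrite /EEi -[RHS](EE_cst grid_incr_iid n (lexx (0 : R))).
  by apply: eq_EE => s _; rewrite indicE in_set0.
rewrite add0e.
apply: (@le_trans _ _ (\sum_(i <- iota 0 n) (dt ^+ 2)%:E)%E); last first.
  by rewrite sumEFin lee_fin big_const_seq count_predT size_iota iter_addr addr0 mulr_natl.
rewrite big_seq [leRHS]big_seq; apply: lee_sum => i; rewrite mem_iota add0n => /andP[_ ilt].
rewrite /EEi -(path_prob grid_incr_iid 0).
have -> : path_of grid_incr 0 n @^-1` Bi i = ~` (grid_incr i @^-1` [set 0%N] `|` grid_incr i @^-1` [set 1%N]).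
  apply/seteqP; split => w; rewrite /Bi /= /path_of (nth_map 0%N) ?size_iota// nth_iota// add0n.
    by move=> h1 [|] h2; move: h1; rewrite h2.
  by case: (grid_incr i w) => [|[|j]]// h1; exfalso; apply: h1; [left|right].
have m01 : measurable (grid_incr i @^-1` [set 0%N] `|` grid_incr i @^-1` [set 1%N]).
  by apply: measurableU; exact: mD.
have hp : P (grid_incr i @^-1` [set 0%N] `|` grid_incr i @^-1` [set 1%N]) =
    (poisson_pmf dt 0 + poisson_pmf dt 1)%:E.
  rewrite measureU; [|exact: mD|exact: mD|]; last first.
    by apply/seteqP; split => w //= [-> ].
  by rewrite EFinD; congr (_ + _)%E; exact: grid_incr_pmf.
apply: (@le_trans _ _ (1 - (poisson_pmf dt 0 + poisson_pmf dt 1)%:E)%E).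
  by rewrite -hp probability_setC.
have e0 : poisson_pmf dt 0 = p0 by rewrite /poisson_pmf dt0 expr0 fact0 invr1 !mul1r.
have e1 : poisson_pmf dt 1 = dt * p0 by rewrite /poisson_pmf dt0 expr1 invr1 mulr1.
rewrite -EFinB lee_fin e0 e1.
have /andP[h1 _] := p0E; have p0p : 0 < p0 by exact: expR_gt0.
rewrite -subr_ge0 (_ : _ - _ = (1 + dt) * (p0 - (1 - dt))); last by ring.
by apply: mulr_ge0; rewrite ?subr_ge0// addr_ge0// ltW.
Qed.

End poisson_grid.

(** * Tightness of the clock at a fixed time *)

Section poisson_growth.
Context d (T : measurableType d) (R : realType) (P : probability T R).
Context (N : R -> T -> nat) (pois : poisson_process P 1 N).

Lemma poisson_tight (t e : R) : 0 <= t -> 0 < e ->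
  exists M : nat, (P [set w | (M < N t w)%N] <= e%:E)%E.
Proof.
move=> t0 e0; pose E M := [set w | (M < N t w)%N].
have mE M : measurable (E M) by exact: (pp_measurable pois t0 [set k | (M < k)%N]).
have h : P \o E @ \oo --> P (\bigcap_n E n).
  apply: nonincreasing_cvg_mu => //.
  - by rewrite (le_lt_trans (probability_le1 P (mE 0%N)))// ltry.
  - exact: bigcap_measurable.
  - by apply/nonincreasing_seqP => n; apply/subsetPset => w /=; exact: ltnW.
rewrite (_ : \bigcap_n E n = set0) in h; last first.
  by apply/seteqP; split => w //= /(_ (N t w) I); rewrite /E /= ltnn.
rewrite measure0 in h; apply: contrapT => hn.
have he : (e%:E <= limn (P \o E))%E.
  apply: lime_ge; first by apply/cvg_ex; exists 0%E.
  apply: nearW => M /=; rewrite leNgt; apply/negP => hM; apply: hn; exists M; exact: ltW.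
by move: he; rewrite (cvg_lim _ h)// lee_fin leNgt e0.
Qed.

End poisson_growth.

(** * Sojourn times of a counting path compared with grid sums *)

Section counting_path.
Context (R : realType) (n : R -> nat).
Hypothesis n_mono : forall s t : R, 0 <= s -> s <= t -> (n s <= n t)%N.
Local Notation mu := (@lebesgue_measure R).

Definition sojourn (A : pred nat) : set R := [set s | 0 <= s /\ A (n s)].

(** The level sets of a nondecreasing path are intervals. *)
Lemma sojourn_measurable A : measurable (sojourn A).
Proof.
rewrite (_ : sojourn A = \bigcup_(k in [set k | A k]) [set s | 0 <= s /\ n s = k]).
  apply: bigcup_measurable => k _; apply: is_interval_measurable.
  move=> x y /= [x0 nx] [y0 ny] z /andP[xz zy]; have z0 : 0 <= z by exact: le_trans xz.
  split=> //; apply/eqP; rewrite eqn_leq -{1}ny n_mono//= -nx n_mono//.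
apply/seteqP; split => [s [s0 As]|s [k Ak [s0 nk]]]; first by exists (n s).
by split=> //; rewrite nk.
Qed.

Variable dt : R.
Hypothesis dt0 : 0 < dt.
Let tt (k : nat) := dt * k%:R.
Let tt0 k : 0 <= tt k. Proof. by rewrite mulr_ge0// ltW. Qed.
Let ttS k : tt k < tt k.+1. Proof. by rewrite ltr_pM2l// ltr_nat. Qed.

Let cell k : set R := [set` `[tt k, tt k.+1[ ].

Lemma mu_cell k : mu (cell k) = dt%:E.
Proof.
rewrite /cell lebesgue_measure_itv /= lte_fin ttS -EFinB /tt.
by rewrite -mulrBr -natrB// subSnn mulr1.
Qed.

(** In a cell without a jump the sojourn is the whole cell or empty. Otherwise the error is at most
    dt, which is charged to the jumps of the cell; the errors then telescope in [sojourn_grid]. *)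
Lemma sojourn_cell (A : pred nat) k :
  ((dt * (A (n (tt k)))%:R - dt * ((n (tt k.+1))%:R - (n (tt k))%:R))%:E <= mu (sojourn A `&` cell k) /\
   mu (sojourn A `&` cell k) <= (dt * (A (n (tt k)))%:R + dt * ((n (tt k.+1))%:R - (n (tt k))%:R))%:E)%E.
Proof.
have nk : (n (tt k) <= n (tt k.+1))%N by apply: n_mono => //; exact: ltW.
have [e|ne] := eqVneq (n (tt k)) (n (tt k.+1)).
  rewrite e subrr mulr0 subr0 addr0 -e.
  have ns s : cell k s -> 0 <= s /\ n s = n (tt k).
    rewrite /cell /= in_itv /= => /andP[s1 s2]; have s0 : 0 <= s by exact: le_trans (tt0 k) s1.
    split=> //; apply/eqP; rewrite eqn_leq {1}e !n_mono//; exact: ltW.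
  have [Ak|nA] := boolP (A (n (tt k))).
    rewrite (_ : sojourn A `&` cell k = cell k) ?mu_cell ?mulr1//.
    by apply/seteqP; split => s; [case|move=> cs; have [s0 E] := ns _ cs; split=> //; split=> //; rewrite E].
  rewrite (_ : sojourn A `&` cell k = set0) ?measure0 ?mulr0//.
  by apply/seteqP; split => s //= [[_ As] cs]; have [_ E] := ns _ cs; move: nA; rewrite -E As.
have lt : (n (tt k) < n (tt k.+1))%N by rewrite ltn_neqAle ne.
have d1 : 1 <= (n (tt k.+1))%:R - (n (tt k))%:R :> R by rewrite -natrB// ler1n subn_gt0.
have dd : dt <= dt * ((n (tt k.+1))%:R - (n (tt k))%:R) by rewrite ler_peMr// ltW.
have A1 : 0 <= dt * (A (n (tt k)))%:R <= dt.
  by case: (A _); rewrite ?mulr1 ?mulr0 lexx ltW.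
have /andP[A10 A11] := A1; split.
  by apply: le_trans (measure_ge0 _ _); rewrite lee_fin; lra.
have mc : measurable (cell k) by exact: measurable_itv.
apply: (@le_trans _ _ (mu (cell k))).
  apply: le_measure; rewrite ?inE//; first by apply: measurableI => //; exact: sojourn_measurable.
rewrite mu_cell lee_fin; lra.
Qed.

Definition upto k : set R := [set s | 0 <= s /\ s < tt k].

Lemma uptoE k : upto k = [set` `[0, tt k[ ].
Proof. by apply/seteqP; split => s /=; rewrite /upto in_itv /=; [case=> -> ->|move=> /andP[]]. Qed.

Lemma sojourn_grid (A : pred nat) k :
  ((dt * (\sum_(j < k) (A (n (tt j)))%:R) - dt * (n (tt k))%:R)%:E <= mu (sojourn A `&` upto k) /\
   mu (sojourn A `&` upto k) <= (dt * (\sum_(j < k) (A (n (tt j)))%:R) + dt * (n (tt k))%:R)%:E)%E.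
Proof.
elim: k => [|k [IH1 IH2]].
  rewrite big_ord0 mulr0 sub0r add0r (_ : _ `&` _ = set0) ?measure0.
    by rewrite !lee_fin oppr_le0 mulr_ge0// ltW.
  apply/seteqP; split => s // [_ [s0]].
  by rewrite /tt mulr0 ltNge s0.
have mup j : measurable (upto j) by rewrite uptoE; exact: measurable_itv.
have ms := sojourn_measurable A.
have -> : mu (sojourn A `&` upto k.+1) = (mu (sojourn A `&` upto k) + mu (sojourn A `&` cell k))%E.
  rewrite -measureU; [|by apply: measurableI; [exact: ms|exact: mup]|by apply: measurableI; [exact: ms|exact: measurable_itv]|].
    congr (mu _); rewrite -setIUr; congr (_ `&` _); apply/seteqP; split => s /=.
      move=> [s0 sk]; have [h|h] := ltP s (tt k); first by left.
      by right; rewrite /cell /= in_itv /= h.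
    case=> [[s0 sk]|]; first by split=> //; exact: lt_trans (ttS k).
    rewrite /cell /= in_itv /= => /andP[h1 h2]; split=> //; exact: le_trans (tt0 k) h1.
  apply/seteqP; split => s // [[_ [_ h1]] [_]].
  by rewrite /cell /= in_itv /= leNgt h1.
have [c1 c2] := sojourn_cell A k; rewrite big_ord_recr /=; split.
  apply: le_trans (leeD IH1 c1); rewrite -EFinD lee_fin; lra.
apply: (le_trans (leeD IH2 c2)); rewrite -EFinD lee_fin; lra.
Qed.

Lemma grid_hits k0 k : n 0 = 0%N -> (forall j, (j < k)%N -> (n (tt j.+1) <= (n (tt j)).+1)%N) ->
  (k0 <= n (tt k))%N -> exists2 j, (j <= k)%N & n (tt j) = k0.
Proof.
move=> n0; elim: k => [|k IH] h hk.
  by exists 0%N => //; move: hk; rewrite /tt mulr0 n0 leqn0 => /eqP ->.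
have [hk'|hk'] := leqP k0 (n (tt k)).
  have [j jk <-] := IH (fun j jk => h j (ltnW jk)) hk'.
  by exists j => //; exact: leqW.
exists k.+1 => //; apply/eqP; rewrite eqn_leq hk andbT.
by apply: leq_trans (h k (ltnSn k)) hk'.
Qed.

End counting_path.

(** * Local time at the exit and visits of the discrete walk *)

Section walk_local_time.
Context d (T : measurableType d) (R : realType) (P : probability T R).
Context (X : nat -> T -> Z2) (N : R -> T -> nat) (pois : poisson_process P 1 N).
Local Notation Y := (ct_walk X N).
Local Notation mu := (@lebesgue_measure R).
Let n_mono w (s t : R) : 0 <= s -> s <= t -> (N s w <= N t w)%N.
Proof. exact: (pp_nondecreasing pois). Qed.

Definition at_site (x : Z2) (w : T) : pred nat := fun k => partial_sum X k w == x.

Lemma local_timeE x (t : \bar R) w : local_time Y x t w =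
  mu (sojourn (N^~ w) (at_site x w) `&` [set s | (0 <= s)%R /\ (s%:E <= t)%E]).
Proof.
set D := [set s | _]; have mD : measurable D.
  apply: is_interval_measurable => a b /= [a0 a1] [b0 b1] c /andP[ac cb].
  split; first exact: le_trans ac.
  by apply: le_trans b1; rewrite lee_fin.
have ms := sojourn_measurable (@n_mono w) (at_site x w).
rewrite /local_time -[RHS]integral_indic//; apply: eq_integral => s /set_mem [s0 _].
rewrite indicE /ct_walk; congr ((nat_of_bool _)%:R%:E).
by apply/idP/idP => [h|/set_mem[]//]; rewrite mem_set.
Qed.

Lemma exit_time_le k k' w : (k <= k')%N -> (exit_time Y k w <= exit_time Y k' w)%E.
Proof.
move=> kk'; apply: ereal_inf_le_tmp => _ [t [t0 h] <-]; exists t => //; split=> //.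
by apply: contra_not h => h i; apply: le_trans (h i) _; rewrite lez_nat.
Qed.

Lemma exit_local_time_le k k' x w : (k <= k')%N ->
  (exit_local_time Y k x w <= exit_local_time Y k' x w)%E.
Proof.
move=> kk'; rewrite /exit_local_time !local_timeE.
have ms := sojourn_measurable (@n_mono w) (at_site x w).
have mD (t : \bar R) : measurable [set s : R | (0 <= s)%R /\ (s%:E <= t)%E].
  apply: is_interval_measurable => a b /= [a0 a1] [b0 b1] c /andP[ac cb].
  split; first exact: le_trans ac.
  by apply: le_trans b1; rewrite lee_fin.
apply: le_measure; rewrite ?inE; [by apply: measurableI; [exact: ms|exact: mD]|by apply: measurableI; [exact: ms|exact: mD]|].
by move=> s [h [s0 h1]]; split=> //; split=> //; apply: le_trans h1 _; exact: exit_time_le.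
Qed.

Variable dt : R.
Hypothesis dt0 : 0 < dt.

Definition visited_at (m : nat) x w : pred nat := fun k => (k < m)%N && (partial_sum X k w == x).

(** The discrete walk is outside the box at some index k0 <= m. Without double jumps the clock
    equals k0 at some grid time, which bounds the exit time, so that only indices below m
    contribute. *)
Lemma exit_local_time_upper (r m k : nat) x w :
  box r x -> (exists2 k0, (k0 <= m)%N & ~ box r (partial_sum X k0 w)) ->
  (forall j, (j < k)%N -> (grid_incr N dt j w <= 1)%N) -> (m <= N (dt * k%:R) w)%N ->
  (exit_local_time Y r x w <= (dt * (\sum_(j < k) (visited_at m x w (N (dt * j%:R) w))%:R) +
     dt * (N (dt * k%:R) w)%:R)%:E)%E.
Proof.
move=> bx [k0 k0m hk0] hD hm.
have [j jk hj] : exists2 j, (j <= k)%N & N (dt * j%:R) w = k0.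
  apply: (@grid_hits _ (N^~ w) dt); [exact: (pp_start pois)| |exact: leq_trans hm].
  by move=> j /hD; rewrite /grid_incr leq_subLR addn1.
have t0 : 0 <= dt * j%:R by rewrite mulr_ge0// ltW.
have tau : (exit_time Y r w <= (dt * j%:R)%:E)%E.
  apply: ereal_inf_lbound; exists (dt * j%:R) => //; split=> //.
  by rewrite /ct_walk hj.
have [_ h] := sojourn_grid (@n_mono w) dt0 (visited_at m x w) k.
apply: le_trans h; rewrite /exit_local_time local_timeE.
have mD (t : \bar R) : measurable [set s : R | (0 <= s)%R /\ (s%:E <= t)%E].
  apply: is_interval_measurable => a b /= [a0 a1] [b0 b1] c /andP[ac cb].
  split; first exact: le_trans ac.
  by apply: le_trans b1; rewrite lee_fin.
apply: le_measure; rewrite ?inE.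
- by apply: measurableI; [exact: (sojourn_measurable (@n_mono w))|exact: mD].
- apply: measurableI; first exact: (sojourn_measurable (@n_mono w)).
  by rewrite uptoE; exact: measurable_itv.
move=> s [[s0 hs] [_ st]]; have hs' : partial_sum X (N s w) w = x by exact/eqP.
have sj : s <= dt * j%:R by rewrite -lee_fin; exact: le_trans st tau.
have Ns : (N s w <= k0)%N by rewrite -hj; exact: n_mono.
have Nk : (N s w < k0)%N.
  by rewrite ltn_neqAle Ns andbT; apply/eqP => e; apply: hk0; rewrite -e hs'.
split; first by split=> //; rewrite /visited_at hs' eqxx andbT (leq_trans Nk).
(* The interval of [sojourn_grid] is open on the right: the grid time itself is excluded because the
   clock already shows k0 there. *)
split=> //; have sj' : s < dt * j%:R.
  by rewrite lt_neqAle sj andbT; apply/eqP => e; move: Nk; rewrite e hj ltnn.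
by apply: lt_le_trans sj' _; rewrite ler_pM2l// ler_nat.
Qed.

(** Any time at which the clock is below m precedes the exit, since the discrete walk has stayed in
    the box up to that index. *)
Lemma exit_local_time_lower (r m k : nat) x w :
  (forall k0, (k0 < m)%N -> box r (partial_sum X k0 w)) ->
  ((dt * (\sum_(j < k) (visited_at m x w (N (dt * j%:R) w))%:R) -
     dt * (N (dt * k%:R) w)%:R)%:E <= exit_local_time Y r x w)%E.
Proof.
move=> hb; have [h _] := sojourn_grid (@n_mono w) dt0 (visited_at m x w) k.
apply: le_trans h _; rewrite /exit_local_time local_timeE.
have mD (t : \bar R) : measurable [set s : R | (0 <= s)%R /\ (s%:E <= t)%E].
  apply: is_interval_measurable => a b /= [a0 a1] [b0 b1] c /andP[ac cb].
  split; first exact: le_trans ac.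
  by apply: le_trans b1; rewrite lee_fin.
apply: le_measure; rewrite ?inE.
- apply: measurableI; first exact: (sojourn_measurable (@n_mono w)).
  by rewrite uptoE; exact: measurable_itv.
- by apply: measurableI; [exact: (sojourn_measurable (@n_mono w))|exact: mD].
move=> s [[s0 /andP[Nm hs]] _]; split=> //; split=> //.
apply: le_ereal_inf_tmp => _ [t [t0 ht] <-]; rewrite lee_fin leNgt; apply/negP => ts.
apply: ht; apply: hb; apply: leq_ltn_trans Nm; apply: n_mono => //; exact: ltW.
Qed.

End walk_local_time.

(** * Visits as counts of times *)

Section path_occupation.
Context (R : realType).
Local Notation shift := (fun x y : Z2 => x + y).

Definition site_times (x : Z2) (s : seq Z2) : pred nat :=
  fun k => (k < size s)%N && (final shift 0 (take k s) == x).

Lemma cnt_site_times x s k : (cnt (site_times x s) k <= cnt (site_times x s) (size s))%N.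
Proof.
have [ks|/ltnW sk] := leqP k (size s); first exact: cnt_le.
rewrite /cnt -(subnKC sk) iotaD count_cat /= add0n -[leqRHS]addn0 leq_add2l leqn0.
rewrite -leqn0 leqNgt -has_count; apply/hasPn => i; rewrite mem_iota => /andP[si _].
by rewrite /site_times ltnNge si.
Qed.

Lemma visits_cnt x s : visits R x 0 s = (cnt (site_times x s) (size s))%:R.
Proof.
elim/last_ind: s => [|s u IH]; first by rewrite /visits.
rewrite /visits -cats1 occ_cat -/(visits R x 0 s) IH /= addr0 size_cat addn1 cntS natrD.
congr (_%:R + _%:R); last first.
  by rewrite /site_times size_cat addn1 ltnSn /= take_size_cat.
apply: eq_in_count => k; rewrite mem_iota add0n => /andP[_ ks].
by rewrite /site_times size_cat ks ltn_addr//= takel_cat// ltnW.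
Qed.

Lemma visits_ge0 z x s : 0 <= visits R z x s.
Proof. by apply: occ_ge0 => y. Qed.

Lemma visits_shift z y x s : visits R (y + z) (y + x) s = visits R z x s.
Proof.
elim: s x => //= u s IH x; rewrite /visits /= -/(visits R (y + z) (y + x + u) s) -/(visits R z (x + u) s).
by rewrite -addrA IH (inj_eq (addrI y)).
Qed.

Lemma visits_gt0 z s : 0 < visits R z 0 s -> exists2 k, (k < size s)%N & final shift 0 (take k s) = z.
Proof.
rewrite visits_cnt ltr0n /cnt -has_count => /hasP[k]; rewrite mem_iota add0n => /andP[_ ks].
by rewrite /site_times ks /= => /eqP <-; exists k.
Qed.

Lemma visits_sum (V : {fset Z2}) x s :
  (forall k, (k < size s)%N -> final shift x (take k s) \in V) ->
  \sum_(z <- V) visits R z x s = (size s)%:R.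
Proof.
elim: s x => [|u s IH] x h; first by rewrite big1.
rewrite (eq_bigr (fun z => (x == z)%:R + visits R z (x + u) s)) // big_split /=.
rewrite IH => [|k ks]; last exact: (h k.+1).
rewrite -natr1 addrC; congr (_ + _).
have xV : x \in V by exact: (h 0%N).
rewrite (big_fsetD1 x)//= eqxx big1_seq ?addr0// => z /andP[_]; rewrite !inE => /andP[/negbTE zx _].
by rewrite eq_sym zx.
Qed.

Lemma occ_final_lt (m : nat) s x : (final (fun a b : nat => (a + b)%N) x s < m)%N ->
  occ (fun a b : nat => (a + b)%N) (fun y => ((y < m)%N)%:R : R) x s = (size s)%:R.
Proof.
have mono : forall s x, (x <= final (fun a b : nat => (a + b)%N) x s)%N.
  by elim=> //= u s' IH y; exact: leq_trans (leq_addr _ _) (IH _).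
elim: s x => //= u s IH x h; rewrite IH// -natr1 addrC; congr (_ + _).
by rewrite (leq_ltn_trans _ h)// (leq_trans (leq_addr u x))// mono.
Qed.

(** The visits to the box add up to m. The bound forces an exit: a confined walk would visit some
    site far too often. *)
Lemma visits_pigeonhole (r m : nat) (t : R) s : size s = m ->
  (forall k, (k < m)%N -> final shift 0 (take k s) \in bx r) ->
  t * (#|` bx r|)%:R <= m%:R -> (0 < #|` bx r|)%N ->
  exists2 x, x \in bx r & t <= visits R x 0 s.
Proof.
move=> sm h ht c0; apply: contrapT => hn.
have := visits_sum (V := bx r) (x := 0) (s := s); rewrite sm => /(_ h) e.
have [x0 x0r] : exists x, x \in bx r by exists 0; rewrite in_bx !mxE normr0.
have : \sum_(z <- bx r) visits R z 0 s < t * (#|` bx r|)%:R.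
  have -> : t * (#|` bx r|)%:R = \sum_(z <- bx r) t.
    by rewrite big_const_seq count_predT iter_addr addr0 mulr_natr.
  rewrite !(big_fsetD1 x0 x0r)/=; apply: ltr_leD.
    by rewrite ltNge; apply/negP => hx; apply: hn; exists x0.
  rewrite big_seq [leRHS]big_seq; apply: ler_sum => z; rewrite !inE => /andP[_ zr].
  by rewrite leNgt; apply/negP => /ltW hx; apply: hn; exists z.
by rewrite e ltNge ht.
Qed.

End path_occupation.

(** * The walk does not leave a large box too early *)

Section early_exit.
Context d (T : measurableType d) (R : realType) (P : probability T R).
Context (X : nat -> T -> Z2) (X_iid : iid P X) (symX : symmetric_law P (X 0%N)).
Context (varX : finite_variance P (X 0%N)).
Local Notation mX := (iid_measurable X_iid 0%N).
Local Notation shift := (fun x y : Z2 => x + y).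

(** The function (|x|^2 + sigma^2 times the remaining steps) / r^2 is a martingale along the walk
    and is at least 1 outside the box. *)
Lemma early_exit (r k : nat) x : (0 < r)%N ->
  (EEi P X k [set s | exists2 j, (j <= size s)%N & final shift x (take j s) \notin bx r] <=
   ((sqn R x + sigma2 P (X 0%N) * k%:R) / r%:R ^+ 2)%:E)%E.
Proof.
move=> r0; have r2 : 0 < r%:R ^+ 2 :> R by rewrite exprn_gt0// ltr0n.
have s0 : 0 <= sigma2 P (X 0%N) by exact: sigma2_ge0.
have sq0 y : 0 <= sqn R y by rewrite addr_ge0// sqr_ge0.
have out k' y : y \notin bx r -> 1 <= (sqn R y + sigma2 P (X 0%N) * k'%:R) / r%:R ^+ 2.
  move=> /(sqn_notin_bx R) h; rewrite ler_pdivlMr// mul1r.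
  apply: (@le_trans _ _ (sqn R y)); last by rewrite lerDl mulr_ge0.
  by apply: le_trans h; apply: lerXn2r; rewrite ?nnegrE// ler_nat.
elim: k x => [|k IH] x.
  have [xr|xr] := boolP (x \in bx r); last first.
    by apply: le_trans (EEi_le1 X_iid _ _) _; rewrite lee_fin; exact: out.
  rewrite /EEi /= indicE memNset; last by move=> [[|j]] //=; rewrite xr.
  by rewrite lee_fin divr_ge0 ?(ltW r2)// addr_ge0// mulr_ge0.
have [xr|xr] := boolP (x \in bx r); last first.
  by apply: le_trans (EEi_le1 X_iid _ _) _; rewrite lee_fin; exact: out.
pose h y := (sqn R y + sigma2 P (X 0%N) * k%:R) / r%:R ^+ 2.
have h0 y : 0 <= h y by rewrite divr_ge0 ?(ltW r2)// addr_ge0// mulr_ge0.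
apply: (@le_trans _ _ (\int[P]_w (h (x + X 0%N w)%R)%:E)%E).
  rewrite /EEi /=; apply: ge0_le_integral => //.
  - by move=> w _; apply: EE_ge0 => s; rewrite lee_fin.
  - exact: (@discrete_measurable_fun _ _ _ _ _ _ (fun u => EE P X k (fun s =>
      (\1_[set s | exists2 j, (j <= size s)%N & final shift x (take j s) \notin bx r] (u :: s))%:E)) _ mX).
  - exact: (@discrete_measurable_fun _ _ _ _ _ _ (fun u => (h (x + u))%:E) _ mX).
  - move=> w _; apply: le_trans (IH (x + X 0%N w)); apply: (EE_le X_iid) => s *; rewrite lee_fin//.
    rewrite !indicE; case: (boolP (X 0%N w :: s \in _)) => // /set_mem /= [[|j] js hj].
      by move: hj; rewrite /= xr.
    by rewrite mem_set//; exists j.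
rewrite le_eqVlt; apply/orP; left; apply/eqP.
transitivity ((r%:R ^+ 2)^-1%:E * (\int[P]_w ((sqn R (x + X 0%N w)%R)%:E + (sigma2 P (X 0%N) * k%:R)%:E)))%E.
  rewrite -ge0_integralZl//.
  - by apply: eq_integral => w _; rewrite /h -EFinD -EFinM mulrC.
  - exact: (@discrete_measurable_fun _ _ _ _ _ _ (fun u => ((sqn R (x + u))%:E + (sigma2 P (X 0%N) * k%:R)%:E)%E) _ mX).
  - by move=> w _; rewrite -EFinD lee_fin addr_ge0// mulr_ge0.
rewrite ge0_integralD//; first last.
- by move=> w _; rewrite lee_fin mulr_ge0.
- exact: (@discrete_measurable_fun _ _ _ _ _ _ (fun u => (sqn R (x + u))%:E) _ mX).
- by move=> w _; rewrite lee_fin.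
rewrite (integral_sqn_step mX symX (mean_sq_fin mX varX)).
have -> : (\int[P]__ (sigma2 P (X 0%N) * k%:R)%:E = (sigma2 P (X 0%N) * k%:R)%:E)%E.
  by rewrite integral_cst// -[RHS]mule1; congr (_ * _)%E; exact: probability_setT.
by rewrite -EFinD -EFinM; congr EFin; rewrite -natr1; field; rewrite pnatr_eq0 -lt0n.
Qed.

End early_exit.

(** * Independent blocks of a path *)

Section blocks.
Context d (T : measurableType d) (R : realType) (P : probability T R).
Context (X : nat -> T -> Z2) (X_iid : iid P X).
Local Notation shift := (fun x y : Z2 => x + y).

Fixpoint no_block (m J : nat) (G : set (seq Z2)) (s : seq Z2) : Prop :=
  if J is J'.+1 then ~ G (take m s) /\ no_block m J' G (drop m s) else True.

(** Disjoint blocks are independent by [EE_cat], so the failures multiply. This turns a success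
    probability that is a small negative power of m into near certainty. *)
Lemma no_block_prob m J (G : set (seq Z2)) (p : R) : 0 <= p <= 1 -> (p%:E <= EEi P X m G)%E ->
  (EEi P X (m * J) (no_block m J G) <= ((1 - p) ^+ J)%:E)%E.
Proof.
move=> /andP[p0 p1] hp; elim: J => [|J IH].
  by rewrite muln0 /EEi /= indicE mem_set.
have q0 : 0 <= 1 - p by rewrite subr_ge0.
have hC : (EEi P X m (~` G) <= (1 - p)%:E)%E.
  have E : (EEi P X m (~` G) + EEi P X m G = 1)%E.
    rewrite -[RHS](EE_cst X_iid m (@ler01 R)) /EEi -(EED X_iid) => [|s|s]; try by rewrite lee_fin.
    apply: eq_EE => s _; rewrite -EFinD !indicE in_setC.
    by case: (s \in G); rewrite ?addr0 ?add0r.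
  have fG : EEi P X m G \is a fin_num.
    by rewrite ge0_fin_numE ?EEi_ge0// (le_lt_trans (EEi_le1 X_iid _ _))// ltry.
  have -> : EEi P X m (~` G) = (1 - EEi P X m G)%E by rewrite -E addeK.
  by rewrite EFinB leeB.
rewrite mulnS /EEi EE_cat.
apply: (@le_trans _ _ (EE P X m (fun s => ((1 - p) ^+ J)%:E * (\1_(~` G) s)%:E)%E)).
  apply: (EE_le X_iid) => [s|s sm]; first by apply: EE_ge0 => s'; rewrite lee_fin.
  rewrite muleC; apply: (@le_trans _ _ (EE P X (m * J) (fun s' => (\1_(~` G) s)%:E * (\1_(no_block m J G) s')%:E)%E)).
    apply: (EE_le X_iid) => [s'|s' _]; first by rewrite lee_fin.
    rewrite -EFinM lee_fin !indicE.
    have [/set_mem /= [h1 h2]|_] := boolP (s ++ s' \in _); last by rewrite mulr_ge0.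
    rewrite -sm take_size_cat// in h1; rewrite -sm drop_size_cat// sm in h2.
    by rewrite !mem_set// mulr1.
  rewrite (EE_Zl X_iid)//; apply: lee_wpmul2l => //; by rewrite lee_fin.
rewrite (EE_Zl X_iid) ?exprn_ge0//.
rewrite exprSr EFinM; apply: lee_wpmul2l => //; by rewrite lee_fin exprn_ge0.
Qed.

Lemma block_witness m J (G : set (seq Z2)) s : size s = (m * J)%N -> ~ no_block m J G s ->
  exists s1 s2 s3, s = s1 ++ s2 ++ s3 /\ G s2.
Proof.
elim: J s => [|J IH] s sz /=; first by move=> /(_ I).
have [Gs|nGs] := pselect (G (take m s)) => h.
  by exists [::], (take m s), (drop m s); rewrite cat_take_drop.
have [|s1 [s2 [s3 [e Gs2]]]] := IH (drop m s) _ (fun hd => h (conj nGs hd)).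
  by rewrite size_drop sz mulnS addKn.
by exists (take m s ++ s1), s2, s3; rewrite -catA -e cat_take_drop.
Qed.

Lemma block_visits s1 s2 s3 z :
  visits R z 0 s2 <= visits R (final shift 0 s1 + z) 0 (s1 ++ s2 ++ s3).
Proof.
have e := visits_shift R z (final shift 0 s1) 0 s2; rewrite addr0 in e.
rewrite -e /visits !occ_cat addrCA lerDl.
by apply: addr_ge0; apply: occ_ge0.
Qed.

End blocks.

(** * Joint law of the walk and the clock *)

Section joint_law.
Context d (T : measurableType d) (R : realType) (P : probability T R).
Context (X : nat -> T -> Z2) (N : R -> T -> nat).
Context (X_iid : iid P X) (pois : poisson_process P 1 N).
Context (XN : indep_systems P (sigma_family setT X) (sigma_family [set t | 0 <= t] N)).
Variable dt : R.
Hypothesis dt0 : 0 < dt.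
Local Notation D := (grid_incr N dt).

Lemma discrete_rv2 d' (T' : measurableType d') (U1 U2 : countType) (U : Type)
    (f : U1 -> U2 -> U) (V : T' -> U1) (W : T' -> U2) :
  discrete_rv V -> discrete_rv W -> discrete_rv (fun w => f (V w) (W w)).
Proof.
move=> mV mW B; rewrite (discrete_bigcup V ((fun w => f (V w) (W w)) @^-1` B)).
apply: bigcup_measurable => k _; rewrite discrete_level; case: (pickle_inv k) => [u|]; last by rewrite setI0.
rewrite (_ : _ `&` _ = V @^-1` [set u] `&` W @^-1` [set v | B (f u v)]).
  by apply: measurableI; [exact: mV|exact: mW].
by apply/seteqP; split => w /= [h1 h2]; split=> //; [move: h1; rewrite h2|rewrite h1].
Qed.

Lemma discrete_rv_path d' (T' : measurableType d') (U : countType) (F : nat -> T' -> U) r :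
  (forall i, discrete_rv (F i)) -> discrete_rv (fun w => [seq F i w | i <- r]).
Proof.
move=> mF; elim: r => [|i r IH].
  move=> B; have [B0|B0] := pselect (B [::]).
    by rewrite (_ : _ @^-1` _ = setT)//; apply/seteqP; split.
  by rewrite (_ : _ @^-1` _ = set0)//; apply/seteqP; split.
exact: (discrete_rv2 cons (mF i) IH).
Qed.

(** Independence lets the walk be frozen: a bound on the clock that is uniform over the walk paths
    holds for the joint event. *)
Lemma joint_prob m n (E : seq Z2 -> set (seq nat)) (be : R) : 0 <= be ->
  (forall s, size s = m -> (EEi P D n (E s) <= be%:E)%E) ->
  measurable [set w | E (path_of X 0 m w) (path_of D 0 n w)] /\
  (P [set w | E (path_of X 0 m w) (path_of D 0 n w)] <= be%:E)%E.
Proof.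
move=> be0 h; have D_iid := grid_incr_iid pois dt0.
have mV := path_of_discrete X_iid 0 m; have mW := path_of_discrete D_iid 0 n.
pose F s s' : \bar R := (\1_(E s) s')%:E.
have mE : measurable [set w | E (path_of X 0 m w) (path_of D 0 n w)].
  rewrite (discrete_bigcup (path_of X 0 m) [set w | _]).
  apply: bigcup_measurable => k _; rewrite discrete_level; case: (pickle_inv k) => [s|]; last by rewrite setI0.
  rewrite (_ : _ `&` _ = path_of D 0 n @^-1` (E s) `&` path_of X 0 m @^-1` [set s]).
    by apply: measurableI; [exact: mW|exact: mV].
  by apply/seteqP; split => w /= [h1 h2]; split=> //; move: h1; rewrite h2.
split=> //.
have -> : P [set w | E (path_of X 0 m w) (path_of D 0 n w)] =
    (\int[P]_w F (path_of X 0 m w) (path_of D 0 n w))%E.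
  have := integral_indic P measurableT mE; rewrite setIT => <-; apply: eq_integral => w _; rewrite /F !indicE.
  by congr ((nat_of_bool _)%:R%:E); apply/idP/idP => /set_mem hh; apply/mem_set.
(* The independence hypothesis concerns the generated sigma-algebras, so path events must be
   measurable for these and not only for the ambient one. *)
have mX' : @discrete_rv _ (g_sigma_algebraType (\bigcup_(i in setT) sigma_rv (X i))) _ (path_of X 0 m).
  apply: discrete_rv_path => i B; apply: sub_sigma_algebra; exists i => //.
  by exists B => //; rewrite setTI.
have mN' t : 0 <= t ->
    @discrete_rv _ (g_sigma_algebraType (\bigcup_(i in [set t | 0 <= t]) sigma_rv (N i))) _ (N t).
  move=> t0 B; apply: sub_sigma_algebra; exists t => //.
  by exists B => //; rewrite setTI.
have mD' : @discrete_rv _ (g_sigma_algebraType (\bigcup_(i in [set t | 0 <= t]) sigma_rv (N i))) _ (path_of D 0 n).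
  apply: discrete_rv_path => i; apply: (discrete_rv2 (fun a b => (a - b)%N)); apply: mN'.
    by rewrite mulr_ge0// ltW.
  by rewrite mulr_ge0// ltW.
rewrite (discrete_integral_indep mV mW) => [|s s'|s s']; first last.
- by apply: XN; [exact: (mX' [set s])|exact: (mD' [set s'])].
- by rewrite /F lee_fin.
rewrite -[leRHS]mule1 -(probability_setT P) -integral_cst//.
apply: ge0_le_integral => //.
- by move=> w _; apply: integral_ge0 => w' _; rewrite lee_fin.
- exact: (@discrete_measurable_fun _ _ (seq Z2) (path_of X 0 m) _ _ (fun s => (\int[P]_w F s (path_of D 0 n w))%E) _ mV).
move=> w _; rewrite /F (path_law D_iid 0 n (F := fun s' => (\1_(E (path_of X 0 m w)) s')%:E)) => [|s]; last by rewrite lee_fin.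
by apply: (h (path_of X 0 m w)); rewrite size_map size_iota.
Qed.

End joint_law.

(** * From visits to local times *)

Section clock.
Context d (T : measurableType d) (R : realType) (P : probability T R).
Context (X : nat -> T -> Z2) (N : R -> T -> nat).
Context (X_iid : iid P X) (pois : poisson_process P 1 N).
Context (XN : indep_systems P (sigma_family setT X) (sigma_family [set t | 0 <= t] N)).
Local Notation Y := (ct_walk X N).
Local Notation shift := (fun x y : Z2 => x + y).
Local Notation addst := (fun x u : nat => (x + u)%N).

Lemma EEi_set0 (U : countType) (Z : nat -> T -> U) (Z_iid : iid P Z) k : EEi P Z k set0 = 0%E.
Proof.
rewrite /EEi -[RHS](EE_cst Z_iid k (lexx (0 : R))).
by apply: eq_EE => s _; rewrite indicE in_set0.
Qed.

Lemma EEi_U (U : countType) (Z : nat -> T -> U) (Z_iid : iid P Z) k (A B : set (seq U)) (a b : R) :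
  (EEi P Z k A <= a%:E)%E -> (EEi P Z k B <= b%:E)%E -> (EEi P Z k (A `|` B) <= (a + b)%:E)%E.
Proof.
move=> ha hb; apply: le_trans (_ : EEi P Z k A + EEi P Z k B <= _)%E; last first.
  by rewrite EFinD; exact: leeD.
have := @EEi_union _ _ _ _ _ _ Z_iid k unit [:: tt] (A `|` B) A (fun=> B).
rewrite big_cons big_nil adde0; apply => s _ [//|Bs] _.
by exists tt; rewrite // inE.
Qed.

Lemma take_path m k w : (k <= m)%N ->
  final shift 0 (take k (path_of X 0 m w)) = partial_sum X k w.
Proof.
move=> km; rewrite /path_of -map_take take_iota (minn_idPl km) -/(path_of X 0 k w).
by rewrite final_path_of add0r.
Qed.

Lemma size_path m w : size (path_of X 0 m w) = m.
Proof. by rewrite size_map size_iota. Qed.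

Lemma visited_atE m x w : visited_at X m x w = site_times x (path_of X 0 m w).
Proof.
apply/funext => k; rewrite /visited_at /site_times size_path.
by case: ltnP => //= km; rewrite take_path// ltnW.
Qed.

Lemma clock_choice (m : nat) (e eta : R) : (0 < m)%N -> 0 < e <= 1 -> 0 < eta ->
  exists (dt : R) (n M : nat), [/\ 0 < dt, dt <= e / 4,
    (P [set w | (M < N (dt * n%:R)%R w)%N] <= eta%:E)%E, n%:R * dt ^+ 2 <= eta & dt * M%:R <= 1] /\
    dt * n%:R = 2 * m%:R /\ 2 ^+ m * dt ^+ 2 * n%:R <= 1.
Proof.
(* Twice the mean time of m jumps: by then the clock has passed m, except with a probability
   exponentially small in m. *)
move=> m0 /andP[e0 e1] eta0; pose t : R := 2 * m%:R.
have t0 : 0 < t by rewrite mulr_gt0// ltr0n.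
have [M hM] := poisson_tight pois (ltW t0) eta0.
(* With dt = t / n each remaining constraint is a lower bound on n. The bound M on the clock depends
   on t only and can be fixed before n. *)
pose c1 := 4 * t / e; pose c2 := t ^+ 2 / eta; pose c3 := t * M%:R; pose c4 := 2 ^+ m * t ^+ 2.
have c10 : 0 <= c1 by rewrite divr_ge0 ?(ltW e0)// mulr_ge0// ltW.
have c20 : 0 <= c2 by rewrite divr_ge0 ?(ltW eta0)// exprn_ge0// ltW.
have c30 : 0 <= c3 by rewrite mulr_ge0// ltW.
have c40 : 0 <= c4 by rewrite mulr_ge0 ?exprn_ge0// ltW.
pose n := (Num.truncn (c1 + c2 + c3 + c4)).+1.
have hn : c1 + c2 + c3 + c4 <= n%:R by exact/ltW/truncnS_gt.
have n0 : 0 < n%:R :> R by rewrite ltr0n.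
have dtn : t / n%:R * n%:R = t by rewrite divfK// gt_eqF.
exists (t / n%:R), n, M; split; last split.
- split; rewrite ?dtn//; first by rewrite divr_gt0.
  + rewrite ler_pdivrMr//; have : c1 <= n%:R by lra.
    by rewrite /c1 ler_pdivrMr// => h; lra.
  + rewrite expr2 mulrA [n%:R * _]mulrC dtn mulrA ler_pdivrMr//.
    have : c2 <= n%:R by lra.
    by rewrite /c2 ler_pdivrMr// expr2 [eta * _]mulrC.
  + by rewrite mulrAC ler_pdivrMr// mul1r -/c3; lra.
- by [].
- have -> : 2 ^+ m * (t / n%:R) ^+ 2 * n%:R = c4 / n%:R by rewrite /c4; field; rewrite gt_eqF.
  by rewrite ler_pdivrMr// mul1r; lra.
Qed.

Variables (r m : nat) (b e eta : R).
Hypotheses (m0 : (0 < m)%N) (b0 : 0 <= b) (e01 : 0 < e <= 1) (eta0 : 0 < eta).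

(** Off this set the grid comparison is valid and its error is at most [dt * M <= 1]. *)
Definition clock_bad (M : nat) : set (seq nat) :=
  [set s | (final addst 0 s < m)%N] `|`
  ([set s | exists2 i, (i < size s)%N & (1 < nth 0 s i)%N] `|`
   [set s | (M < final addst 0 s)%N]).

Lemma clock_bad_prob dt n M : 0 < dt -> dt <= 4^-1 ->
  (P [set w | (M < N (dt * n%:R)%R w)%N] <= eta%:E)%E -> n%:R * dt ^+ 2 <= eta ->
  dt * n%:R = 2 * m%:R ->
  (EEi P (grid_incr N dt) n (clock_bad M) <= (expR (- (m%:R / 32)) + (eta + eta))%:E)%E.
Proof.
move=> dt0 d4 hM hn hdt; have D_iid := grid_incr_iid pois dt0.
apply: (EEi_U D_iid); last apply: (EEi_U D_iid).
- have e1 : 0 < (1 : R) <= 1 by rewrite ltr01 lexx.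
  have de : dt <= 1 / 4 by rewrite div1r.
  have hc k : (cnt (fun y => (y < m)%N) k)%:R <= m%:R :> R.
    rewrite ler_nat /cnt; elim: k => // k IH; rewrite -addn1 iotaD count_cat /= add0n addn0.
    have [km|mk] := ltnP k m; last by rewrite addn0.
    by rewrite addn1 (leq_trans _ km)// ltnS -[leqRHS](size_iota 0) count_size.
  have := grid_upper pois dt0 n e1 de hc; rewrite expr1n mulr1; apply: le_trans.
  apply: (EEi_le D_iid) => s sn /= hs; rewrite (occ_final_lt _ hs) sn hdt; lra.
- by apply: le_trans (grid_skip pois dt0 n) _; rewrite lee_fin.
- rewrite /EEi -(path_prob D_iid 0); apply: le_trans hM.
  by rewrite le_eqVlt; apply/orP; left; apply/eqP; congr (P _); apply/funext => w /=; rewrite (grid_final pois dt0).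
Qed.

Lemma clock_ok dt n M w : 0 < dt -> ~ clock_bad M (path_of (grid_incr N dt) 0 n w) ->
  [/\ (m <= N (dt * n%:R) w)%N, forall j, (j < n)%N -> (grid_incr N dt j w <= 1)%N &
      (N (dt * n%:R) w <= M)%N].
Proof.
move=> dt0 h; rewrite -(grid_final pois dt0); split.
- by rewrite leqNgt; apply/negP => hh; apply: h; left.
- move=> j jn; rewrite leqNgt; apply/negP => hh; apply: h; right; left.
  by exists j; rewrite /path_of ?size_map ?size_iota// (nth_map 0%N) ?size_iota// nth_iota.
- by rewrite leqNgt; apply/negP => hh; apply: h; right; right.
Qed.

(** For a frozen walk the time spent at x sums at most b holding times ([grid_upper]); a union bound
    covers the box. The extra 1 is the discretization error. *)
Lemma clock_upper : exists E : set T, [/\ measurable E,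
  (P E <= ((#|` bx r|)%:R * expR (- (b * e ^+ 2 / 32)) + (expR (- (m%:R / 32)) + (eta + eta)))%:E)%E &
  forall w, ~ E w -> (exists2 k0, (k0 <= m)%N & ~ box r (partial_sum X k0 w)) ->
  forall x, x \in bx r -> visits R x 0 (path_of X 0 m w) <= b ->
  (exit_local_time Y r x w < ((1 + e) * b + 1)%:E)%E].
Proof.
have [dt [n [M [[dt0 de hM hn hdM] [hdt _]]]]] := clock_choice m0 e01 eta0.
have D_iid := grid_incr_iid pois dt0.
have /andP[e0 e1] := e01.
pose Ex s x : set (seq nat) := [set s' | visits R x 0 s <= b /\
  (1 + e) * b <= dt * occ addst (fun y => (site_times x s y)%:R) 0%N s'].
pose E s : set (seq nat) := [set s' | exists2 x, x \in bx r & Ex s x s'] `|` clock_bad M.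
set be := _ + _.
have be0 : 0 <= be by rewrite addr_ge0 ?mulr_ge0 ?expR_ge0// !addr_ge0 ?expR_ge0// ltW.
have hE s : size s = m -> (EEi P (grid_incr N dt) n (E s) <= be%:E)%E.
  move=> sm; apply: (EEi_U D_iid); last by apply: clock_bad_prob => //; lra.
  have := @EEi_union _ _ _ _ _ _ D_iid n _ (enum_fset (bx r)) [set s' | exists2 x, x \in bx r & Ex s x s'] set0 (Ex s).
  move=> /(_ _)/wrap[s' _ [x xr hx] _|]; first by exists x.
  rewrite (EEi_set0 D_iid) add0e => h; apply: (le_trans h).
  apply: (@le_trans _ _ (\sum_(x <- bx r) (expR (- (b * e ^+ 2 / 32)))%:E)%E); last first.
    by rewrite sumEFin lee_fin big_const_seq count_predT iter_addr addr0 -[leLHS]mulr_natl.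
  apply: lee_sum => x _; have [vb|vb] := leP (visits R x 0 s) b; last first.
    rewrite (_ : Ex s x = set0) ?(EEi_set0 D_iid) ?lee_fin ?expR_ge0//.
    by apply/seteqP; split => s' // [] /le_lt_trans/(_ vb); rewrite ltxx.
  have hc k : (cnt (site_times x s) k)%:R <= b.
    by apply: le_trans vb; rewrite visits_cnt ler_nat cnt_site_times.
  apply: le_trans (grid_upper pois dt0 n e01 de hc).
  by apply: (EEi_le D_iid) => s' _ [].
have [mE pE] := joint_prob X_iid pois XN dt0 be0 hE.
eexists; split; [exact: mE|exact: pE|].
move=> w /= nE hout x xr vb.
have [hm hD hNM] := clock_ok dt0 (fun h => nE (or_intror h)).
have xb : box r x by move: xr; rewrite in_fset_set ?in_setE//; exact: finite_box.
apply: le_lt_trans (exit_local_time_upper pois dt0 xb hout hD hm) _.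
rewrite lte_fin visited_atE; apply: ltr_leD; last first.
  by apply: le_trans hdM; rewrite ler_pM2l// ler_nat.
rewrite -(grid_occ pois dt0 (fun y => (site_times x (path_of X 0 m w) y)%:R)) ltNge.
by apply/negP => hh; apply: nE; left; exists x.
Qed.

(** The counterpart through [grid_lower], whose condition that the clock has reached m is ensured
    off [clock_bad]. *)
Lemma clock_lower : exists E : set T, [/\ measurable E,
  (P E <= ((#|` bx r|)%:R * expR (1 - b * e ^+ 2 / 4) + (expR (- (m%:R / 32)) + (eta + eta)))%:E)%E &
  forall w, ~ E w -> (forall k0, (k0 < m)%N -> box r (partial_sum X k0 w)) ->
  forall x, x \in bx r -> b <= visits R x 0 (path_of X 0 m w) ->
  (((1 - e) * b - 1)%:E <= exit_local_time Y r x w)%E].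
Proof.
have [dt [n [M [[dt0 de hM hn hdM] [hdt hdt2]]]]] := clock_choice m0 e01 eta0.
have D_iid := grid_incr_iid pois dt0.
have /andP[e0 e1] := e01.
pose Ex s x : set (seq nat) := [set s' | b <= visits R x 0 s /\ ((m <= final addst 0 s')%N /\
  dt * occ addst (fun y => (site_times x s y)%:R) 0%N s' <= (1 - e) * b)].
pose E s : set (seq nat) := [set s' | exists2 x, x \in bx r & Ex s x s'] `|` clock_bad M.
set be := _ + _.
have be0 : 0 <= be by rewrite addr_ge0 ?mulr_ge0 ?expR_ge0// !addr_ge0 ?expR_ge0// ltW.
have hE s : size s = m -> (EEi P (grid_incr N dt) n (E s) <= be%:E)%E.
  move=> sm; apply: (EEi_U D_iid); last by apply: clock_bad_prob => //; lra.
  have := @EEi_union _ _ _ _ _ _ D_iid n _ (enum_fset (bx r)) [set s' | exists2 x, x \in bx r & Ex s x s'] set0 (Ex s).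
  move=> /(_ _)/wrap[s' _ [x xr hx] _|]; first by exists x.
  rewrite (EEi_set0 D_iid) add0e => h; apply: (le_trans h).
  apply: (@le_trans _ _ (\sum_(x <- bx r) (expR (1 - b * e ^+ 2 / 4))%:E)%E); last first.
    by rewrite sumEFin lee_fin big_const_seq count_predT iter_addr addr0 -[leLHS]mulr_natl.
  apply: lee_sum => x _; have [vb|vb] := leP b (visits R x 0 s); last first.
    rewrite (_ : Ex s x = set0) ?(EEi_set0 D_iid) ?lee_fin ?expR_ge0//.
    by apply/seteqP; split => s' // [] /(lt_le_trans vb); rewrite ltxx.
  have hA k : site_times x s k -> (k < m)%N by rewrite /site_times sm => /andP[].
  have hb : b <= (cnt (site_times x s) m)%:R by move: vb; rewrite visits_cnt sm.
  have d1 : dt <= 1 by lra.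
  have h2 : 2 ^+ cnt (site_times x s) m * dt ^+ 2 * n%:R <= 1.
    apply: le_trans hdt2; apply: ler_wpM2r; first exact: ler0n.
    apply: ler_wpM2r; first exact: sqr_ge0.
    by apply: ler_weXn2l; [rewrite ler1n|rewrite -[leqRHS](size_iota 0) count_size].
  have := grid_lower pois dt0 e01 b0 d1 hA hb h2; apply: le_trans.
  by apply: (EEi_le D_iid) => s' _ [].
have [mE pE] := joint_prob X_iid pois XN dt0 be0 hE.
eexists; split; [exact: mE|exact: pE|].
move=> w /= nE hin x xr vb.
have [hm hD hNM] := clock_ok dt0 (fun h => nE (or_intror h)).
apply: le_trans (exit_local_time_lower pois dt0 n x hin).
rewrite lee_fin visited_atE; apply: lerB; last first.
  by apply: le_trans hdM; rewrite ler_pM2l// ler_nat.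
rewrite -(grid_occ pois dt0 (fun y => (site_times x (path_of X 0 m w) y)%:R)) leNgt.
apply/negP => hh; apply: nE; left; exists x => //; split=> //.
by rewrite (grid_final pois dt0); split=> //; exact: ltW.
Qed.

End clock.

(** * Dyadic scales and their arithmetic *)

Section dyadic.
Context (R : realType).

Definition dl (k : nat) : R := k%:R * ln 2.

Lemma ln2_gt0 : 0 < ln 2 :> R.
Proof. by rewrite ln_gt0// ltr1n. Qed.

Lemma ln_exp2 k : ln (2 ^ k)%:R = dl k.
Proof. by rewrite natrX lnXn// /dl mulr_natl. Qed.

Lemma exp2E k : (2 ^ k)%:R = expR (dl k).
Proof. by rewrite -ln_exp2 lnK// posrE ltr0n expn_gt0. Qed.

Lemma dl_near (A : R) : \forall k \near \oo, A <= dl k.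
Proof.
near=> k; rewrite /dl -ler_pdivrMr ?ln2_gt0//.
by near: k; exact: nbhs_infty_ger.
Unshelve. all: by end_near. Qed.

Lemma exp_dl_near (c x : R) : 0 < x -> \forall k \near \oo, c <= expR (x * dl k).
Proof.
move=> x0; near=> k; have h : c / x <= dl k by near: k; exact: dl_near.
apply: le_trans (expR_ge1Dx _); rewrite ler_pdivrMr// mulrC in h; lra.
Unshelve. all: by end_near. Qed.

Lemma sqr_dl_near (c x : R) : 0 < x -> \forall k \near \oo, c * dl k ^+ 2 <= expR (x * dl k).
Proof.
move=> x0; have c0 : 0 < x ^+ 2 / 16 by rewrite divr_gt0// exprn_gt0.
have x2 : 0 < x / 2 by rewrite divr_gt0.
near=> k; have h : c / (x ^+ 2 / 16) <= expR (x / 2 * dl k) by near: k; exact: exp_dl_near.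
have d0 : 0 <= dl k by rewrite mulr_ge0// ltW// ln2_gt0.
have := expR_sqr (mulr_ge0 (ltW x2) d0); rewrite ler_pdivrMr// in h.
rewrite (_ : x * dl k = x / 2 * dl k + x / 2 * dl k); last by field.
rewrite expRD; move: (expR _) h => E h; rewrite (_ : (x / 2 * dl k) ^+ 2 / 4 = x ^+ 2 / 16 * dl k ^+ 2); last by field.
move=> h2; apply: (@le_trans _ _ (E * (x ^+ 2 / 16) * dl k ^+ 2)).
  by apply: ler_wpM2r => //; exact: sqr_ge0.
rewrite -mulrA; apply: ler_wpM2l => //; apply: le_trans h2.
by rewrite mulr_ge0 ?sqr_ge0 ?ltW.
Unshelve. all: by end_near. Qed.

Lemma near_exp2 (Q : nat -> Prop) (p : nat -> nat) : (forall k, (k <= p k)%N) ->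
  (\forall m \near \oo, Q m) -> \forall k \near \oo, Q (2 ^ p k)%N.
Proof.
move=> hp [M _ hM]; exists M => // k /= Mk; apply: hM => /=.
exact: leq_trans Mk (leq_trans (hp k) (ltnW (ltn_expl _ _))).
Qed.

Lemma card_bx_exp2 k : (#|` bx (2 ^ k)|)%:R <= 9 * expR (2 * dl k) :> R.
Proof.
rewrite card_bx (_ : 2 * dl k = dl k + dl k); last by ring.
rewrite expRD -exp2E -natrM -natrM ler_nat; have : (0 < 2 ^ k)%N by rewrite expn_gt0.
by move: (2 ^ k)%N => n n0; nia.
Qed.

Lemma divn_bounds (k q : nat) : (0 < q)%N ->
  k%:R / q%:R - 1 <= (k %/ q)%:R :> R /\ (k %/ q)%:R <= k%:R / q%:R :> R.
Proof.
move=> q0; have q1 : 0 < q%:R :> R by rewrite ltr0n.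
split; last by rewrite ler_pdivlMr// -natrM ler_nat leq_trunc_div.
rewrite lerBlDr ler_pdivrMr// natr1 -natrM ler_nat.
by rewrite {1}(divn_eq k q) mulSn addnC leq_add2r ltnW// ltn_mod.
Qed.

(** Here L = ln N and l = ln m with m at most N^(2 + ka). The right side is the number of visits
    that [clock_upper] needs for an a-thick site; it exceeds (a - de) [lev m], and it is large
    enough for the concentration of the clock. *)
Lemma upper_arith1 (hh a de ka L l : R) : 0 < hh -> 0 < a -> 0 < de -> de <= a / 2 -> 0 < ka <= 1 ->
  8 * a * ka <= de -> 1 <= L -> (2 * hh * de)^-1 + 1 <= L -> 0 <= l -> l <= (2 + ka) * L ->
  (a - de) * (hh * l * l) <= (4 * hh * a * L ^+ 2 - 1) / (1 + ka) /\
  hh * a * L ^+ 2 <= (4 * hh * a * L ^+ 2 - 1) / (1 + ka).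
Proof.
move=> h0 a0 d0 da /andP[k0 k1] kd L1 hL l0 lL.
have hd : 0 < 2 * hh * de by rewrite !mulr_gt0.
have h1 : 1 <= 2 * hh * de * L ^+ 2.
  have : (2 * hh * de)^-1 <= L by lra.
  rewrite -[X in X <= _]div1r ler_pdivrMr// => hl; apply: (le_trans hl).
  by rewrite [L * _]mulrC ler_pM2l// expr2 ler_peMl//; lra.
have W0 : 0 < hh * L ^+ 2 by rewrite mulr_gt0// exprn_gt0//; lra.
have k10 : 0 < 1 + ka by lra.
split; rewrite ler_pdivlMr//.
  have ll : l * l <= (2 + ka) * L * ((2 + ka) * L) by apply: ler_pM.
  have c1 : (2 + ka) ^+ 2 * (1 + ka) <= 4 * (1 + 4 * ka) by nra.
  have c2 : (a - de) * (1 + 4 * ka) <= a - de / 2 by nra.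
  have ad : 0 <= (a - de) * hh by rewrite mulr_ge0 ?(ltW h0)//; lra.
  apply: (@le_trans _ _ ((a - de) * hh * ((2 + ka) * L * ((2 + ka) * L)) * (1 + ka))).
    rewrite ler_pM2r//; have -> : (a - de) * (hh * l * l) = (a - de) * hh * (l * l) by ring.
    exact: ler_wpM2l.
  have -> : (a - de) * hh * ((2 + ka) * L * ((2 + ka) * L)) * (1 + ka) =
     (a - de) * ((2 + ka) ^+ 2 * (1 + ka)) * (hh * L ^+ 2) by ring.
  apply: (@le_trans _ _ (4 * (a - de / 2) * (hh * L ^+ 2))); last first.
    have -> : 4 * hh * a * L ^+ 2 = 4 * a * (hh * L ^+ 2) by ring.
    move: h1; have -> : 2 * hh * de * L ^+ 2 = 2 * de * (hh * L ^+ 2) by ring.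
    by move: (hh * L ^+ 2) => W h1; lra.
  rewrite ler_pM2r//; apply: le_trans (_ : (a - de) * (4 * (1 + 4 * ka)) <= _).
    by rewrite ler_pM2l//; lra.
  by rewrite mulrCA ler_pM2l.
have -> : hh * a * L ^+ 2 * (1 + ka) = a * (1 + ka) * (hh * L ^+ 2) by ring.
have -> : 4 * hh * a * L ^+ 2 = 4 * a * (hh * L ^+ 2) by ring.
move: h1; have -> : 2 * hh * de * L ^+ 2 = 2 * de * (hh * L ^+ 2) by ring.
by move: (hh * L ^+ 2) W0 => W W0 h1; nra.
Qed.

(** The pigeonhole condition: 10 [lev m] visits at every site of the box take fewer than m steps,
    since m exceeds N^2 by a power of N. *)
Lemma upper_arith2 (hh ka L l : R) : 0 < hh -> 0 < ka <= 1 -> 1 <= L -> 0 <= l -> l <= (2 + ka) * L ->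
  2 * L + ka * L - ln 2 <= l -> 4096 * hh * L ^+ 2 <= expR (ka / 2 * L) -> 2 <= expR (ka / 2 * L) ->
  10 * (hh * l * l) * (9 * expR (2 * L)) <= expR l.
Proof.
move=> h0 /andP[k0 k1] L1 l0 lL lL2 hE hE2.
have l3 : l <= 3 * L by nra.
have ll : l * l <= 3 * L * (3 * L) by apply: ler_pM.
have : expR (2 * L + ka * L - ln 2) <= expR l by rewrite ler_expR.
apply: le_trans; rewrite (_ : 2 * L + ka * L - ln 2 = 2 * L + (ka / 2 * L + ka / 2 * L) - ln 2); last by field.
rewrite expRD expRD (expRD (ka / 2 * L)) expRN lnK ?posrE//.
have e0 := expR_gt0 (2 * L); move: (expR (2 * L)) e0 => F F0.
move: (expR _) hE hE2 => E hE hE2.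
have : 10 * (hh * l * l) * 9 <= E * E / 2.
  have : hh * (l * l) <= hh * (3 * L * (3 * L)) by rewrite ler_pM2l.
  have -> : hh * (3 * L * (3 * L)) = 9 * (hh * L ^+ 2) by ring.
  rewrite [hh * (l * l)]mulrA; rewrite (_ : 4096 * hh * L ^+ 2 = 4096 * (hh * L ^+ 2)) in hE; last by ring.
  have W0 : 0 < hh * L ^+ 2 by rewrite mulr_gt0// exprn_gt0//; lra.
  have : E <= E * E / 2 by nra.
  lra.
by move=> hh2; nra.
Qed.

End dyadic.

(** * Upper bound on the count at a dyadic scale *)

Section scale_events.
Context d (T : measurableType d) (R : realType) (P : probability T R).
Context (X : nat -> T -> Z2) (N : R -> T -> nat).
Context (X_iid : iid P X) (symX : symmetric_law P (X 0%N)) (varX : finite_variance P (X 0%N)).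
Context (C : R) (C0 : 0 < C)
  (hC : forall th x, 1 - cos (ip th x) <= C * sqn R x * (1 - charf P (X 0%N) th)).
Context (pois : poisson_process P 1 N).
Context (XN : indep_systems P (sigma_family setT X) (sigma_family [set t | 0 <= t] N)).
Local Notation Y := (ct_walk X N).
Local Notation G := (covariance_mx P (X 0%N)).
Local Notation h := (gconst P (X 0%N)).
Local Notation mX := (iid_measurable X_iid 0%N).
Let h0 : 0 < h. Proof. exact: (gconst_gt0 mX varX C0 hC). Qed.

Definition nthick (a : R) (r : nat) (w : T) : R := (#|` fset_set (thick_points G Y a r w)|)%:R.

Lemma nthickE a r w : nthick a r w = (#|` fset_set (thick_points G Y a r w)|)%:R.
Proof. by []. Qed.

Lemma thickE a k : thick_const G * a * ln (2 ^ k)%:R ^+ 2 = 4 * h * a * dl R k ^+ 2.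
Proof. by rewrite ln_exp2 (gconstE mX varX C0 hC); field. Qed.

Lemma in_thick a r w x : (x \in fset_set (thick_points G Y a r w)) =
  (x \in bx r) && ((thick_const G * a * ln r%:R ^+ 2)%:E <= exit_local_time Y r x w)%E.
Proof.
rewrite in_fset_set; last exact: finite_thick_points.
rewrite in_fset_set; last exact: finite_box.
by apply/idP/andP => [/set_mem[h1 h2]|[/set_mem h1 h2]]; [split=> //; exact/mem_set|exact/mem_set].
Qed.

Lemma count_markov m r (t v be : R) : 0 < t -> 0 <= be ->
  (forall x, (EEi P X m [set s | (v <= visits R x 0 s)%R] <= be%:E)%E) ->
  (EEi P X m [set s | (t <= \sum_(x <- bx r) \1_[set s | (v <= visits R x 0 s)%R] s)%R] <=
   ((#|` bx r|)%:R * be / t)%:E)%E.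
Proof.
move=> t0 be0 hb; apply: le_trans (_ : EE P X m (fun s => t^-1%:E *
    (\sum_(x <- bx r) (\1_[set s | (v <= visits R x 0 s)%R] s)%:E)) <= _)%E.
  apply: (EE_le X_iid) => [s|s _]; first by rewrite lee_fin.
  rewrite sumEFin -EFinM lee_fin indicE; have [/set_mem /= hs|_] := boolP (s \in _).
    by rewrite mulrC ler_pdivlMr// mul1r.
  by rewrite mulr_ge0 ?invr_ge0 ?(ltW t0)// sumr_ge0.
rewrite (EE_Zl X_iid) ?invr_ge0 ?(ltW t0)//; last by move=> s; apply: sume_ge0 => x _; rewrite lee_fin.
rewrite (EE_sum X_iid) => [|x s]; last by rewrite lee_fin.
rewrite [_ * be]mulrC mulrAC -mulrA [X in (_ <= X)%E]EFinM.
apply: le_trans (_ : t^-1%:E * (\sum_(x <- bx r) be%:E) <= _)%E.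
  apply: lee_wpmul2l; first by rewrite lee_fin invr_ge0 ltW.
  by apply: lee_sum => x _; exact: hb.
rewrite sumEFin big_const_seq count_predT iter_addr addr0 -EFinM -EFinM lee_fin.
by rewrite -[be *+ _]mulr_natl le_eqVlt; apply/orP; left; apply/eqP; ring.
Qed.

(** Let N = 2^k and run m = N^(2 + ka) steps. The exceptional event joins a failure of the clock, a
    site with 10 [lev m] visits ([B1]), and too many sites with (a - de) [lev m] visits ([B2], by
    Markov's inequality). Off [B1] the pigeonhole principle forces an exit within m steps, and then
    each a-thick site is among those counted in [B2]. *)
Lemma upper_scale (a e : R) : 0 < a -> 0 < e <= 1 -> \forall k \near \oo, exists E : set T,
  [/\ measurable E, (P E <= (expR (- (e / 8) * dl R k))%:E)%E &
  forall w, ~ E w -> nthick a (2 ^ k) w <= expR ((2 - 2 * a + e) * dl R k)].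
Proof.
move=> a0 /andP[e0 e1].
pose de := Num.min (e / 16) (a / 2).
have de0 : 0 < de by rewrite lt_min !divr_gt0.
have dee : de <= e / 16 by rewrite ge_min lexx.
have dea : de <= a / 2 by rewrite ge_min lexx orbT.
(* An integer q keeps the length of the walk a power of 2, namely 2^(2k + k %/ q). *)
pose q := (Num.truncn (8 * a / de + 1)).+1; pose ka : R := q%:R^-1.
have q0 : 0 < q%:R :> R by rewrite ltr0n.
have hq : 8 * a / de + 1 <= q%:R by exact/ltW/truncnS_gt.
have qa0 : 0 <= 8 * a / de by rewrite divr_ge0 ?mulr_ge0 ?ltW.
have ka0 : 0 < ka by rewrite invr_gt0.
have ka1 : ka <= 1 by rewrite invf_le1//; lra.
have kaq : ka * q%:R = 1 by rewrite mulVf// gt_eqF.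
have kad : 8 * a * ka <= de.
  have : 8 * a / de <= q%:R by lra.
  rewrite ler_pdivrMr// => hh; have := ler_wpM2r (ltW ka0) hh.
  rewrite (_ : q%:R * de * ka = ka * q%:R * de); last by ring.
  by rewrite kaq mul1r.
have ka01 : 0 < ka <= 1 by rewrite ka0.
pose a' := a - de; have a'0 : 0 < a' by rewrite /a'; lra.
pose p k := (2 * k + k %/ q)%N.
have kp k : (k <= p k)%N by rewrite /p mul2n -addnn -addnA leq_addr.
(* Large enough that m^(-9) <= N^(-18) beats the number of sites of the box. *)
have ten : 0 < 10 :> R by [].
have [M1 M10 hM1] := visits_tail X_iid symX varX C0 hC ten (@ltr01 R).
have [M2 M20 hM2] := visits_tail X_iid symX varX C0 hC a'0 de0.
have n1 := near_exp2 kp hM1; have n2 := near_exp2 kp hM2.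
have L1 := dl_near (1 : R).
have L2 := sqr_dl_near (4096 * h) (divr_gt0 ka0 (ltr0n R 2)).
have L2' := exp_dl_near 2 (divr_gt0 ka0 (ltr0n R 2)).
have L3 := dl_near ((2 * h * de)^-1 + 1 : R).
have L4 := dl_near (128 / (h * a * ka ^+ 2) : R).
have L5 := sqr_dl_near 32 (ltr01 : 0 < 1 :> R).
have L6 := exp_dl_near (9 * M1 + 9 * M2 + 12) (divr_gt0 e0 (ltr0n R 8)).
have A9 (L l : R) : 2 * L <= l -> 18 * L <= (10 - 1) * l by lra.
have A1 (L : R) : 1 <= L -> 2 * L - 18 * L <= - (e / 4 * L) by move=> ?; nra.
have A2 (L : R) : 1 <= L -> 2 * L - 2 * (a - de - de) * L <= - (e / 4 * L) + (2 - 2 * a + e) * L.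
  move=> L0; have : de * L <= e / 16 * L by rewrite ler_wpM2r//; lra.
  by have : 0 <= e * L by [apply: mulr_ge0; lra]; lra.
have A3 (L : R) : 1 <= L -> e / 4 * L <= L by move=> ?; nra.
have A4 (x y z E4 : R) : x <= 9 * z -> y <= z -> z <= E4 -> x + (y + (z + z)) <= 12 * E4 by lra.
have A5 (L : R) : e / 8 * L + - (e / 4 * L) <= - (e / 8) * L by lra.
have A7 (L l : R) : 1 <= L -> 2 * L <= l -> 1 * L <= l by lra.
have A8 (L : R) : 1 <= L -> 2 * L + - (4 * L) <= - L by lra.
have A10 (L l x y z : R) : l = 2 * L + x -> y - z <= x -> 2 * L + y - z <= l by lra.
have ad0 : 0 <= a' - de by rewrite /a'; lra.
apply: filterS3 n1 n2 (filterI (filterI (filterI L1 L2) (filterI L2' L3)) (filterI L4 (filterI L5 L6))) =>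
  k h1 h2 [[[l1 L2k] [L2'k L3k]] [L4k [L5k L6k]]].
have l0 : 0 <= (dl R k) by exact: le_trans ler01 l1.
pose m := (2 ^ p k)%N; have m0 : (0 < m)%N by rewrite expn_gt0.
have [b1 b2] := divn_bounds R k (ltn0Sn _ : (0 < q)%N).
have lm : ln m%:R = dl R (p k) by rewrite /m ln_exp2.
have pE : dl R (p k) = 2 * (dl R k) + (k %/ q)%:R * ln 2 by rewrite /dl /p natrD natrM; ring.
have kq : k%:R / q%:R * ln 2 = ka * (dl R k) :> R by rewrite /ka /dl; ring.
have l2 := ln2_gt0 R.
have lp1 : dl R (p k) <= (2 + ka) * (dl R k).
  by rewrite pE [(2 + ka) * _]mulrDl -kq lerD2l ler_pM2r.
have lp2 : 2 * (dl R k) <= dl R (p k) by rewrite pE lerDl mulr_ge0// ltW.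
have lp3 : 2 * (dl R k) + ka * (dl R k) - ln 2 <= dl R (p k).
  by apply: (A10 _ _ _ _ _ pE); rewrite -kq; have := ler_wpM2r (ltW l2) b1; rewrite mulrBl mul1r.
have lk0 : 0 <= dl R (p k) by apply: le_trans lp2; rewrite mulr_ge0.
have levE : lev P X m = h * dl R (p k) * dl R (p k) by rewrite /lev /U lm.
pose b := (4 * h * a * (dl R k) ^+ 2 - 1) / (1 + ka).
have [bv bL] := upper_arith1 h0 a0 de0 dea ka01 kad l1 L3k lk0 lp1.
have pig := upper_arith2 h0 ka01 l1 lk0 lp1 lp3 L2k L2'k.
have mE : m%:R = expR (dl R (p k)) :> R by rewrite /m exp2E.
have cb := card_bx_exp2 R k.
have b0 : 0 <= b.
  apply: le_trans bL; apply: mulr_ge0; last exact: sqr_ge0.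
  by apply: mulr_ge0; exact: ltW.
have eta0 : 0 < expR (- (dl R k)) by exact: expR_gt0.
have [E [mE' pEv hE]] := clock_upper X_iid pois XN (2 ^ k)%N b m0 ka01 eta0.
pose B1 : set (seq Z2) := [set s | exists2 x, x \in bx (2 ^ k) & 10 * lev P X m <= visits R x 0 s].
pose t := expR ((2 - 2 * a + e) * (dl R k)).
pose B2 : set (seq Z2) := [set s | (t <= \sum_(x <- bx (2 ^ k)) \1_[set s | (a' * lev P X m <= visits R x 0 s)%R] s)%R].
have p9 : m%:R `^ (- (10 - 1)) <= expR (- (18 * (dl R k))) :> R.
  by rewrite natr_powRE// lm ler_expR mulNr lerN2; exact: A9.
have pd : m%:R `^ (- (a' - de)) <= expR (- (2 * (a' - de) * (dl R k))) :> R.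
  rewrite natr_powRE// lm ler_expR mulNr lerN2 [2 * _]mulrC -mulrA.
  exact: ler_wpM2l.
have q1 : (EEi P X m B1 <= (9 * M1 * expR (- (e / 4 * (dl R k))))%:E)%E.
  have := @EEi_union _ _ _ _ _ _ X_iid m _ (enum_fset (bx (2 ^ k))) B1 set0
    (fun x => [set s | (10 * lev P X m <= visits R x 0 s)%R]).
  move=> /(_ _)/wrap[s' _ [x xr hx] _|]; first by exists x.
  rewrite (EEi_set0 X_iid) add0e => hu; apply: (le_trans hu).
  apply: (@le_trans _ _ (\sum_(x <- bx (2 ^ k)) (M1 * expR (- (18 * (dl R k))))%:E)%E).
    apply: lee_sum => x _; apply: (le_trans (h1 x)); rewrite lee_fin.
    by apply: ler_wpM2l => //; exact: ltW.
  rewrite sumEFin lee_fin big_const_seq count_predT iter_addr addr0 -[leLHS]mulr_natl.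
  apply: (@le_trans _ _ (9 * expR (2 * (dl R k)) * (M1 * expR (- (18 * (dl R k)))))).
    by apply: ler_wpM2r => //; rewrite mulr_ge0 ?expR_ge0// ltW.
  have -> : 9 * expR (2 * (dl R k)) * (M1 * expR (- (18 * (dl R k)))) = 9 * M1 * expR (2 * (dl R k) - 18 * (dl R k)).
    by rewrite expRD; ring.
  by rewrite ler_pM2l ?mulr_gt0// ler_expR; exact: A1.
have q2 : (EEi P X m B2 <= (9 * M2 * expR (- (e / 4 * (dl R k))))%:E)%E.
  have be0 : 0 <= M2 * expR (- (2 * (a' - de) * (dl R k))) by rewrite mulr_ge0 ?expR_ge0// ltW.
  apply: le_trans (count_markov (v := a' * lev P X m) (2 ^ k) (expR_gt0 _ : 0 < t) be0 _) _.
    by move=> x; apply: (le_trans (h2 x)); rewrite lee_fin; apply: ler_wpM2l => //; exact: ltW.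
  rewrite lee_fin ler_pdivrMr ?expR_gt0//.
  apply: (@le_trans _ _ (9 * expR (2 * (dl R k)) * (M2 * expR (- (2 * (a' - de) * (dl R k)))))).
    by apply: ler_wpM2r.
  have -> : 9 * expR (2 * (dl R k)) * (M2 * expR (- (2 * (a' - de) * (dl R k)))) =
      9 * M2 * expR (2 * (dl R k) - 2 * (a' - de) * (dl R k)) by rewrite expRD; ring.
  by rewrite -[leRHS]mulrA ler_pM2l ?mulr_gt0// -expRD ler_expR /a'; exact: A2.
have q3 : (P E <= (12 * expR (- (e / 4 * (dl R k))))%:E)%E.
  apply: (le_trans pEv); rewrite lee_fin.
  have eL : expR (- (dl R k)) <= expR (- (e / 4 * (dl R k))).
    by rewrite ler_expR lerN2; exact: A3.
  have c1 : expR (- (m%:R / 32)) <= expR (- (dl R k)).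
    rewrite ler_expR lerN2 ler_pdivlMr// mE.
    have : expR (1 * (dl R k)) <= expR (dl R (p k)) by rewrite ler_expR; exact: A7.
    apply: le_trans; apply: le_trans L5k; rewrite mulrC expr2.
    by rewrite ler_pM2l// ler_peMl.
  have c2 : expR (- (b * ka ^+ 2 / 32)) <= expR (- (4 * (dl R k))).
    rewrite ler_expR lerN2; have hk : 0 < h * a * ka ^+ 2 by rewrite !mulr_gt0// exprn_gt0.
    rewrite ler_pdivlMr//; apply: (@le_trans _ _ (h * a * (dl R k) ^+ 2 * ka ^+ 2)); last first.
      by apply: ler_wpM2r; [exact: sqr_ge0|exact: bL].
    rewrite ler_pdivrMr// in L4k.
    have -> : h * a * (dl R k) ^+ 2 * ka ^+ 2 = (dl R k) * ((dl R k) * (h * a * ka ^+ 2)) by ring.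
    have -> : 4 * (dl R k) * 32 = (dl R k) * 128 by ring.
    exact: ler_wpM2l.
  have c3 : (#|` bx (2 ^ k)|)%:R * expR (- (b * ka ^+ 2 / 32)) <= 9 * expR (- (dl R k)).
    apply: (@le_trans _ _ (9 * expR (2 * (dl R k)) * expR (- (4 * (dl R k))))).
      by apply: ler_pM; rewrite ?expR_ge0.
    by rewrite -mulrA -expRD ler_pM2l// ler_expR; exact: A8.
  exact: A4.
exists (E `|` path_of X 0 m @^-1` (B1 `|` B2)); split.
- by apply: measurableU => //; exact: (path_of_discrete X_iid).
- have := EEi_U X_iid q1 q2; rewrite /EEi -(path_prob X_iid 0 m) => q4.
  apply: le_trans (measureU2 _ mE' (path_of_discrete X_iid 0 m (B1 `|` B2))) _.
  apply: le_trans (leeD q3 q4) _; rewrite -EFinD lee_fin.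
  have -> : 12 * expR (- (e / 4 * (dl R k))) + (9 * M1 * expR (- (e / 4 * (dl R k))) + 9 * M2 * expR (- (e / 4 * (dl R k)))) =
    (9 * M1 + 9 * M2 + 12) * expR (- (e / 4 * (dl R k))) by ring.
  apply: (@le_trans _ _ (expR (e / 8 * (dl R k)) * expR (- (e / 4 * (dl R k))))).
    by rewrite ler_wpM2r// expR_ge0.
  by rewrite -expRD ler_expR; exact: A5.
move=> w nE; have nEc : ~ E w by move=> hw; apply: nE; left.
have nB1 : ~ B1 (path_of X 0 m w) by move=> hw; apply: nE; right; left.
have nB2 : ~ B2 (path_of X 0 m w) by move=> hw; apply: nE; right; right.
have hout : exists2 k0, (k0 <= m)%N & ~ box (2 ^ k) (partial_sum X k0 w).
  apply: contrapT => hn; apply: nB1.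
  apply: (visits_pigeonhole (r := 2 ^ k) (size_path X m w)).
  - move=> j jm; rewrite take_path ?(ltnW jm)//.
    rewrite in_fset_set; last exact: finite_box.
    by apply/mem_set; apply: contrapT => hb; apply: hn; exists j => //; exact: ltnW.
  - rewrite mE levE; apply: le_trans pig; apply: ler_wpM2l => //.
    apply: mulr_ge0 => //; apply: mulr_ge0 => //; apply: mulr_ge0 => //.
    exact: ltW.
  - by rewrite card_bx expn_gt0.
apply: le_trans (ltW _ : \sum_(x <- bx (2 ^ k)) \1_[set s | (a' * lev P X m <= visits R x 0 s)%R] (path_of X 0 m w) <= t); last first.
  by rewrite ltNge; apply/negP.
rewrite /nthick; pose S := [seq x <- enum_fset (bx (2 ^ k)) | a' * lev P X m <= visits R x 0 (path_of X 0 m w)].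
have -> : \sum_(x <- bx (2 ^ k)) \1_[set s | (a' * lev P X m <= visits R x 0 s)%R] (path_of X 0 m w) = (size S)%:R :> R.
  rewrite size_filter -sum1_count natr_sum [RHS]big_mkcond; apply: eq_bigr => x _.
  by rewrite indicE; case: ifPn => hx; [rewrite mem_set|rewrite memNset//; exact/negP].
rewrite ler_nat; apply: uniq_leq_size => [|x]; first exact: fset_uniq.
rewrite in_thick => /andP[xr hx]; rewrite mem_filter xr andbT levE; apply: (le_trans bv).
rewrite leNgt; apply/negP => hv.
have := hE w nEc hout x xr (ltW hv).
rewrite ltNge; move: hx; rewrite thickE => hx; apply/negP; rewrite negbK; apply: le_trans hx.
by rewrite lee_fin /b mulrC divfK ?subrK// gt_eqF// addr_gt0.
Qed.

End scale_events.

(** * Lower bound on the count at a dyadic scale *)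

Section lower_arithmetic.
Context (R : realType).

Lemma lower_arith1 (hh a de ka L l : R) : 0 < hh -> 0 < a -> 0 < de -> a + de <= 1 -> 0 < ka <= 2^-1 ->
  6 * ka <= de -> 1 <= L -> (2 * hh * de)^-1 + 1 <= L -> (2 - 2 * ka) * L <= l ->
  4 * hh * a * L ^+ 2 <= (1 - ka) * ((a + de) * (hh * l * l)) - 1.
Proof.
move=> h0 a0 d0 a1 /andP[k0 k1] kd L1 hL lL.
have hd : 0 < 2 * hh * de by rewrite !mulr_gt0.
have h1 : 1 <= 2 * hh * de * L ^+ 2.
  have : (2 * hh * de)^-1 <= L by lra.
  rewrite -[X in X <= _]div1r ler_pdivrMr// => hl; apply: (le_trans hl).
  by rewrite [L * _]mulrC ler_pM2l// expr2 ler_peMl//; lra.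
have W0 : 0 < hh * L ^+ 2 by rewrite mulr_gt0// exprn_gt0//; lra.
have ll : (2 - 2 * ka) * L * ((2 - 2 * ka) * L) <= l * l.
  by apply: ler_pM => //; apply: mulr_ge0; lra.
have c0 : 0 <= (1 - ka) * (a + de) * hh by apply: mulr_ge0; [apply: mulr_ge0|]; lra.
have c1 : 4 * (1 - 3 * ka) <= (1 - ka) * (2 - 2 * ka) ^+ 2 by nra.
have c2 : a + de / 2 <= (a + de) * (1 - 3 * ka) by nra.
rewrite lerBrDr; apply: (@le_trans _ _ ((1 - ka) * (a + de) * hh * ((2 - 2 * ka) * L * ((2 - 2 * ka) * L)))); last first.
  have -> : (1 - ka) * ((a + de) * (hh * l * l)) = (1 - ka) * (a + de) * hh * (l * l) by ring.
  exact: ler_wpM2l.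
have -> : (1 - ka) * (a + de) * hh * ((2 - 2 * ka) * L * ((2 - 2 * ka) * L)) =
  (a + de) * ((1 - ka) * (2 - 2 * ka) ^+ 2) * (hh * L ^+ 2) by ring.
apply: (@le_trans _ _ (4 * (a + de / 2) * (hh * L ^+ 2))).
  have -> : 4 * hh * a * L ^+ 2 = 4 * a * (hh * L ^+ 2) by ring.
  move: h1; have -> : 2 * hh * de * L ^+ 2 = 2 * de * (hh * L ^+ 2) by ring.
  by move: (hh * L ^+ 2) => W h1; lra.
rewrite ler_pM2r//; apply: le_trans (_ : (a + de) * (4 * (1 - 3 * ka)) <= _).
  by rewrite mulrCA ler_pM2l.
by rewrite ler_pM2l//; lra.
Qed.

Lemma lower_arith2 (hh a de L l : R) : 0 < hh -> 0 < a -> 0 < de -> 0 <= L -> L <= l ->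
  hh * a * L ^+ 2 <= (a + de) * (hh * l * l).
Proof.
move=> h0 a0 d0 L0 Ll.
have -> : hh * a * L ^+ 2 = a * (hh * (L * L)) by ring.
rewrite -[hh * l * l]mulrA; apply: ler_pM; rewrite ?(ltW a0)//.
- by apply: mulr_ge0; [exact: ltW|exact: mulr_ge0].
- by rewrite lerDl ltW.
- by rewrite ler_pM2l//; apply: ler_pM.
Qed.

End lower_arithmetic.

Section lower_scale.
Context d (T : measurableType d) (R : realType) (P : probability T R).
Context (X : nat -> T -> Z2) (N : R -> T -> nat).
Context (X_iid : iid P X) (symX : symmetric_law P (X 0%N)) (varX : finite_variance P (X 0%N)).
Context (C : R) (C0 : 0 < C)
  (hC : forall th x, 1 - cos (ip th x) <= C * sqn R x * (1 - charf P (X 0%N) th)).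
Context (pois : poisson_process P 1 N).
Context (XN : indep_systems P (sigma_family setT X) (sigma_family [set t | 0 <= t] N)).
Local Notation Y := (ct_walk X N).
Local Notation h := (gconst P (X 0%N)).
Local Notation mX := (iid_measurable X_iid 0%N).
Local Notation nthick := (nthick P X N).
Let h0 : 0 < h. Proof. exact: (gconst_gt0 mX varX C0 hC). Qed.

(** Run J = N^ka blocks of m = N^(2 - 2 ka) steps. The total N^(2 - ka) is too short to leave the
    box ([early_exit]). Each block has enough thick sites with probability m^(- ka / 4) >= N^(- ka /
    2), so among J blocks one succeeds. Its thick sites, translated by the start of the block, are
    visited inside the box, and the other blocks only add visits. *)
Lemma lower_scale (a e : R) : 0 < a < 1 -> 0 < e <= 1 -> exists2 q : R, 0 < q &
  \forall k \near \oo, exists E : set T,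
  [/\ measurable E, (P E <= (expR (- q * dl R k))%:E)%E &
  forall w, ~ E w -> expR ((2 - 2 * a - e) * dl R k) <= nthick a (2 ^ k) w].
Proof.
move=> /andP[a0 a1] /andP[e0 e1].
pose de := Num.min (e / 8) ((1 - a) / 2).
have de0 : 0 < de by rewrite lt_min !divr_gt0// subr_gt0.
have dee : de <= e / 8 by rewrite ge_min lexx.
have dea : de <= (1 - a) / 2 by rewrite ge_min lexx orbT.
pose q := (Num.truncn (6 / de)).+2; pose ka : R := q%:R^-1.
have q0 : 0 < q%:R :> R by rewrite ltr0n.
have hq : 6 / de <= q%:R by apply: (le_trans (ltW (truncnS_gt _))); rewrite ler_nat.
have ka0 : 0 < ka by rewrite invr_gt0.
have ka1 : ka <= 2^-1 by rewrite lef_pV2 ?posrE// ler_nat.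
have kad : 6 * ka <= de by rewrite ler_pdivrMr// mulrC -ler_pdivrMr.
have ka01 : 0 < ka <= 2^-1 by rewrite ka0.
have ka11 : 0 < ka <= 1 by rewrite ka0/=; lra.
have ad01 : 0 < a + de < 1 by lra.
have ad0 : 0 < a + de by lra.
have e20 : 0 < ka / 4 by rewrite divr_gt0.
(* The logarithm of m in base 2; that of J is k %/ q. *)
pose p k := (2 * k - 2 * (k %/ q))%N.
have kq2 k : (2 * (k %/ q) <= k)%N.
  by apply: leq_trans (leq_trunc_div k q); rewrite mulnC leq_mul2l orbC.
have kp k : (k <= p k)%N by rewrite /p mul2n -addnn -addnBA// leq_addr.
have n1 := near_exp2 kp (thick_lower X_iid symX varX C0 hC ad01 e20).
have L1 := dl_near (1 : R).
have L2 := sqr_dl_near 2 (divr_gt0 ka0 (ltr0n R 2)).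
have L3 := dl_near ((2 * h * de)^-1 + 1 : R).
have L4 := dl_near (16 / (h * a * ka ^+ 2) : R).
have L5 := sqr_dl_near 32 (ltr01 : 0 < 1 :> R).
pose s2 := sigma2 P (X 0%N); have s20 : 0 <= s2 by exact: sigma2_ge0.
have L6 := exp_dl_near (2 * s2 + 9 * expR 1 + 4) (divr_gt0 ka0 (ltr0n R 2)).
exists (ka / 2); first by rewrite divr_gt0.
have A1 (L l x : R) : l = 2 * L - 2 * x -> x <= ka * L -> (2 - 2 * ka) * L <= l by lra.
have A2 (L l : R) : 1 <= L -> (2 - 2 * ka) * L <= l -> 1 * L <= l by move=> ? ?; nra.
have A3 (L : R) : 1 <= L -> ka * L <= L by move=> ?; nra.
have A4 (L : R) : 1 <= L -> 2 * L + (1 - 4 * L) <= 1 - ka * L by move=> ?; nra.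
have A5 (x1 x2 y z E4 F : R) : x1 <= 2 * s2 * E4 -> x2 <= z -> F <= 9 * expR 1 * E4 -> y <= z -> z <= E4 ->
  F + (y + (z + z)) + (x1 + x2) <= (2 * s2 + 9 * expR 1 + 4) * E4 by lra.
have A6 (L : R) : ka / 2 * L + - (ka * L) <= - (ka / 2) * L by lra.
have A7 (L l : R) : 1 <= L -> (2 - 2 * ka) * L <= l ->
    (2 - 2 * a - e) * L <= (1 - (a + de) - ka / 4) * l.
  move=> L0 hl; apply: (@le_trans _ _ ((1 - (a + de) - ka / 4) * ((2 - 2 * ka) * L))); last first.
    by apply: ler_wpM2l => //; lra.
  by rewrite mulrA; apply: ler_wpM2r; [lra|nra].
have A8 (L l x : R) : ka * L - ln 2 <= x -> l <= 2 * L -> ka / 2 * L - ln 2 <= x - ka / 4 * l.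
  by move=> h1 h2; have : ka / 4 * l <= ka / 4 * (2 * L) by [rewrite ler_pM2l]; lra.
have A9 (L l x : R) : l = 2 * L - 2 * x -> ka * L - ln 2 <= x -> l + x <= ln 2 + - (ka * L) + (L + L) by lra.
apply: filterS3 n1 L1 (filterI (filterI L2 L3) (filterI L4 (filterI L5 L6))) =>
  k [V hV] l1 [[L2k L3k] [L4k [L5k L6k]]].
have l0 : 0 <= dl R k by exact: le_trans ler01 l1.
pose m := (2 ^ p k)%N; have m0 : (0 < m)%N by rewrite expn_gt0.
pose J := (2 ^ (k %/ q))%N; have J0 : (0 < J)%N by rewrite expn_gt0.
have mJ0 : (0 < m * J)%N by rewrite muln_gt0 m0.
have [b1 b2] := divn_bounds R k (ltn0Sn _ : (0 < q)%N).
have l2 := ln2_gt0 R.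
pose x : R := (k %/ q)%:R * ln 2.
have lm : ln m%:R = dl R (p k) by rewrite /m ln_exp2.
have pE : dl R (p k) = 2 * dl R k - 2 * x.
  by rewrite /dl /p /x natrB ?natrM ?leq_mul2l ?leq_div//; ring.
have kq : k%:R / q%:R * ln 2 = ka * dl R k :> R by rewrite /ka /dl; ring.
have x1 : x <= ka * dl R k by rewrite -kq ler_pM2r.
have x2 : ka * dl R k - ln 2 <= x.
  by rewrite -kq; have := ler_wpM2r (ltW l2) b1; rewrite mulrBl mul1r.
have x0 : 0 <= x by rewrite mulr_ge0// ltW.
have lp1 := A1 _ _ _ pE x1.
have lp2 : dl R (p k) <= 2 * dl R k by rewrite pE gerBl mulr_ge0.
have lp3 : 1 * dl R k <= dl R (p k) by exact: A2.
have levE : lev P X m = h * dl R (p k) * dl R (p k) by rewrite /lev /U lm.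
pose b := (a + de) * lev P X m.
have bE : b = (a + de) * (h * dl R (p k) * dl R (p k)) by rewrite /b levE.
have low := lower_arith1 h0 a0 de0 (ltW (proj2 (andP ad01))) ka01 kad l1 L3k lp1.
have bL : h * a * dl R k ^+ 2 <= b.
  by rewrite bE; apply: lower_arith2 => //; rewrite -[leLHS]mul1r.
have hal : 0 < h * a * dl R k ^+ 2.
  by apply: mulr_gt0; [exact: mulr_gt0|apply: exprn_gt0; exact: lt_le_trans l1].
have bp : 0 < b by exact: lt_le_trans hal bL.
have eta0 : 0 < expR (- dl R k) by exact: expR_gt0.
have [E [mE' pEv hE]] := clock_lower X_iid pois XN (2 ^ k)%N mJ0 (ltW bp) ka11 eta0.
pose Gs : set (seq Z2) := [set s | (m%:R `^ (1 - (a + de) - ka / 4) <=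
     \sum_(z <- V) \1_[set s | ((a + de) * lev P X m <= visits R z 0 s)%R] s)%R].
pose B1 : set (seq Z2) := [set s | exists2 j, (j <= size s)%N &
   final (fun x y : Z2 => x + y) 0 (take j s) \notin bx (2 ^ k)].
pose B2 := no_block m J Gs.
have mJE : (m * J)%:R = expR (dl R (p k) + x) :> R.
  by rewrite natrM /m /J exp2E exp2E -expRD.
have q1 : (EEi P X (m * J) B1 <= (2 * s2 * expR (- (ka * dl R k)))%:E)%E.
  apply: le_trans (early_exit X_iid symX varX (m * J) 0 (expn_gt0 2 k : (0 < 2 ^ k)%N)) _.
  have s0E : sqn R 0 = 0 by rewrite /sqn !mxE expr0n /= addr0.
  rewrite lee_fin s0E add0r mJE exp2E -/s2 ler_pdivrMr ?exprn_gt0 ?expR_gt0//.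
  rewrite [leRHS](_ : _ = s2 * (2 * expR (- (ka * dl R k)) * expR (dl R k) ^+ 2)); last by ring.
  apply: ler_wpM2l => //.
  rewrite -[X in X * _ * _](@lnK _ 2) ?posrE// expr2 -!expRD ler_expR; exact: A9.
have pw : 0 < (m%:R : R) `^ (- (ka / 4)) by exact: natr_powR_gt0.
have pw1 : (m%:R : R) `^ (- (ka / 4)) <= 1.
  by rewrite -[leRHS](powRr0 (m%:R : R)) ler_powR ?ler1n// oppr_le0 ltW.
have p01 : 0 <= (m%:R : R) `^ (- (ka / 4)) <= 1 by rewrite (ltW pw).
have q2 : (EEi P X (m * J) B2 <= (expR (- dl R k))%:E)%E.
  apply: le_trans (no_block_prob X_iid J p01 hV) _; rewrite lee_fin.
  apply: (@le_trans _ _ (expR (- (m%:R `^ (- (ka / 4)))) ^+ J)).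
    by apply: lerXn2r; rewrite ?nnegrE ?expR_ge0 ?subr_ge0//; exact: expR_ge1Dx.
  rewrite -expRM_natl ler_expR mulrN lerN2 natr_powRE// lm mulNr /J exp2E -expRD -/(dl R (k %/ q)) -/x.
  apply: (@le_trans _ _ (expR (ka / 2 * dl R k - ln 2))); last by rewrite ler_expR; exact: A8.
  rewrite expRD expRN lnK ?posrE// ler_pdivlMr// mulrC; apply: le_trans L2k.
  by rewrite ler_pM2l// expr2 ler_peMl.
have q3 : (#|` bx (2 ^ k)|)%:R * expR (1 - b * ka ^+ 2 / 4) <= 9 * expR 1 * expR (- (ka * dl R k)).
  have c2 : expR (1 - b * ka ^+ 2 / 4) <= expR (1 - 4 * dl R k).
    rewrite ler_expR lerD2l lerN2; have hk : 0 < h * a * ka ^+ 2 by rewrite !mulr_gt0// exprn_gt0.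
    rewrite ler_pdivlMr//; apply: (@le_trans _ _ (h * a * dl R k ^+ 2 * ka ^+ 2)); last first.
      by apply: ler_wpM2r; [exact: sqr_ge0|exact: bL].
    rewrite ler_pdivrMr// in L4k.
    have -> : h * a * dl R k ^+ 2 * ka ^+ 2 = dl R k * (dl R k * (h * a * ka ^+ 2)) by ring.
    have -> : 4 * dl R k * 4 = dl R k * 16 by ring.
    exact: ler_wpM2l.
  apply: (@le_trans _ _ (9 * expR (2 * dl R k) * expR (1 - 4 * dl R k))).
    by apply: ler_pM; rewrite ?expR_ge0//; exact: card_bx_exp2.
  by rewrite -!mulrA ler_pM2l// -!expRD ler_expR; exact: A4.
have c1 : expR (- ((m * J)%:R / 32)) <= expR (- dl R k).
  rewrite ler_expR lerN2 ler_pdivlMr// mJE.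
  have : expR (1 * dl R k) <= expR (dl R (p k) + x).
    by rewrite ler_expR (le_trans lp3)// lerDl.
  apply: le_trans; apply: le_trans L5k; rewrite mulrC expr2.
  by rewrite ler_pM2l// ler_peMl.
have eL : expR (- dl R k) <= expR (- (ka * dl R k)) by rewrite ler_expR lerN2; exact: A3.
exists (E `|` path_of X 0 (m * J) @^-1` (B1 `|` B2)); split.
- by apply: measurableU => //; exact: (path_of_discrete X_iid).
- have := EEi_U X_iid q1 q2; rewrite /EEi -(path_prob X_iid 0 (m * J)) => q4.
  apply: le_trans (measureU2 _ mE' (path_of_discrete X_iid 0 (m * J) (B1 `|` B2))) _.
  apply: le_trans (leeD pEv q4) _; rewrite -EFinD lee_fin.
  apply: (@le_trans _ _ ((2 * s2 + 9 * expR 1 + 4) * expR (- (ka * dl R k)))).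
    exact: (A5 _ _ _ (expR (- dl R k))).
  apply: (@le_trans _ _ (expR (ka / 2 * dl R k) * expR (- (ka * dl R k)))).
    by apply: ler_wpM2r; [exact: expR_ge0|exact: L6k].
  by rewrite -expRD ler_expR; exact: A6.
move=> w nE; have nEc : ~ E w by move=> hw; apply: nE; left.
have nB1 : ~ B1 (path_of X 0 (m * J) w) by move=> hw; apply: nE; right; left.
have nB2 : ~ B2 (path_of X 0 (m * J) w) by move=> hw; apply: nE; right; right.
have inb j : (j < m * J)%N -> partial_sum X j w \in bx (2 ^ k).
  move=> jm; apply: contrapT => /negP hb; apply: nB1; exists j; first by rewrite size_path ltnW.
  by rewrite take_path// ltnW.
have inb' j : (j < m * J)%N -> box (2 ^ k) (partial_sum X j w).
  by move=> /inb; rewrite in_fset_set ?in_setE//; exact: finite_box.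
have [t1 [t2 [t3 [tE Gt2]]]] := block_witness (size_path X (m * J) w) nB2.
(* The position of the walk when the successful block starts. *)
pose y := final (fun x y : Z2 => x + y) 0 t1.
pose S := [seq y + z | z <- enum_fset V & b <= visits R z 0 t2].
have hS : \sum_(z <- V) \1_[set s | ((a + de) * lev P X m <= visits R z 0 s)%R] t2 = (size S)%:R :> R.
  rewrite size_map size_filter -sum1_count natr_sum [RHS]big_mkcond; apply: eq_bigr => z _.
  by rewrite indicE; case: ifPn => hx; [rewrite mem_set|rewrite memNset//; exact/negP].
apply: (@le_trans _ _ (size S)%:R).
  rewrite -hS; apply: le_trans Gt2; rewrite natr_powRE// lm ler_expR; exact: A7.
rewrite !nthickE ler_nat; apply: uniq_leq_size => [|z].
  by rewrite map_inj_uniq ?filter_uniq ?fset_uniq// => z1 z2 /addrI.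
move=> /mapP[z']; rewrite mem_filter => /andP[hz' _] ->.
have vz : b <= visits R (y + z') 0 (path_of X 0 (m * J) w).
  by rewrite tE; apply: (le_trans hz'); exact: block_visits.
have [j] := visits_gt0 (lt_le_trans bp vz); rewrite size_path => jm; rewrite take_path ?(ltnW jm)// => jE.
have yb : y + z' \in bx (2 ^ k) by rewrite -jE; exact: inb.
rewrite in_thick yb /= (thickE X_iid varX C0 hC); apply: le_trans (hE w nEc inb' _ yb vz).
by rewrite lee_fin bE.
Qed.

End lower_scale.

(** * Borel-Cantelli along dyadic scales *)

Section borel_cantelli.
Context d (T : measurableType d) (R : realType) (P : probability T R).

(** A negative power of 2^k is a geometric sequence in k, hence summable; the null set is the upper
    limit of the exceptional events. *)
Lemma ae_dyadic (Q : nat -> T -> Prop) (q : R) : 0 < q ->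
  (\forall k \near \oo, exists E : set T,
     [/\ measurable E, (P E <= (expR (- q * dl R k))%:E)%E & forall w, ~ E w -> Q k w]) ->
  {ae P, forall w, \forall k \near \oo, Q k w}.
Proof.
move=> q0 [K _ hK].
have ex k : exists E : set T, [/\ measurable E, (P E <= (expR (- q * dl R k))%:E)%E &
    (K <= k)%N -> forall w, ~ E w -> Q k w].
  have [Kk|kK] := leqP K k; first by have [E [m1 m2 m3]] := hK k Kk; exists E.
  exists set0; split=> //; first by rewrite measure0 lee_fin expR_ge0.
have /choice[F hF] := ex.
pose r := expR (- q * ln 2); have r0 : 0 < r by exact: expR_gt0.
have r1 : r < 1 by rewrite -[ltRHS]expR0 ltr_expR mulNr oppr_lt0 mulr_gt0// ln2_gt0.
have rk k : expR (- q * dl R k) = r ^+ k by rewrite /r -expRM_natl /dl mulrCA.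
have sum_le n : \sum_(0 <= k < n) r ^+ k <= (1 - r)^-1.
  rewrite -[leRHS]mul1r ler_pdivlMr ?subr_gt0//.
  have -> : (\sum_(0 <= k < n) r ^+ k) * (1 - r) = 1 - r ^+ n.
    elim: n => [|n IH]; first by rewrite big_geq// mul0r expr0 subrr.
    by rewrite big_nat_recr//= mulrDl IH exprS; ring.
  by rewrite gerBl exprn_ge0// ltW.
have fin : (\sum_(n <oo) P (F n) < +oo)%E.
  apply: (@le_lt_trans _ _ ((1 - r)^-1)%:E); last exact: ltry.
  apply: lime_le; first by apply: is_cvg_nneseries => n _ _; exact: measure_ge0.
  apply: nearW => n; apply: (@le_trans _ _ (\sum_(0 <= k < n) (r ^+ k)%:E)%E).
    by apply: lee_sum => k _; have [_ + _] := hF k; rewrite rk.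
  by rewrite sumEFin lee_fin.
exists (lim_sup_set F); split.
- apply: bigcap_measurable => // n _; apply: bigcup_measurable => k _.
  by have [] := hF k.
- by apply: lim_sup_set_cvg0 => // k; have [] := hF k.
move=> w /= hw n _; apply: contrapT => hn; apply: hw.
exists (maxn n K) => // k /= hk; have [_ _ h] := hF k.
apply: h; first by rewrite (leq_trans _ hk)// leq_maxr.
by move=> Fk; apply: hn; exists k => //=; rewrite (leq_trans _ hk)// leq_maxl.
Qed.

End borel_cantelli.

(** * Interpolation between dyadic scales and the two limits *)

Section interpolation_arithmetic.
Context (R : realType).

Lemma upper_interp1 (a a' de D l : R) : 0 < de -> de <= a / 2 -> 0 <= a' -> a' <= a - de / 2 ->
  l <= D -> D <= l + 1 -> 1 <= l -> 6 * a / de <= l -> a' * D ^+ 2 <= a * l ^+ 2.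
Proof.
move=> d0 da a'0 ha lD Dl l1; rewrite ler_pdivrMr// => hl.
have h1 : a' * D ^+ 2 <= (a - de / 2) * (l + 1) ^+ 2.
  by apply: ler_pM => //; [exact: sqr_ge0|apply: lerXn2r; rewrite ?nnegrE//; lra].
have h2 : (l + 1) ^+ 2 <= l ^+ 2 + 3 * l by nra.
have h3 : (a - de / 2) * (l + 1) ^+ 2 <= (a - de / 2) * (l ^+ 2 + 3 * l).
  by apply: ler_wpM2l => //; lra.
apply: (le_trans h1); apply: (le_trans h3).
have h4 : 6 * a * l <= l * de * l by rewrite ler_pM2r//; lra.
have h5 : 0 <= de * l by apply: mulr_ge0; lra.
by rewrite expr2; nra.
Qed.

Lemma upper_interp2 (a e a' e' de D l : R) : 0 < e -> de <= e / 8 -> a - de <= a' -> e' <= de / 2 ->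
  0 < a -> l <= D -> D <= l + 1 -> 1 <= l -> (2 + e) * 2 / e <= l ->
  (2 - 2 * a' + e') * D <= (2 - 2 * a + e) * l.
Proof.
move=> e0 de8 ha he a0 lD Dl l1; rewrite ler_pdivrMr// => hl.
apply: (@le_trans _ _ ((2 - 2 * a + e / 2) * D)).
  by apply: ler_wpM2r; lra.
have h1 : (2 - 2 * a + e / 2) * (D - l) <= (2 + e) * (D - l) by apply: ler_wpM2r; lra.
have h2 : (2 + e) * (D - l) <= 2 + e by apply: ler_piMr; lra.
by lra.
Qed.

Lemma lower_interp1 (a a' de D l : R) : 0 < a -> 0 < de -> a + de / 2 <= a' -> l - 1 <= D -> 1 <= l ->
  4 * (a + de) / de <= l -> a * l ^+ 2 <= a' * D ^+ 2.
Proof.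
move=> a0 d0 ha lD l1; rewrite ler_pdivrMr// => hl.
have h1 : (a + de / 2) * (l - 1) ^+ 2 <= a' * D ^+ 2.
  by apply: ler_pM => //; [lra|exact: sqr_ge0|apply: lerXn2r; rewrite ?nnegrE//; lra].
have h3 : (a + de / 2) * (l ^+ 2 - 2 * l) <= (a + de / 2) * (l - 1) ^+ 2.
  by apply: ler_wpM2l; [lra|nra].
apply: le_trans h1; apply: le_trans h3.
have h4 : 4 * (a + de) * l <= l * de * l by rewrite ler_pM2r//; lra.
have h5 : 0 <= de * l by apply: mulr_ge0; lra.
by rewrite expr2; nra.
Qed.

Lemma lower_interp2 (a e a' e' de D l : R) : 0 < a -> 0 < e -> de <= e / 8 -> a' <= a + de -> e' <= de / 2 ->
  D <= l -> l - 1 <= D -> 1 <= l -> 4 / e <= l ->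
  (2 - 2 * a - e) * l <= (2 - 2 * a' - e') * D.
Proof.
move=> a0 e0 de8 ha he Dl lD l1; rewrite ler_pdivrMr// => hl.
apply: (@le_trans _ _ ((2 - 2 * a - e / 2) * D)); last by apply: ler_wpM2r; lra.
have h1 : (2 - 2 * a - e / 2) * (l - D) <= 2 * (l - D) by apply: ler_wpM2r; lra.
by lra.
Qed.

Lemma ln2_le1 : ln 2 <= 1 :> R.
Proof. by have := @le_ln1Dx R 1; rewrite -natr1 natr1; apply; lra. Qed.

Lemma dyadic_near (Q : nat -> Prop) : (\forall k \near \oo, Q k) ->
  \forall n \near \oo, exists k, [/\ Q k, Q k.+1, (2 ^ k <= n)%N & (n < 2 ^ k.+1)%N].
Proof.
move=> [K _ hK]; exists (2 ^ K)%N => // n /= hn.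
have n0 : (0 < n)%N by apply: leq_trans hn; rewrite expn_gt0.
have kK : (K <= trunc_log 2 n)%N by exact: trunc_log_max.
exists (trunc_log 2 n); split; first exact: hK.
- by apply: hK => /=; exact: leqW.
- exact: trunc_logP.
- exact: trunc_log_ltn.
Qed.

Lemma ln_dyadic k n : (2 ^ k <= n)%N -> (n < 2 ^ k.+1)%N ->
  dl R k <= ln n%:R <= dl R k + 1 /\ ln n%:R <= dl R k.+1 <= ln n%:R + 1.
Proof.
move=> h1 h2; have k0 : (0 < 2 ^ k)%N by rewrite expn_gt0.
have n0 : 0 < n%:R :> R by rewrite ltr0n (leq_trans k0).
have k0' : 0 < (2 ^ k)%:R :> R by rewrite ltr0n.
have k1' : 0 < (2 ^ k.+1)%:R :> R by rewrite ltr0n expn_gt0.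
have h1' : (2 ^ k)%:R <= n%:R :> R by rewrite ler_nat.
have h2' : n%:R <= (2 ^ k.+1)%:R :> R by rewrite ler_nat ltnW.
have e1 : dl R k <= ln n%:R by rewrite -ln_exp2 ler_ln.
have e2 : ln n%:R <= dl R k.+1 by rewrite -ln_exp2 ler_ln.
have e3 : dl R k.+1 = dl R k + ln 2 by rewrite /dl -natr1 mulrDl mul1r.
have := ln2_le1; move: e2; rewrite e1 /= e3 => e2 e4; rewrite e2 /=; split; lra.
Qed.

(** The denominator serves twice: it makes i / (j + 1) close to a0, and its inverse is the error
    allowed in [upper_at] and [lower_at]. *)
Lemma ratio_between (a0 de : R) : 0 < de -> de < a0 -> exists i j : nat,
  [/\ (0 < i)%N, a0 - de <= i%:R / j.+1%:R, i%:R / j.+1%:R <= a0 & j.+1%:R^-1 <= de].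
Proof.
move=> d0 da; pose j := Num.truncn de^-1.
have jd : de^-1 <= j.+1%:R by exact/ltW/truncnS_gt.
have j0 : 0 < j.+1%:R :> R by [].
have jd' : j.+1%:R^-1 <= de by rewrite -[leRHS]invrK lef_pV2 ?posrE ?invr_gt0.
have a00 : 0 <= a0 * j.+1%:R by rewrite mulr_ge0//; lra.
have /andP[t1 t2] := truncn_itv a00.
exists (Num.truncn (a0 * j.+1%:R)), j; split=> //; last by rewrite ler_pdivrMr.
- rewrite truncn_gt0; apply: (@le_trans _ _ (de * j.+1%:R)).
    by rewrite -ler_pdivrMl// mulr1.
  by rewrite ler_pM2r// ltW.
- rewrite ler_pdivlMr// mulrBl lerBlDr.
  move: t2; rewrite -natr1 => t2.
  have : 1 <= de * j.+1%:R by rewrite -ler_pdivrMl// mulr1.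
  lra.
Qed.

End interpolation_arithmetic.

Section interpolation.
Context d (T : measurableType d) (R : realType) (P : probability T R).
Context (X : nat -> T -> Z2) (N : R -> T -> nat).
Context (X_iid : iid P X) (varX : finite_variance P (X 0%N)).
Context (C : R) (C0 : 0 < C)
  (hC : forall th x, 1 - cos (ip th x) <= C * sqn R x * (1 - charf P (X 0%N) th)).
Context (pois : poisson_process P 1 N).
Local Notation Y := (ct_walk X N).
Local Notation G := (covariance_mx P (X 0%N)).
Local Notation h := (gconst P (X 0%N)).
Local Notation mX := (iid_measurable X_iid 0%N).
Local Notation nthick := (nthick P X N).
Let h0 : 0 < h. Proof. exact: (gconst_gt0 mX varX C0 hC). Qed.

Lemma thick_const_gt0 : 0 < thick_const G.
Proof.
have -> : thick_const G = 4 * h by rewrite (gconstE mX varX C0 hC); field.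
by rewrite mulr_gt0.
Qed.

(** The exit from a larger box occurs later, so local times at the exit grow with the box, and the
    threshold does not rise by hypothesis. *)
Lemma nthick_le (a a' : R) (n n' : nat) w : (n <= n')%N ->
  a' * ln n'%:R ^+ 2 <= a * ln n%:R ^+ 2 -> nthick a n w <= nthick a' n' w.
Proof.
move=> nn ha; rewrite !nthickE ler_nat; apply: uniq_leq_size; first exact: fset_uniq.
move=> x xin; rewrite in_thick in xin; case/andP: xin => xn hx; rewrite in_thick; apply/andP; split.
  move: xn; rewrite !in_bx => /andP[h1 h2].
  have nz : (n <= n' :> int)%R by rewrite lez_nat.
  by apply/andP; split; [exact: le_trans h1 nz|exact: le_trans h2 nz].
apply: (le_trans _ (exit_local_time_le X pois x w nn)); apply: (le_trans _ hx).
rewrite lee_fin -!(mulrA (thick_const G)); apply: ler_wpM2l ha.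
exact: ltW thick_const_gt0.
Qed.

(* a dyadic scale only sees the parameters i / j, so that a countable union of
   null sets suffices *)
Definition upper_at (i j : nat) w := (0 < i)%N -> \forall k \near \oo,
  nthick (i%:R / j.+1%:R) (2 ^ k) w <= expR ((2 - 2 * (i%:R / j.+1%:R) + j.+1%:R^-1) * dl R k).
Definition lower_at (i j : nat) w := (0 < i < j.+1)%N -> \forall k \near \oo,
  expR ((2 - 2 * (i%:R / j.+1%:R) - j.+1%:R^-1) * dl R k) <= nthick (i%:R / j.+1%:R) (2 ^ k) w.

(** Compare n with the next power of 2 and a with a slightly smaller ratio: ln changes by at most ln
    2 <= 1, which the change of parameter absorbs for large n. *)
Lemma nthick_upper (a e : R) w : (forall i j, upper_at i j w) -> 0 < a -> 0 < e ->
  \forall n \near \oo, nthick a n w <= expR ((2 - 2 * a + e) * ln n%:R).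
Proof.
move=> hU a0 e0; pose de := Num.min (e / 8) (a / 2).
have d0 : 0 < de by rewrite lt_min !divr_gt0.
have d1 : de <= e / 8 by rewrite ge_min lexx.
have d2 : de <= a / 2 by rewrite ge_min lexx orbT.
have d20 : 0 < de / 2 by rewrite divr_gt0.
have [|i [j [i0 hi1 hi2 hj]]] := ratio_between (a0 := a - de / 2) d20; first by lra.
have Q := dyadic_near (hU i j i0).
have L1 := @ln_near R (6 * a / de + 1 + (2 + e) * 2 / e).
have p1 : 0 <= 6 * a / de by rewrite divr_ge0 ?mulr_ge0 ?ltW.
have p2 : 0 <= (2 + e) * 2 / e by apply: divr_ge0; [apply: mulr_ge0|]; lra.
apply: filterS2 Q L1 => n [k [_ qk h1 h2]] hl.
have [_ /andP[g1 g2]] := ln_dyadic R h1 h2.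
have l1 : 1 <= ln (n%:R : R) by lra.
have l2 : 6 * a / de <= ln (n%:R : R) by lra.
have l3 : (2 + e) * 2 / e <= ln (n%:R : R) by lra.
apply: (@le_trans _ _ (nthick (i%:R / j.+1%:R) (2 ^ k.+1) w)).
  apply: nthick_le; first exact: ltnW.
  by rewrite ln_exp2; apply: (upper_interp1 d0 d2) => //; apply: divr_ge0.
apply: (le_trans qk); rewrite ler_expR; apply: (upper_interp2 e0 d1) => //; apply: (le_trans _ hi1); lra.
Qed.

(** The mirror comparison, with the preceding power of 2 and a slightly larger ratio. *)
Lemma nthick_lower (a e : R) w : (forall i j, lower_at i j w) -> 0 < a < 1 -> 0 < e ->
  \forall n \near \oo, expR ((2 - 2 * a - e) * ln n%:R) <= nthick a n w.
Proof.
move=> hU /andP[a0 a1] e0; pose de := Num.min (e / 8) ((1 - a) / 2).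
have d0 : 0 < de by rewrite lt_min !divr_gt0// subr_gt0.
have d1 : de <= e / 8 by rewrite ge_min lexx.
have d2 : de <= (1 - a) / 2 by rewrite ge_min lexx orbT.
have d20 : 0 < de / 2 by rewrite divr_gt0.
have [|i [j [i0 hi1 hi2 hj]]] := ratio_between (a0 := a + de) d20; first by lra.
have ij : (0 < i < j.+1)%N.
  have r1 : i%:R / j.+1%:R < 1 :> R by apply: (le_lt_trans hi2); lra.
  by rewrite i0 /= -(ltr_nat R); move: r1; rewrite ltr_pdivrMr// mul1r.
have Q := dyadic_near (hU i j ij).
have L1 := @ln_near R (4 * (a + de) / de + 1 + 4 / e).
have p1 : 0 <= 4 * (a + de) / de by apply: divr_ge0; [apply: mulr_ge0|]; lra.
have p2 : 0 <= 4 / e by rewrite divr_ge0// ltW.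
apply: filterS2 Q L1 => n [k [qk _ h1 h2]] hl.
have [/andP[g1 g2] _] := ln_dyadic R h1 h2.
have l1 : 1 <= ln (n%:R : R) by lra.
have l2 : 4 * (a + de) / de <= ln (n%:R : R) by lra.
have l3 : 4 / e <= ln (n%:R : R) by lra.
apply: (@le_trans _ _ (nthick (i%:R / j.+1%:R) (2 ^ k) w)); last first.
  by apply: nthick_le => //; rewrite ln_exp2; apply: (lower_interp1 a0 d0) => //; first [lra|apply: (le_trans _ hi1); lra].
apply: le_trans qk; rewrite ler_expR; apply: (lower_interp2 a0 e0 d1) => //; first [lra|exact: hi2].
Qed.

(** For large n some site is (1 - eta)-thick and no site is (1 + eta)-thick, which encloses the
    maximum. *)
Lemma max_limit w : (forall i j, upper_at i j w) -> (forall i j, lower_at i j w) ->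
  (max_local_time Y n w / (ln n%:R ^+ 2 : R)%:E)%E @[n --> \oo] --> (thick_const G)%:E.
Proof.
move=> hU hL; have c0 := thick_const_gt0; set c := thick_const G in c0 *.
have key (eta : R) : 0 < eta < 1 -> \forall n \near \oo,
    ((c * (1 - eta))%:E <= max_local_time Y n w / (ln n%:R ^+ 2 : R)%:E <= (c * (1 + eta))%:E)%E.
  move=> /andP[t0 t1]; have t01 : 0 < 1 - eta < 1 by lra.
  have u0 : 0 < 1 + eta by lra.
  have nU := nthick_upper hU u0 t0; have nL := nthick_lower hL t01 t0.
  apply: filterS3 nU nL (ln_near (1 : R)) => n h1 h2 l1.
  have l0 : 0 < ln (n%:R : R) by exact: lt_le_trans l1.
  have L0 : 0 < ln (n%:R : R) ^+ 2 by rewrite exprn_gt0.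
  have -> : ((ln n%:R ^+ 2 : R)%:E^-1 = ((ln n%:R ^+ 2)^-1 : R)%:E)%E by rewrite inver gt_eqF.
  apply/andP; split.
    rewrite lee_pdivlMr// -EFinM.
    have : 0 < nthick (1 - eta) n w by apply: lt_le_trans h2; exact: expR_gt0.
    rewrite !nthickE ltr0n cardfs_gt0 => /fset0Pn[x]; rewrite in_thick => /andP[xn hx].
    by rewrite /max_local_time; apply: (bigmax_sup_seq _ x).
  rewrite lee_pdivrMr// -EFinM.
  (* The exponent 2 - 2 (1 + eta) + eta = - eta is negative, and a count below 1 vanishes. *)
  have e0 : nthick (1 + eta) n w < 1.
    by apply: (le_lt_trans h1); rewrite -[ltRHS]expR0 ltr_expR; nra.
  rewrite /max_local_time big_seq; apply: bigmax_le => [|x xn]; first exact: leNye.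
  have xb : x \in bx n by [].
  apply: ltW; rewrite ltNge; apply/negP => hx.
  have : 1 <= nthick (1 + eta) n w; last by rewrite leNgt e0.
  by rewrite !nthickE ler1n cardfs_gt0; apply/fset0Pn; exists x; rewrite in_thick xb.
apply/fine_cvgP; split.
  have half : 0 < (2^-1 : R) < 1 by lra.
  apply: filterS (key _ half) => n /andP[h1 h2].
  by rewrite fin_numElt (lt_le_trans _ h1) ?ltNyr//= (le_lt_trans h2)// ltry.
apply/cvgrPdist_le => e e0; pose eta := Num.min (2^-1) (e / c).
have eta01 : 0 < eta < 1.
  apply/andP; split; first by rewrite lt_min divr_gt0// invr_gt0 ltr0n.
  by apply: (@le_lt_trans _ _ 2^-1); [rewrite ge_min lexx|lra].
have etae : c * eta <= e by rewrite mulrC -ler_pdivlMr// ge_min lexx orbT.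
apply: filterS (key _ eta01) => n /andP[h1 h2] /=.
have fn : (max_local_time Y n w / (ln n%:R ^+ 2 : R)%:E)%E \is a fin_num.
  by rewrite fin_numElt (lt_le_trans _ h1) ?ltNyr//= (le_lt_trans h2)// ltry.
move: h1 h2; rewrite -(fineK fn) !lee_fin /=; move: (fine _) => v.
have -> : c * (1 - eta) = c - c * eta by ring.
have -> : c * (1 + eta) = c + c * eta by ring.
by rewrite ler_norml => h1 h2; apply/andP; split; lra.
Qed.

(** The logarithms of the two bounds on the count, with e arbitrary; the boundary value a = 0 is
    treated apart. *)
Lemma count_limit (a : R) w : (forall i j, upper_at i j w) -> (forall i j, lower_at i j w) ->
  0 <= a < 1 -> (ln (nthick a n w) / ln n%:R) @[n --> \oo] --> 2 * (1 - a).
Proof.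
move=> hU hL /andP[a0 a1]; apply/cvgrPdist_le => e e0.
have e20 : 0 < e / 2 by rewrite divr_gt0.
have lower : \forall n \near \oo, expR ((2 - 2 * a - e) * ln n%:R) <= nthick a n w.
  (* A slightly larger parameter is positive, so that [nthick_lower] also covers a = 0. *)
  pose a' := a + Num.min (e / 4) ((1 - a) / 2).
  have m0 : 0 < Num.min (e / 4) ((1 - a) / 2) by rewrite lt_min !divr_gt0// subr_gt0.
  have m1 : Num.min (e / 4) ((1 - a) / 2) <= e / 4 by rewrite ge_min lexx.
  have m2 : Num.min (e / 4) ((1 - a) / 2) <= (1 - a) / 2 by rewrite ge_min lexx orbT.
  have a'01 : 0 < a' < 1 by rewrite /a'; lra.
  have aa' : 2 - 2 * a - e <= 2 - 2 * a' - e / 2 by rewrite /a'; lra.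
  have aa : a <= a' by rewrite /a' lerDl ltW.
  apply: filterS2 (nthick_lower hL a'01 e20) (ln_near (1 : R)) => n h1 l1.
  apply: le_trans (le_trans h1 _).
    by rewrite ler_expR ler_wpM2r// (le_trans ler01).
  by apply: nthick_le => //; rewrite ler_wpM2r ?sqr_ge0.
have upper : \forall n \near \oo, nthick a n w <= expR ((2 - 2 * a + e) * ln n%:R).
  (* At a = 0 the cardinality of the box, at most 9 n^2, gives the bound. *)
  have [->|an0] := eqVneq a 0; last by apply: nthick_upper => //; rewrite lt_neqAle eq_sym an0.
  have n1 : \forall n \near \oo, (0 < n)%N by exact: nbhs_infty_gt.
  apply: filterS2 (@ln_near R (ln 9 / e)) n1 => n hl n0.
  rewrite mulr0 subr0; apply: (@le_trans _ _ (#|` bx n|)%:R).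
    rewrite !nthickE ler_nat; apply: uniq_leq_size => [|x]; first exact: fset_uniq.
    by rewrite in_thick => /andP[].
  have np : 0 < n%:R :> R by rewrite ltr0n.
  apply: (@le_trans _ _ (9 * n%:R ^+ 2)).
    by rewrite card_bx -natrX -natrM ler_nat; nia.
  rewrite (mulrDl 2 e) expRD (_ : expR (2 * ln n%:R) = n%:R ^+ 2); last first.
    by rewrite expRM_natl lnK ?posrE.
  rewrite [leLHS]mulrC ler_pM2l ?exprn_gt0// -[leLHS]lnK ?posrE// ler_expR.
  by rewrite [leRHS]mulrC -ler_pdivrMr.
apply: filterS3 lower upper (ln_near (1 : R)) => n h1 h2 l1.
have l0 : 0 < ln (n%:R : R) by exact: lt_le_trans l1.
have nt0 : 0 < nthick a n w by apply: lt_le_trans h1; exact: expR_gt0.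
have g1 : (2 - 2 * a - e) * ln n%:R <= ln (nthick a n w).
  by rewrite -ler_expR lnK ?posrE.
have g2 : ln (nthick a n w) <= (2 - 2 * a + e) * ln n%:R.
  by rewrite -ler_expR lnK ?posrE.
rewrite -ler_pdivlMr// in g1; rewrite -ler_pdivrMr// in g2.
by move: (ln (nthick a n w) / _) g1 g2 => v g1 g2; rewrite ler_norml; apply/andP; split; lra.
Qed.

End interpolation.

Theorem theorem1p1p1 (R : realType) (d : measure_display)
    (T : measurableType d) (P : probability T R)
    (X : nat -> T -> Z2) (N : R -> T -> nat)
    (X_iid : iid P X)
    (X_symmetric : symmetric_law P (X 0%N))
    (X_variance : finite_variance P (X 0%N))
    (X_irreducible : irreducible_walk P X)
    (N_poisson : poisson_process P 1 N)
    (X_N_indep : indep_systems P (sigma_family setT X)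
                                 (sigma_family [set t | 0 <= t] N)) :
  let G := covariance_mx P (X 0%N) in
  let Y := ct_walk X N in
  {ae P, forall w,
     (max_local_time Y n w / (ln n%:R ^+ 2 : R)%:E)%E @[n --> \oo]
       --> (2 / (pi * Num.sqrt (\det G)))%:E} /\
  {ae P, forall w, forall a : R, 0 <= a < 1 ->
     (ln (#|` fset_set (thick_points G Y a n w)|%:R : R) / ln n%:R) @[n --> \oo]
       --> 2 * (1 - a)}.
Proof.
move=> G Y; have [C C0 hC] := cos_ip_le X_iid X_symmetric X_irreducible.
have hU : {ae P, forall w, forall i j, upper_at P X N i j w}.
  apply: ae_foralln => i; apply: ae_foralln => j.
  have [i0|i0] := ltnP 0 i; last by apply: aeW => w; rewrite /upper_at ltnNge i0.
  have a0 : 0 < i%:R / j.+1%:R :> R by rewrite divr_gt0// ltr0n.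
  have e01 : 0 < (j.+1%:R^-1 : R) <= 1 by rewrite invr_gt0 ltr0n /= invf_le1// ler1n.
  have q0 : 0 < j.+1%:R^-1 / 8 :> R by rewrite divr_gt0// invr_gt0.
  have := ae_dyadic q0 (upper_scale X_iid X_symmetric X_variance C0 hC N_poisson X_N_indep a0 e01).
  by apply: filterS => w hw _.
have hL : {ae P, forall w, forall i j, lower_at P X N i j w}.
  apply: ae_foralln => i; apply: ae_foralln => j.
  have [ij|ij] := boolP (0 < i < j.+1)%N; last by apply: aeW => w; rewrite /lower_at (negbTE ij).
  have /andP[i0 i1] := ij.
  have a01 : 0 < (i%:R / j.+1%:R : R) < 1.
    by rewrite divr_gt0 ?ltr0n//= ltr_pdivrMr// mul1r ltr_nat.
  have e01 : 0 < (j.+1%:R^-1 : R) <= 1 by rewrite invr_gt0 ltr0n /= invf_le1// ler1n.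
  have [q q0 hq] := lower_scale X_iid X_symmetric X_variance C0 hC N_poisson X_N_indep a01 e01.
  by have := ae_dyadic q0 hq; apply: filterS => w hw _.
split.
  by apply: filterS2 hU hL => w hU hL; exact: (max_limit X_iid X_variance C0 hC N_poisson).
apply: filterS2 hU hL => w hU hL a a01.
exact: (count_limit X_iid X_variance C0 hC N_poisson).
Qed.
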